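(* Let $S$ be an $\mathbb R^d$-valued semimartingale ($d\ge2$), $H\in L^2(\mathsf P)$ and $v\in\mathbb R$. If $\mathcal M_2(S,\mathsf P)$ contains a strictly positive element, then the hedging problem $$\min_{\vartheta\in\overline\Theta_v(S,\mathsf P)}\mathsf E[(\vartheta_TS_T-H)^2]$$ allows for an optimizer $\vartheta\in\overline\Theta_v(S,\mathsf P)$, provided $\overline\Theta_v(S,\mathsf P)$ is non-empty. Moreover, the value process $\vartheta S$ of the optimizer is unique up to indistinguishability.
   Context: $(\Omega,\mathscr F,(\mathscr F_t)_{t\in[0,T]},\mathsf P)$ is a filtered probability space with $\mathscr F_0$ trivial. $S$ is a column vector, strategies $\vartheta$ are row vectors; $L(S)$ is the set of predictable $S$-integrable processes (vector stochastic integration); $\vartheta\bullet S_t=\int_{(0,t]}\vartheta_u\,dS_u$; $\vartheta S=\sum_i\vartheta^iS^i$. $\vartheta\in L(S)$ is self-financing if $\vartheta S=\vartheta_0S_0+\vartheta\bullet S$ on $[0,T]$. It is tame, $\vartheta\in\Theta(S,\mathsf P)$, if it is self-financing and $\sup_\sigma\mathsf E[(\vartheta_\sigma S_\sigma)^2]<\infty$ over all $[0,T]$-valued stopping times $\sigma$. It is admissible, $\vartheta\in\overline\Theta(S,\mathsf P)$, if it is self-financing and there is a sequence $\vartheta^{(n)}\in\Theta(S,\mathsf P)$ with $\vartheta^{(n)}_\sigma S_\sigma\to\vartheta_\sigma S_\sigma$ in probability for all $[0,T]$-valued stopping times $\sigma$ and $\vartheta^{(n)}_TS_T\to\vartheta_TS_T$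 in $L^2(\mathsf P)$. $\Theta_v(S,\mathsf P)$ and $\overline\Theta_v(S,\mathsf P)$ denote the subsets with $\vartheta_0S_0=v$. A process $Z=(Z_t)_{0\le t\le T}$ is a deflator, $Z\in\mathcal M_2(S,\mathsf P)$, if (i) $Z_T\in L^2(\mathsf P)$; (ii) $Z(\vartheta S)$ is a $\mathsf P$-martingale for all $\vartheta\in\Theta_0(S,\mathsf P)$; (iii) $Z(\varphi S)$ is a $\mathsf P$-martingale for some self-financing strategy $\varphi$ with $\varphi S>0$. *)

(* Defs.v *)
From HB Require Import structures.
From mathcomp Require Import all_boot all_order all_algebra.
From mathcomp Require Import all_classical all_reals all_analysis.

Set Implicit Arguments.
Unset Strict Implicit.
Unset Printing Implicit Defensive.

Import Order.TTheory GRing.Theory Num.Theory.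
Import numFieldNormedType.Exports.

Local Open Scope classical_set_scope.
Local Open Scope ring_scope.

(* A process indexed by [0, T] is a function on all of R; its values outside
   [0, T] are never used. *)
Section StochasticCalculus.
Context {disp : measure_display} {Omega : measurableType disp} {R : realType}.
Variables (P : probability Omega R) (T : R) (F : R -> set (set Omega)).

(* Neither right-continuity nor completeness is assumed. *)
Definition filtration : Prop :=
  [/\ forall t, t \in `[0, T] -> sigma_algebra setT (F t),
      forall s t, s \in `[0, T] -> t \in `[0, T] -> s <= t -> F s `<=` F t
    & forall t, t \in `[0, T] -> F t `<=` measurable].

Definition trivial_at0 : Prop :=
  forall A, F 0 A -> P A = 0%E \/ P A = 1%E.

Definition stopping_time (sigma : Omega -> R) : Prop :=
  (forall w, sigma w \in `[0, T]) /\
  (forall t, t \in `[0, T] -> F t [set w | sigma w <= t]).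

Definition indistinguishable (X Y : R -> Omega -> R) : Prop :=
  {ae P, forall w, forall t, t \in `[0, T] -> X t w = Y t w}.

Definition strictly_positive (X : R -> Omega -> R) : Prop :=
  {ae P, forall w, forall t, t \in `[0, T] -> 0 < X t w}.

Definition cvg_in_probability (X_ : nat -> Omega -> R) (X : Omega -> R) : Prop :=
  forall e : R, 0 < e ->
    P [set w | e <= `|X_ n w - X w|] @[n --> \oo] --> 0%E.

Definition cvg_in_L2 (X_ : nat -> Omega -> R) (X : Omega -> R) : Prop :=
  [/\ forall n, X_ n \in Lfun P 2%:E,
      X \in Lfun P 2%:E
    & ('N[P]_(2%:E)[EFin \o (fun w => (X_ n w - X w)%R)])%E
        @[n --> \oo] --> 0%E].

Definition adapted (X : R -> Omega -> R) : Prop :=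
  forall t, t \in `[0, T] ->
  forall B : set R, measurable B -> F t (X t @^-1` B).

Definition cadlag (X : R -> Omega -> R) : Prop :=
  forall w,
    (forall t, 0 <= t < T -> X u w @[u --> t^'+] --> X t w) /\
    (forall t, 0 < t <= T -> cvg (X u w @[u --> t^'-])).

(* The last clause says E[X_t | F_s] = X_s. *)
Definition martingale (X : R -> Omega -> R) : Prop :=
  [/\ adapted X,
      forall t, t \in `[0, T] -> X t \in Lfun P 1%E
    & forall s t, s \in `[0, T] -> t \in `[0, T] -> s <= t ->
      forall A, F s A ->
        (\int[P]_(w in A) (X t w)%:E = \int[P]_(w in A) (X s w)%:E)%E].

Definition stopped (X : R -> Omega -> R) (tau : Omega -> R) : R -> Omega -> R :=
  fun t w => X (Num.min t (tau w)) w.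

(* On a finite horizon a localizing sequence reaches T after finitely many
   steps, almost surely. *)
Definition local_martingale (M : R -> Omega -> R) : Prop :=
  [/\ adapted M, cadlag M
    & exists tau : nat -> Omega -> R,
      [/\ forall n, stopping_time (tau n),
          forall n w, tau n w <= tau n.+1 w,
          {ae P, forall w, exists n, tau n w = T}
        & forall n, martingale (stopped M (tau n))]].

Definition finite_variation_process (A : R -> Omega -> R) : Prop :=
  [/\ adapted A, cadlag A
    & forall w, bounded_variation 0 T (fun t => A t w)].

Definition semimartingale (X : R -> Omega -> R) : Prop :=
  [/\ adapted X, cadlag X
    & exists M A : R -> Omega -> R,
      [/\ local_martingale M, finite_variation_process A,
          forall w, M 0 w = 0, forall w, A 0 w = 0
        & indistinguishable X (fun t w => X 0 w + M t w + A t w)]].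

Definition predictable_rectangles : set (set (R * Omega)) :=
  [set `[0, 0] `*` A | A in F 0] `|`
  [set B | exists s t A,
     [/\ 0 <= s, s <= t, t <= T, F s A & B = `]s, t] `*` A]].

Definition predictable_sets : set (set (R * Omega)) :=
  <<s `[0, T] `*` setT, predictable_rectangles >>.

Definition predictable (H : R -> Omega -> R) : Prop :=
  forall B : set R, measurable B ->
    predictable_sets
      ((`[0, T] `*` setT) `&` [set tw : R * Omega | B (H tw.1 tw.2)]).

Definition bounded_predictable (H : R -> Omega -> R) : Prop :=
  predictable H /\
  exists C : R, forall t w, t \in `[0, T] -> `|H t w| <= C.

(* J is the integral H |-> H . X, over (0, t], of bounded predictable
   integrands: the extension of the elementary integral (third and fourth
   clauses) that is linear and satisfies dominated convergence in probability.
   If X is a semimartingale then J exists, and it is unique up to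
   indistinguishability.  Measurability rather than adaptedness of J H is
   required because the filtration need not be complete; J H is adapted up to
   null sets by uniqueness. *)
Definition stochastic_integral_operator (X : R -> Omega -> R)
    (J : (R -> Omega -> R) -> (R -> Omega -> R)) : Prop :=
  [/\ forall H, bounded_predictable H ->
        cadlag (J H) /\
        (forall t, t \in `[0, T] -> measurable_fun setT (J H t)),
      forall (a : R) H K, bounded_predictable H -> bounded_predictable K ->
        indistinguishable (J (fun t w => a * H t w + K t w))
                          (fun t w => a * J H t w + J K t w),
      forall s t A, 0 <= s -> s <= t -> t <= T -> F s A ->
        indistinguishable (J (fun u w => \1_(`]s, t]) u * \1_A w))
          (fun u w => \1_A w * (X (Num.min t u) w - X (Num.min s u) w)),
      forall A, F 0 A ->
        indistinguishable (J (fun u w => \1_(`[0, 0]) u * \1_A w))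
                          (fun _ _ => 0)
    & forall (H_ : nat -> R -> Omega -> R) (H : R -> Omega -> R) (C : R),
        (forall n, predictable (H_ n)) -> predictable H ->
        (forall n t w, t \in `[0, T] -> `|H_ n t w| <= C) ->
        (forall t w, t \in `[0, T] -> H_ n t w @[n --> \oo] --> H t w) ->
        forall t, t \in `[0, T] ->
          cvg_in_probability (fun n => J (H_ n) t) (J H t)].

(* W is a version of H . X, for H bounded and predictable. *)
Definition bounded_integral (X H W : R -> Omega -> R) : Prop :=
  bounded_predictable H /\
  exists2 J, stochastic_integral_operator X J & W = J H.

(* Convergence in Emery's semimartingale topology of processes starting
   at 0: K . (Y_n - Y) tends to 0 uniformly in time, in probability, uniformly
   over predictable K with |K| <= 1. *)
Definition emery_cvg (Y_ : nat -> R -> Omega -> R) (Y : R -> Omega -> R) :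
    Prop :=
  forall e : R, 0 < e -> exists N, forall n, (N <= n)%N ->
    forall K, predictable K ->
      (forall t w, t \in `[0, T] -> `|K t w| <= 1) ->
      exists2 W, bounded_integral (fun t w => Y_ n t w - Y t w) K W &
        (P [set w | exists2 t, (t \in `[0, T])%R & (e < `|W t w|)%R]
          <= e%:E)%E.

Section Market.
Context {d : nat}.
Implicit Types (S : R -> Omega -> 'cV[R]_d) (theta : R -> Omega -> 'rV[R]_d).

Definition vector_semimartingale S : Prop :=
  forall i : 'I_d, semimartingale (fun t w => S t w i 0).

Definition vector_predictable theta : Prop :=
  forall i : 'I_d, predictable (fun t w => theta t w 0 i).

(* For bounded integrands the vector integral is the sum of the component
   integrals. *)
Definition bounded_vector_integral S theta (W : R -> Omega -> R) : Prop :=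
  exists2 W_ : 'I_d -> R -> Omega -> R,
    forall i, bounded_integral (fun t w => S t w i 0)
                               (fun t w => theta t w 0 i) (W_ i) &
    forall t w, W t w = \sum_(i < d) W_ i t w.

Definition truncation theta (n : nat) : R -> Omega -> 'rV[R]_d :=
  fun t w => if `|theta t w| <= n%:R then theta t w else 0.

(* theta is in L(S) and Y is a version of theta . S: the bounded integrals
   (theta 1_{|theta| <= n}) . S converge to Y in the semimartingale topology.
   The components of theta need not be integrable one by one. *)
Definition vector_integral S theta (Y : R -> Omega -> R) : Prop :=
  [/\ vector_predictable theta,
      cadlag Y /\ (forall t, t \in `[0, T] -> measurable_fun setT (Y t)),
      forall w, Y 0 w = 0
    & exists2 Y_ : nat -> R -> Omega -> R,
        forall n, bounded_vector_integral S (truncation theta n) (Y_ n) &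
        emery_cvg Y_ Y].

Definition value theta S : R -> Omega -> R :=
  fun t w => (theta t w *m S t w) 0 0.

Definition self_financing S theta : Prop :=
  exists2 Y, vector_integral S theta Y &
    indistinguishable (value theta S) (fun t w => value theta S 0 w + Y t w).

Definition tame S theta : Prop :=
  self_financing S theta /\
  (ereal_sup [set ('E_P[fun w => (value theta S (sigma w) w ^+ 2)%R])%E
             | sigma in [set sigma | stopping_time sigma]] < +oo)%E.

Definition admissible S theta : Prop :=
  self_financing S theta /\
  exists theta_ : nat -> R -> Omega -> 'rV[R]_d,
    [/\ forall n, tame S (theta_ n),
        forall sigma, stopping_time sigma ->
          cvg_in_probability (fun n w => value (theta_ n) S (sigma w) w)
                             (fun w => value theta S (sigma w) w)
      & cvg_in_L2 (fun n => value (theta_ n) S T) (value theta S T)].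

Definition initial_value S theta (v : R) : Prop :=
  {ae P, forall w, value theta S 0 w = v}.

Definition tame_from S (v : R) theta : Prop :=
  tame S theta /\ initial_value S theta v.

Definition admissible_from S (v : R) theta : Prop :=
  admissible S theta /\ initial_value S theta v.

Definition deflator S (Z : R -> Omega -> R) : Prop :=
  [/\ Z T \in Lfun P 2%:E,
      forall theta, tame_from S 0 theta ->
        martingale (fun t w => Z t w * value theta S t w)
    & exists phi : R -> Omega -> 'rV[R]_d,
        [/\ self_financing S phi, strictly_positive (value phi S)
          & martingale (fun t w => Z t w * value phi S t w)]].

Definition hedging_error S (H : Omega -> R) theta : \bar R :=
  ('E_P[fun w => ((value theta S T w - H w) ^+ 2)%R])%E.

Definition hedging_optimizer S (H : Omega -> R) (v : R) theta : Prop :=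
  admissible_from S v theta /\
  forall eta, admissible_from S v eta ->
    (hedging_error S H theta <= hedging_error S H eta)%E.

End Market.
End StochasticCalculus.

(* Main.v *)
(* Call a process V the value of a tame strategy started at 0.  If Z is a positive
   deflator and X = phi S > 0 its positive value process, then N = Z X and M = Z V
   are martingales, and the quotient U = V / X = M / N is a martingale under the
   weights N.  A Burkholder-type weak inequality for M / N, proved on dyadic grids
   by stopping U at the exit from [-lam, lam], and the product rule
   dV = U dX + X dU + dX dU show that K . V is small in probability, uniformly over
   predictable |K| <= 1, as soon as E|Z_T V_T| is small, hence as soon as E[V_T^2]
   is small.

   Consequently tame strategies started at v whose terminal values are Cauchy in L^2
   have value processes that are Cauchy in the semimartingale topology.  The limit is
   again an S-integral: one takes, pointwise in (t, w), a predictably chosen random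
   subsequence along which the integrands converge after compactification; where
   they diverge, the limiting direction is a null strategy, whose elimination makes
   one more coordinate vanish.  The relation "integral = value" survives because it
   can be tested on left limits and jumps.

   By the parallelogram identity a minimizing sequence of tame strategies is Cauchy
   in L^2, which gives the optimizer; any two optimizers are limits of minimizing
   sequences, whose values merge at every time by the same estimate. *)

Require Import Defs.
From HB Require Import structures.
From mathcomp Require Import all_boot all_order all_algebra.
From mathcomp Require Import all_classical all_reals all_analysis.
From mathcomp Require Import measurable_realfun.
From mathcomp Require Import ring lra zify.

Set Implicit Arguments.
Unset Strict Implicit.
Unset Printing Implicit Defensive.

Import Order.TTheory GRing.Theory Num.Theory.
Import numFieldNormedType.Exports.

Local Open Scope classical_set_scope.
Local Open Scope ring_scope.

(** * Convergence in probability *)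

(** An L^2 bound controls terminal values only, whereas a limit strategy must have a value process
    that is an S-integral and is approached at all stopping times; the deflator carries smallness
    from T back to the whole path. What it provides is merely a bound on E|Z_T V_T|, a first moment,
    so L^2 isometries are out of reach and everything is measured by [l0], a metric for convergence
    in probability. The constants must not depend on the strategy, the test integrand or the grid:
    they come from tightness of the integrals against the single process X. Integrals are handled as
    operators on bounded predictable integrands, and facts about them are proved by monotone class
    arguments. Since the filtration is neither complete nor right-continuous, adaptedness is used up
    to approximation and stopping takes place on finite grids only. Finally S may be degenerate:
    different integrands can have the same integral and can diverge along null strategies while
    their integrals converge, so convergence of the integrands cannot be read off that of the
    integrals. *)

Section ConvergenceInProbability.
Context {disp : measure_display} {Omega : measurableType disp} {R : realType}.
Variable P : probability Omega R.
Implicit Types f g h : Omega -> R.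

(** One-sided on purpose: applied to nonnegative quantities it means convergence to 0, and it is
    inherited from an upper bound without any lower estimate. *)
Definition vanishing (u : nat -> R) : Prop :=
  forall e, 0 < e -> exists N, forall n, (N <= n)%N -> u n <= e.

Lemma cvg0_vanishing (u : nat -> R) : (forall n, 0 <= u n) ->
  (u n @[n --> \oo] --> (0 : R)) <-> vanishing u.
Proof.
move=> u0; split=> [/cvgrPdist_le h e e0|h].
  have [N _ hN] := h e e0; exists N => n /hN /=.
  by rewrite sub0r normrN ger0_norm.
apply/cvgrPdist_le => e e0; have [N hN] := h e e0.
by exists N => // n /= /hN; rewrite sub0r normrN ger0_norm.
Qed.

Lemma vanishing_le (u v : nat -> R) :
  (forall n, u n <= v n) -> vanishing v -> vanishing u.
Proof.
by move=> uv hv e e0; have [N hN] := hv e e0; exists N => n /hN; apply: le_trans.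
Qed.

Lemma vanishingD (u v : nat -> R) :
  vanishing u -> vanishing v -> vanishing (fun n => u n + v n).
Proof.
move=> hu hv e e0; have e2 : 0 < e / 2 by lra.
have [N hN] := hu _ e2; have [M hM] := hv _ e2; exists (maxn N M) => n.
rewrite geq_max => /andP[/hN un /hM vn]; lra.
Qed.

Lemma vanishingZ (c : R) (u : nat -> R) : 0 <= c ->
  vanishing u -> vanishing (fun n => c * u n).
Proof.
move=> c0 hu e e0; have [N hN] := hu (e / (c + 1)) ltac:(apply: divr_gt0; lra).
exists N => n /hN un; apply: (le_trans (ler_wpM2l c0 un)).
by rewrite mulrA ler_pdivrMr; nra.
Qed.

(** The Ky Fan type distance to 0: subadditive, monotone and metrizing convergence in probability
    ([cvg_in_probability_l0]), so that limits in probability become estimates between real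
    numbers. *)
Definition l0 f : R := \int[P]_w Num.min `|f w| 1.

Lemma bounded_integrable f (C : R) : measurable_fun setT f ->
  (forall w, `|f w| <= C) -> P.-integrable setT (EFin \o f).
Proof.
move=> mf fC; apply: measurable_bounded_integrable => //.
  by rewrite -ge0_fin_numE// fin_num_measure.
exists C; split; first by rewrite num_real.
by move=> M CM w _ /=; apply: (le_trans (fC w)); exact: ltW.
Qed.

Lemma integrable_fun_eq f g : f =1 g ->
  P.-integrable setT (EFin \o f) -> P.-integrable setT (EFin \o g).
Proof. by move=> /funext ->. Qed.

Lemma integrable_funD f g :
  P.-integrable setT (EFin \o f) -> P.-integrable setT (EFin \o g) ->
  P.-integrable setT (EFin \o (fun w => f w + g w)).
Proof. by move=> intf intg; exact: (integrableD measurableT intf intg). Qed.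

Lemma integrable_funB f g :
  P.-integrable setT (EFin \o f) -> P.-integrable setT (EFin \o g) ->
  P.-integrable setT (EFin \o (fun w => f w - g w)).
Proof. by move=> intf intg; exact: (integrableB measurableT intf intg). Qed.

Lemma integrable_funZ (c : R) f : P.-integrable setT (EFin \o f) ->
  P.-integrable setT (EFin \o (fun w => c * f w)).
Proof. by move=> intf; exact: (integrableZl measurableT c intf). Qed.

Lemma measurable_l0 f : measurable_fun setT f ->
  measurable_fun setT (fun w => Num.min `|f w| 1 : R).
Proof.
move=> mf; apply: measurable_minr => //.
exact: measurableT_comp.
Qed.

Lemma min1_bound (x : R) : `|Num.min `|x| 1| <= 1.
Proof. by rewrite ger0_norm ?ge_min ?lexx ?orbT// le_min normr_ge0 ler01. Qed.

Lemma l0_integrable f : measurable_fun setT f ->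
  P.-integrable setT (EFin \o (fun w => Num.min `|f w| 1)).
Proof.
move=> mf; apply: (@bounded_integrable _ 1); first exact: measurable_l0.
by move=> w; exact: min1_bound.
Qed.

Lemma ae_le_Rintegral f g :
  P.-integrable setT (EFin \o f) -> P.-integrable setT (EFin \o g) ->
  {ae P, forall w, f w <= g w} ->
  \int[P]_w f w <= \int[P]_w g w.
Proof.
move=> intf intg fg.
rewrite -subr_ge0 -RintegralB//; apply: fine_ge0.
have igf : P.-integrable setT (EFin \o (fun w => g w - f w)).
  exact: integrable_funB.
have mgf := measurable_int _ igf.
have -> : (\int[P]_w (g w - f w)%:E = \int[P]_w (Num.max (g w - f w) 0)%:E)%E.
  apply: ae_eq_integral => //.
    apply/measurable_EFinP; apply: measurable_maxr => //.
    exact/measurable_EFinP.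
  by apply: filterS fg => w fgw _; congr EFin; rewrite max_l// subr_ge0.
by apply: integral_ge0 => w _; rewrite lee_fin le_max lexx orbT.
Qed.

Lemma ae_eq_Rintegral f g :
  measurable_fun setT f -> measurable_fun setT g ->
  {ae P, forall w, f w = g w} -> \int[P]_w f w = \int[P]_w g w.
Proof.
move=> mf mg fg; congr fine; apply: ae_eq_integral => //; try exact/measurable_EFinP.
by apply: filterS fg => w -> .
Qed.

Lemma l0_ge0 f : 0 <= l0 f.
Proof. by apply: Rintegral_ge0 => w _; rewrite le_min normr_ge0 ler01. Qed.

Lemma Rintegral_probability_cst (c : R) : \int[P]_w c = c.
Proof. rewrite Rintegral_cst//; transitivity (c * fine 1%E); last by rewrite /= mulr1.
by congr (_ * fine _); exact: probability_setT. Qed.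

Lemma integrable_cst (c : R) : P.-integrable setT (EFin \o (fun _ : Omega => c)).
Proof. exact: finite_measure_integrable_cst. Qed.

Lemma l0_le_ae f g : measurable_fun setT f -> measurable_fun setT g ->
  {ae P, forall w, `|f w| <= `|g w|} -> l0 f <= l0 g.
Proof.
move=> mf mg fg; apply: ae_le_Rintegral; try exact: l0_integrable.
by apply: filterS fg => w fgw; rewrite le_min ge_min fgw/= ge_min lexx orbT.
Qed.

Lemma l0_ae f g : measurable_fun setT f -> measurable_fun setT g ->
  {ae P, forall w, f w = g w} -> l0 f = l0 g.
Proof.
move=> mf mg fg; apply/le_anti; rewrite !l0_le_ae//;
  by apply: filterS fg => w ->.
Qed.

Lemma l0D f g : measurable_fun setT f -> measurable_fun setT g ->
  l0 (fun w => f w + g w) <= l0 f + l0 g.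
Proof.
move=> mf mg; rewrite -RintegralD ?l0_integrable//.
apply: le_Rintegral => //; first exact/l0_integrable/measurable_funD.
  by apply: integrable_funD; exact: l0_integrable.
move=> w _; have := ler_normD (f w) (g w).
have := normr_ge0 (f w); have := normr_ge0 (g w).
rewrite /Num.min; do 3 (case: ltP => ?); lra.
Qed.

Lemma l0N f : l0 (fun w => - f w) = l0 f.
Proof. by congr fine; apply: eq_integral => w _; rewrite normrN. Qed.

Lemma l0B f g : measurable_fun setT f -> measurable_fun setT g ->
  l0 (fun w => f w - g w) <= l0 f + l0 g.
Proof. by move=> mf mg; rewrite -(l0N g); apply: l0D => //; exact: measurableT_comp. Qed.

Lemma l0_cst0 : l0 (fun _ => 0) = 0.
Proof.
rewrite /l0 -[RHS](Rintegral_probability_cst 0); congr fine; apply: eq_integral => w _.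
by rewrite normr0 min_l.
Qed.

(** The truncation at 1 destroys homogeneity, so a factor below 1 brings no gain. *)
Lemma l0Z (c : R) f : measurable_fun setT f ->
  l0 (fun w => c * f w) <= Num.max 1 `|c| * l0 f.
Proof.
move=> mf; rewrite -RintegralZl ?l0_integrable//.
apply: le_Rintegral => //; first exact/l0_integrable/measurable_funM.
  exact/integrable_funZ/l0_integrable.
move=> w _; rewrite normrM.
have := normr_ge0 (f w); have := normr_ge0 c.
rewrite /Num.min /Num.max; do 3 (case: ltP => ?); nra.
Qed.

Lemma l0_sum (I : Type) (s : seq I) (F : I -> Omega -> R) :
  (forall i, measurable_fun setT (F i)) ->
  l0 (fun w => \sum_(i <- s) F i w) <= \sum_(i <- s) l0 (F i).
Proof.
move=> mF; elim: s => [|i s ih].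
  rewrite big_nil (_ : (fun _ => _) = fun=> 0) ?l0_cst0//.
  by apply/funext => w; rewrite big_nil.
rewrite big_cons (_ : (fun _ => _) = fun w => F i w + \sum_(j <- s) F j w).
  apply: (le_trans (l0D _ _)) => //; first exact: measurable_sum.
  by rewrite lerD2l.
by apply/funext => w; rewrite big_cons.
Qed.

Lemma l0_eq0 f : measurable_fun setT f -> l0 f <= 0 -> {ae P, forall w, f w = 0}.
Proof.
move=> mf l0f; have {}l0f : l0 f = 0 by apply/le_anti; rewrite l0f l0_ge0.
pose m w : R := Num.min `|f w| 1.
have mm : measurable_fun setT (EFin \o m) by exact/measurable_EFinP/measurable_l0.
have : (\int[P]_w `|(EFin \o m) w| = 0)%E.
  under eq_integral do rewrite /= ger0_norm ?le_min ?normr_ge0 ?ler01//=.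
  rewrite -[LHS]fineK; first by congr EFin.
  exact/integrable_fin_num/l0_integrable.
move/(ae_eq_integral_abs _ measurableT mm); apply: filterS => w /(_ I) /= [].
rewrite /m /Num.min; case: ltP => [_ /eqP|_ /eqP]; last by rewrite oner_eq0.
by rewrite normr_eq0 => /eqP.
Qed.

Lemma vanishing_l0_ae (f_ : nat -> Omega -> R) f :
  (forall n, measurable_fun setT (f_ n)) -> measurable_fun setT f ->
  {ae P, forall w, f_ n w @[n --> \oo] --> f w} ->
  vanishing (fun n => l0 (fun w => f_ n w - f w)).
Proof.
move=> mf_ mf cvf; apply/cvg0_vanishing; first by move=> n; exact: l0_ge0.
pose g n w := Num.min `|f_ n w - f w| 1 : R.
have mg n : measurable_fun setT (g n).
  by apply: measurable_l0; exact: measurable_funB.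
have mEg n : measurable_fun setT (EFin \o g n) by exact/measurable_EFinP.
have cvg0 : {ae P, forall w, setT w -> (EFin \o g n) w @[n --> \oo] --> @cst Omega (\bar R) 0%E w}.
  apply: filterS cvf => w cvw _; apply: cvg_EFin; first by near=> n.
  apply/cvgrPdist_le => e e0.
  move/cvgrPdist_le : cvw => /(_ e e0); apply: filterS => n /=.
  rewrite sub0r normrN distrC => h.
  by rewrite /g ger0_norm ?le_min ?normr_ge0 ?ler01// ge_min h.
have gb : {ae P, forall w, forall n, setT w -> (`|(EFin \o g n) w| <= (EFin \o fun=> 1%R) w)%E}.
  by apply/aeW => w n _; rewrite /= lee_fin min1_bound.
have [_ _ /=] := dominated_convergence measurableT mEg
  (measurable_cst _) cvg0 (integrable_cst 1) gb.
rewrite integral0 => /fine_cvgP[_]; exact.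
Unshelve. all: by end_near.
Qed.

Lemma integrable_indicator A : measurable A ->
  P.-integrable setT (EFin \o (fun w => \1_A w)).
Proof.
move=> mA; apply: (@bounded_integrable _ 1) => [|w]; first exact: measurable_indic.
by rewrite indicE; case: (_ \in _); rewrite ?normr0 ?normr1.
Qed.

Lemma Rintegral_indicator A : measurable A -> \int[P]_w \1_A w = fine (P A).
Proof. by move=> mA; rewrite /Rintegral integral_indic// setIT. Qed.

(** Markov's inequality; the level is at most 1 because the truncation hides everything above 1. *)
Lemma l0_markov f (e : R) : measurable_fun setT f -> 0 < e -> e <= 1 ->
  (P [set w | (e <= `|f w|)%R] <= (l0 f / e)%:E)%E.
Proof.
move=> mf e0 e1; pose A := [set w | e <= `|f w|].
have mA : measurable A.
  rewrite -[A]setTI; apply: measurable_fun_ler => //; exact: measurableT_comp.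
rewrite -[leLHS]fineK ?fin_num_measure// lee_fin ler_pdivlMr//.
have -> : fine (P A) * e = \int[P]_w (e * \1_A w).
  by rewrite RintegralZl ?integrable_indicator// Rintegral_indicator// mulrC.
apply: le_Rintegral => //; last 2 first.
  exact: l0_integrable.
  move=> w _; rewrite indicE; case: (boolP (w \in A)) => [|_].
    by rewrite inE /A/= mulr1 => h; rewrite le_min h.
  by rewrite mulr0 le_min normr_ge0 ler01.
apply: (@bounded_integrable _ e); first exact: measurable_funM.
move=> w; rewrite indicE; case: (_ \in _); rewrite ?mulr0 ?mulr1 ?normr0 ?(gtr0_norm e0) ?(ltW e0)//.
Qed.

Lemma l0_le_probability f (e : R) : measurable_fun setT f -> 0 <= e ->
  l0 f <= e + fine (P [set w | e < `|f w|]).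
Proof.
move=> mf e0; pose A := [set w | e < `|f w|].
have mA : measurable A.
  rewrite -[A]setTI; apply: measurable_fun_ltr => //; exact: measurableT_comp.
have -> : e + fine (P A) = \int[P]_w (e + \1_A w).
  rewrite RintegralD ?integrable_cst ?integrable_indicator//.
  by rewrite Rintegral_probability_cst Rintegral_indicator.
apply: le_Rintegral => //; first exact: l0_integrable.
  apply: (@bounded_integrable _ (e + 1)); first exact: measurable_funD.
  move=> w; rewrite indicE; case: (_ \in _); rewrite ?mulr1n ?mulr0n ger0_norm; lra.
move=> w _; rewrite indicE; case: (boolP (w \in A)) => [_|].
  by rewrite ge_min; apply/orP; right; rewrite lerDr.
by rewrite notin_setE /A/= => /negP; rewrite -leNgt addr0 ge_min => ->.
Qed.

Lemma cvg_in_probability_l0 (f_ : nat -> Omega -> R) f :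
  (forall n, measurable_fun setT (f_ n)) -> measurable_fun setT f ->
  cvg_in_probability P f_ f <-> vanishing (fun n => l0 (fun w => f_ n w - f w)).
Proof.
move=> mf_ mf; have mB n : measurable_fun setT (fun w => f_ n w - f w).
  exact: measurable_funB.
have mS e n : measurable [set w | e <= `|f_ n w - f w|].
  by rewrite -[X in measurable X]setTI; apply: measurable_fun_ler => //; exact: measurableT_comp.
split=> [cf e e0|vf e e0].
  have e2 : 0 < e / 2 by lra.
  have /fine_cvgP[_ /cvgrPdist_le /(_ _ e2)[N _ hN]] := cf _ e2.
  exists N => n /hN /=; rewrite sub0r normrN ger0_norm ?fine_ge0// => h.
  apply: (le_trans (l0_le_probability (mB n) (ltW e2))).
  suff : fine (P [set w | e / 2 < `|f_ n w - f w|]) <= fine (P [set w | e / 2 <= `|f_ n w - f w|]) by lra.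
  apply: fine_le; rewrite ?fin_num_measure//.
    by rewrite -[X in measurable X]setTI; apply: measurable_fun_ltr => //; exact: measurableT_comp.
  apply: le_measure; rewrite ?inE//; last by move=> w /=; exact: ltW.
  by rewrite -[X in measurable X]setTI; apply: measurable_fun_ltr => //; exact: measurableT_comp.
(* Markov's inequality is available at levels up to 1 only; a larger e is lowered to 1. *)
pose m := Num.min e 1.
have m0 : 0 < m by rewrite lt_min e0 ltr01.
apply/fine_cvgP; split; first by near=> n; rewrite fin_num_measure.
apply/cvg0_vanishing => [n|]; first exact: fine_ge0.
have : vanishing (fun n => m^-1 * l0 (fun w => f_ n w - f w)).
  by apply: vanishingZ => //; rewrite invr_ge0 ltW.
apply: vanishing_le => n; rewrite -lee_fin fineK ?fin_num_measure// mulrC.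
apply: le_trans (l0_markov (mB n) m0 _); last by rewrite ge_min lexx orbT.
apply: le_measure; rewrite ?inE// => w /=; apply: le_trans.
by rewrite ge_min lexx.
Unshelve. all: by end_near.
Qed.

(** Borel-Cantelli in integral form: by monotone convergence the series of truncated terms has
    integral at most 2 C, hence is finite almost everywhere. This is what makes fast subsequences
    converge almost surely. *)
Lemma l0_summable_ae (f_ : nat -> Omega -> R) (C : R) :
  (forall n, measurable_fun setT (f_ n)) ->
  (forall n, l0 (f_ n) <= C * (1 / 2) ^+ n) ->
  {ae P, forall w, exists M : R, forall n, \sum_(k < n) Num.min `|f_ k w| 1 <= M}.
Proof.
move=> mf_ hf; pose g n w := (Num.min `|f_ n w| 1)%:E : \bar R.
have mg n : measurable_fun setT (g n).
  by apply/measurable_EFinP; exact: measurable_l0.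
have g0 n w : (0 <= g n w)%E by rewrite lee_fin le_min normr_ge0 ler01.
have geo n : \sum_(k < n) (1 / 2 : R) ^+ k <= 2.
  have -> : \sum_(k < n) (1 / 2 : R) ^+ k = 2 - 2 * (1 / 2) ^+ n.
    elim: n => [|n ih]; first by rewrite big_ord0 expr0; lra.
    by rewrite big_ord_recr/= ih exprS; lra.
  have : 0 <= (1 / 2 : R) ^+ n by apply: exprn_ge0; lra.
  lra.
have C0 : 0 <= C by have := hf 0%N; rewrite expr0 mulr1; apply: le_trans; exact: l0_ge0.
pose G w := (\sum_(k <oo) g k w)%E.
have mG : measurable_fun setT G by exact: ge0_emeasurable_sum.
have iG : (\int[P]_w G w <= (C * 2)%:E)%E.
  rewrite integral_nneseries//.
  apply: lime_le; first by apply: is_cvg_nneseries => n _ _; exact: integral_ge0.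
  near=> n; rewrite (eq_bigr (fun k => (l0 (f_ k))%:E)); last first.
    by move=> k _; rewrite fineK//; exact/integrable_fin_num/l0_integrable.
  rewrite sumEFin lee_fin big_mkord; apply: (@le_trans _ _ (\sum_(k < n) C * (1 / 2) ^+ k)).
    by apply: ler_sum => k _; exact: hf.
  by rewrite -mulr_sumr ler_wpM2l.
have intG : P.-integrable setT G.
  apply/integrableP; split=> //; apply: le_lt_trans (ltry (C * 2)).
  apply: le_trans iG; under eq_integral do rewrite gee0_abs ?nneseries_ge0//.
  by [].
have := integrable_ae measurableT intG; apply: filterS => w /(_ I) Gw.
exists (fine (G w)) => n; rewrite -lee_fin fineK// -sumEFin.
rewrite -(big_mkord xpredT (fun k => g k w)).
exact: nneseries_lim_ge.
Unshelve. all: by end_near.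
Qed.

Lemma sum_bounded_cvg0 (u : nat -> R) (M : R) : (forall n, 0 <= u n) ->
  (forall n, \sum_(k < n) u k <= M) -> u n @[n --> \oo] --> (0 : R).
Proof.
move=> u0 hM; apply: cvg_series_cvg_0; apply: nondecreasing_is_cvgn.
  apply: nondecreasing_series => n _ _; exact: u0.
exists M => _ [n _ <-]; rewrite /series/= big_mkord; exact: hM.
Qed.

End ConvergenceInProbability.

(** * Predictable processes *)

Section BoundedInduction.
Context {d : measure_display} {X : measurableType d} {R : realType}.

(** A monotone class principle based on the indicators of all measurable sets. A function with
    values in [0, 1] is the uniform limit of its truncated binary expansions, which are finite
    linear combinations of indicators; an affine rescaling gives the bounded case. *)
Lemma bounded_measurable_ind (Pr : (X -> R) -> Prop) :
  (forall A, measurable A -> Pr (fun x => \1_A x)) ->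
  (forall a (f g : X -> R), measurable_fun setT f -> measurable_fun setT g ->
    (exists C : R, forall x, `|f x| <= C) -> (exists C : R, forall x, `|g x| <= C) ->
    Pr f -> Pr g -> Pr (fun x => a * f x + g x)) ->
  (forall (f_ : nat -> X -> R) (f : X -> R) (C : R), (forall n, measurable_fun setT (f_ n)) ->
    measurable_fun setT f -> (forall n x, `|f_ n x| <= C) ->
    (forall x, f_ n x @[n --> \oo] --> f x) ->
    (forall n, Pr (f_ n)) -> Pr f) ->
  forall (f : X -> R) (C : R), measurable_fun setT f -> (forall x, `|f x| <= C) -> Pr f.
Proof.
move=> Pind Plin Plim.
have b1 A : exists C : R, forall x : X, `|\1_A x : R| <= C.
  exists 1 => x; rewrite indicE; case: (_ \in _); rewrite ?normr0 ?normr1//.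
have P1 : Pr (fun=> 1).
  rewrite (_ : (fun=> 1) = fun x => \1_setT x); first exact: Pind.
  by apply/funext => x; rewrite indicE in_setT.
have P0 : Pr (fun=> 0).
  rewrite (_ : (fun=> 0) = fun x => \1_set0 x); first exact: Pind.
  by apply/funext => x; rewrite indicE in_set0.
have unit_case (f : X -> R) : measurable_fun setT f -> (forall x, 0 <= f x <= 1) -> Pr f.
  move=> mf f01.
  (* Greedy binary expansion: the digit 2^-n is added where the remainder f - s m still allows it,
     so that the new remainder lies in [0, 2^-n]. *)
  pose fix s n : X -> R := if n is m.+1 then
    fun x => (1 / 2) ^+ n * \1_[set x | (1 / 2) ^+ n <= f x - s m x] x + s m x
    else fun=> 0.
  have sS n x : s n.+1 x = (1 / 2) ^+ n.+1 *
      \1_[set x | (1 / 2) ^+ n.+1 <= f x - s n x] x + s n x by [].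
  have sb n x : 0 <= f x - s n x <= (1 / 2) ^+ n.
    elim: n => [|n /andP[ih0 ih1]]; first by rewrite subr0 expr0 f01.
    rewrite sS indicE; set u := (1 / 2) ^+ n.+1.
    have u2 : (1 / 2) ^+ n = 2 * u by rewrite /u exprS; field.
    have : x \in [set x | u <= f x - s n x] = (u <= f x - s n x).
      by apply/idP/idP; rewrite inE.
    rewrite u2 in ih1; clear u2; clearbody u.
    move=> ->; case: (leP u (f x - s n x)) => h; rewrite ?mulr1n ?mulr0n ?mulr1 ?mulr0; apply/andP; split; lra.
  have s0 n x : 0 <= s n x.
    elim: n => [//|n ih]; rewrite sS addr_ge0// mulr_ge0// ?indicE ?ler0n//.
  have sb1 n x : `|s n x| <= 1.
    rewrite ger0_norm//; have /andP[_ ?] := f01 x; have /andP[? _] := sb n x; lra.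
  have ms n : measurable_fun setT (s n) /\ Pr (s n).
    elim: n => [|n [ms Ps]]; first by split=> //; exact: measurable_cst.
    set A := [set x | (1 / 2) ^+ n.+1 <= f x - s n x].
    have mA : measurable A.
      by rewrite -[A]setTI; apply: measurable_fun_ler => //; exact: measurable_funB.
    split.
      apply: measurable_funD => //; apply: measurable_funM => //.
    apply: Plin => //; [by exists 1|exact: Pind].
  apply: (Plim s f 1) => // [n|x|n]; [by case: (ms n)| |by case: (ms n)].
  apply/cvgrPdist_le => e e0.
  have /cvgrPdist_le /(_ e e0) : (1 / 2 : R) ^+ n @[n --> \oo] --> (0 : R).
    by apply: cvg_expr; rewrite ger0_norm; lra.
  apply: filterS => n /=; rewrite sub0r normrN => h.
  have := sb n x; move=> /andP[h1 h2]; rewrite ger0_norm//.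
  apply: (le_trans h2); apply: le_trans h; exact: ler_norm.
move=> f C mf fC.
have [C0|C0] := leP C 0.
  rewrite (_ : f = fun=> 0)//; apply/funext => x; apply/eqP.
  by rewrite -normr_le0 (le_trans (fC x)).
pose g x := (f x + C) / (2 * C).
have mg : measurable_fun setT g.
  apply: measurable_funM => //; exact: measurable_funD.
have g01 x : 0 <= g x <= 1.
  have := fC x; rewrite ler_norml => /andP[h1 h2].
  by rewrite divr_ge0 ?ler_pdivrMr/=; lra.
have Pg := unit_case g mg g01.
rewrite (_ : f = fun x => (2 * C) * g x + (- C * 1 + 0)); last first.
  by apply/funext => x; rewrite /g; field; lra.
apply: (Plin) => //.
- by exists 1 => x; case/andP: (g01 x) => ? ?; rewrite ger0_norm.
- by exists C => x; rewrite mulr1 addr0 normrN ger0_norm// ltW.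
- by apply: (Plin) => //; [exists 1 => x; rewrite normr1|exists 0 => x; rewrite normr0].
Qed.

End BoundedInduction.

Lemma cvg_eventually (R : realType) (u : nat -> R) (c : R) (N : nat) :
  (forall n, (N <= n)%N -> u n = c) -> u n @[n --> \oo] --> c.
Proof.
move=> uc; apply/cvgrPdist_le => e e0; exists N => // n /= /uc ->.
by rewrite subrr normr0 ltW.
Qed.

(** With 0^-1 = 0 the inverse is the pointwise limit, at 0 as well, of the continuous functions x /
    (x^2 + 1/(n+1)). *)
Lemma measurable_inv (R : realType) : measurable_fun setT (fun x : R => x^-1).
Proof.
pose f n (x : R) := x * (x ^+ 2 + n.+1%:R^-1)^-1.
have fpos n (x : R) : 0 < x ^+ 2 + n.+1%:R^-1.
  by rewrite ltr_wpDl ?sqr_ge0// invr_gt0 ltr0n.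
apply: (@measurable_fun_cvg _ _ _ _ f).
  move=> n; apply: measurable_funM => //; apply: continuous_measurable_fun => x.
  apply: (@continuousV _ _ (fun x : R => x ^+ 2 + n.+1%:R^-1)).
    by rewrite gt_eqF.
  by apply: cvgD; [exact: exprn_continuous|exact: cvg_cst].
move=> x _; have [->|x0] := eqVneq x 0.
  by rewrite invr0 /f; under eq_fun do rewrite mul0r; exact: cvg_cst.
have -> : x^-1 = x * (x ^+ 2 + 0)^-1 by rewrite addr0; field.
apply: cvgM; first exact: cvg_cst.
apply: cvgV; first by rewrite addr0 sqrf_eq0.
apply: cvgD; first exact: cvg_cst.
exact: cvg_harmonic.
Qed.

Section Predictable.
Context {disp : measure_display} {Omega : measurableType disp} {R : realType}.
Variables (T : R) (F : R -> set (set Omega)).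
Hypothesis T_ge0 : 0 <= T.
Hypothesis filF : filtration T F.
Implicit Types H K : R -> Omega -> R.

Definition timeline : set (R * Omega) := `[0, T] `*` setT.

Lemma predictable_sets_sub A : predictable_sets T F A -> A `<=` timeline.
Proof.
have : predictable_sets T F `<=` [set A | A `<=` timeline].
  apply: smallest_sub.
    by split=> [t []//|B BD t []//|A_ AD]; apply: bigcup_sub => i _; exact: AD.
  move=> B [[C _ <-]|[s [t [C [s0 st tT _ ->]]]]] [u w] /= [].
    by rewrite in_itv/= => /andP[u0 u0'] _; split=> //=; rewrite in_itv/= u0 (le_trans u0').
  by rewrite !in_itv/= => /andP[su ut] _; split=> //=; rewrite in_itv/= (le_trans s0 (ltW su)) (le_trans ut).
by apply.
Qed.

Lemma predictable_sets_sigma_algebra :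
  sigma_algebra timeline (predictable_sets T F).
Proof. exact: smallest_sigma_algebra. Qed.

(** The predictable sets form a sigma-algebra on [0, T] x Omega only. Passing to traces gives one on
    the whole product, so that general measurable functions, restricted to [timeline], can model
    predictable processes. *)
Definition predictable_algebra : set (set (R * Omega)) :=
  [set A | predictable_sets T F (timeline `&` A)].

Lemma predictable_algebra_sigma_algebra :
  sigma_algebra setT predictable_algebra.
Proof.
have [h0 hC hU] := predictable_sets_sigma_algebra.
split=> [|A hA|A_ hA]; rewrite /predictable_algebra/=.
- by rewrite setI0.
- rewrite (_ : _ `&` _ = timeline `\` (timeline `&` A)); first exact: hC.
  by rewrite setDIr setDv set0U setTD setDE.
- by rewrite setI_bigcupr; exact: hU.
Qed.

Definition predictableType := g_sigma_algebraType predictable_algebra.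

Lemma predictableType_measurableE :
  @measurable _ predictableType = predictable_algebra.
Proof. exact/sigma_algebra_id/predictable_algebra_sigma_algebra. Qed.

Lemma measurable_timeline : measurable (timeline : set predictableType).
Proof.
rewrite predictableType_measurableE /predictable_algebra/= setIid.
have [h0 hC _] := predictable_sets_sigma_algebra.
by rewrite -[timeline]setD0; exact: hC.
Qed.

Lemma predictableP H : predictable T F H <->
  measurable_fun (timeline : set predictableType) (fun z => H z.1 z.2).
Proof.
split=> [h _ B mB|h B mB].
  rewrite predictableType_measurableE /predictable_algebra/= setIA setIid.
  exact: h.
have := h measurable_timeline B mB.
by rewrite predictableType_measurableE /predictable_algebra/= setIA setIid.
Qed.

Lemma predictable_ext H K : (forall t w, t \in `[0, T] -> H t w = K t w) ->
  predictable T F H -> predictable T F K.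
Proof.
move=> HK /predictableP h; apply/predictableP; apply: eq_measurable_fun h.
by move=> [t w]; rewrite inE => -[/= tT _]; exact: HK.
Qed.

Lemma predictable_cst (c : R) : predictable T F (fun _ _ => c).
Proof. by apply/predictableP; exact: measurable_cst. Qed.

Lemma predictableD H K : predictable T F H -> predictable T F K ->
  predictable T F (fun t w => H t w + K t w).
Proof. by move=> /predictableP h /predictableP k; apply/predictableP; exact: measurable_funD. Qed.

Lemma predictableB H K : predictable T F H -> predictable T F K ->
  predictable T F (fun t w => H t w - K t w).
Proof. by move=> /predictableP h /predictableP k; apply/predictableP; exact: measurable_funB. Qed.

Lemma predictableM H K : predictable T F H -> predictable T F K ->
  predictable T F (fun t w => H t w * K t w).
Proof. by move=> /predictableP h /predictableP k; apply/predictableP; exact: measurable_funM. Qed.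

Lemma predictableZ (c : R) H : predictable T F H ->
  predictable T F (fun t w => c * H t w).
Proof. by move=> h; apply: predictableM => //; exact: predictable_cst. Qed.

Lemma predictableN H : predictable T F H -> predictable T F (fun t w => - H t w).
Proof.
move=> h; apply: (@predictable_ext (fun t w => -1 * H t w)); last exact: predictableZ.
by move=> t w _; rewrite mulN1r.
Qed.

Lemma predictable_comp (g : R -> R) H : measurable_fun setT g ->
  predictable T F H -> predictable T F (fun t w => g (H t w)).
Proof. by move=> mg /predictableP h; apply/predictableP; exact: measurableT_comp. Qed.

Lemma predictable_norm H : predictable T F H -> predictable T F (fun t w => `|H t w|).
Proof. exact: predictable_comp. Qed.

Lemma predictable_inv H : predictable T F H -> predictable T F (fun t w => (H t w)^-1).
Proof. by apply: predictable_comp; exact: measurable_inv. Qed.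

Lemma predictable_sum (I : Type) (s : seq I) (H_ : I -> R -> Omega -> R) :
  (forall i, predictable T F (H_ i)) ->
  predictable T F (fun t w => \sum_(i <- s) H_ i t w).
Proof.
move=> h; apply/predictableP; apply: measurable_sum => i; exact/predictableP.
Qed.

Lemma predictable_lim (H_ : nat -> R -> Omega -> R) H :
  (forall n, predictable T F (H_ n)) ->
  (forall t w, t \in `[0, T] -> H_ n t w @[n --> \oo] --> H t w) ->
  predictable T F H.
Proof.
move=> h cv; apply/predictableP.
apply: (@measurable_fun_cvg _ _ _ _ (fun n (z : predictableType) => H_ n z.1 z.2)).
  by move=> n; exact/predictableP.
by move=> [t w] [/= tT _]; exact: cv.
Qed.

Lemma measurable_natr_bool : measurable_fun setT (fun b : bool => b%:R : R).
Proof. by []. Qed.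

Lemma predictable_ler H K : predictable T F H -> predictable T F K ->
  predictable T F (fun t w => (H t w <= K t w)%R%:R).
Proof.
move=> /predictableP h /predictableP k; apply/predictableP.
apply: (measurableT_comp (f := fun b : bool => b%:R : R)) => //.
exact: measurable_fun_ler.
Qed.

Lemma predictable_eqr H (c : R) : predictable T F H ->
  predictable T F (fun t w => (H t w == c)%:R).
Proof.
move=> /predictableP h; apply/predictableP.
apply: (measurableT_comp (f := fun b : bool => b%:R : R)) => //.
exact: measurable_fun_eqr.
Qed.

Lemma predictableC (b : R -> Omega -> bool) : predictable T F (fun t w => (b t w)%:R) ->
  predictable T F (fun t w => (~~ b t w)%:R).
Proof.
move=> h; apply: (@predictable_ext (fun t w => 1 - (b t w)%:R)).
  by move=> t w _; case: (b t w); rewrite ?subrr ?subr0.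
by apply: predictableB => //; exact: predictable_cst.
Qed.

Lemma predictableI (b c : R -> Omega -> bool) :
  predictable T F (fun t w => (b t w)%:R) -> predictable T F (fun t w => (c t w)%:R) ->
  predictable T F (fun t w => (b t w && c t w)%:R).
Proof.
move=> hb hc; apply: predictable_ext (predictableM hb hc).
by move=> t w _; rewrite -natrM mulnb.
Qed.

Lemma predictable_if (b : R -> Omega -> bool) H K :
  predictable T F (fun t w => (b t w)%:R) -> predictable T F H -> predictable T F K ->
  predictable T F (fun t w => if b t w then H t w else K t w).
Proof.
move=> hb hH hK.
apply: (@predictable_ext (fun t w => (b t w)%:R * H t w + (~~ b t w)%:R * K t w)).
  by move=> t w _; case: (b t w); rewrite /= ?mul1r ?mul0r ?addr0 ?add0r.
by apply: predictableD; apply: predictableM => //; exact: predictableC.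
Qed.

Lemma predictable_indicator (B : set (R * Omega)) : predictable_sets T F B ->
  predictable T F (fun t w => \1_B (t, w)).
Proof.
move=> hB; apply/predictableP.
have -> : (fun z : R * Omega => \1_B (z.1, z.2) : R) = \1_B.
  by apply/funext => -[].
apply: measurable_funTS; apply: measurable_indic.
rewrite predictableType_measurableE /predictable_algebra/= setIidr//.
exact: predictable_sets_sub.
Qed.

Lemma predictable_rectangle s t A : 0 <= s -> s <= t -> t <= T -> F s A ->
  predictable T F (fun u w => \1_(`]s, t]) u * \1_A w).
Proof.
move=> s0 st tT FA.
apply: (@predictable_ext (fun u w => \1_(`]s, t] `*` A) (u, w))).
  by move=> u w _; rewrite !indicE in_setX -natrM mulnb.
apply: predictable_indicator; apply: sub_sigma_algebra; right.
by exists s, t, A.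
Qed.

Lemma predictable_rectangle0 A : F 0 A ->
  predictable T F (fun u w => \1_(`[0, 0]) u * \1_A w).
Proof.
move=> FA.
apply: (@predictable_ext (fun u w => \1_(`[0, 0] `*` A) (u, w))).
  by move=> u w _; rewrite !indicE in_setX -natrM mulnb.
by apply: predictable_indicator; apply: sub_sigma_algebra; left; exists A.
Qed.

Lemma bp_pred H : bounded_predictable T F H -> predictable T F H.
Proof. by case. Qed.

Lemma bp_cst (c : R) : bounded_predictable T F (fun _ _ => c).
Proof. by split; [exact: predictable_cst|exists `|c|]. Qed.

Lemma bpD H K : bounded_predictable T F H -> bounded_predictable T F K ->
  bounded_predictable T F (fun t w => H t w + K t w).
Proof.
move=> [pH [C hC]] [pK [D hD]]; split; first exact: predictableD.
exists (C + D) => t w tT; apply: (le_trans (ler_normD _ _)).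
by rewrite lerD ?hC ?hD.
Qed.

Lemma bpM H K : bounded_predictable T F H -> bounded_predictable T F K ->
  bounded_predictable T F (fun t w => H t w * K t w).
Proof.
move=> [pH [C hC]] [pK [D hD]]; split; first exact: predictableM.
by exists (C * D) => t w tT; rewrite normrM ler_pM ?hC ?hD.
Qed.

Lemma bpZ (c : R) H : bounded_predictable T F H ->
  bounded_predictable T F (fun t w => c * H t w).
Proof. by move=> hH; apply: bpM => //; exact: bp_cst. Qed.

Lemma bpN H : bounded_predictable T F H -> bounded_predictable T F (fun t w => - H t w).
Proof.
move=> [pH [C hC]]; split; first exact: predictableN.
by exists C => t w tT; rewrite normrN hC.
Qed.

Lemma bpB H K : bounded_predictable T F H -> bounded_predictable T F K ->
  bounded_predictable T F (fun t w => H t w - K t w).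
Proof. by move=> hH hK; apply: bpD => //; exact: bpN. Qed.

Lemma bp_bool (b : R -> Omega -> bool) : predictable T F (fun t w => (b t w)%:R) ->
  bounded_predictable T F (fun t w => (b t w)%:R).
Proof.
by move=> h; split=> //; exists 1 => t w _; case: (b t w); rewrite ?normr1 ?normr0.
Qed.

Lemma norm_rectangle_le1 (D : set R) (A : set Omega) u w :
  `|\1_D u * \1_A w : R| <= 1.
Proof. by rewrite !indicE; do 2 case: (_ \in _); rewrite ?mulr0 ?mulr1 ?normr1 ?normr0. Qed.

Lemma bp_rectangle s t A : 0 <= s -> s <= t -> t <= T -> F s A ->
  bounded_predictable T F (fun u w => \1_(`]s, t]) u * \1_A w).
Proof.
move=> s0 st tT FA; split; first exact: predictable_rectangle.
by exists 1 => u w _; exact: norm_rectangle_le1.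
Qed.

Lemma bp_rectangle0 A : F 0 A ->
  bounded_predictable T F (fun u w => \1_(`[0, 0]) u * \1_A w).
Proof.
move=> FA; split; first exact: predictable_rectangle0.
by exists 1 => u w _; exact: norm_rectangle_le1.
Qed.

Lemma filtrationT t : t \in `[0, T] -> F t setT.
Proof.
by case: filF => h _ _ /h [F0 FC _]; rewrite -(setD0 setT); exact: FC.
Qed.

Lemma zero_in : 0 \in `[0, T].
Proof. by rewrite in_itv/= lexx. Qed.

Lemma T_in : T \in `[0, T].
Proof. by rewrite in_itv/= lexx andbT. Qed.

(** The pi-system hypothesis of Dynkin's theorem. An empty intersection counts as a rectangle over
    ]0, 0]. *)
Lemma predictable_rectangles_setI : setI_closed (predictable_rectangles T F).
Proof.
have [hs hm _] := filF.
have FI t A B : t \in `[0, T] -> F t A -> F t B -> F t (A `&` B).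
  move=> /hs [F0 FC FU] FA FB.
  rewrite -(setCK A) -(setCK B) -setCU -setTD; apply: (FC).
  rewrite -bigcup2E; apply: FU => -[|[|n]] //=; rewrite -setTD; exact: FC.
have emp A : predictable_rectangles T F (`]0, 0] `*` A) ->
    predictable_rectangles T F set0.
  by rewrite set_itv_ge ?set0X//= bnd_simp ltxx.
have E0 : predictable_rectangles T F set0.
  apply: (emp setT); right; exists 0, 0, setT; split=> //.
  exact/filtrationT/zero_in.
move=> _ _ [[A FA <-]|[s [t [A [s0 st tT FA ->]]]]] [[B FB <-]|[s' [t' [B [s0' st' tT' FB ->]]]]].
- left; exists (A `&` B); first exact: (FI _ _ _ zero_in).
  by rewrite -setXI setIid.
- suff -> : (`[0, 0] `*` A) `&` (`]s', t'] `*` B) = set0 by [].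
  apply/seteqP; split=> // -[u w] [] [/= + _] [/= + _].
  by rewrite !in_itv/= => /andP[_ u0] /andP[s'u _]; lra.
- suff -> : (`]s, t] `*` A) `&` (`[0, 0] `*` B) = set0 by [].
  apply/seteqP; split=> // -[u w] [] [/= + _] [/= + _].
  by rewrite !in_itv/= => /andP[su _] /andP[_ u0]; lra.
- have [h|h] := leP (Num.max s s') (Num.min t t').
    right; exists (Num.max s s'), (Num.min t t'), (A `&` B); split=> //.
    + by rewrite le_max s0.
    + by rewrite ge_min tT.
    + have mT : Num.max s s' \in `[0, T].
        by rewrite in_itv/= le_max s0/= ge_max; apply/andP; split; lra.
      apply: FI => //; [apply: (hm s) FA|apply: (hm s') FB] => //;
        rewrite ?in_itv/= ?s0 ?s0' ?le_max ?lexx ?orbT//; lra.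
    + rewrite -setXI; congr (_ `*` _); apply/seteqP; split=> u /=;
        rewrite !in_itv/= gt_max le_min.
        by move=> [/andP[-> ->] /andP[-> ->]].
      by move=> /andP[/andP[-> ->] /andP[-> ->]].
  suff -> : (`]s, t] `*` A) `&` (`]s', t'] `*` B) = set0 by [].
  apply/seteqP; split=> // -[u w] [] [/= + _] [/= + _].
  rewrite !in_itv/= => /andP[su ut] /andP[su' ut'].
  have : Num.max s s' < Num.min t t' by rewrite gt_max !lt_min; lra.
  by lra.
Qed.

(** Monotone class theorem for integrands. The hypotheses mirror the clauses that define
    [stochastic_integral_operator], so a property of the integral need only be checked on elementary
    integrands and on bounded pointwise limits. *)
Lemma bounded_predictable_ind (Pr : (R -> Omega -> R) -> Prop) :
  (forall A, F 0 A -> Pr (fun u w => \1_(`[0, 0]) u * \1_A w)) ->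
  (forall s t A, 0 <= s -> s <= t -> t <= T -> F s A ->
    Pr (fun u w => \1_(`]s, t]) u * \1_A w)) ->
  (forall a H K, bounded_predictable T F H -> bounded_predictable T F K ->
    Pr H -> Pr K -> Pr (fun t w => a * H t w + K t w)) ->
  (forall (H_ : nat -> R -> Omega -> R) H (C : R),
    (forall n, predictable T F (H_ n)) -> predictable T F H ->
    (forall n t w, t \in `[0, T] -> `|H_ n t w| <= C) ->
    (forall t w, t \in `[0, T] -> H_ n t w @[n --> \oo] --> H t w) ->
    (forall n, Pr (H_ n)) -> Pr H) ->
  forall H, bounded_predictable T F H -> Pr H.
Proof.
move=> P0 P1 Plin Plim.
(* Values outside [0, T] do not matter: the constant sequence H converges to K on [0, T], and the
   limit hypothesis transfers [Pr]. *)
have Pext H K : bounded_predictable T F H ->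
    (forall t w, t \in `[0, T] -> H t w = K t w) -> Pr H -> Pr K.
  move=> [pH [C hC]] HK PH; apply: (Plim (fun=> H) K C) => //.
    exact: predictable_ext HK pH.
  by move=> t w tT; rewrite HK//; exact: cvg_cst.
have b1 (B : set (R * Omega)) : predictable_sets T F B ->
    bounded_predictable T F (fun t w => \1_B (t, w)).
  move=> hB; split; first exact: predictable_indicator.
  by exists 1 => t w _; rewrite indicE; case: (_ \in _); rewrite ?normr1 ?normr0.
have Pset (E : set (R * Omega)) : predictable_sets T F E ->
    Pr (fun t w => \1_E (t, w)).
  suff : predictable_sets T F `<=`
     [set B | predictable_sets T F B /\ Pr (fun t w => \1_B (t, w))].
    by move=> h /h [].
  have [s0 sC sU] := predictable_sets_sigma_algebra.
  have sT : predictable_sets T F timeline by rewrite -(setD0 timeline); exact: sC.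
  apply: lambda_system_subset.
  - exact: predictable_rectangles_setI.
  - split.
    + by move=> B [/predictable_sets_sub].
    + split=> //.
      (* The time line is the union of the two basic rectangles over {0} and over ]0, T]. *)
      apply: (@Pext (fun t w => 1 * (\1_(`[0, 0]) t * \1_setT w) +
                               \1_(`]0, T]) t * \1_setT w)).
      * apply: bpD; first by apply/bpZ/bp_rectangle0/filtrationT/zero_in.
        by apply: bp_rectangle => //; exact/filtrationT/zero_in.
      * move=> t w tT; rewrite !indicE in_setT !mulr1 mul1r.
        rewrite in_setX in_setT andbT !mem_setE tT.
        move: tT; rewrite !in_itv/= => /andP[t0 tT]; rewrite t0 tT/= andbT.
        by case: leP => _; rewrite ?addr0 ?add0r.
      * apply: Plin.
        - by apply/bp_rectangle0/filtrationT/zero_in.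
        - by apply: bp_rectangle => //; exact/filtrationT/zero_in.
        - by apply/P0/filtrationT/zero_in.
        - by apply: P1 => //; exact/filtrationT/zero_in.
    + move=> A B BA [pA PA] [pB PB].
      have pAB : predictable_sets T F (A `\` B).
        have -> : A `\` B = timeline `\` ((timeline `\` A) `|` B).
          apply/seteqP; split=> x /=.
            move=> [Ax nBx]; split; first exact: (predictable_sets_sub pA Ax).
            by move=> [[]|].
          move=> [tx h]; split; last by move=> Bx; apply: h; right.
          by apply: contrapT => nA; apply: h; left.
        by apply: (sC); rewrite -bigcup2E; apply: sU => -[|[|n]] //=; exact: sC.
      split=> //.
      apply: (@Pext (fun t w => -1 * \1_B (t, w) + \1_A (t, w))).
      * by apply: bpD; [apply: bpZ|]; exact: b1.
      * move=> t w _; rewrite !indicE in_setD.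
        case: (boolP (_ \in B)) => [/set_mem Btw|_]; last first.
          by rewrite mulr0 add0r andbT.
        by rewrite mem_set ?andbF/=; [lra|exact: BA].
      * by apply: Plin => //; exact: b1.
    + move=> B_ ndB hB; have pU : predictable_sets T F (\bigcup_n B_ n).
        by apply: sU => n; case: (hB n).
      split=> //.
      apply: (Plim (fun n t w => \1_(B_ n) (t, w)) _ 1).
      * by move=> n; apply: predictable_indicator; case: (hB n).
      * exact: predictable_indicator.
      * by move=> n t w _; rewrite indicE; case: (_ \in _); rewrite ?normr1 ?normr0.
      * move=> t w _; rewrite [X in _ --> X]indicE; case: (boolP ((t, w) \in _)).
          rewrite inE => -[N _ BN]; apply: (@cvg_eventually _ _ _ N) => n Nn.
          by rewrite indicE mem_set//; move/ndB : Nn => /subsetPset; exact.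
        rewrite notin_setE => nB; apply: (@cvg_eventually _ _ _ 0) => n _.
        by rewrite indicE memNset// => h; apply: nB; exists n.
      * by move=> n; case: (hB n).
  - move=> B hB; have pB : predictable_sets T F B by exact: sub_sigma_algebra.
    split=> //; case: hB pB => [[A FA <-] pB|[s [t [A [s0' st tT FA ->]]]] pB].
      apply: Pext (P0 _ FA); first exact: bp_rectangle0.
      by move=> u w _; rewrite !indicE in_setX -natrM mulnb.
    apply: Pext (P1 _ _ _ s0' st tT FA); first exact: bp_rectangle.
    by move=> u w _; rewrite !indicE in_setX -natrM mulnb.
  - by move=> B /predictable_sets_sub.
move=> H bpH; have [pH [C hC]] := bpH.
(* Extension by 0 off the time line makes the process measurable and bounded on the whole product,
   as [bounded_measurable_ind] requires. *)
pose h (z : predictableType) : R := if z.1 \in `[0, T] then H z.1 z.2 else 0.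
have mT : measurable_fun setT h.
  move=> _ B mB; rewrite setTI.
  have mt := measurable_timeline.
  have -> : h @^-1` B = (timeline `&` (fun z : predictableType => H z.1 z.2) @^-1` B) `|`
      (if 0 \in B then ~` timeline else set0).
    apply/seteqP; split=> [[t w]|[t w]]; rewrite /h/=.
      case: ifPn => tT hB; first by left.
      by right; rewrite mem_set// => -[/= tT' _]; move: tT; rewrite tT'.
    move=> [[[/= -> _]]//|]; case: ifPn => // B0 nt.
    rewrite inE in B0; case: ifPn => // tT; exfalso; apply: nt; by split.
  apply: measurableU; first by move/predictableP : pH => /(_ mt B mB).
  by case: ifPn => // _; exact: measurableC.
have pE (f : predictableType -> R) : measurable_fun setT f ->
    predictable T F (fun t w => f (t, w)).
  move=> mf; apply/predictableP; apply: measurable_funTS.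
  by rewrite (_ : (fun z => _) = f)//; apply/funext => -[].
have bE (f : predictableType -> R) (D : R) : measurable_fun setT f ->
    (forall z, `|f z| <= D) -> bounded_predictable T F (fun t w => f (t, w)).
  by move=> mf fD; split; [exact: pE|exists D].
apply: (@Pext (fun t w => h (t, w))).
- apply: (bE _ `|C|) => // z; rewrite /h; case: ifPn => zT; last by rewrite normr0.
  by apply: le_trans (hC _ _ zT) _; exact: ler_norm.
- by move=> t w tT; rewrite /h/= tT.
apply: (@bounded_measurable_ind _ predictableType R (fun f => Pr (fun t w => f (t, w))) _ _ _ h `|C|).
- move=> A mA; apply: (@Pext (fun t w => \1_(timeline `&` A) (t, w))).
  + by apply: b1; move: mA; rewrite predictableType_measurableE.
  + move=> t w tT; rewrite !indicE in_setI [X in X && _]mem_set//.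
  + by apply: Pset; move: mA; rewrite predictableType_measurableE.
- by move=> a f g mf mg [D fD] [E gE] Pf Pg; apply: Plin => //; [apply: bE fD|apply: bE gE].
- move=> f_ f D mf_ mf fD cvf Pf; apply: (Plim (fun n t w => f_ n (t, w)) _ D) => //.
  + by move=> n; exact: pE.
  + exact: pE.
- by [].
- move=> z; rewrite /h; case: ifPn => zT; last by rewrite normr0.
  by apply: le_trans (hC _ _ zT) _; exact: ler_norm.
Qed.

End Predictable.

(** * Cadlag paths and dyadic grids *)

Section CadlagPaths.
Context {disp : measure_display} {Omega : measurableType disp} {R : realType}.
Variables (P : probability Omega R) (T : R).
Hypothesis T_ge0 : 0 <= T.
Implicit Types W V : R -> Omega -> R.

Definition dyadic (n i : nat) : R := T * i%:R / 2 ^+ n.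

Lemma pow2_gt0 n : 0 < 2 ^+ n :> R. Proof. exact: exprn_gt0. Qed.

Lemma dyadic0 n : dyadic n 0 = 0.
Proof. by rewrite /dyadic mulr0 mul0r. Qed.

Lemma dyadicT n : dyadic n (2 ^ n) = T.
Proof. by rewrite /dyadic natrX mulfK// gt_eqF// pow2_gt0. Qed.

Lemma dyadic_le n i j : (i <= j)%N -> dyadic n i <= dyadic n j.
Proof.
by move=> ij; rewrite ler_pM2r ?invr_gt0 ?pow2_gt0// ler_wpM2l// ler_nat.
Qed.

Lemma dyadic_in n i : (i <= 2 ^ n)%N -> dyadic n i \in `[0, T].
Proof.
move=> i2; rewrite in_itv/=; apply/andP; split.
  by rewrite -(dyadic0 n) dyadic_le.
by rewrite -(dyadicT n) dyadic_le.
Qed.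

Lemma dyadic_refine n k i : dyadic (n + k) (i * 2 ^ k) = dyadic n i.
Proof.
rewrite /dyadic natrM natrX exprD invfM mulrA.
by rewrite -!mulrA (mulrCA (2 ^+ k)) mulfV ?mulr1// gt_eqF// pow2_gt0.
Qed.

Lemma dyadic_floor n (t : R) : 0 < T -> 0 <= t < T ->
  exists2 i, (i < 2 ^ n)%N & dyadic n i <= t < dyadic n i.+1.
Proof.
move=> T0 /andP[t0 tT]; pose x := t * 2 ^+ n / T.
have x0 : 0 <= x by rewrite /x divr_ge0// mulr_ge0// ltW// pow2_gt0.
have /andP[h1 h2] := truncn_itv x0.
have tx : t = T * x / 2 ^+ n.
  by rewrite /x; field; rewrite !gt_eqF// pow2_gt0.
exists (Num.truncn x).
  rewrite -(ltr_nat R) (le_lt_trans h1)// natrX /x ltr_pdivrMr// mulrC.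
  by rewrite ltr_pM2l// pow2_gt0.
clearbody x; rewrite /dyadic tx ler_pM2r ?invr_gt0 ?pow2_gt0// ler_pM2l// h1/=.
by rewrite ltr_pM2r ?invr_gt0 ?pow2_gt0// ltr_pM2l.
Qed.

Lemma dyadic_step n i : dyadic n i.+1 = dyadic n i + T / 2 ^+ n.
Proof. by rewrite /dyadic -natr1; field; rewrite gt_eqF// pow2_gt0. Qed.

Lemma dyadic_mesh (e : R) : 0 < e -> exists N, forall n, (N <= n)%N -> T / 2 ^+ n < e.
Proof.
move=> e0.
have /cvgrPdist_lt /(_ e e0) [N _ hN] : T * (1 / 2 : R) ^+ n @[n --> \oo] --> (T * 0 : R).
  by apply: cvgM; [exact: cvg_cst|apply: cvg_expr; rewrite ger0_norm; lra].
exists N => n /hN /=; rewrite mulr0 sub0r normrN ger0_norm.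
  by rewrite expr_div_n expr1n mul1r.
by rewrite mulr_ge0// exprn_ge0//; lra.
Qed.

Lemma dyadic_dense_right (t e : R) : 0 <= t < T -> 0 < e ->
  exists n i, [/\ (i <= 2 ^ n)%N, t < dyadic n i & dyadic n i < t + e].
Proof.
move=> /[dup] tT /andP[t0 tT'] e0; have T0 : 0 < T by lra.
have [N /(_ N (leqnn N)) hN] := dyadic_mesh e0.
have [i i2 /andP[h1 h2]] := dyadic_floor N T0 tT.
by exists N, i.+1; split => //; rewrite dyadic_step; lra.
Qed.

Lemma cadlagB W V : cadlag T W -> cadlag T V ->
  cadlag T (fun t w => W t w - V t w).
Proof.
move=> hW hV w; have [W1 W2] := hW w; have [V1 V2] := hV w.
split=> t ht; first exact: cvgB (W1 t ht) (V1 t ht).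
exact: is_cvgB (W2 t ht) (V2 t ht).
Qed.

Lemma cadlagD W V : cadlag T W -> cadlag T V ->
  cadlag T (fun t w => W t w + V t w).
Proof.
move=> hW hV w; have [W1 W2] := hW w; have [V1 V2] := hV w.
split=> t ht; first exact: cvgD (W1 t ht) (V1 t ht).
exact: is_cvgD (W2 t ht) (V2 t ht).
Qed.

Lemma cadlag_scale (g : Omega -> R) W : cadlag T W ->
  cadlag T (fun t w => g w * W t w).
Proof.
move=> hW w; have [W1 W2] := hW w.
split=> t ht; first by apply: cvgM (W1 t ht); exact: cvg_cst.
by apply: is_cvgM (W2 t ht); exact: is_cvg_cst.
Qed.

Lemma cadlag_cst (g : Omega -> R) : cadlag T (fun _ w => g w).
Proof. by move=> w; split=> t ht; [exact: cvg_cst|exact: is_cvg_cst]. Qed.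

Lemma cadlag_sum (I : Type) (s : seq I) (W_ : I -> R -> Omega -> R) :
  (forall i, cadlag T (W_ i)) -> cadlag T (fun t w => \sum_(i <- s) W_ i t w).
Proof.
move=> h; elim: s => [|i s ih].
  rewrite (_ : (fun _ _ => _) = fun _ _ => 0); first exact: cadlag_cst.
  by apply/funext => t; apply/funext => w; rewrite big_nil.
rewrite (_ : (fun _ _ => _) = fun t w => W_ i t w + \sum_(j <- s) W_ j t w).
  exact: cadlagD.
by apply/funext => t; apply/funext => w; rewrite big_cons.
Qed.

(** By right continuity a value at t < T is a limit of values at grid points to the right of t; T
    itself is a grid point. *)
Lemma cadlag_dyadic_bound W w (c : R) : cadlag T W ->
  (forall n i, (i <= 2 ^ n)%N -> `|W (dyadic n i) w| <= c) ->
  forall t, t \in `[0, T] -> `|W t w| <= c.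
Proof.
move=> hW hc t; rewrite in_itv/= => /andP[t0 tT].
have [{}tT|Tt] := ltP t T; last first.
  have -> : t = T by apply/le_anti; rewrite tT Tt.
  by rewrite -(dyadicT 0); exact: hc.
rewrite leNgt; apply/negP => ct.
have tT' : 0 <= t < T by rewrite t0.
have [/(_ t tT') cv _] := hW w.
have /cvgrPdist_lt /(_ (`|W t w| - c)) : `|W u w| @[u --> t^'+] --> `|W t w|.
  exact: cvg_norm.
rewrite subr_gt0 => /(_ ct) [e /= e0 he].
have [n [i [i2 ti ie]]] := dyadic_dense_right tT' e0.
have := he (dyadic n i); rewrite /= ltr0_norm ?subr_lt0// => /(_ _ ti).
have : - (t - dyadic n i) < e by lra.
move=> /[swap] /[apply].
have := hc n i i2; have := ler_norm (`|W t w| - `|W (dyadic n i) w|); lra.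
Qed.

Lemma ae_dyadic (Q : nat -> nat -> Omega -> Prop) :
  (forall n i, (i <= 2 ^ n)%N -> {ae P, forall w, Q n i w}) ->
  {ae P, forall w, forall n i, (i <= 2 ^ n)%N -> Q n i w}.
Proof.
move=> h.
have hn n : {ae P, forall w, forall i, (i <= 2 ^ n)%N -> Q n i w}.
  apply: ae_foralln => i.
  have [i2|i2] := boolP (i <= 2 ^ n)%N; last by apply: aeW.
  by apply: filterS (h n i i2) => w.
exact: ae_foralln.
Qed.

(** The countable grid merges the null sets that depend on t, and right continuity extends the
    equality from the grid to [0, T]. *)
Lemma cadlag_indistinguishable W V : cadlag T W -> cadlag T V ->
  (forall t, t \in `[0, T] -> {ae P, forall w, W t w = V t w}) ->
  indistinguishable P T W V.
Proof.
move=> cW cV h.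
have : {ae P, forall w, forall n i, (i <= 2 ^ n)%N -> W (dyadic n i) w = V (dyadic n i) w}.
  by apply: ae_dyadic => n i i2; apply: h; exact: dyadic_in.
apply: filterS => w hw t tT; apply/eqP; rewrite -subr_eq0 -normr_le0.
apply: (cadlag_dyadic_bound (cadlagB cW cV) _ tT) => n i i2.
by rewrite hw// subrr normr0.
Qed.

(** One sequence running through all grids: [minn] clips illegal indices and codes that decode to
    nothing give 0, so every term lies in [0, T]. *)
Definition dyadic_enum (k : nat) : R :=
  if @unpickle (nat * nat)%type k is Some p then dyadic p.1 (minn p.2 (2 ^ p.1)) else 0.

Lemma dyadic_enum_in k : dyadic_enum k \in `[0, T].
Proof.
rewrite /dyadic_enum; case: unpickle => [p|]; last by rewrite in_itv/= lexx.
by apply: dyadic_in; exact: geq_minr.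
Qed.

Lemma dyadic_enumP n i : (i <= 2 ^ n)%N -> exists k, dyadic_enum k = dyadic n i.
Proof.
by move=> i2; exists (pickle (n, i)); rewrite /dyadic_enum pickleK/= (minn_idPl i2).
Qed.

(* For a cadlag path this is [sup_{t <= T} min(|W_t|, 1)]; a countable supremum
   keeps it measurable. *)
Definition running_sup W (w : Omega) : R :=
  sup (range (fun k => Num.min `|W (dyadic_enum k) w| 1)).

Lemma has_sup_running W w : has_sup (range (fun k => Num.min `|W (dyadic_enum k) w| 1)).
Proof.
split; first by exists (Num.min `|W (dyadic_enum 0) w| 1); exists 0%N.
by exists 1 => _ [k _ <-]; rewrite ge_min lexx orbT.
Qed.

Lemma running_sup_le W w (c : R) :
  (forall t, t \in `[0, T] -> Num.min `|W t w| 1 <= c) -> running_sup W w <= c.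
Proof.
move=> h; apply: ge_sup; first by case: (has_sup_running W w).
by move=> _ [k _ <-]; apply: h; exact: dyadic_enum_in.
Qed.

Lemma running_sup_enum W w k : Num.min `|W (dyadic_enum k) w| 1 <= running_sup W w.
Proof. by apply: ub_le_sup; [case: (has_sup_running W w)|exists k]. Qed.

Lemma running_sup_ge0 W w : 0 <= running_sup W w.
Proof.
by apply: le_trans (running_sup_enum W w 0); rewrite le_min normr_ge0 ler01.
Qed.

Lemma running_sup_le1 W w : running_sup W w <= 1.
Proof. by apply: running_sup_le => t _; rewrite ge_min lexx orbT. Qed.

Lemma running_sup_ge W w t : cadlag T W -> t \in `[0, T] ->
  Num.min `|W t w| 1 <= running_sup W w.
Proof.
(* From the value 1 on the truncation makes the bound trivial; below 1 it is inactive on the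
   grid. *)
move=> cW tT; have [h1|h1] := ltP (running_sup W w) 1; last first.
  by apply: le_trans h1; rewrite ge_min lexx orbT.
rewrite ge_min; apply/orP; left.
apply: (cadlag_dyadic_bound cW) tT => n i /dyadic_enumP [k <-].
have := running_sup_enum W w k; rewrite ge_min => /orP[//|].
by move=> /le_lt_trans /(_ h1); rewrite ltxx.
Qed.

Lemma running_sup_D W V w :
  running_sup (fun t w => W t w + V t w) w <= running_sup W w + running_sup V w.
Proof.
apply: ge_sup; first by case: (has_sup_running (fun t w => W t w + V t w) w).
move=> _ [k _ <-].
have := running_sup_enum W w k; have := running_sup_enum V w k.
have := ler_normD (W (dyadic_enum k) w) (V (dyadic_enum k) w).
have := normr_ge0 (W (dyadic_enum k) w); have := normr_ge0 (V (dyadic_enum k) w).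
rewrite /Num.min; do 3 (case: ltP => ?); lra.
Qed.

Lemma running_sup_N W w : running_sup (fun t w => - W t w) w = running_sup W w.
Proof.
by congr sup; apply/seteqP; split=> _ [k _ <-]; exists k => //; rewrite normrN.
Qed.

Lemma measurable_running_sup W :
  (forall t, t \in `[0, T] -> measurable_fun setT (W t)) ->
  measurable_fun setT (running_sup W).
Proof.
move=> mW; pose h k w : R := Num.min `|W (dyadic_enum k) w| 1.
have -> : running_sup W = fun w => sups (h ^~ w) 0.
  apply/funext => w; rewrite /running_sup /sups; congr sup.
  by apply/seteqP; split=> _ [k _ <-]; exists k.
apply: measurable_fun_sups.
  move=> w _; exists 1 => _ [k _ <-]; by rewrite ge_min lexx orbT.
by move=> k; apply: measurable_l0; apply: mW; exact: dyadic_enum_in.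
Qed.

Lemma l0_running_sup_ge W t : cadlag T W ->
  (forall t, t \in `[0, T] -> measurable_fun setT (W t)) -> t \in `[0, T] ->
  l0 P (W t) <= l0 P (running_sup W).
Proof.
move=> cW mW tT; apply: le_Rintegral => //.
- exact/l0_integrable/mW.
- exact/l0_integrable/measurable_running_sup.
- move=> w _; rewrite (ger0_norm (running_sup_ge0 W w)) (min_l (running_sup_le1 W w)).
  exact: running_sup_ge.
Qed.

Lemma running_sup_ae W V : indistinguishable P T W V ->
  {ae P, forall w, running_sup W w = running_sup V w}.
Proof.
apply: filterS => w h; congr sup; apply/seteqP.
by split=> _ [k _ <-]; exists k => //; rewrite h//; exact: dyadic_enum_in.
Qed.

End CadlagPaths.

(** An increment is kept as long as [ok] has held up to its left end, so the sum telescopes to the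
    first failure, or to m. This is stopping without probability: the value at the first failure is
    attained, not the one before it. *)
Lemma stopped_sum (R : realType) (a : nat -> R) (ok : nat -> bool) m :
  exists k, [/\ (k <= m)%N,
    \sum_(i < m) (all ok (iota 0 i.+1))%:R * (a i.+1 - a i) = a k - a 0%N &
    (exists2 i, (i <= m)%N & ~~ ok i) -> ~~ ok k].
Proof.
have : exists k, [/\ (k <= m)%N,
    \sum_(i < m) (all ok (iota 0 i.+1))%:R * (a i.+1 - a i) = a k - a 0%N &
    if all ok (iota 0 m) then k = m else ~~ ok k].
  elim: m => [|m [k [km Ek hk]]].
    by exists 0%N; rewrite big_ord0 subrr.
  rewrite big_ord_recr/= Ek -/(iota 0 m.+1).
  have E : all ok (iota 0 m.+1) = all ok (iota 0 m) && ok m.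
    by rewrite -{1}addn1 iotaD all_cat/= andbT add0n.
  have -> : ok 0%N && all ok (iota 1 m) = all ok (iota 0 m.+1) by [].
  rewrite E; case: (all ok (iota 0 m)) hk => /= hk; last first.
    by exists k; rewrite mul0r addr0; split=> //; exact: leqW.
  rewrite hk in Ek *; case: (boolP (ok m)) => okm.
    by exists m.+1; rewrite mul1r; split=> //; lra.
  by exists m; rewrite mul0r addr0; split.
move=> [k [km Ek hk]]; exists k; split=> // -[i im oki].
case: ifP hk => // h kE; rewrite kE.
have [->|im'] := eqVneq m i; first by [].
move/allP : h => /(_ i); rewrite mem_iota add0n/= ltn_neqAle eq_sym im' im => /(_ isT).
by rewrite (negbTE oki).
Qed.

(** * Measurability with respect to the filtration *)

Section AdaptedApproximation.
Context {disp : measure_display} {Omega : measurableType disp} {R : realType}.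
Variables (P : probability Omega R) (T : R) (F : R -> set (set Omega)).
Hypothesis T_ge0 : 0 <= T.
Hypothesis filF : filtration T F.

Definition known (s : R) (g : Omega -> R) : Prop :=
  measurable_fun (setT : set (g_sigma_algebraType (F s))) g.

Lemma knownP s g : s \in `[0, T] ->
  known s g <-> forall B, measurable B -> F s (g @^-1` B).
Proof.
move=> sT; have [hs _ _] := filF.
have E : @measurable _ (g_sigma_algebraType (F s)) = F s.
  by apply/sigma_algebra_id; exact: hs.
split=> [h B mB|h _ B mB].
  by have := h measurableT B mB; rewrite setTI E.
by rewrite setTI E; exact: h.
Qed.

Lemma known_indic s A : F s A -> known s (fun w => \1_A w).
Proof. by move=> FA; apply: measurable_indic; exact: sub_sigma_algebra. Qed.

Lemma known_sub s t g : s \in `[0, T] -> t \in `[0, T] -> s <= t ->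
  known s g -> known t g.
Proof.
move=> sT tT st /knownP -/(_ sT) h; apply/knownP => // B mB.
by have [_ hm _] := filF; apply: (hm s t sT tT st); exact: h.
Qed.

Lemma known_measurable s g : s \in `[0, T] -> known s g -> measurable_fun setT g.
Proof.
move=> sT /knownP -/(_ sT) h _ B mB; rewrite setTI.
by have [_ _ hm] := filF; apply: (hm s sT); exact: h.
Qed.

Lemma filtration_measurable s A : s \in `[0, T] -> F s A -> measurable A.
Proof. by move=> sT FA; have [_ _ hm] := filF; exact: (hm s sT). Qed.

Lemma known_le_set s (g : Omega -> R) (c : R) : s \in `[0, T] -> known s g -> F s [set w | g w <= c].
Proof.
move=> sT /knownP -/(_ sT) h.
have := h [set x | x <= c] ltac:(exact: (measurable_itv `]-oo, c])).
by apply.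
Qed.

Lemma filtration_setI s A B : s \in `[0, T] -> F s A -> F s B -> F s (A `&` B).
Proof.
move=> sT FA FB.
have [hs _ _] := filF.
rewrite -(sigma_algebra_id (hs s sT)).
by apply: (@measurableI _ (g_sigma_algebraType (F s))); exact: sub_sigma_algebra.
Qed.

Lemma filtration_sub s t A : s \in `[0, T] -> t \in `[0, T] -> s <= t -> F s A -> F t A.
Proof. by have [_ hm _] := filF => sT tT st; exact: (hm s t sT tT st). Qed.

(** For indicators g this is a rectangle; the extension is a monotone class argument in the random
    variable alone. *)
Lemma predictable_known_indic s t (g : Omega -> R) (C : R) :
  0 <= s -> s <= t -> t <= T -> known s g -> (forall w, `|g w| <= C) ->
  predictable T F (fun u w => \1_(`]s, t]) u * g w).
Proof.
move=> s0 st tT kg gC.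
have sT : s \in `[0, T] by rewrite in_itv/= s0 (le_trans st).
apply: (@bounded_measurable_ind _ (g_sigma_algebraType (F s)) R
  (fun g => predictable T F (fun u w => \1_(`]s, t]) u * g w)) _ _ _ g C) => //.
- move=> A mA; apply: predictable_rectangle => //.
  by have [hs _ _] := filF; move: mA; rewrite /measurable/= (sigma_algebra_id (hs s sT)).
- move=> a f h _ _ _ _ pf ph.
  apply: (@predictable_ext _ _ _ _ _ (fun u w => a * (\1_(`]s, t]) u * f w) + \1_(`]s, t]) u * h w)).
    by move=> u w _; ring.
  by apply: predictableD => //; exact: predictableZ.
- move=> f_ f D _ _ _ cv h; apply: predictable_lim h _ => u w uT.
  by apply: cvgM; [exact: cvg_cst|exact: cv].
Qed.

Lemma predictable_at0 (g : Omega -> R) (C : R) : known 0 g -> (forall w, `|g w| <= C) ->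
  predictable T F (fun u w => \1_(`[0, 0]) u * g w).
Proof.
move=> kg gC; have sT := zero_in T_ge0.
apply: (@bounded_measurable_ind _ (g_sigma_algebraType (F 0)) R
  (fun g => predictable T F (fun u w => \1_(`[0, 0]) u * g w)) _ _ _ g C) => //.
- move=> A mA; apply: predictable_rectangle0 => //.
  by have [hs _ _] := filF; move: mA; rewrite /measurable/= (sigma_algebra_id (hs 0 sT)).
- move=> a f h _ _ _ _ pf ph.
  apply: (@predictable_ext _ _ _ _ _ (fun u w => a * (\1_(`[0, 0]) u * f w) + \1_(`[0, 0]) u * h w)).
    by move=> u w _; ring.
  by apply: predictableD => //; exact: predictableZ.
- move=> f_ f D _ _ _ cv h; apply: predictable_lim h _ => u w uT.
  by apply: cvgM; [exact: cvg_cst|exact: cv].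
Qed.

(* Adaptedness up to null sets, in the form that survives limits in
   probability over an incomplete filtration. *)
Definition nearly_known (t : R) (f : Omega -> R) : Prop :=
  forall e, 0 < e -> exists2 g, known t g & l0 P (fun w => f w - g w) <= e.

Lemma known_nearly t g : known t g -> nearly_known t g.
Proof.
move=> kg e e0; exists g => //.
rewrite (_ : (fun w => _) = fun=> 0) ?l0_cst0 ?ltW//.
by apply/funext => w; rewrite subrr.
Qed.

Lemma nearly_known_lin t (a : R) f g : t \in `[0, T] ->
  measurable_fun setT f -> measurable_fun setT g ->
  nearly_known t f -> nearly_known t g -> nearly_known t (fun w => a * f w + g w).
Proof.
move=> tT mf mg hf hg e e0.
have M0 : 0 < Num.max 1 `|a| by rewrite lt_max ltr01.
have [f' kf' f'e] := hf (e / 2 / Num.max 1 `|a|) ltac:(by rewrite !divr_gt0).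
have [g' kg' g'e] := hg (e / 2) ltac:(by rewrite divr_gt0).
have mf' := known_measurable tT kf'; have mg' := known_measurable tT kg'.
exists (fun w => a * f' w + g' w).
  by apply: measurable_funD => //; exact: measurable_funM.
rewrite (_ : (fun w => _) = fun w => a * (f w - f' w) + (g w - g' w)); last first.
  by apply/funext => w; ring.
apply: (le_trans (l0D _ _ _)).
- by apply: measurable_funM => //; exact: measurable_funB.
- exact: measurable_funB.
have := l0Z P a (measurable_funB mf mf').
have : Num.max 1 `|a| * l0 P (fun w => f w - f' w) <= e / 2.
  by rewrite mulrC -ler_pdivlMr.
move: g'e; rewrite /=; lra.
Qed.

Lemma nearly_known_ae t f g : measurable_fun setT f -> measurable_fun setT g ->
  t \in `[0, T] ->
  {ae P, forall w, f w = g w} -> nearly_known t f -> nearly_known t g.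
Proof.
move=> mf mg tT fg hf e e0; have [h kh he] := hf e e0; exists h => //.
have mh := known_measurable tT kh.
rewrite (@l0_ae _ _ _ _ _ (fun w => f w - h w))//; try exact: measurable_funB.
by apply: filterS fg => w ->.
Qed.

Lemma nearly_known_lim t (f_ : nat -> Omega -> R) (f : Omega -> R) : t \in `[0, T] ->
  (forall n, measurable_fun setT (f_ n)) -> measurable_fun setT f ->
  vanishing (fun n => l0 P (fun w => f_ n w - f w)) ->
  (forall n, nearly_known t (f_ n)) -> nearly_known t f.
Proof.
move=> tT mf_ mf cv h e e0; have e2 : 0 < e / 2 by lra.
have [N /(_ N (leqnn N)) hN] := cv _ e2.
have [g kg ge] := h N _ e2; exists g => //.
have mg := known_measurable tT kg.
rewrite (_ : (fun w => _) = fun w => (f_ N w - g w) - (f_ N w - f w)); last first.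
  by apply/funext => w; ring.
have := l0B P (measurable_funB (mf_ N) mg) (measurable_funB (mf_ N) mf).
by move: hN ge; rewrite /=; lra.
Qed.

Lemma nearly_known_sub s t f : s \in `[0, T] -> t \in `[0, T] -> s <= t ->
  nearly_known s f -> nearly_known t f.
Proof.
move=> sT tT st h e e0; have [g kg ge] := h e e0; exists g => //.
exact: known_sub kg.
Qed.

Lemma nearly_known_indic t A f : t \in `[0, T] -> F t A ->
  measurable_fun setT f ->
  nearly_known t f -> nearly_known t (fun w => \1_A w * f w).
Proof.
move=> tT FA mf h e e0; have [g kg ge] := h e e0.
have mA : measurable A by exact: filtration_measurable FA.
have mg := known_measurable tT kg.
exists (fun w => \1_A w * g w); first exact: measurable_funM (known_indic FA) kg.
apply: le_trans ge; apply: l0_le_ae; try exact: measurable_funB.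
  by apply: measurable_funB; apply: measurable_funM => //; exact: measurable_indic.
by apply/aeW => w; rewrite -mulrBr normrM indicE; case: (_ \in _);
  rewrite ?normr1 ?normr0 ?mul1r ?mul0r.
Qed.

End AdaptedApproximation.

(** * Stochastic integral operators *)

Lemma ae_and (d : measure_display) (X : measurableType d) (R : realType)
    (P : probability X R) (Q1 Q2 : X -> Prop) :
  {ae P, forall w, Q1 w} -> {ae P, forall w, Q2 w} ->
  {ae P, forall w, Q1 w /\ Q2 w}.
Proof. by move=> h1 h2; apply: filterS2 h1 h2 => w. Qed.

Lemma cvg_norm_bound (R : realType) (u : nat -> R) (l C : R) :
  u n @[n --> \oo] --> l -> (forall n, `|u n| <= C) -> `|l| <= C.
Proof.
move=> /cvgrPdist_lt cv uC; rewrite leNgt; apply/negP => Cl.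
have [N _ /(_ N (leqnn N)) /= h] := cv (`|l| - C) ltac:(rewrite subr_gt0//).
have := uC N; have := ler_normD (l - u N) (u N); rewrite subrK; lra.
Qed.

Section VanishingL0.
Context {disp : measure_display} {Omega : measurableType disp} {R : realType}.
Variable P : probability Omega R.
Implicit Types f g h : Omega -> R.

Lemma vanishing_l0B (f_ g_ : nat -> Omega -> R) f g :
  (forall n, measurable_fun setT (f_ n)) -> measurable_fun setT f ->
  (forall n, measurable_fun setT (g_ n)) -> measurable_fun setT g ->
  vanishing (fun n => l0 P (fun w => f_ n w - f w)) ->
  vanishing (fun n => l0 P (fun w => g_ n w - g w)) ->
  vanishing (fun n => l0 P (fun w => (f_ n w - g_ n w) - (f w - g w))).
Proof.
move=> mf_ mf mg_ mg hf hg; apply: vanishing_le (vanishingD hf hg) => n.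
apply: le_trans (l0B P (measurable_funB (mf_ n) mf) (measurable_funB (mg_ n) mg)).
rewrite le_eqVlt; apply/orP; left; apply/eqP; congr (l0 P _).
by apply/funext => w /=; ring.
Qed.

Lemma vanishing_l0D (f_ g_ : nat -> Omega -> R) f g :
  (forall n, measurable_fun setT (f_ n)) -> measurable_fun setT f ->
  (forall n, measurable_fun setT (g_ n)) -> measurable_fun setT g ->
  vanishing (fun n => l0 P (fun w => f_ n w - f w)) ->
  vanishing (fun n => l0 P (fun w => g_ n w - g w)) ->
  vanishing (fun n => l0 P (fun w => (f_ n w + g_ n w) - (f w + g w))).
Proof.
move=> mf_ mf mg_ mg hf hg; apply: vanishing_le (vanishingD hf hg) => n.
apply: le_trans (l0D P (measurable_funB (mf_ n) mf) (measurable_funB (mg_ n) mg)).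
rewrite le_eqVlt; apply/orP; left; apply/eqP; congr (l0 P _).
by apply/funext => w /=; ring.
Qed.

Lemma l0_contract (c h : Omega -> R) : measurable_fun setT c -> measurable_fun setT h ->
  (forall w, `|c w| <= 1) -> l0 P (fun w => c w * h w) <= l0 P h.
Proof.
move=> mc mh c1; apply: l0_le_ae => //; first exact: measurable_funM.
by apply/aeW => w; rewrite normrM ler_piMl.
Qed.

Lemma vanishing_l0_contract (c : Omega -> R) (f_ : nat -> Omega -> R) f :
  measurable_fun setT c -> (forall w, `|c w| <= 1) ->
  (forall n, measurable_fun setT (f_ n)) -> measurable_fun setT f ->
  vanishing (fun n => l0 P (fun w => f_ n w - f w)) ->
  vanishing (fun n => l0 P (fun w => c w * f_ n w - c w * f w)).
Proof.
move=> mc c1 mf_ mf; apply: vanishing_le => n.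
apply: le_trans (l0_contract mc (measurable_funB (mf_ n) mf) c1).
rewrite le_eqVlt; apply/orP; left; apply/eqP; congr (l0 P _).
by apply/funext => w /=; ring.
Qed.

Lemma vanishing_l0_scale (a : R) (f_ : nat -> Omega -> R) f :
  (forall n, measurable_fun setT (f_ n)) -> measurable_fun setT f ->
  vanishing (fun n => l0 P (fun w => f_ n w - f w)) ->
  vanishing (fun n => l0 P (fun w => a * f_ n w - a * f w)).
Proof.
move=> mf_ mf h; have M0 : 0 <= Num.max 1 `|a| by rewrite le_max ler01.
apply: vanishing_le (vanishingZ M0 h) => n.
apply: le_trans (l0Z P a (measurable_funB (mf_ n) mf)).
rewrite le_eqVlt; apply/orP; left; apply/eqP; congr (l0 P _).
by apply/funext => w /=; ring.
Qed.

Lemma l0_eq_ae f g : measurable_fun setT f -> measurable_fun setT g ->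
  l0 P (fun w => f w - g w) <= 0 -> {ae P, forall w, f w = g w}.
Proof.
move=> mf mg /(l0_eq0 (measurable_funB mf mg)); apply: filterS => w /eqP.
by rewrite subr_eq0 => /eqP.
Qed.

(** Uniqueness of limits in probability. It closes the limit case of the monotone class arguments
    that prove almost sure identities between integrals. *)
Lemma ae_eq_vanishing (f_ g_ : nat -> Omega -> R) f g :
  (forall n, measurable_fun setT (f_ n)) -> measurable_fun setT f ->
  (forall n, measurable_fun setT (g_ n)) -> measurable_fun setT g ->
  vanishing (fun n => l0 P (fun w => f_ n w - f w)) ->
  vanishing (fun n => l0 P (fun w => g_ n w - g w)) ->
  (forall n, {ae P, forall w, f_ n w = g_ n w}) ->
  {ae P, forall w, f w = g w}.
Proof.
move=> mf_ mf mg_ mg hf hg fg; apply: l0_eq_ae => //.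
apply/ler_addgt0Pr => e e0; rewrite add0r.
have [N /(_ N (leqnn N)) hN] := vanishing_l0B mf_ mf mg_ mg hf hg e0.
apply: le_trans hN; rewrite -(l0N P) le_eqVlt; apply/orP; left; apply/eqP.
apply: l0_ae.
- by apply: measurableT_comp => //; exact: measurable_funB.
- by apply: measurable_funB; exact: measurable_funB.
- by apply: filterS (fg N) => w ->; ring.
Qed.

End VanishingL0.

Lemma norm_indic_le1 (R : realType) (X : Type) (A : set X) x : `|\1_A x : R| <= 1.
Proof. by rewrite indicE; case: (_ \in _); rewrite ?normr1 ?normr0. Qed.

Section StochasticIntegralOperator.
Context {disp : measure_display} {Omega : measurableType disp} {R : realType}.
Variables (P : probability Omega R) (T : R) (F : R -> set (set Omega)).
Hypothesis T_ge0 : 0 <= T.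
Hypothesis filF : filtration T F.
Variables (X : R -> Omega -> R) (J : (R -> Omega -> R) -> (R -> Omega -> R)).
Hypothesis op : stochastic_integral_operator P T F X J.
Implicit Types H K : R -> Omega -> R.
Local Notation bp := (bounded_predictable T F).

Lemma op_cadlag H : bp H -> cadlag T (J H).
Proof. by move=> hH; case: op => h _ _ _ _; case: (h H hH). Qed.

Lemma op_measurable H t : bp H -> t \in `[0, T] -> measurable_fun setT (J H t).
Proof. by move=> hH tT; case: op => h _ _ _ _; case: (h H hH) => _; exact. Qed.

Lemma op_lin (a : R) H K t : bp H -> bp K -> t \in `[0, T] ->
  {ae P, forall w, J (fun t w => a * H t w + K t w) t w = a * J H t w + J K t w}.
Proof.
move=> hH hK tT; case: op => _ h _ _ _.
by apply: filterS (h a H K hH hK) => w; exact.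
Qed.

Lemma op_dominated (H_ : nat -> R -> Omega -> R) H (C : R) t :
  (forall n, predictable T F (H_ n)) -> predictable T F H ->
  (forall n t w, t \in `[0, T] -> `|H_ n t w| <= C) ->
  (forall t w, t \in `[0, T] -> H_ n t w @[n --> \oo] --> H t w) ->
  t \in `[0, T] -> vanishing (fun n => l0 P (fun w => J (H_ n) t w - J H t w)).
Proof.
move=> pH_ pH bH cv tT.
have bpH_ n : bp (H_ n) by split=> //; exists C => *; exact: bH.
have bpH : bp H.
  split=> //; exists C => u w uT.
  by apply: (cvg_norm_bound (cv u w uT)) => n; exact: bH.
case: op => _ _ _ _ h; apply/cvg_in_probability_l0.
- by move=> n; exact: op_measurable.
- exact: op_measurable.
- exact: h bH cv _ tT.
Qed.

(** No clause states that [J] ignores values outside [0, T]; dominated convergence along the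
    constant sequence H, whose limit on [0, T] is K, yields it. *)
Lemma op_ext H K t : bp H -> (forall u w, u \in `[0, T] -> H u w = K u w) ->
  t \in `[0, T] -> {ae P, forall w, J H t w = J K t w}.
Proof.
move=> hH HK tT; have [pH [C hC]] := hH.
have pK : predictable T F K by exact: predictable_ext HK pH.
have bK : bp K by split=> //; exists C => u w uT; rewrite -HK// hC.
have cv u w : u \in `[0, T] -> (fun _ : nat => H u w) n @[n --> \oo] --> K u w.
  by move=> uT; rewrite HK//; exact: cvg_cst.
have := op_dominated (fun=> pH) pK (fun _ : nat => hC) cv tT.
move=> h; have mB := measurable_funB (op_measurable hH tT) (op_measurable bK tT).
have : l0 P (fun w => J H t w - J K t w) <= 0.
  apply/ler_addgt0Pr => e e0; rewrite add0r.
  by have [N /(_ N (leqnn N))] := h e e0.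
by move/(l0_eq0 mB); apply: filterS => w /eqP; rewrite subr_eq0 => /eqP.
Qed.

Lemma op_scale (a : R) H t : bp H -> t \in `[0, T] ->
  {ae P, forall w, J (fun t w => a * H t w) t w = a * J H t w}.
Proof.
move=> hH tT.
have b0 : bp (fun _ _ => 0) by exact: bp_cst.
have z : {ae P, forall w, J (fun _ _ => 0) t w = 0}.
  have := op_lin (-1) b0 b0 tT.
  have -> : (fun (_ : R) (_ : Omega) => -1 * 0 + 0 : R) = fun _ _ => 0.
    by apply/funext => u; apply/funext => w; lra.
  by apply: filterS => w; lra.
have := op_lin a hH b0 tT.
have -> : (fun t w => a * H t w + 0) = fun t w => a * H t w.
  by apply/funext => u; apply/funext => w; rewrite addr0.
by apply: filterS2 z => w -> ->; rewrite addr0.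
Qed.

Lemma op_eq0 H t : (forall u w, u \in `[0, T] -> H u w = 0) -> t \in `[0, T] ->
  {ae P, forall w, J H t w = 0}.
Proof.
move=> H0 tT; have b0 : bp (fun _ _ => 0) by exact: bp_cst.
have bH : bp H.
  have E u w : u \in `[0, T] -> 0 = H u w by move=> uT; rewrite H0.
  split; first by apply: (predictable_ext E); exact: predictable_cst.
  by exists 0 => u w uT; rewrite H0// normr0.
have h1 := op_scale 0 b0 tT.
have h2 : {ae P, forall w, J H t w = J (fun t w => 0 * 0) t w}.
  by apply: op_ext => // u w uT; rewrite H0// mul0r.
by apply: filterS2 h1 h2 => w -> ->; rewrite mul0r.
Qed.

Lemma op_D H K t : bp H -> bp K -> t \in `[0, T] ->
  {ae P, forall w, J (fun t w => H t w + K t w) t w = J H t w + J K t w}.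
Proof.
move=> hH hK tT; have := op_lin 1 hH hK tT.
have -> : (fun t w => 1 * H t w + K t w) = fun t w => H t w + K t w.
  by apply/funext => u; apply/funext => w; rewrite mul1r.
by apply: filterS => w ->; rewrite mul1r.
Qed.

Lemma op_B H K t : bp H -> bp K -> t \in `[0, T] ->
  {ae P, forall w, J (fun t w => H t w - K t w) t w = J H t w - J K t w}.
Proof.
move=> hH hK tT; have := op_lin (-1) hK hH tT.
have -> : (fun t w => -1 * K t w + H t w) = fun t w => H t w - K t w.
  by apply/funext => u; apply/funext => w; lra.
by apply: filterS => w ->; lra.
Qed.

Lemma op_sum (I : Type) (s : seq I) (H_ : I -> R -> Omega -> R) t :
  (forall i, bp (H_ i)) -> t \in `[0, T] ->
  bp (fun t w => \sum_(i <- s) H_ i t w) /\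
  {ae P, forall w, J (fun t w => \sum_(i <- s) H_ i t w) t w = \sum_(i <- s) J (H_ i) t w}.
Proof.
move=> hH tT; elim: s => [|i s [ih1 ih2]].
  have -> : (fun t w => \sum_(i <- [::]) H_ i t w) = (fun _ _ => 0).
    by apply/funext => u; apply/funext => w; rewrite big_nil.
  split; first exact: bp_cst.
  by apply: filterS (op_eq0 (H := fun _ _ => 0) (fun _ _ _ => erefl) tT) => w ->; rewrite big_nil.
have E : (fun t w => \sum_(j <- i :: s) H_ j t w) = (fun t w => H_ i t w + \sum_(j <- s) H_ j t w).
  by apply/funext => u; apply/funext => w; rewrite big_cons.
split; first by rewrite E; exact: bpD.
rewrite E; apply: filterS2 ih2 (op_D (hH i) ih1 tT) => w h1 h2.
by rewrite h2 h1 big_cons.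
Qed.

Lemma op_rectangle s t A u : 0 <= s -> s <= t -> t <= T -> F s A -> u \in `[0, T] ->
  {ae P, forall w, J (fun u w => \1_(`]s, t]) u * \1_A w) u w =
    \1_A w * (X (Num.min t u) w - X (Num.min s u) w)}.
Proof.
move=> s0 st tT FA uT; case: op => _ _ h _ _.
by apply: filterS (h s t A s0 st tT FA) => w; exact.
Qed.

Lemma op_rectangle0 A u : F 0 A -> u \in `[0, T] ->
  {ae P, forall w, J (fun u w => \1_(`[0, 0]) u * \1_A w) u w = 0}.
Proof.
move=> FA uT; case: op => _ _ _ h _.
by apply: filterS (h A FA) => w; exact.
Qed.

Lemma min_in (s u : R) : 0 <= s -> u \in `[0, T] -> Num.min s u \in `[0, T].
Proof.
by rewrite !in_itv/= => s0 /andP[u0 uT]; rewrite le_min s0 u0/= ge_min uT orbT.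
Qed.

(** The part of the increment over ]s', t'] that accrues between s and t is the increment over the
    intersection of the two intervals. This is the case of rectangles in [op_local]. *)
Lemma increment_overlap (x : R -> R) (s t s' t' u : R) :
  s <= t -> s' <= t' ->
  x (Num.min t' (Num.min t u)) - x (Num.min s' (Num.min t u)) -
    (x (Num.min t' (Num.min s u)) - x (Num.min s' (Num.min s u))) =
  if Num.max s s' <= Num.min t t' then
    x (Num.min (Num.min t t') u) - x (Num.min (Num.max s s') u)
  else 0.
Proof.
move=> st st'.
have [us|su] := leP u s.
  rewrite (min_r (le_trans us st)) subrr.
  case: ifP => // h; move: h; rewrite ge_max => /andP[h _].
  have us' : u <= Num.max s s' by rewrite le_max us.
  by rewrite (min_r (le_trans us h)) (min_r us') subrr.
have [ts'|s't] := ltP t s'.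
  have h1 : Num.min t u <= t by rewrite ge_min lexx.
  rewrite (min_r (_ : Num.min t u <= t')); last by lra.
  rewrite (min_r (_ : Num.min t u <= s')); last by lra.
  rewrite (min_r (_ : s <= t')); last by lra.
  rewrite (min_r (_ : s <= s')) ?subrr; last by lra.
  case: ifP => // h; move: h; rewrite ge_max !le_min => /andP[_ /andP[]]; lra.
have [t's|st''] := ltP t' s.
  have h1 : s <= Num.min t u by rewrite le_min st ltW.
  rewrite (min_l (_ : t' <= Num.min t u)); last by lra.
  rewrite (min_l (_ : s' <= Num.min t u)); last by lra.
  rewrite (min_l (_ : s' <= s)) ?subrr; last by lra.
  case: ifP => // h; move: h; rewrite ge_max !le_min => /andP[/andP[]]; lra.
have -> : Num.max s s' <= Num.min t t' by rewrite ge_max !le_min st st' s't st''.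
rewrite (_ : Num.min t' (Num.min t u) = Num.min (Num.min t t') u); last first.
  by rewrite minA (minC t').
have [s's|ss'] := leP s' s.
  rewrite (min_l (ltW su)) (min_l (_ : s' <= Num.min t u)); last by rewrite le_min s't; lra.
  lra.
rewrite subrr subr0 minA (min_l s't); lra.
Qed.

(** Integration over a rectangle takes increments of the integral. For elementary H it holds because
    the product of two rectangles is a rectangle; the rest is a monotone class argument. *)
Lemma op_local s t A H u : 0 <= s -> s <= t -> t <= T -> F s A ->
  bp H -> u \in `[0, T] ->
  {ae P, forall w, J (fun u w => \1_(`]s, t]) u * \1_A w * H u w) u w =
    \1_A w * (J H (Num.min t u) w - J H (Num.min s u) w)}.
Proof.
move=> s0 st tT FA + uT.
have sT : s \in `[0, T] by rewrite in_itv/= s0 (le_trans st).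
have tu : Num.min t u \in `[0, T] by apply: min_in => //; exact: le_trans st.
have su : Num.min s u \in `[0, T] by apply: min_in.
have bR := bp_rectangle T_ge0 s0 st tT FA.
have mA := filtration_measurable filF sT FA.
have m1 : measurable_fun setT (fun w => \1_A w : R) by exact: measurable_indic.
apply: (@bounded_predictable_ind _ _ _ T F T_ge0 filF
  (fun H => {ae P, forall w, J (fun u w => \1_(`]s, t]) u * \1_A w * H u w) u w =
    \1_A w * (J H (Num.min t u) w - J H (Num.min s u) w)})).
- move=> B FB.
  have z : {ae P, forall w,
      J (fun u w => \1_(`]s, t]) u * \1_A w * (\1_(`[0, 0]) u * \1_B w)) u w = 0}.
    apply: op_eq0 => // v w vT; rewrite !indicE !mem_setE !in_itv/=.
    have [|] := ltP s v; last by rewrite mul0r mul0r.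
    move=> sv; have -> : (v <= 0) = false by apply/negbTE; rewrite -ltNge; lra.
    by rewrite andbF mul0r mulr0.
  apply: filterS3 z (op_rectangle0 FB tu) (op_rectangle0 FB su) => w -> -> ->.
  by rewrite subrr mulr0.
- move=> s' t' B s0' st' tT' FB.
  have r1 := op_rectangle s0' st' tT' FB tu; have r2 := op_rectangle s0' st' tT' FB su.
  pose a := Num.max s s'; pose b := Num.min t t'.
  have : {ae P, forall w,
      J (fun u w => \1_(`]s, t]) u * \1_A w * (\1_(`]s', t']) u * \1_B w)) u w =
      \1_A w * \1_B w * (if a <= b then X (Num.min b u) w - X (Num.min a u) w else 0)}.
    have E v w : v \in `[0, T] -> \1_(`]s, t]) v * \1_A w * (\1_(`]s', t']) v * \1_B w) =
       \1_(`]a, b]) v * \1_(A `&` B) w :> R.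
      move=> vT; rewrite !indicE !mem_setE !in_itv/= in_setI /a /b gt_max le_min.
      by rewrite -!natrM !mulnb; congr (_%:R); congr nat_of_bool; case: (s < v);
        case: (v <= t); case: (s' < v); case: (v <= t'); case: (w \in A) => //=;
        rewrite ?andbF.
    have b0 : bp (fun u w => \1_(`]s, t]) u * \1_A w * (\1_(`]s', t']) u * \1_B w)).
      by apply: bpM => //; exact: bp_rectangle.
    have e := op_ext b0 E uT.
    case: (leP a b) => ab.
      have aT : a \in `[0, T].
        rewrite in_itv/= /a le_max s0/= ge_max (le_trans st tT).
        exact: le_trans st' tT'.
      have sa : s <= a by rewrite /a le_max lexx.
      have sa' : s' <= a by rewrite /a le_max lexx orbT.
      have sT' : s' \in `[0, T] by rewrite in_itv/= s0' (le_trans st').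
      have FAB : F a (A `&` B).
        apply: (filtration_setI filF aT).
          exact: (filtration_sub filF sT aT sa FA).
        exact: (filtration_sub filF sT' aT sa' FB).
      have a0 : 0 <= a by move: aT; rewrite in_itv/= => /andP[].
      have bT : b <= T by rewrite /b ge_min tT.
      apply: filterS2 e (op_rectangle a0 ab bT FAB uT) => w -> ->.
      by rewrite !indicE in_setI -natrM mulnb.
    have z : {ae P, forall w, J (fun v w => \1_(`]a, b]) v * \1_(A `&` B) w) u w = 0}.
      apply: op_eq0 => // v w vT; rewrite set_itv_ge ?indic0 ?mul0r//.
      by rewrite bnd_simp -leNgt ltW.
    by apply: filterS2 e z => w -> ->; rewrite mulr0.
  move=> r3; apply: filterS3 r1 r2 r3 => w -> -> ->.
  rewrite -(increment_overlap (fun v => X v w) u st st'); ring.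
- move=> a {}H K bH bK hH hK.
  have bRH : bp (fun u w => \1_(`]s, t]) u * \1_A w * H u w) by exact: bpM.
  have bRK : bp (fun u w => \1_(`]s, t]) u * \1_A w * K u w) by exact: bpM.
  have e := op_lin a bRH bRK uT.
  have -> : (fun u w => \1_(`]s, t]) u * \1_A w * (a * H u w + K u w)) =
    (fun u w => a * (\1_(`]s, t]) u * \1_A w * H u w) + \1_(`]s, t]) u * \1_A w * K u w).
    by apply/funext => v; apply/funext => w; ring.
  have l1 := op_lin a bH bK tu; have l2 := op_lin a bH bK su.
  have hHK := ae_and hH hK; have l12 := ae_and l1 l2.
  by apply: filterS3 e hHK l12 => w -> [-> ->] [-> ->]; ring.
- move=> H_ {}H C pH_ pH hC cv h.
  have bH_ n : bp (H_ n) by split=> //; exists C => *; exact: hC.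
  have bH : bp H.
    split=> //; exists C => v w vT.
    by apply: (cvg_norm_bound (cv v w vT)) => n; exact: hC.
  have c1 := op_dominated pH_ pH hC cv tu; have c2 := op_dominated pH_ pH hC cv su.
  have c3 : vanishing (fun n => l0 P (fun w =>
      J (fun u w => \1_(`]s, t]) u * \1_A w * H_ n u w) u w -
      J (fun u w => \1_(`]s, t]) u * \1_A w * H u w) u w)).
    apply: (@op_dominated _ _ C) => //.
    + by move=> n; apply: predictableM => //; case: bR.
    + by apply: predictableM => //; case: bR.
    + move=> n v w vT; rewrite normrM -[leRHS]mul1r ler_pM ?hC//.
      exact: norm_rectangle_le1.
    + by move=> v w vT; apply: cvgM; [exact: cvg_cst|exact: cv].
  have mJ K v : bp K -> v \in `[0, T] -> measurable_fun setT (J K v) by exact: op_measurable.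
  apply: ae_eq_vanishing c3 (vanishing_l0_contract m1 _ _ _ (vanishing_l0B _ _ _ _ c1 c2)) h => //.
  + by move=> n; apply: mJ => //; exact: bpM.
  + by apply: mJ => //; exact: bpM.
  + move=> n; apply: measurable_funM => //; apply: measurable_funB; exact: mJ.
  + apply: measurable_funM => //; apply: measurable_funB; exact: mJ.
  + by move=> w; exact: norm_indic_le1.
  + by move=> n; apply: measurable_funB; exact: mJ.
  + by apply: measurable_funB; exact: mJ.
  + by move=> n; exact: mJ.
  + exact: mJ.
  + by move=> n; exact: mJ.
  + exact: mJ.
Qed.

End StochasticIntegralOperator.

Section OperatorUniqueness.
Context {disp : measure_display} {Omega : measurableType disp} {R : realType}.
Variables (P : probability Omega R) (T : R) (F : R -> set (set Omega)).
Hypothesis T_ge0 : 0 <= T.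
Hypothesis filF : filtration T F.
Implicit Types H K : R -> Omega -> R.
Local Notation bp := (bounded_predictable T F).
Local Notation soi := (stochastic_integral_operator P T F).

Lemma bp_of_dominated (H_ : nat -> R -> Omega -> R) H (C : R) :
  (forall n, predictable T F (H_ n)) -> predictable T F H ->
  (forall n t w, t \in `[0, T] -> `|H_ n t w| <= C) ->
  (forall t w, t \in `[0, T] -> H_ n t w @[n --> \oo] --> H t w) ->
  (forall n, bp (H_ n)) /\ bp H.
Proof.
move=> pH_ pH hC cv; split=> [n|]; split => //; exists C => t w tT; first exact: hC.
by apply: (cvg_norm_bound (cv t w tT)) => n; exact: hC.
Qed.

Lemma op_at0 X J : soi X J -> forall H, bp H -> {ae P, forall w, J H 0 w = 0}.
Proof.
move=> op; have z0 := zero_in T_ge0; apply: (bounded_predictable_ind T_ge0 filF).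
- by move=> A FA; exact: (op_rectangle0 op FA z0).
- move=> s t A s0 st tT FA.
  apply: filterS (op_rectangle op s0 st tT FA z0) => w ->.
  by rewrite !min_r ?subrr ?mulr0// (le_trans s0).
- move=> a H K bH bK hH hK; have e := op_lin op a bH bK z0.
  by apply: filterS3 e hH hK => w -> -> ->; rewrite mulr0 addr0.
- move=> H_ H C pH_ pH hC cv h; have [bH_ bH] := bp_of_dominated pH_ pH hC cv.
  have c := op_dominated op pH_ pH hC cv z0.
  apply: (ae_eq_vanishing (f_ := fun n => J (H_ n) 0) (g_ := fun _ _ => 0)) c _ h => //.
  + by move=> n; exact: (op_measurable op).
  + exact: (op_measurable op).
  + move=> e e0; exists 0%N => n _.
    rewrite (_ : (fun _ => _) = fun=> 0) ?l0_cst0 ?ltW//.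
    by apply/funext => w; rewrite subrr.
Qed.

Lemma op_one X J t : soi X J -> t \in `[0, T] ->
  {ae P, forall w, J (fun _ _ => 1) t w = X t w - X 0 w}.
Proof.
move=> op tT; have z0 := zero_in T_ge0.
have FT := filtrationT filF z0.
have b0 := bp_rectangle0 T_ge0 FT.
have b1 : bp (fun u w => \1_(`]0, T]) u * \1_setT w) by exact: bp_rectangle.
have E u (w : Omega) : u \in `[0, T] -> (\1_(`[0, 0]) u * \1_setT w + \1_(`]0, T]) u * \1_setT w : R) = 1.
  move=> uT; rewrite !indicE in_setT !mem_setE !mulr1; move: uT.
  rewrite !in_itv/= => /andP[-> ->]; rewrite andbT/=.
  by case: leP => _; rewrite ?addr0 ?add0r.
have e := op_ext op (bpD b0 b1) E tT.
have d := op_D op b0 b1 tT.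
have r0 := op_rectangle0 op FT tT.
have r1 := op_rectangle op (lexx 0) T_ge0 (lexx T) FT tT.
apply: filterS2 (ae_and e d) (ae_and r0 r1) => w [<- ->] [-> ->].
move: tT; rewrite in_itv/= => /andP[t0 tT].
by rewrite add0r indicE in_setT mul1r min_r// min_l.
Qed.

(** Only increments from time 0 enter the elementary integrals, so the initial values of the
    integrators are not compared. *)
Lemma op_unique X J X' J' : soi X J -> soi X' J' ->
  (forall t, t \in `[0, T] -> {ae P, forall w, X t w - X 0 w = X' t w - X' 0 w}) ->
  forall H t, bp H -> t \in `[0, T] -> {ae P, forall w, J H t w = J' H t w}.
Proof.
move=> op op' XX' H t + tT; move: H; apply: (bounded_predictable_ind T_ge0 filF).
- move=> A FA.
  by apply: filterS2 (op_rectangle0 op FA tT) (op_rectangle0 op' FA tT) => w -> ->.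
- move=> s u A s0 su uT FA.
  have h1 : Num.min u t \in `[0, T] by apply: min_in => //; exact: le_trans su.
  have h2 : Num.min s t \in `[0, T] by apply: min_in.
  apply: filterS2 (ae_and (op_rectangle op s0 su uT FA tT) (op_rectangle op' s0 su uT FA tT))
    (ae_and (XX' _ h1) (XX' _ h2)) => w [-> ->] [e1 e2]; congr (_ * _); lra.
- move=> a H K bH bK hH hK.
  apply: filterS2 (ae_and (op_lin op a bH bK tT) (op_lin op' a bH bK tT))
    (ae_and hH hK) => w [-> ->] [-> ->] //.
- move=> H_ H C pH_ pH hC cv h; have [bH_ bH] := bp_of_dominated pH_ pH hC cv.
  apply: ae_eq_vanishing (op_dominated op pH_ pH hC cv tT) (op_dominated op' pH_ pH hC cv tT) h;
    try (by move=> n; exact: (op_measurable op)); try (by move=> n; exact: (op_measurable op'));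
    try exact: (op_measurable op); exact: (op_measurable op').
Qed.

(** Trades the integral up to t for an integral up to T; therefore estimates that are uniform in the
    integrand need only be stated at T. *)
Lemma op_from0 X J H t : soi X J -> bp H -> t \in `[0, T] ->
  {ae P, forall w, J (fun u w => \1_(`]0, t]) u * H u w) T w = J H t w}.
Proof.
move=> op bH; move=> /[dup] tT; rewrite in_itv/= => /andP[t0 tT'].
have z0 := zero_in T_ge0; have TT := T_in T_ge0.
have FT := filtrationT filF z0.
have := op_local T_ge0 filF op (lexx 0) t0 tT' FT bH TT.
have -> : (fun u w => \1_(`]0, t]) u * \1_setT w * H u w) =
          (fun u w => \1_(`]0, t]) u * H u w).
  by apply/funext => u; apply/funext => w; rewrite (_ : \1_setT w = 1) ?mulr1// indicE in_setT.
apply: filterS2 (op_at0 op bH) => w h0 ->.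
by rewrite min_l// min_l// h0 subr0 indicE in_setT mul1r.
Qed.

(** An operator promises no more than measurable values. Approximate adaptedness holds on rectangles
    and survives linear combinations and limits in probability, hence holds on the whole monotone
    class. *)
Lemma op_nearly_known X J : soi X J ->
  (forall t, t \in `[0, T] -> nearly_known P F t (X t)) ->
  (forall t, t \in `[0, T] -> measurable_fun setT (X t)) ->
  forall H t, bp H -> t \in `[0, T] -> nearly_known P F t (J H t).
Proof.
move=> op kX mX H t + tT.
have k0 : nearly_known P F t (fun=> 0) by apply: known_nearly; exact: measurable_cst.
move: H; apply: (bounded_predictable_ind T_ge0 filF).
- move=> A FA; have b0 := bp_rectangle0 T_ge0 FA.
  apply: (nearly_known_ae filF _ _ tT _ k0) => //; first exact: (op_measurable op).
  by apply: filterS (op_rectangle0 op FA tT) => w ->.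
- move=> s u A s0 su uT FA; have b1 := bp_rectangle T_ge0 s0 su uT FA.
  have e := op_rectangle op s0 su uT FA tT.
  have sT : s \in `[0, T] by rewrite in_itv/= s0 (le_trans su).
  (* For t <= s the integral vanishes, so it is harmless that A need not be known at t. *)
  have [ts|st] := leP t s.
    apply: (nearly_known_ae filF _ _ tT _ k0) => //; first exact: (op_measurable op).
    by apply: filterS e => w ->; rewrite !min_r ?subrr ?mulr0// (le_trans ts).
  have h1 : Num.min u t \in `[0, T] by apply: min_in => //; exact: le_trans su.
  have h2 : Num.min s t \in `[0, T] by apply: min_in.
  have FA' := filtration_sub filF sT tT (ltW st) FA.
  have mA := filtration_measurable filF sT FA.
  apply: (nearly_known_ae (f := fun w => \1_A w * (-1 * X (Num.min s t) w + X (Num.min u t) w)) filF _ _ tT) => //.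
  + apply: measurable_funM; first exact: measurable_indic.
    by apply: measurable_funD; [apply: measurable_funM => //; exact: mX|exact: mX].
  + exact: (op_measurable op).
  + by apply: filterS e => w ->; congr (_ * _); lra.
  + apply: (nearly_known_indic filF) => //.
      by apply: measurable_funD; [apply: measurable_funM => //; exact: mX|exact: mX].
    apply: (nearly_known_lin filF _ tT); try exact: mX.
      apply: (nearly_known_sub filF h2 tT); last exact: kX.
      by rewrite ge_min lexx orbT.
    apply: (nearly_known_sub filF h1 tT); last exact: kX.
    by rewrite ge_min lexx orbT.
- move=> a H K bH bK hH hK.
  apply: (nearly_known_ae (f := fun w => a * J H t w + J K t w) filF _ _ tT) => //.
  + apply: measurable_funD; last exact: (op_measurable op).
    by apply: measurable_funM => //; exact: (op_measurable op).
  + by apply: (op_measurable op) => //; apply: bpD => //; exact: bpZ.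
  + by apply: filterS (op_lin op a bH bK tT) => w ->.
  + by apply: (nearly_known_lin filF) => //; exact: (op_measurable op).
- move=> H_ H C pH_ pH hC cv h; have [bH_ bH] := bp_of_dominated pH_ pH hC cv.
  apply: (nearly_known_lim filF tT _ _ (op_dominated op pH_ pH hC cv tT)) => //.
  + by move=> n; exact: (op_measurable op).
  + exact: (op_measurable op).
Qed.

(** Uniformity in K comes from choice: if a bad K_n existed for infinitely many n, the products K_n
    D_n would still be dominated and tend to 0 pointwise, against dominated convergence. *)
Lemma op_uniform X J (D_ : nat -> R -> Omega -> R) (C : R) : soi X J ->
  (forall n, predictable T F (D_ n)) ->
  (forall n t w, t \in `[0, T] -> `|D_ n t w| <= C) ->
  (forall t w, t \in `[0, T] -> D_ n t w @[n --> \oo] --> (0 : R)) ->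
  forall e, 0 < e -> exists N, forall n, (N <= n)%N ->
    forall K, predictable T F K -> (forall t w, t \in `[0, T] -> `|K t w| <= 1) ->
      l0 P (J (fun t w => K t w * D_ n t w) T) <= e.
Proof.
move=> op pD hD cv e e0; have TT := T_in T_ge0.
pose bad n K := [/\ predictable T F K, forall t w, t \in `[0, T] -> `|K t w| <= 1
  & e < l0 P (J (fun t w => K t w * D_ n t w) T)].
have /choice [K_ hK] : forall n, exists K,
    (predictable T F K /\ forall t w, t \in `[0, T] -> `|K t w| <= 1) /\
    ((exists K', bad n K') -> bad n K).
  move=> n; have [[K bK]|nK] := pselect (exists K, bad n K).
    by exists K; split=> //; case: bK.
  exists (fun _ _ => 0); split => //.
  by split=> [|t w _]; [exact: predictable_cst|rewrite normr0].
have pKD n : predictable T F (fun t w => K_ n t w * D_ n t w).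
  by apply: predictableM => //; case: (hK n) => -[].
have p0 : predictable T F (fun _ _ => 0) by exact: predictable_cst.
have bKD n t w : t \in `[0, T] -> `|K_ n t w * D_ n t w| <= C.
  move=> tT; rewrite normrM; have [[_ /(_ t w tT) k1] _] := hK n.
  by apply: le_trans (hD n t w tT); rewrite ler_piMl.
have cKD t w : t \in `[0, T] -> K_ n t w * D_ n t w @[n --> \oo] --> (0 : R).
  move=> tT; have /cvgrPdist_le cD := cv t w tT; apply/cvgrPdist_le => d d0.
  have [N _ hN] := cD d d0; exists N => // n /hN /=.
  rewrite !sub0r !normrN normrM; apply: le_trans.
  by rewrite ler_piMl//; case: (hK n) => -[_ h _]; exact: h.
have [N hN] := op_dominated op pKD p0 bKD cKD TT e0.
exists N => n Nn K pK K1; rewrite leNgt; apply/negP => eK.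
have [_ /(_ (ex_intro _ K (And3 pK K1 eK))) [pKn Kn1 eKn]] := hK n.
have := hN n Nn; rewrite leNgt => /negP; apply.
apply: (lt_le_trans eKn).
have bK : bp (fun t w => K_ n t w * D_ n t w) by split => //; exists C => *; exact: bKD.
have b0 : bp (fun _ _ => 0) by exact: bp_cst.
rewrite le_eqVlt; apply/orP; left; apply/eqP; apply: l0_ae.
- exact: (op_measurable op).
- by apply: measurable_funB; exact: (op_measurable op).
- by apply: filterS (op_eq0 op (H := fun _ _ => 0) (fun _ _ _ => erefl) TT) => w ->; rewrite subr0.
Qed.

(** Boundedness in probability of the integrals of all |K| <= 1; it is [op_uniform] for the
    constants 1/(n+1). *)
Lemma op_tight X J : soi X J -> forall e, 0 < e -> exists2 C : R, 0 < C &
  forall K, predictable T F K -> (forall t w, t \in `[0, T] -> `|K t w| <= 1) ->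
    l0 P (fun w => C^-1 * J K T w) <= e.
Proof.
move=> op e e0; have TT := T_in T_ge0.
have [|||N /(_ N (leqnn N)) hN] := @op_uniform X J (fun n _ _ => n.+1%:R^-1) 1 op _ _ _ e e0.
- by move=> n; exact: predictable_cst.
- by move=> n t w _; rewrite ger0_norm ?invr_ge0// invf_le1 ?ler1n ?ltr0n.
- by move=> t w _; exact: cvg_harmonic.
exists N.+1%:R => // K pK K1; apply: le_trans (hN K pK K1).
have bK : bp K by split=> //; exists 1.
have E : (fun t w => K t w * N.+1%:R^-1) = (fun t w => N.+1%:R^-1 * K t w).
  by apply/funext => t; apply/funext => w; rewrite mulrC.
rewrite E le_eqVlt; apply/orP; left; apply/eqP; apply: l0_ae.
- by apply: measurable_funM => //; exact: (op_measurable op).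
- by apply: (op_measurable op) => //; exact: bpZ.
- by apply: filterS (op_scale op N.+1%:R^-1 bK TT) => w ->.
Qed.

(** Extends [op_local] from indicators to bounded coefficients known at s, by a monotone class
    argument in g with H fixed. *)
Lemma op_local_known X J s t (g : Omega -> R) (C : R) H : soi X J ->
  0 <= s -> s <= t -> t <= T -> known F s g -> (forall w, `|g w| <= C) -> bp H ->
  {ae P, forall w, J (fun u w => \1_(`]s, t]) u * g w * H u w) T w =
    g w * (J H t w - J H s w)}.
Proof.
move=> op s0 st tT kg gC bH; have TT := T_in T_ge0.
have sT : s \in `[0, T] by rewrite in_itv/= s0 (le_trans st).
have tT' : t \in `[0, T] by rewrite in_itv/= tT (le_trans s0).
have pr f (D : R) : known F s f -> (forall w, `|f w| <= D) -> bp (fun u w => \1_(`]s, t]) u * f w * H u w).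
  move=> kf fD; apply: bpM => //; split; first exact: (predictable_known_indic T_ge0 filF _ _ _ _ fD).
  exists D => u w _; rewrite normrM; apply: le_trans (fD w).
  by rewrite ler_piMl// norm_indic_le1.
apply: (@bounded_measurable_ind _ (g_sigma_algebraType (F s)) R
  (fun g => {ae P, forall w, J (fun u w => \1_(`]s, t]) u * g w * H u w) T w =
    g w * (J H t w - J H s w)}) _ _ _ g C) => //.
- move=> A mA.
  have FA : F s A by have [hs _ _] := filF; move: mA; rewrite /measurable/= (sigma_algebra_id (hs s sT)).
  have := op_local T_ge0 filF op s0 st tT FA bH TT.
  by rewrite !min_l// (le_trans st).
- move=> a f h kf kh [D1 fD] [D2 hD] Pf Ph.
  have E : (fun u w => \1_(`]s, t]) u * (a * f w + h w) * H u w) =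
    (fun u w => a * (\1_(`]s, t]) u * f w * H u w) + \1_(`]s, t]) u * h w * H u w).
    by apply/funext => u; apply/funext => w; ring.
  rewrite E; apply: filterS3 (op_lin op a (pr _ _ kf fD) (pr _ _ kh hD) TT) Pf Ph.
  by move=> w -> -> ->; ring.
- move=> f_ f D kf_ kf fD cvf Pf.
  have [_ [B hB]] := bH.
  have fD' w : `|f w| <= D by apply: (cvg_norm_bound (cvf w)) => n; exact: fD.
  have mf := known_measurable filF sT kf.
  have mf_ n := known_measurable filF sT (kf_ n).
  have mJ u : u \in `[0, T] -> measurable_fun setT (J H u) by move=> uT; exact: (op_measurable op).
  have mJB := measurable_funB (mJ _ tT') (mJ _ sT).
  apply: (ae_eq_vanishing (f_ := fun n => J (fun u w => \1_(`]s, t]) u * f_ n w * H u w) T)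
    (g_ := fun n w => f_ n w * (J H t w - J H s w))) _ _ Pf.
  + by move=> n; apply: (op_measurable op) => //; exact: (pr _ _ (kf_ n) (fD n)).
  + by apply: (op_measurable op) => //; exact: (pr _ _ kf fD').
  + by move=> n; exact: measurable_funM.
  + exact: measurable_funM.
  + apply: (op_dominated op (C := D * `|B|)) => //.
    * by move=> n; exact: bp_pred (pr _ _ (kf_ n) (fD n)).
    * exact: bp_pred (pr _ _ kf fD').
    * move=> n u w uT; rewrite !normrM ler_pM ?mulr_ge0//.
        by apply: le_trans (fD n w); rewrite ler_piMl// norm_indic_le1.
      exact: le_trans (hB u w uT) (ler_norm _).
    * by move=> u w uT; apply: cvgM; [apply: cvgM; [exact: cvg_cst|exact: cvf]|exact: cvg_cst].
  + apply: vanishing_l0_ae; [by move=> n; exact: measurable_funM|exact: measurable_funM|].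
    by apply/aeW => w; apply: cvgM; [exact: cvf|exact: cvg_cst].
Qed.

End OperatorUniqueness.

Lemma ae_forall_ord (d : measure_display) (X : measurableType d) (R : realType)
    (P : probability X R) (m : nat) (Q : 'I_m -> X -> Prop) :
  (forall i, {ae P, forall w, Q i w}) -> {ae P, forall w, forall i, Q i w}.
Proof.
move=> h.
have : {ae P, forall w, forall k (km : (k < m)%N), Q (Ordinal km) w}.
  apply: ae_foralln => k; have [km|km] := pselect (k < m)%N.
    apply: filterS (h (Ordinal km)) => w hw km'.
    by rewrite (_ : Ordinal km' = Ordinal km)//; exact: val_inj.
  by apply/aeW => w km'.
apply: filterS => w hw i; have := hw i (ltn_ord i).
by rewrite (_ : Ordinal _ = i)//; exact: val_inj.
Qed.

Lemma Rintegral_sum (d : measure_display) (X : measurableType d) (R : realType)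
    (P : probability X R) (I : Type) (s : seq I) (f : I -> X -> R) :
  (forall i, P.-integrable setT (EFin \o f i)) ->
  P.-integrable setT (EFin \o (fun w => \sum_(i <- s) f i w)) /\
  \int[P]_w (\sum_(i <- s) f i w) = \sum_(i <- s) \int[P]_w f i w.
Proof.
move=> intf; elim: s => [|i s [ih1 ih2]].
  have -> : (fun w => \sum_(i <- [::]) f i w) = fun=> 0.
    by apply/funext => w; rewrite big_nil.
  by rewrite big_nil Rintegral_probability_cst; split=> //; exact: integrable_cst.
have -> : (fun w => \sum_(j <- i :: s) f j w) = fun w => f i w + \sum_(j <- s) f j w.
  by apply/funext => w; rewrite big_cons.
by rewrite big_cons RintegralD ?ih2//; split=> //; exact: integrable_funD.
Qed.

(** * Maximal inequality and uniform convergence in time *)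

Section MaximalInequality.
Context {disp : measure_display} {Omega : measurableType disp} {R : realType}.
Variables (P : probability Omega R) (T : R) (F : R -> set (set Omega)).
Hypothesis T_ge0 : 0 <= T.
Hypothesis filF : filtration T F.
Implicit Types H K : R -> Omega -> R.
Local Notation bp := (bounded_predictable T F).
Local Notation soi := (stochastic_integral_operator P T F).

Lemma all_iotaS (ok : nat -> bool) i :
  all ok (iota 0 i.+2) = all ok (iota 0 i.+1) && ok i.+1.
Proof. by rewrite -[i.+2]addn1 iotaD all_cat/= andbT add0n. Qed.

Lemma in_set_bool (X : Type) (b : X -> bool) x : (x \in [set y | b y]) = b x.
Proof. by apply/idP/idP; rewrite inE. Qed.

(** Adjacent half-open cells are disjoint, which keeps step integrands with coefficients in [-1, 1]
    inside [-1, 1]. *)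
Lemma sum_indic_intervals (c : nat -> R) m u : (forall i, c i <= c i.+1) ->
  \sum_(i < m) \1_(`]c i, c i.+1]) u <= 1 :> R.
Proof.
move=> hc; have -> : \sum_(i < m) \1_(`]c i, c i.+1]) u = (c 0%N < u)%R%:R - (c m < u)%R%:R :> R.
  elim: m => [|m ih]; first by rewrite big_ord0 subrr.
  rewrite big_ord_recr/= ih indicE mem_setE in_itv/=.
  case: (ltP (c m) u) => h1; case: (leP u (c m.+1)) => h2; rewrite /=; try lra.
  by have := hc m; lra.
by case: (c 0%N < u); case: (c m < u); rewrite ?mulr1n ?mulr0n; lra.
Qed.

(* The integrand is cut off at the first grid time at which (an adapted
   approximation of) [J H] is large; the value of the stopped integral at [T]
   then dominates the running supremum. *)
Lemma op_running_sup X J H (eta e : R) : soi X J ->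
  (forall t, t \in `[0, T] -> nearly_known P F t (J H t)) ->
  bp H -> 0 < e -> e <= 1 ->
  (forall K, predictable T F K -> (forall t w, t \in `[0, T] -> `|K t w| <= 1) ->
     l0 P (J (fun t w => K t w * H t w) T) <= eta) ->
  l0 P (running_sup T (J H)) <= e + 2 * eta / e.
Proof.
move=> op kJ bH e0 e1 hK; have TT := T_in T_ge0.
have mJ t : t \in `[0, T] -> measurable_fun setT (J H t) by move=> tT; exact: (op_measurable op).
pose a n i w := J H (dyadic T n i) w.
pose A n := [set w | exists2 i, (i <= 2 ^ n)%N & e < `|a n i w|].
have ma n i : (i <= 2 ^ n)%N -> measurable_fun setT (a n i).
  by move=> i2; apply: mJ; exact: dyadic_in.
have mA n : measurable (A n).
  have -> : A n = \bigcup_(i in [set i | (i <= 2 ^ n)%N]) [set w | e < `|a n i w|].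
    by apply/seteqP; split=> [w [i i2 ei]|w [i i2 ei]]; exists i.
  apply: bigcup_measurable => i i2; rewrite -[X in measurable X]setTI.
  by apply: measurable_fun_ltr => //; apply: measurableT_comp => //; exact: ma.
have mU : measurable (\bigcup_n A n) by exact: bigcupT_measurable.
have claim n : fine (P (A n)) <= 2 * eta / e.
  pose m := (2 ^ n)%N; apply/ler_addgt0Pr => d d0.
  have e4 : 0 < e / 4 by lra.
  (* With this precision the m + 1 approximation errors, each tested at level e / 4 by Markov's
     inequality, cost at most d together. *)
  pose eps := d * (e / 4) / m.+1%:R.
  have eps0 : 0 < eps by rewrite /eps divr_gt0 ?ltr0n// mulr_gt0.
  have /choice [g hg] : forall i, exists g : Omega -> R, (i <= m)%N ->
      known F (dyadic T n i) g /\ l0 P (fun w => a n i w - g w) <= eps.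
    move=> i; have [i2|i2] := boolP (i <= m)%N; last by exists (fun=> 0).
    have [g kg ge] := kJ _ (dyadic_in T_ge0 i2) _ eps0.
    by exists g.
  (* With errors below e / 4, the threshold 3/4 e is crossed whenever [a] exceeds e in absolute
     value, and crossing it forces [a] beyond e / 2. *)
  pose ok w j := `|g j w| <= 3 / 4 * e.
  pose B i := [set w | all (ok w) (iota 0 i.+1)].
  have FB i : (i <= m)%N -> F (dyadic T n i) (B i).
    elim: i => [|i ih] im.
      have -> : B 0%N = [set w | `|g 0%N w| <= 3 / 4 * e].
        by apply/seteqP; split=> w; rewrite /B /ok /= ?andbT.
      apply: (known_le_set filF); first exact: dyadic_in.
      by apply: measurableT_comp => //; case: (hg 0%N im).
    have -> : B i.+1 = B i `&` [set w | `|g i.+1 w| <= 3 / 4 * e].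
      have E w : all (ok w) (iota 0 i.+2) = all (ok w) (iota 0 i.+1) && ok w i.+1.
        exact: all_iotaS.
      apply/seteqP; split=> w.
        by rewrite /B /mkset E => /andP[h1 h2]; split.
      by move=> [h1 h2]; rewrite /B /mkset E; apply/andP.
    apply: (filtration_setI filF); first exact: dyadic_in.
      apply: (filtration_sub filF _ _ _ (ih (ltnW im))); rewrite ?dyadic_in//; last exact: dyadic_le.
      exact: ltnW.
    apply: (known_le_set filF); first exact: dyadic_in.
    by apply: measurableT_comp => //; case: (hg _ im).
  pose c i := dyadic T n i.
  have cS i : c i <= c i.+1 by exact: dyadic_le.
  have c0 (i : 'I_m) : 0 <= c i.
    by rewrite /c -(dyadic0 T n); exact: dyadic_le.
  have cT (i : 'I_m) : c i.+1 <= T.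
    by rewrite /c -[leRHS](dyadicT T n); exact: dyadic_le.
  (* The integrand 1 up to the first failure of [ok]; it is predictable because [B i] is known at
     the left end of its cell. *)
  pose D u w : R := \sum_(i < m) \1_(`]c i, c i.+1]) u * \1_(B i) w.
  have FBi (i : 'I_m) : F (c i) (B i) by apply: FB; exact: ltnW.
  have pD : predictable T F D.
    by apply: predictable_sum => i; apply: (predictable_rectangle T_ge0).
  have D1 u w : u \in `[0, T] -> `|D u w| <= 1.
    move=> uT; rewrite ger0_norm; last by apply: sumr_ge0 => i _; rewrite !indicE mulr_ge0.
    apply: le_trans (sum_indic_intervals m u cS).
    by apply: ler_sum => i _; rewrite ler_piMr// !indicE.
  have bH_ (i : 'I_m) : bp (fun u w => \1_(`]c i, c i.+1]) u * \1_(B i) w * H u w).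
    by apply: bpM => //; exact: (bp_rectangle T_ge0).
  have [_ s1] := op_sum op (index_enum 'I_m) bH_ TT.
  have s2 : {ae P, forall w, J (fun u w => D u w * H u w) T w =
      \sum_(i < m) \1_(B i) w * (a n i.+1 w - a n i w)}.
    have -> : (fun u w => D u w * H u w) =
        (fun u w => \sum_(i < m) \1_(`]c i, c i.+1]) u * \1_(B i) w * H u w).
      by apply/funext => u; apply/funext => w; rewrite /D mulr_suml.
    have : {ae P, forall w, forall i : 'I_m,
       J (fun u w => \1_(`]c i, c i.+1]) u * \1_(B i) w * H u w) T w =
       \1_(B i) w * (a n i.+1 w - a n i w)}.
      apply: ae_forall_ord => i.
      have := op_local T_ge0 filF op (c0 i) (cS i) (cT i) (FBi i) bH TT.
      by rewrite !min_l ?(cT i) ?(le_trans (cS i) (cT i)).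
    by apply: filterS2 s1 => w -> h; apply: eq_bigr => i _; exact: h.
  have mDH : measurable_fun setT (J (fun u w => D u w * H u w) T).
    by apply: (op_measurable op) => //; apply: bpM => //; split => //; exists 1.
  have mg i : (i <= m)%N -> measurable_fun setT (g i).
    by move=> im; apply: (known_measurable filF (dyadic_in T_ge0 im)); case: (hg i im).
  have mag (i : 'I_m.+1) : measurable_fun setT (fun w => a n i w - g i w).
    have im : (i <= m)%N by rewrite -ltnS.
    by apply: measurable_funB; [exact: ma|exact: mg].
  pose b0 w : R := 2 / e * Num.min `|J (fun u w => D u w * H u w) T w| 1.
  pose b1 (i : 'I_m.+1) w : R := (e / 4)^-1 * Num.min `|a n i w - g i w| 1.
  have ib0 : P.-integrable setT (EFin \o b0) by exact/integrable_funZ/l0_integrable.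
  have ib1 i : P.-integrable setT (EFin \o b1 i) by exact/integrable_funZ/l0_integrable.
  have [isum isumE] := Rintegral_sum (index_enum 'I_m.+1) ib1.
  have b1ge i w : 0 <= b1 i w.
    by rewrite mulr_ge0 ?invr_ge0 ?(ltW e4)// le_min normr_ge0 ler01.
  have b0ge w : 0 <= b0 w.
    by rewrite mulr_ge0 ?divr_ge0 ?(ltW e0)// le_min normr_ge0 ler01.
  (* On [A n] either some approximation is off by e / 4 or the stopped integral is at least e / 2 in
     absolute value; [b1] and [b0] are the two Markov bounds written pointwise. *)
  have dom : {ae P, forall w, \1_(A n) w <= b0 w + \sum_(i < m.+1) b1 i w}.
    apply: filterS2 (op_at0 T_ge0 filF op bH) s2 => w h0 h2.
    have sge0 : 0 <= \sum_(i < m.+1) b1 i w by apply: sumr_ge0.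
    rewrite indicE; case: (boolP (w \in A n)) => [/set_mem [i0 i0m ei0]|_]; last exact: addr_ge0.
    have [[i im ei]|nex] := pselect (exists2 i, (i <= m)%N & e / 4 <= `|a n i w - g i w|).
      have im' : (i < m.+1)%N by rewrite ltnS.
      have : 1 <= b1 (Ordinal im') w.
        rewrite /b1/= mulrC ler_pdivlMr// mul1r le_min ei; lra.
      rewrite (bigD1 (Ordinal im'))//= => h1.
      have : 0 <= \sum_(j < m.+1 | j != Ordinal im') b1 j w by apply: sumr_ge0.
      by have := b0ge w; lra.
    have close i : (i <= m)%N -> `|a n i w - g i w| < e / 4.
      by move=> im; rewrite ltNge; apply/negP => h; apply: nex; exists i.
    have [k [km Ek hk]] := stopped_sum (fun i => a n i w) (ok w) m.
    have nok : ~~ ok w k.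
      apply: hk; exists i0 => //; rewrite /ok -ltNge.
      have := close i0 i0m; have := ler_normD (a n i0 w - g i0 w) (g i0 w).
      by rewrite subrK; lra.
    have ak : e / 2 < `|a n k w|.
      move: nok; rewrite /ok -ltNge; have := close k km.
      have := ler_normD (- (a n k w - g k w)) (a n k w).
      by rewrite normrN (_ : - _ + _ = g k w); [lra|ring].
    have : 1 <= b0 w.
      rewrite /b0 h2 (eq_bigr (fun i : 'I_m => (all (ok w) (iota 0 i.+1))%:R * (a n i.+1 w - a n i w))).
        rewrite [X in `|X|]Ek {2}/a dyadic0 h0 subr0 mulrAC ler_pdivlMr// mul1r.
        have : e / 2 <= Num.min `|a n k w| 1 by rewrite le_min (ltW ak); lra.
        by rewrite /a; lra.
      by move=> i _; rewrite indicE in_set_bool.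
    by move=> h; apply: (le_trans h); rewrite lerDl.
  have := ae_le_Rintegral (integrable_indicator P (mA n)) (integrable_funD ib0 isum) dom.
  rewrite Rintegral_indicator// RintegralD// => h; apply: (le_trans h).
  apply: lerD.
    rewrite RintegralZl ?l0_integrable//.
    have := hK D pD D1; rewrite -/(l0 _ _) => h1.
    rewrite [leRHS]mulrAC; apply: ler_wpM2l => //.
    by rewrite divr_ge0// ltW.
  rewrite isumE.
  apply: (@le_trans _ _ (\sum_(i < m.+1) (e / 4)^-1 * eps)).
    apply: ler_sum => i _; rewrite RintegralZl ?l0_integrable//.
    apply: ler_wpM2l; first by rewrite invr_ge0 ltW.
    have im : (i <= m)%N by rewrite -ltnS.
    by case: (hg i im).
  rewrite sumr_const card_ord -[leLHS]mulr_natr /eps -mulrA divfK ?pnatr_eq0//.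
  by rewrite mulrCA mulVf ?mulr1// gt_eqF.
apply: (le_trans (l0_le_probability P (measurable_running_sup T_ge0 mJ) (ltW e0))).
rewrite lerD2l.
have PU : (P (\bigcup_n A n) <= (2 * eta / e)%:E)%E.
  (* Finer grids contain coarser ones, and the bound of [claim] does not depend on n, so it passes
     to the union. *)
  have ndA : nondecreasing_seq A.
    apply/nondecreasing_seqP => n; apply/subsetPset => w [i i2 ei].
    exists (i * 2 ^ 1)%N; first by rewrite expn1 expnSr leq_pmul2r.
    by rewrite /a -addn1 dyadic_refine.
  have cv : (P \o A) n @[n --> \oo] --> P (\bigcup_n A n).
    exact: (nondecreasing_cvg_mu mA mU ndA).
  rewrite -(cvg_lim _ cv)//; apply: lime_le; first by apply: cvgP cv.
  apply: nearW => n; rewrite -[leLHS]fineK ?fin_num_measure//= lee_fin.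
  exact: claim.
rewrite -lee_fin fineK ?fin_num_measure//; last first.
  rewrite -[X in measurable X]setTI; apply: measurable_fun_ltr => //.
  by apply: measurableT_comp => //; exact: measurable_running_sup.
apply: le_trans PU; apply: le_measure; rewrite ?inE//.
  rewrite -[X in measurable X]setTI; apply: measurable_fun_ltr => //.
  by apply: measurableT_comp => //; exact: measurable_running_sup.
move=> w /=; rewrite ger0_norm ?running_sup_ge0// => ew.
apply: contrapT => nU; move: ew; rewrite ltNge => /negP; apply.
apply: (running_sup_le T_ge0) => t tT; rewrite ge_min; apply/orP; left.
apply: (cadlag_dyadic_bound T_ge0 (op_cadlag op bH) _ tT) => n i i2.
by rewrite leNgt; apply/negP => ei; apply: nU; exists n => //; exists i.
Qed.

Lemma op_ucp X J (H_ : nat -> R -> Omega -> R) H (C : R) : soi X J ->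
  (forall K t, bp K -> t \in `[0, T] -> nearly_known P F t (J K t)) ->
  (forall n, predictable T F (H_ n)) -> predictable T F H ->
  (forall n t w, t \in `[0, T] -> `|H_ n t w| <= C) ->
  (forall t w, t \in `[0, T] -> H_ n t w @[n --> \oo] --> H t w) ->
  vanishing (fun n => l0 P (running_sup T (fun t w => J (H_ n) t w - J H t w))).
Proof.
move=> op kJ pH_ pH hC cv; have [bH_ bH] := bp_of_dominated pH_ pH hC cv.
have hC' t w : t \in `[0, T] -> `|H t w| <= C.
  by move=> tT; apply: (cvg_norm_bound (cv t w tT)) => n; exact: hC.
pose D n t w := H_ n t w - H t w.
have pD n : predictable T F (D n) by exact: predictableB.
have bD n : bp (D n) by exact: bpB.
have hD n t w : t \in `[0, T] -> `|D n t w| <= C + C.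
  by move=> tT; apply: (le_trans (ler_normB _ _)); rewrite lerD ?hC ?hC'.
have cD t w : t \in `[0, T] -> D n t w @[n --> \oo] --> (0 : R).
  by move=> tT; rewrite -(subrr (H t w)); apply: cvgB; [exact: cv|exact: cvg_cst].
move=> e e0; pose d := Num.min (e / 2) 1.
have d0 : 0 < d by rewrite lt_min ltr01 divr_gt0.
have d1 : d <= 1 by rewrite ge_min lexx orbT.
have de : d <= e / 2 by rewrite ge_min lexx.
(* The level d * d / 2 is tuned to the maximal inequality, whose bound becomes d + d <= e. *)
have [N hN] := op_uniform T_ge0 op pD hD cD (e := d * d / 2) ltac:(rewrite !(mulr_gt0, invr_gt0)//).
exists N => n Nn.
have mD t : t \in `[0, T] -> measurable_fun setT (J (D n) t) by move=> tT; exact: (op_measurable op).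
have -> : l0 P (running_sup T (fun t w => J (H_ n) t w - J H t w)) = l0 P (running_sup T (J (D n))).
  apply: l0_ae.
  - apply: (measurable_running_sup T_ge0) => t tT.
    by apply: measurable_funB; exact: (op_measurable op).
  - exact: (measurable_running_sup T_ge0).
  - apply: running_sup_ae => //; apply: cadlag_indistinguishable => //.
    + by apply: cadlagB; exact: (op_cadlag op).
    + exact: (op_cadlag op).
    + by move=> t tT; apply: filterS (op_B op (bH_ n) bH tT) => w ->.
have := op_running_sup op (fun t tT => kJ _ t (bD n) tT) (bD n) d0 d1 (hN n Nn).
have -> : 2 * (d * d / 2) / d = d by field; rewrite gt_eqF.
lra.
Qed.

End MaximalInequality.

(** * Approximation of integrands by dyadic step processes *)

Section SimpleApproximation.
Context {disp : measure_display} {Omega : measurableType disp} {R : realType}.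
Variables (P : probability Omega R) (T : R) (F : R -> set (set Omega)).
Hypothesis T_ge0 : 0 <= T.
Hypothesis filF : filtration T F.
Implicit Types H K : R -> Omega -> R.
Local Notation bp := (bounded_predictable T F).
Local Notation soi := (stochastic_integral_operator P T F).
Local Notation dy := (dyadic T).

(** A cell is open at the left, so its constant is read off at the right end, while being known at
    the left end is what makes the process predictable. *)
Definition dyadic_simple (n : nat) (k : R -> Omega -> R) : Prop :=
  known F 0 (k 0) /\ forall i, (i < 2 ^ n)%N ->
    known F (dy n i) (k (dy n i.+1)) /\
    forall t, t \in `]dy n i, dy n i.+1] -> k t = k (dy n i.+1).

Lemma dyadic_ge0 n i : 0 <= dy n i.
Proof. by rewrite -(dyadic0 T n); exact: dyadic_le. Qed.

Lemma dyadic_leT n i : (i <= 2 ^ n)%N -> dy n i <= T.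
Proof. by move=> i2; rewrite -[leRHS](dyadicT T n); exact: dyadic_le. Qed.

Lemma dyadic_simple_refine n p k : dyadic_simple n k -> dyadic_simple (n + p) k.
Proof.
move=> [k0 hk]; split=> // i i2; pose j := (i %/ 2 ^ p)%N.
have p0 : (0 < 2 ^ p)%N by rewrite expn_gt0.
have j2 : (j < 2 ^ n)%N by rewrite ltn_divLR// -expnD.
have [kj cj] := hk j j2.
have l1 : dy n j <= dy (n + p) i.
  by rewrite -(dyadic_refine T n p); apply: dyadic_le => //; exact: leq_trunc_div.
have l2 : dy (n + p) i.+1 <= dy n j.+1.
  rewrite -(dyadic_refine T n p); apply: dyadic_le => //.
  by rewrite /j; have := ltn_ceil i p0.
have i2' : (i <= 2 ^ (n + p))%N by exact: ltnW.
have c t : t \in `]dy (n + p) i, dy (n + p) i.+1] -> k t = k (dy n j.+1).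
  by rewrite in_itv/= => /andP[h1 h2]; apply: cj; rewrite in_itv/= (le_lt_trans l1 h1) (le_trans h2).
(* For T = 0 all grid points coincide and the cells are empty. *)
have step : dy (n + p) i < dy (n + p) i.+1 \/ dy (n + p) i.+1 = dy n j.+1.
  have [T0|T0] := ltP 0 T; [left|right].
    by rewrite dyadic_step ltrDl divr_gt0// pow2_gt0.
  have -> : T = 0 by apply/le_anti; rewrite T0.
  by rewrite /dyadic !mul0r.
have e : k (dy (n + p) i.+1) = k (dy n j.+1).
  case: step => [lt|->//]; apply: c; by rewrite in_itv/= lt lexx.
split.
  rewrite e; apply: (known_sub filF _ _ l1 kj); apply: dyadic_in => //; exact: ltnW.
by move=> t tI; rewrite e; exact: c.
Qed.

Lemma dyadic_simple_le n m k : (n <= m)%N -> dyadic_simple n k -> dyadic_simple m k.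
Proof. by move=> /subnKC <-; exact: dyadic_simple_refine. Qed.

Lemma dyadic_simple_lin n (a : R) k l : dyadic_simple n k -> dyadic_simple n l ->
  dyadic_simple n (fun t w => a * k t w + l t w).
Proof.
move=> [k0 hk] [l0 hl]; split.
  by apply: measurable_funD => //; exact: measurable_funM.
move=> i i2; have [ki ci] := hk i i2; have [li di] := hl i i2; split.
  by apply: measurable_funD => //; exact: measurable_funM.
by move=> t tI; apply/funext => w; rewrite (ci t tI) (di t tI).
Qed.

Lemma dyadic_simple_comp n (f : R -> R) k : measurable_fun setT f ->
  dyadic_simple n k -> dyadic_simple n (fun t w => f (k t w)).
Proof.
move=> mf [k0 hk]; split; first exact: measurableT_comp.
move=> i i2; have [ki ci] := hk i i2; split; first exact: measurableT_comp.
by move=> t tI; apply/funext => w; rewrite (ci t tI).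
Qed.

Lemma dyadic_simple_predictable n k (C : R) : dyadic_simple n k ->
  (forall t w, `|k t w| <= C) -> predictable T F k.
Proof.
move=> [k0 hk] kC.
apply: (@predictable_ext _ _ _ _ _ (fun u w => \1_(`[0, 0]) u * k 0 w +
  \sum_(i < 2 ^ n) \1_(`]dy n i, dy n i.+1]) u * k (dy n i.+1) w)).
  move=> u w; rewrite in_itv/= => /andP[u0 uT].
  have [u0'|u0'] := leP u 0.
    have -> : u = 0 by apply/le_anti; rewrite u0 u0'.
    rewrite big1 ?addr0; last first.
      move=> i _; rewrite indicE mem_setE in_itv/= ltNge dyadic_ge0/= mul0r//.
    by rewrite indicE mem_setE in_itv/= lexx mul1r.
  rewrite indicE mem_setE in_itv/= (leNgt u 0) u0' andbF mul0r add0r.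
  have T0 : 0 < T by lra.
  have [j j2 jI] : exists2 j, (j < 2 ^ n)%N & u \in `]dy n j, dy n j.+1].
    have ex : exists j, u <= dy n j by exists (2 ^ n)%N; rewrite dyadicT.
    case: (ex_minnP ex) => -[|j] uj minj.
      by move: uj; rewrite dyadic0 leNgt u0'.
    exists j.
      have := minj (2 ^ n)%N; rewrite dyadicT => /(_ uT).
      exact.
    rewrite in_itv/= uj andbT ltNge; apply/negP => /minj.
    by rewrite ltnn.
  rewrite (bigD1 (Ordinal j2))//= indicE mem_setE jI mul1r big1 ?addr0.
    by have [_ ->] := hk j j2.
  move=> i ij; rewrite indicE mem_setE in_itv/=; move: jI; rewrite in_itv/= => /andP[h1 h2].
  case: (ltngtP i j) => ij'.
  - have -> : (u <= dy n i.+1) = false.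
      by apply/negbTE; rewrite -ltNge (le_lt_trans (dyadic_le T_ge0 n ij')).
    by rewrite andbF mul0r.
  - have -> : (dy n i < u) = false.
      by apply/negbTE; rewrite -leNgt (le_trans h2 (dyadic_le T_ge0 n ij')).
    by rewrite mul0r.
  - by move: ij; rewrite -val_eqE/= ij' eqxx.
apply: predictableD; first exact: (predictable_at0 T_ge0 filF k0 (kC 0)).
apply: predictable_sum => i; have i2 := ltn_ord i.
apply: (predictable_known_indic T_ge0 filF _ _ _ _ (kC (dy n i.+1))).
- exact: dyadic_ge0.
- exact: dyadic_le.
- exact: dyadic_leT.
- by case: (hk i i2).
Qed.

Lemma op_indep_at0 X J H : soi X J -> bp H ->
  {ae P, forall w, J (fun u w => \1_(`]0, T]) u * H u w) T w = J H T w}.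
Proof. by move=> op bH; exact: (op_from0 T_ge0 filF op bH (T_in T_ge0)). Qed.

Lemma op_dyadic_simple X J n k (C : R) : soi X J -> dyadic_simple n k ->
  (forall t w, `|k t w| <= C) ->
  {ae P, forall w, J k T w =
    \sum_(i < 2 ^ n) k (dy n i.+1) w * (X (dy n i.+1) w - X (dy n i) w)}.
Proof.
move=> op sk kC; have pk := dyadic_simple_predictable sk kC.
have bk : bp k by split=> //; exists C.
have TT := T_in T_ge0; have [k0 hk] := sk.
have b1 : bp (fun _ _ => 1) by exact: bp_cst.
have h : {ae P, forall w, forall i : 'I_(2 ^ n), J k (dy n i.+1) w - J k (dy n i) w =
    k (dy n i.+1) w * (X (dy n i.+1) w - X (dy n i) w)}.
  apply: ae_forall_ord => i; have i2 := ltn_ord i; have [ki ci] := hk i i2.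
  have d0 := dyadic_ge0 n i; have dS : dy n i <= dy n i.+1 by exact: dyadic_le.
  have dT : dy n i.+1 <= T by exact: dyadic_leT.
  have F0 := filtrationT filF (dyadic_in T_ge0 (ltnW i2)).
  have l1 := op_local T_ge0 filF op d0 dS dT F0 bk TT.
  have l2 := op_local_known T_ge0 filF op d0 dS dT ki (kC _) b1.
  have i1 := op_one T_ge0 filF op (dyadic_in T_ge0 i2).
  have i0 := op_one T_ge0 filF op (dyadic_in T_ge0 (ltnW i2)).
  have bR := bp_rectangle T_ge0 d0 dS dT F0.
  have E u w : u \in `[0, T] -> \1_(`]dy n i, dy n i.+1]) u * \1_setT w * k u w =
      \1_(`]dy n i, dy n i.+1]) u * k (dy n i.+1) w * 1.
    move=> _; rewrite mulr1 indicT/= mulr1 !indicE mem_setE.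
    by case: (boolP (u \in _)) => uI; rewrite ?mul0r// ci.
  have e := op_ext op (bpM bR bk) E TT.
  apply: filterS3 (ae_and l1 l2) (ae_and i1 i0) e => w [-> e2] [e3 e4].
  rewrite e2 e3 e4 indicT/= mul1r !min_l//; last exact: le_trans dT.
  by move=> ->; congr (_ * _); lra.
apply: filterS2 (op_at0 T_ge0 filF op bk) h => w z hw.
rewrite -(eq_bigr _ (fun i _ => hw i)).
have -> : \sum_(i < 2 ^ n) (J k (dy n i.+1) w - J k (dy n i) w) =
  J k (dy n (2 ^ n)) w - J k (dy n 0) w.
  by rewrite -(big_mkord xpredT (fun i => J k (dy n i.+1) w - J k (dy n i) w)) telescope_sumr.
by rewrite dyadicT dyadic0 z subr0.
Qed.

(** Uniformity over G allows the approximant to be modified afterwards: in [op_approx_contraction]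
    the factor G depends on k. *)
Definition simply_approximable J H := forall e, 0 < e ->
  exists n k (C : R), [/\ dyadic_simple n k, forall t w, `|k t w| <= C &
    forall G, predictable T F G -> (forall t w, t \in `[0, T] -> `|G t w| <= 1) ->
      l0 P (J (fun t w => G t w * (H t w - k t w)) T) <= e].

Lemma dyadic_simple_approximable X J n k (C : R) : soi X J ->
  dyadic_simple n k -> (forall t w, `|k t w| <= C) -> simply_approximable J k.
Proof.
move=> op sk kC e e0; exists n, k, C; split=> // G pG G1.
have TT := T_in T_ge0.
have E : (fun t w => G t w * (k t w - k t w)) = fun _ _ => 0.
  by apply/funext => t; apply/funext => w; rewrite subrr mulr0.
rewrite E (@l0_ae _ _ _ _ _ (fun=> 0)) ?l0_cst0 ?ltW//.
  by apply: (op_measurable op) => //; exact: bp_cst.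
exact: (op_eq0 op).
Qed.

(** By [op_uniform] the approximable integrands are closed under bounded limits. A rectangle with
    arbitrary end points is a limit of rectangles with dyadic ones, rounded upwards so that A is
    still known at the left end. *)
Lemma op_simply_approximable X J : soi X J ->
  forall H, bp H -> simply_approximable J H.
Proof.
move=> op; have TT := T_in T_ge0.
have Plim (H_ : nat -> R -> Omega -> R) H (C : R) :
    (forall n, predictable T F (H_ n)) -> predictable T F H ->
    (forall n t w, t \in `[0, T] -> `|H_ n t w| <= C) ->
    (forall t w, t \in `[0, T] -> H_ n t w @[n --> \oo] --> H t w) ->
    (forall n, simply_approximable J (H_ n)) -> simply_approximable J H.
  move=> pH_ pH hC cv hS e e0; have [bH_ bH] := bp_of_dominated pH_ pH hC cv.
  have hC' t w : t \in `[0, T] -> `|H t w| <= C.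
    by move=> tT; apply: (cvg_norm_bound (cv t w tT)) => n; exact: hC.
  have e2 : 0 < e / 2 by lra.
  pose D_ n t w := H t w - H_ n t w.
  have pD n : predictable T F (D_ n) by exact: predictableB.
  have hD n t w : t \in `[0, T] -> `|D_ n t w| <= C + C.
    by move=> tT; apply: (le_trans (ler_normB _ _)); rewrite lerD ?hC ?hC'.
  have cD t w : t \in `[0, T] -> D_ n t w @[n --> \oo] --> (0 : R).
    by move=> tT; rewrite -(subrr (H t w)); apply: cvgB; [exact: cvg_cst|exact: cv].
  have [N /(_ N (leqnn N)) hN] := op_uniform T_ge0 op pD hD cD e2.
  have [n [k [D [sk kD hk]]]] := hS N _ e2.
  exists n, k, D; split=> // G pG G1.
  have pk := dyadic_simple_predictable sk kD.
  have bk : bp k by split=> //; exists D.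
  have bG : bp G by split=> //; exists 1.
  have b1 : bp (fun t w => G t w * (H t w - H_ N t w)) by apply: bpM => //; exact: bpB.
  have b2 : bp (fun t w => G t w * (H_ N t w - k t w)) by apply: bpM => //; exact: bpB.
  have E : (fun t w => G t w * (H t w - k t w)) =
      fun t w => G t w * (H t w - H_ N t w) + G t w * (H_ N t w - k t w).
    by apply/funext => t; apply/funext => w; ring.
  rewrite E (@l0_ae _ _ _ _ _ (fun w => J (fun t w => G t w * (H t w - H_ N t w)) T w +
     J (fun t w => G t w * (H_ N t w - k t w)) T w)).
  - apply: (le_trans (l0D _ _ _)); try exact: (op_measurable op).
    by have := hN G pG G1; have := hk G pG G1; lra.
  - by apply: (op_measurable op) => //; exact: bpD.
  - by apply: measurable_funD; exact: (op_measurable op).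
  - exact: (op_D op b1 b2 TT).
have rect_bound (D : set R) (A : set Omega) t w : `|\1_D t * \1_A w : R| <= 1.
  exact: norm_rectangle_le1.
have dyad n a b A : (a <= b)%N -> (b <= 2 ^ n)%N -> F (dy n a) A -> 0 < T ->
    simply_approximable J (fun u w => \1_(`]dy n a, dy n b]) u * \1_A w).
  move=> ab b2 FA T0.
  have dlt i j : (dy n i < dy n j) = (i < j)%N.
    apply/idP/idP; last first.
      move=> ij; apply: lt_le_trans (dyadic_le T_ge0 n ij).
      by rewrite dyadic_step ltrDl divr_gt0// pow2_gt0.
    by apply: contraTT; rewrite -leqNgt -leNgt => h; exact: dyadic_le.
  have val u i : u \in `]dy n i, dy n i.+1] ->
      (u \in `]dy n a, dy n b]) = (a <= i < b)%N.
    rewrite !in_itv/= => /andP[h1 h2]; case: (leqP a i) => ai /=.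
      rewrite (le_lt_trans (dyadic_le T_ge0 n ai) h1)/=.
      case: (ltnP i b) => ib; first by rewrite (le_trans h2)//; exact: dyadic_le.
      by rewrite leNgt (le_lt_trans (dyadic_le T_ge0 n ib) h1).
    by rewrite ltNge (le_trans h2 (dyadic_le T_ge0 n ai)).
  have self i : dy n i.+1 \in `]dy n i, dy n i.+1] by rewrite in_itv/= lexx dlt ltnSn.
  apply: (@dyadic_simple_approximable X J n _ 1) => //; split.
    rewrite (_ : (fun w => _) = fun=> 0); first exact: measurable_cst.
    apply/funext => w; rewrite indicE mem_setE in_itv/=.
    by rewrite ltNge dyadic_ge0/= mul0r.
  move=> i i2; split; last first.
    by move=> u uI; apply/funext => w; rewrite !indicE !mem_setE (val _ _ uI) (val _ _ (self i)).
  have -> : (fun w => \1_(`]dy n a, dy n b]) (dy n i.+1) * \1_A w) =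
      (fun w => (a <= i < b)%N%:R * \1_A w : R).
    by apply/funext => w; rewrite !indicE !mem_setE (val _ _ (self i)).
  case: (boolP (a <= i < b)%N) => h; last first.
    rewrite (_ : (fun w => _) = fun=> 0); first exact: measurable_cst.
    by apply/funext => w; rewrite mul0r.
  move: h => /andP[ai ib]; apply: measurable_funM; first exact: measurable_cst.
  apply: known_indic; apply: (filtration_sub filF _ _ (dyadic_le T_ge0 n ai) FA).
    by apply: dyadic_in => //; exact: leq_trans ab b2.
  by apply: dyadic_in => //; exact: ltnW.
apply: (bounded_predictable_ind T_ge0 filF) => //.
- move=> A FA; apply: (@dyadic_simple_approximable X J 0 _ 1) => //.
  have k0 (c : R) : known F 0 (fun w => c * \1_A w).
    by apply: measurable_funM; [exact: measurable_cst|exact: known_indic].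
  split; first exact: k0.
  move=> i; rewrite expn0 ltnS leqn0 => /eqP ->; rewrite dyadic0; split; first exact: k0.
  move=> t tI; apply/funext => w; rewrite !indicE !mem_setE; move: tI; rewrite !in_itv/=.
  move=> /andP[t0 t1]; rewrite !(leNgt _ 0) t0 andbF.
  by rewrite (lt_le_trans t0 t1) andbF.
- move=> s t A s0 st tT FA.
  have [T0|T0] := ltP 0 T; last first.
    apply: (@dyadic_simple_approximable X J 0 _ 1) => //.
    have -> : (fun u w => \1_(`]s, t]) u * \1_A w) = fun (_ : R) (_ : Omega) => 0 : R.
      apply/funext => u; apply/funext => w; rewrite set_itv_ge ?indic0 ?mul0r//.
      by rewrite bnd_simp -leNgt; lra.
    by split=> [|i _]; [exact: measurable_cst|split=> //; exact: measurable_cst].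
  have up (x : R) : 0 <= x <= T -> exists a : nat -> nat, [/\ forall n, (a n <= 2 ^ n)%N,
      forall n, x <= dy n (a n) & forall n, dy n (a n) <= x + T / 2 ^+ n].
    move=> /andP[x0 xT]; have [xT'|Tx] := ltP x T.
      have /choice [a ha] : forall n, exists i, [/\ (i <= 2 ^ n)%N, x <= dy n i & dy n i <= x + T / 2 ^+ n].
        move=> n; have x0T : 0 <= x < T by rewrite x0.
        have [i i2 /andP[h1 h2]] := dyadic_floor T_ge0 n T0 x0T.
        by exists i.+1; split=> //; [exact: ltW|rewrite dyadic_step lerD2r].
      by exists a; split=> n; have [] := ha n.
    exists (fun n => 2 ^ n)%N; split=> n //; rewrite dyadicT//.
    by apply: (le_trans Tx); rewrite lerDl divr_ge0// ltW// pow2_gt0.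
  have [a [a2 sa as_]] := up s ltac:(rewrite s0 (le_trans st)//).
  have [b [b2 tb bt]] := up t ltac:(rewrite tT (le_trans s0)//).
  (* The end points are rounded independently; the maximum restores their order. *)
  pose b' n := maxn (a n) (b n).
  have b'2 n : (b' n <= 2 ^ n)%N by rewrite geq_max a2 b2.
  have db' n : dy n (b' n) = Num.max (dy n (a n)) (dy n (b n)).
    rewrite /b'; case: (leqP (a n) (b n)) => h.
      by rewrite max_r//; exact: dyadic_le.
    by rewrite max_l//; apply: dyadic_le => //; exact: ltnW.
  have sT : s \in `[0, T] by rewrite in_itv/= s0 (le_trans st).
  have FAn n : F (dy n (a n)) A.
    by apply: (filtration_sub filF sT _ (sa n) FA); exact: dyadic_in.
  apply: (Plim (fun n u w => \1_(`]dy n (a n), dy n (b' n)]) u * \1_A w) _ 1) => //.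
  + move=> n; apply: (predictable_rectangle T_ge0) => //; first exact: dyadic_ge0.
      by apply: dyadic_le => //; exact: leq_maxl.
    exact: dyadic_leT.
  + exact: (predictable_rectangle T_ge0).
  + move=> u w uT.
    suff [N hN] : exists N, forall n, (N <= n)%N -> (u \in `]dy n (a n), dy n (b' n)]) = (u \in `]s, t]).
      apply: (@cvg_eventually _ _ _ N) => n Nn.
      by rewrite !indicE !mem_setE hN.
    have [us|su] := leP u s.
      exists 0%N => n _; rewrite !in_itv/= ltNge (le_trans us (sa n))/=.
      by rewrite ltNge us.
    have [N1 hN1] := @dyadic_mesh _ T T_ge0 (u - s) ltac:(rewrite subr_gt0//).
    have [ut|tu] := leP u t.
      exists N1 => n nN; rewrite !in_itv/= su ut db' le_max (le_trans ut (tb n)) orbT.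
      by have := hN1 n nN; have := as_ n; case: ltP => //; lra.
    have [N2 hN2] := @dyadic_mesh _ T T_ge0 (u - t) ltac:(rewrite subr_gt0//).
    exists (maxn N1 N2) => n; rewrite geq_max => /andP[n1 n2].
    rewrite !in_itv/= su (leNgt u t) tu/= db' le_max !leNgt.
    have -> : dy n (a n) < u by have := hN1 n n1; have := as_ n; lra.
    by have -> : dy n (b n) < u by have := hN2 n n2; have := bt n; lra.
  + by move=> n; apply: dyad => //; exact: leq_maxl.
- move=> a H K bH bK hH hK e e0.
  have M0 : 0 < Num.max 1 `|a| by rewrite lt_max ltr01.
  have [n [k [C [sk kC hk]]]] := hH (e / 2 / Num.max 1 `|a|) ltac:(rewrite !divr_gt0//).
  have [m [l [D [sl lD hl]]]] := hK (e / 2) ltac:(rewrite divr_gt0//).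
  exists (maxn n m), (fun t w => a * k t w + l t w), (`|a| * C + D); split.
  + apply: dyadic_simple_lin; [apply: dyadic_simple_le sk|apply: dyadic_simple_le sl].
      exact: leq_maxl.
    exact: leq_maxr.
  + move=> t w; apply: (le_trans (ler_normD _ _)); apply: lerD => //.
    by rewrite normrM ler_wpM2l.
  move=> G pG G1.
  have pk := dyadic_simple_predictable sk kC; have pl := dyadic_simple_predictable sl lD.
  have bk : bp k by split=> //; exists C.
  have bl : bp l by split=> //; exists D.
  have bG : bp G by split=> //; exists 1.
  have b1 : bp (fun t w => G t w * (H t w - k t w)) by apply: bpM => //; exact: bpB.
  have b2 : bp (fun t w => G t w * (K t w - l t w)) by apply: bpM => //; exact: bpB.
  have E : (fun t w => G t w * (a * H t w + K t w - (a * k t w + l t w))) =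
      fun t w => a * (G t w * (H t w - k t w)) + G t w * (K t w - l t w).
    by apply/funext => t; apply/funext => w; ring.
  have m1 := op_measurable op b1 TT; have m2 := op_measurable op b2 TT.
  rewrite E (@l0_ae _ _ _ _ _ (fun w => a * J (fun t w => G t w * (H t w - k t w)) T w +
     J (fun t w => G t w * (K t w - l t w)) T w)).
  + apply: (le_trans (l0D _ _ _)) => //; first exact: measurable_funM.
    have := l0Z P a m1; have := hl G pG G1.
    have : Num.max 1 `|a| * l0 P (J (fun t w => G t w * (H t w - k t w)) T) <= e / 2.
      by rewrite mulrC -ler_pdivlMr//; exact: hk.
    by lra.
  + by apply: (op_measurable op) => //; apply: bpD => //; exact: bpZ.
  + by apply: measurable_funD => //; exact: measurable_funM.
  + exact: (op_lin op a b1 b2 TT).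
Qed.

Definition clip (x : R) : R := Num.max (-1) (Num.min x 1).

Lemma clip_le1 x : `|clip x| <= 1.
Proof.
rewrite /clip ler_norml; case: (ltP x 1) => ? ; case: (ltP (-1) _) => ?; apply/andP; split; lra.
Qed.

Lemma clip_id x : `|x| <= 1 -> clip x = x.
Proof.
by rewrite ler_norml => /andP[h1 h2]; rewrite /clip (min_l h2) (max_r h1).
Qed.

Lemma clip_lip x y : `|x| <= 1 -> `|x - clip y| <= `|x - y|.
Proof.
rewrite ler_norml => /andP[h1 h2]; rewrite /clip.
have [y1|y1] := ltP y 1; have [y2|y2] := ltP (-1) _; try (by []); rewrite ler_norml.
- by apply/andP; split; have := ler_norm (x - y); have := ler_norm (- (x - y)); rewrite normrN; lra.
- by apply/andP; split; have := ler_norm (x - y); have := ler_norm (- (x - y)); rewrite normrN; lra.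
- by apply/andP; split; have := ler_norm (x - y); have := ler_norm (- (x - y)); rewrite normrN; lra.
Qed.

Lemma measurable_clip : measurable_fun setT clip.
Proof.
apply: measurable_maxr; first exact: measurable_cst.
by apply: measurable_minr; [exact: measurable_id|exact: measurable_cst].
Qed.

(** Clipping k to [-1, 1] moves it no farther from H, since |H| <= 1. Hence H - clip k = G (H - k)
    with |G| <= 1, and the uniformity in [simply_approximable] absorbs G. *)
Lemma op_approx_contraction X J H (e : R) : soi X J -> predictable T F H ->
  (forall t w, t \in `[0, T] -> `|H t w| <= 1) -> 0 < e ->
  exists n k, [/\ dyadic_simple n k, forall t w, `|k t w| <= 1 &
    l0 P (fun w => J H T w - J k T w) <= e].
Proof.
move=> op pH H1 e0; have TT := T_in T_ge0.
have bH : bp H by split=> //; exists 1.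
have [n [k [C [sk kC hk]]]] := op_simply_approximable op bH e0.
have pk := dyadic_simple_predictable sk kC.
pose k' t w := clip (k t w).
have sk' : dyadic_simple n k' by apply: dyadic_simple_comp => //; exact: measurable_clip.
have k'1 t w : `|k' t w| <= 1 by exact: clip_le1.
exists n, k'; split=> //.
have pk' := dyadic_simple_predictable sk' k'1.
have bk' : bp k' by split=> //; exists 1.
pose G t w := (H t w - k' t w) * (H t w - k t w)^-1.
have pG : predictable T F G.
  by apply: predictableM; [exact: predictableB|apply: predictable_inv; exact: predictableB].
have G1 t w : t \in `[0, T] -> `|G t w| <= 1.
  move=> tT; rewrite /G normrM normfV; have [->|d0] := eqVneq (H t w - k t w) 0.
    by rewrite normr0 invr0 mulr0.
  by rewrite ler_pdivrMr ?normr_gt0// mul1r; apply: clip_lip; exact: H1.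
apply: le_trans (hk G pG G1).
have E t w : t \in `[0, T] -> G t w * (H t w - k t w) = H t w - k' t w.
  move=> tT; rewrite /G; have [d0|d0] := eqVneq (H t w - k t w) 0.
    rewrite d0 mulr0; apply/esym/eqP; rewrite -normr_le0.
    by apply: (le_trans (clip_lip _ (H1 t w tT))); rewrite d0 normr0.
  by rewrite divfK.
have bk : bp k by split=> //; exists C.
have bGH : bp (fun t w => G t w * (H t w - k t w)).
  by apply: bpM; [split=> //; exists 1|exact: bpB].
rewrite le_eqVlt; apply/orP; left; apply/eqP; apply: l0_ae.
- by apply: measurable_funB; exact: (op_measurable op).
- exact: (op_measurable op).
- by apply: filterS2 (op_ext op bGH E TT) (op_B op bH bk' TT) => w -> ->.
Qed.

End SimpleApproximation.

(** * Jumps of stochastic integrals *)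

Section Jumps.
Context {disp : measure_display} {Omega : measurableType disp} {R : realType}.
Variables (P : probability Omega R) (T : R) (F : R -> set (set Omega)).
Hypothesis T_ge0 : 0 <= T.
Hypothesis filF : filtration T F.
Implicit Types H K : R -> Omega -> R.
Local Notation bp := (bounded_predictable T F).
Local Notation soi := (stochastic_integral_operator P T F).

Lemma running_sup_lt1 (W : R -> Omega -> R) w t : cadlag T W -> t \in `[0, T] ->
  running_sup T W w < 1 -> `|W t w| <= running_sup T W w.
Proof.
move=> cW tT; have := running_sup_ge T_ge0 w cW tT.
by rewrite ge_min => /orP[//|h1 h2]; have := le_lt_trans h1 h2; rewrite ltxx.
Qed.

Lemma cvg_near_eq (Fl : set_system R) (FF : ProperFilter Fl) (f : R -> R) (l : R) :
  (\forall u \near Fl, f u = l) -> f u @[u --> Fl] --> l.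
Proof.
move=> h; apply/cvgrPdist_le => e e0; apply: filterS h => u ->.
by rewrite subrr normr0 ltW.
Qed.

(** Ranks at which [l0] is at most 2^-k give a summable series. The condition [k <= s k] takes the
    place of monotonicity. *)
Lemma ae_fast_subsequence (f_ : nat -> Omega -> R) :
  (forall n, measurable_fun setT (f_ n)) -> vanishing (fun n => l0 P (f_ n)) ->
  exists s : nat -> nat, (forall k, (k <= s k)%N) /\
    {ae P, forall w, Num.min `|f_ (s k) w| 1 @[k --> \oo] --> (0 : R)}.
Proof.
move=> mf vf.
have /choice [s hs] : forall k, exists n, (k <= n)%N /\ l0 P (f_ n) <= 1 * (1 / 2) ^+ k.
  move=> k; have [N hN] := vf ((1 / 2) ^+ k) ltac:(apply: exprn_gt0; lra).
  exists (maxn N k); rewrite leq_maxr mul1r; split=> //.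
  by apply: hN; exact: leq_maxl.
exists s; split; first by move=> k; case: (hs k).
have := @l0_summable_ae _ _ _ P (fun k => f_ (s k)) 1 (fun k => mf (s k)) (fun k => (hs k).2).
apply: filterS => w [M hM]; apply: sum_bounded_cvg0 hM => n.
by rewrite le_min normr_ge0 ler01.
Qed.

(** The jump of the integral is H_t times the jump of X, stated through u tending to t from the
    left. In the limit case a fast subsequence converges uniformly in time almost surely, so one
    null set serves all t. *)
Lemma op_jump X J : soi X J -> cadlag T X ->
  (forall K t, bp K -> t \in `[0, T] -> nearly_known P F t (J K t)) ->
  forall H, bp H -> {ae P, forall w, forall t, 0 < t <= T ->
    (J H t w - J H u w) - H t w * (X t w - X u w) @[u --> t^'-] --> (0 : R)}.
Proof.
move=> op cX kJ.
have in0T t u : 0 < t <= T -> 0 < u -> u < t -> u \in `[0, T].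
  by move=> /andP[t0 tT] u0 ut; rewrite in_itv/= ltW//= (le_trans (ltW ut)).
have tin t : 0 < t <= T -> t \in `[0, T].
  by move=> /andP[t0 tT]; rewrite in_itv/= ltW.
apply: (bounded_predictable_ind T_ge0 filF).
- move=> A FA; have [_ _ _ h0 _] := op.
  apply: filterS (h0 A FA) => w h t tT; apply: cvg_near_eq; near=> u.
  have u0 : 0 < u by near: u; apply: nbhs_left_gt; case/andP: (tT).
  have ut : u < t by near: u; exact: nbhs_left_lt.
  rewrite h ?tin// h ?(in0T t u)// subrr indicE mem_setE in_itv/=.
  have t0 : 0 < t by case/andP: (tT).
  by rewrite (leNgt t) t0 andbF !mul0r subrr.
- move=> s r A s0 sr rT FA; have [_ _ h0 _ _] := op.
  apply: filterS (h0 s r A s0 sr rT FA) => w h t tT; apply: cvg_near_eq.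
  have [ts|st] := leP t s.
    near=> u.
    have u0 : 0 < u by near: u; apply: nbhs_left_gt; case/andP: (tT).
    have ut : u < t by near: u; exact: nbhs_left_lt.
    rewrite h ?tin// h ?(in0T t u)// !indicE mem_setE in_itv/= ltNge ts/=.
    have us := le_trans (ltW ut) ts.
    rewrite (min_r ts) (min_r (le_trans ts sr)) (min_r us) (min_r (le_trans us sr)).
    ring.
  have [tr|rt] := leP t r.
    near=> u.
    have u0 : 0 < u by near: u; apply: nbhs_left_gt; case/andP: (tT).
    have ut : u < t by near: u; exact: nbhs_left_lt.
    have su : s < u by near: u; exact: nbhs_left_gt.
    rewrite h ?tin// h ?(in0T t u)// !indicE mem_setE in_itv/= st tr/= mul1r.
    rewrite (min_r tr) (min_l (ltW st)) (min_r (le_trans (ltW ut) tr)) (min_l (ltW su)).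
    ring.
  near=> u.
  have u0 : 0 < u by near: u; apply: nbhs_left_gt; case/andP: (tT).
  have ut : u < t by near: u; exact: nbhs_left_lt.
  have ru : r < u by near: u; exact: nbhs_left_gt.
  rewrite h ?tin// h ?(in0T t u)// !indicE mem_setE in_itv/= (leNgt t) rt andbF.
  rewrite (min_l (ltW rt)) (min_l (ltW st)) (min_l (ltW ru)) (min_l (le_trans sr (ltW ru))) !mul0r.
  ring.
- move=> a H K bH bK hH hK; have [_ hl _ _ _] := op.
  apply: filterS3 (hl a H K bH bK) hH hK => w hw h1 h2 t tT.
  have c : a * ((J H t w - J H u w) - H t w * (X t w - X u w)) +
      ((J K t w - J K u w) - K t w * (X t w - X u w)) @[u --> t^'-] --> a * 0 + 0.
    by apply: cvgD; [apply: cvgM; [exact: cvg_cst|exact: h1]|exact: h2].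
  rewrite mulr0 addr0 in c; apply: cvg_trans c; apply: near_eq_cvg; near=> u.
  have u0 : 0 < u by near: u; apply: nbhs_left_gt; case/andP: (tT).
  have ut : u < t by near: u; exact: nbhs_left_lt.
  rewrite hw ?tin// hw ?(in0T t u)//; ring.
- move=> H_ H C pH_ pH hC cv hn; have [bH_ bH] := bp_of_dominated pH_ pH hC cv.
  have v := op_ucp T_ge0 filF op kJ pH_ pH hC cv.
  pose W n t w := J (H_ n) t w - J H t w.
  have cW n : cadlag T (W n) by apply: cadlagB; exact: (op_cadlag op).
  have mW n : measurable_fun setT (running_sup T (W n)).
    apply: (measurable_running_sup T_ge0) => t tT.
    by apply: measurable_funB; exact: (op_measurable op).
  have [s [sk hs]] := ae_fast_subsequence mW v.
  apply: filterS2 (ae_foralln hn) hs => w hw c0 t tT.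
  have [_ /(_ t tT) /cvg_ex [l cl]] := cX w.
  (* Bounds the increments X_t - X_u just before t; l is the left limit of X. *)
  pose M := `|X t w - l| + 1.
  have M0 : 0 < M by rewrite ltr_wpDl.
  apply/cvgrPdist_le => e e0; have e4 : 0 < e / 4 by lra.
  (* The cap 1/2 keeps the running supremum below 1, where its truncation is inactive. *)
  pose d := Num.min (e / 4) (1 / 2).
  have d0 : 0 < d by rewrite lt_min e4/=; lra.
  have [N1 _ hN1] := (cvgrPdist_le _ _).1 c0 d d0.
  have e4M : 0 < e / 4 / M by rewrite divr_gt0.
  have [N2 _ hN2] := (cvgrPdist_le _ _).1 (cv t w (tin _ tT)) _ e4M.
  pose k := maxn N1 N2; have k1 := hN1 k (leq_maxl _ _).
  have k2 := hN2 (s k) (leq_trans (leq_maxr _ _) (sk k)).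
  have rs : running_sup T (W (s k)) w <= d.
    have d12 : d <= 1 / 2 by rewrite ge_min lexx orbT.
    have m0 : 0 <= Num.min `|running_sup T (W (s k)) w| 1 by rewrite le_min normr_ge0 ler01.
    move: k1; rewrite /= sub0r normrN (ger0_norm m0).
    rewrite (ger0_norm (running_sup_ge0 _ _ _)).
    have := minEge (running_sup T (W (s k)) w) 1; move=> ->.
    by case: ifP => // _ h1; lra.
  have rs1 : running_sup T (W (s k)) w < 1.
    by apply: (le_lt_trans rs); rewrite /d gt_min; apply/orP; right; lra.
  have rse : running_sup T (W (s k)) w <= e / 4 by apply: (le_trans rs); rewrite ge_min lexx.
  have hW u : u \in `[0, T] -> `|W (s k) u w| <= e / 4.
    by move=> uT; apply: le_trans rse; exact: running_sup_lt1.
  have cl1 := (cvgrPdist_le _ _).1 cl 1 ltr01.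
  have ck := (cvgrPdist_le _ _).1 (hw (s k) t tT) _ e4.
  near=> u.
  have u0 : 0 < u by near: u; apply: nbhs_left_gt; case/andP: (tT).
  have ut : u < t by near: u; exact: nbhs_left_lt.
  have uT := in0T t u tT u0 ut.
  have b1 := hW t (tin _ tT); have b2 := hW u uT.
  have b3 : `|0 - (J (H_ (s k)) t w - J (H_ (s k)) u w - H_ (s k) t w * (X t w - X u w))| <= e / 4.
    by near: u; exact: ck.
  have b4 : `|X t w - X u w| <= M.
    have h4 : `|l - X u w| <= 1 by near: u; exact: cl1.
    rewrite (_ : X t w - X u w = (X t w - l) + (l - X u w)); last by ring.
    by apply: (le_trans (ler_normD _ _)); rewrite /M lerD2l.
  have b5 : `|(H t w - H_ (s k) t w) * (X t w - X u w)| <= e / 4.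
    rewrite normrM; apply: (@le_trans _ _ (e / 4 / M * M)); last by rewrite divfK// gt_eqF.
    by apply: ler_pM.
  rewrite (_ : 0 - _ = (0 - (J (H_ (s k)) t w - J (H_ (s k)) u w - H_ (s k) t w * (X t w - X u w)))
     + W (s k) t w + (- W (s k) u w) + (H t w - H_ (s k) t w) * (X t w - X u w)); last first.
    by rewrite /W; ring.
  apply: (le_trans (ler_normD _ _)).
  have n1 := ler_normD (0 - (J (H_ (s k)) t w - J (H_ (s k)) u w - H_ (s k) t w * (X t w - X u w)) + W (s k) t w) (- W (s k) u w).
  have n2 := ler_normD (0 - (J (H_ (s k)) t w - J (H_ (s k)) u w - H_ (s k) t w * (X t w - X u w))) (W (s k) t w).
  rewrite normrN in n1; lra.
Unshelve. all: by end_near.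
Qed.

End Jumps.

(** * Vector integrals *)

Section VectorIntegral.
Context {disp : measure_display} {Omega : measurableType disp} {R : realType}.
Variables (P : probability Omega R) (T : R) (F : R -> set (set Omega)).
Hypothesis T_ge0 : 0 <= T.
Hypothesis filF : filtration T F.
Local Notation bp := (bounded_predictable T F).
Local Notation soi := (stochastic_integral_operator P T F).

Lemma rv_norm_le (d : nat) (x : 'rV[R]_d) (c : R) : 0 <= c ->
  (`|x| <= c) = [forall i, `|x 0 i| <= c].
Proof.
move=> c0; rewrite /Num.norm/= mx_normrE; apply/idP/forallP => [h i|h].
  by apply: le_trans h; exact: (le_bigmax _ (fun ij => `|x ij.1 ij.2|) (0, i)).
apply/bigmax_leP; split=> // -[i j] _ /=.
by rewrite (ord1 i); exact: h.
Qed.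

Lemma rv_norm_coord (d : nat) (x : 'rV[R]_d) i : `|x 0 i| <= `|x|.
Proof.
by have := rv_norm_le x (normr_ge0 x); rewrite lexx => /esym /forallP.
Qed.

Lemma soi_lin (a : R) X J X' J' : soi X J -> soi X' J' ->
  soi (fun t w => a * X t w + X' t w) (fun K t w => a * J K t w + J' K t w).
Proof.
move=> op op'; split.
- move=> H bH; split.
    apply: cadlagD; last exact: (op_cadlag op').
    by apply: (cadlag_scale (fun _ => a)); exact: (op_cadlag op).
  move=> t tT; apply: measurable_funD; last exact: (op_measurable op').
  by apply: measurable_funM => //; exact: (op_measurable op).
- move=> b H K bH bK; have [_ h _ _ _] := op; have [_ h' _ _ _] := op'.
  by apply: filterS2 (h b H K bH bK) (h' b H K bH bK) => w e e' t tT; rewrite e// e'//; ring.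
- move=> s t A s0 st tT FA; have [_ _ h _ _] := op; have [_ _ h' _ _] := op'.
  by apply: filterS2 (h s t A s0 st tT FA) (h' s t A s0 st tT FA) => w e e' u uT; rewrite e// e'//; ring.
- move=> A FA; have [_ _ _ h _] := op; have [_ _ _ h' _] := op'.
  by apply: filterS2 (h A FA) (h' A FA) => w e e' u uT; rewrite e// e'//; ring.
- move=> H_ H C pH_ pH hC cv t tT; have [bH_ bH] := bp_of_dominated pH_ pH hC cv.
  have mJ K : bp K -> measurable_fun setT (J K t) by move=> bK; exact: (op_measurable op).
  have mJ' K : bp K -> measurable_fun setT (J' K t) by move=> bK; exact: (op_measurable op').
  have maJ K : bp K -> measurable_fun setT (fun w => a * J K t w) by move=> bK; exact: measurable_funM (mJ K bK).
  apply/cvg_in_probability_l0.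
  + by move=> n; apply: measurable_funD; [exact: maJ|exact: mJ'].
  + by apply: measurable_funD; [exact: maJ|exact: mJ'].
  apply: vanishing_l0D.
  + by move=> n; exact: maJ.
  + exact: maJ.
  + by move=> n; exact: mJ'.
  + exact: mJ'.
  + apply: vanishing_l0_scale; [by move=> n; exact: mJ|exact: mJ|].
    exact: (op_dominated op pH_ pH hC cv tT).
  + exact: (op_dominated op' pH_ pH hC cv tT).
Qed.

Lemma soi_sub X J X' J' : soi X J -> soi X' J' ->
  soi (fun t w => X t w - X' t w) (fun K t w => J K t w - J' K t w).
Proof.
move=> op op'; have := soi_lin (-1) op' op.
have -> : (fun t w => -1 * X' t w + X t w) = (fun t w => X t w - X' t w).
  by apply/funext => t; apply/funext => w; ring.
have -> // : (fun K t w => -1 * J' K t w + J K t w) = (fun K t w => J K t w - J' K t w).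
by apply/funext => K; apply/funext => t; apply/funext => w; ring.
Qed.

Lemma soi_indistinguishable X X' J : soi X J -> indistinguishable P T X X' -> soi X' J.
Proof.
move=> [h1 h2 h3 h4 h5] XX'; split=> // s t A s0 st tT FA.
apply: filterS2 (h3 s t A s0 st tT FA) XX' => w e x u uT.
by rewrite e// !x//; apply: min_in => //; exact: le_trans st.
Qed.

Lemma cadlag_stop (Y : R -> Omega -> R) t : cadlag T Y -> t \in `[0, T] ->
  cadlag T (fun u w => Y (Num.min t u) w).
Proof.
move=> cY; rewrite in_itv/= => /andP[t0 tT] w; have [Y1 Y2] := cY w; split=> u uT.
  have [ut|tu] := ltP u t.
    apply: cvg_trans (Y1 u uT).
    apply: near_eq_cvg; near=> v; rewrite min_r//.
    by near: v; apply: nbhs_right_le.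
  apply: cvg_near_eq; near=> v; rewrite min_l//.
  by apply: (le_trans tu); near: v; exact: nbhs_right_ge.
have [ut|tu] := leP u t.
  have /cvg_ex [l hl] := Y2 u uT; apply/cvg_ex; exists l.
  apply: cvg_trans hl; apply: near_eq_cvg; near=> v; rewrite min_r//.
  by apply: le_trans ut; near: v; exact: nbhs_left_le.
apply/cvg_ex; exists (Y t w); apply: cvg_near_eq; near=> v; rewrite min_l//.
by near: v; exact: nbhs_left_ge.
Unshelve. all: by end_near.
Qed.

Lemma op_rectangle0_mul X J A H u : soi X J -> F 0 A -> bp H -> u \in `[0, T] ->
  {ae P, forall w, J (fun u w => \1_(`[0, 0]) u * \1_A w * H u w) u w = 0}.
Proof.
move=> op FA bH uT; have TT := T_in T_ge0.
have b0 : bp (fun u w => \1_(`[0, 0]) u * \1_A w * H u w).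
  by apply: bpM => //; exact: bp_rectangle0.
have h1 := op_from0 T_ge0 filF op b0 uT.
have h2 : {ae P, forall w, J (fun v w => \1_(`]0, u]) v * (\1_(`[0, 0]) v * \1_A w * H v w)) T w = 0}.
  apply: (op_eq0 op) => // v w _; rewrite !indicE !mem_setE !in_itv/=.
  by have [v0|v0] := ltP 0 v; rewrite ?andbF/= ?mul0r ?mulr0.
by apply: filterS2 h1 h2 => w <-.
Qed.

(** Associativity K . (H . X) = (K H) . X at the level of operators: the integral becomes an
    integrator in its own right. *)
Lemma soi_assoc X J H : soi X J -> bp H -> soi (J H) (fun K => J (fun t w => K t w * H t w)).
Proof.
move=> op bH; split.
- by move=> K bK; have bKH := bpM bK bH; split; [exact: (op_cadlag op)|move=> t tT; exact: (op_measurable op)].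
- move=> a K L bK bL; have bKH := bpM bK bH; have bLH := bpM bL bH.
  have E : (fun t w => (a * K t w + L t w) * H t w) = (fun t w => a * (K t w * H t w) + L t w * H t w).
    by apply/funext => t; apply/funext => w; ring.
  by rewrite E; have [_ h _ _ _] := op; exact: h.
- move=> s t A s0 st tT FA.
  have bR := bp_rectangle T_ge0 s0 st tT FA.
  have tT' : t \in `[0, T] by rewrite in_itv/= (le_trans s0 st).
  have sT' : s \in `[0, T] by rewrite in_itv/= s0 (le_trans st).
  apply: cadlag_indistinguishable => //.
  + by apply: (op_cadlag op); exact: bpM.
  + apply: (cadlag_scale (fun w => \1_A w)); apply: cadlagB; apply: cadlag_stop => //; exact: (op_cadlag op).
  + by move=> u uT; exact: (op_local T_ge0 filF op s0 st tT FA bH uT).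
- move=> A FA; apply: cadlag_indistinguishable => //.
  + by apply: (op_cadlag op); apply: bpM => //; exact: bp_rectangle0.
  + exact: cadlag_cst.
  + by move=> u uT; exact: (op_rectangle0_mul op FA bH uT).
- move=> K_ K C pK_ pK hC cv t tT; have [pH [D hD]] := bH.
  have [bK_ bK] := bp_of_dominated pK_ pK hC cv.
  have [_ _ _ _ h] := op; apply: (h _ _ (C * `|D|)) => //.
  + by move=> n; exact: predictableM.
  + exact: predictableM.
  + move=> n u w uT; rewrite normrM ler_pM ?hC//.
    by apply: (le_trans (hD u w uT)); exact: ler_norm.
  + by move=> u w uT; apply: cvgM; [exact: cv|exact: cvg_cst].
Qed.

Lemma soi_zero : soi (fun _ _ => 0) (fun _ _ _ => 0).
Proof.
split.
- by move=> H _; split; [exact: cadlag_cst|move=> t _; exact: measurable_cst].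
- by move=> a H K _ _; apply/aeW => w t _; rewrite mulr0 addr0.
- by move=> s t A _ _ _ _; apply/aeW => w u _; rewrite subrr mulr0.
- by move=> A _; apply/aeW => w u _.
- move=> H_ H C _ _ _ _ t tT; apply/cvg_in_probability_l0 => // e e0; exists 0%N => n _.
  by rewrite subrr l0_cst0 ltW.
Qed.

Lemma soi_sum (I : Type) (s : seq I) (X_ : I -> R -> Omega -> R) J_ :
  (forall i, soi (X_ i) (J_ i)) ->
  soi (fun t w => \sum_(i <- s) X_ i t w) (fun K t w => \sum_(i <- s) J_ i K t w).
Proof.
move=> h; elim: s => [|i s ih].
  have -> : (fun t w => \sum_(i <- [::]) X_ i t w) = fun _ _ => 0.
    by apply/funext => t; apply/funext => w; rewrite big_nil.
  have -> : (fun K t w => \sum_(i <- [::]) J_ i K t w) = fun _ _ _ => 0.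
    by apply/funext => K; apply/funext => t; apply/funext => w; rewrite big_nil.
  exact: soi_zero.
have -> : (fun t w => \sum_(j <- i :: s) X_ j t w) = fun t w => 1 * X_ i t w + \sum_(j <- s) X_ j t w.
  by apply/funext => t; apply/funext => w; rewrite big_cons mul1r.
have -> : (fun K t w => \sum_(j <- i :: s) J_ j K t w) = fun K t w => 1 * J_ i K t w + \sum_(j <- s) J_ j K t w.
  by apply/funext => K; apply/funext => t; apply/funext => w; rewrite big_cons mul1r.
exact: soi_lin.
Qed.

Section Integrators.
Context {d : nat}.
Variables (S : R -> Omega -> 'cV[R]_d) (JS : 'I_d -> (R -> Omega -> R) -> R -> Omega -> R).
Hypothesis JSop : forall i, soi (fun t w => S t w i 0) (JS i).
Hypothesis S_adapted : forall i, adapted T F (fun t w => S t w i 0).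
Implicit Types theta eta : R -> Omega -> 'rV[R]_d.

Definition scaled (K : R -> Omega -> R) theta : R -> Omega -> 'rV[R]_d :=
  fun t w => K t w *: theta t w.

Definition vector_bp theta : Prop := forall i, bp (fun t w => theta t w 0 i).

Definition vint theta : R -> Omega -> R :=
  fun t w => \sum_i JS i (fun t w => theta t w 0 i) t w.

Lemma scaled_bp K theta : bp K -> vector_bp theta -> vector_bp (scaled K theta).
Proof.
move=> bK bt i; rewrite /scaled.
have -> : (fun t w => (K t w *: theta t w) 0 i) = (fun t w => K t w * theta t w 0 i).
  by apply/funext => t; apply/funext => w; rewrite mxE.
exact: bpM.
Qed.

Lemma vint_cadlag theta : vector_bp theta -> cadlag T (vint theta).
Proof. by move=> bt; apply: cadlag_sum => i; exact: (op_cadlag (JSop i)). Qed.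

Lemma vint_measurable theta t : vector_bp theta -> t \in `[0, T] ->
  measurable_fun setT (vint theta t).
Proof. by move=> bt tT; apply: measurable_sum => i; exact: (op_measurable (JSop i)). Qed.

Lemma soi_vint theta : vector_bp theta -> soi (vint theta) (fun K => vint (scaled K theta)).
Proof.
move=> bt.
have := @soi_sum _ (index_enum 'I_d) _ _ (fun i => soi_assoc (JSop i) (bt i)).
have -> // : (fun K t w => \sum_i JS i (fun t w => K t w * theta t w 0 i) t w) =
  (fun K => vint (scaled K theta)).
apply/funext => K; apply/funext => t; apply/funext => w; apply: eq_bigr => i _.
by congr (JS i _ t w); apply/funext => u; apply/funext => v; rewrite /scaled mxE.
Qed.

Lemma vint_lin (a : R) theta eta t : vector_bp theta -> vector_bp eta -> t \in `[0, T] ->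
  {ae P, forall w, vint (fun t w => a *: theta t w + eta t w) t w = a * vint theta t w + vint eta t w}.
Proof.
move=> bt be tT.
have : {ae P, forall w, forall i, JS i (fun t w => (a *: theta t w + eta t w) 0 i) t w =
    a * JS i (fun t w => theta t w 0 i) t w + JS i (fun t w => eta t w 0 i) t w}.
  apply: ae_forall_ord => i.
  have -> : (fun t w => (a *: theta t w + eta t w) 0 i) = (fun t w => a * theta t w 0 i + eta t w 0 i).
    by apply/funext => u; apply/funext => w; rewrite !mxE.
  exact: (op_lin (JSop i)).
apply: filterS => w h; rewrite /vint mulr_sumr -big_split/=.
by apply: eq_bigr => i _; exact: h.
Qed.

Lemma vint_dominated (theta_ : nat -> R -> Omega -> 'rV[R]_d) theta (C : R) t :
  (forall n i, predictable T F (fun t w => theta_ n t w 0 i)) ->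
  (forall i, predictable T F (fun t w => theta t w 0 i)) ->
  (forall n i t w, t \in `[0, T] -> `|theta_ n t w 0 i| <= C) ->
  (forall i t w, t \in `[0, T] -> theta_ n t w 0 i @[n --> \oo] --> theta t w 0 i) ->
  t \in `[0, T] -> vanishing (fun n => l0 P (fun w => vint (theta_ n) t w - vint theta t w)).
Proof.
move=> p_ p hC cv tT.
have b i := bp_of_dominated (fun n => p_ n i) (p i) (fun n => hC n i) (cv i).
have m_ n i : measurable_fun setT (JS i (fun t w => theta_ n t w 0 i) t).
  by apply: (op_measurable (JSop i)) => //; case: (b i).
have m i : measurable_fun setT (JS i (fun t w => theta t w 0 i) t).
  by apply: (op_measurable (JSop i)) => //; case: (b i).
have : forall s : seq 'I_d, vanishing (fun n => \sum_(i <- s) l0 P (fun w =>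
    JS i (fun t w => theta_ n t w 0 i) t w - JS i (fun t w => theta t w 0 i) t w)).
  elim=> [|i s ih].
    by move=> e e0; exists 0%N => n _; rewrite big_nil ltW.
  apply: vanishing_le (vanishingD (op_dominated (JSop i) (fun n => p_ n i) (p i) (fun n => hC n i) (cv i) tT) ih).
  by move=> n; rewrite big_cons.
move=> /(_ (index_enum 'I_d)); apply: vanishing_le => n.
apply: le_trans (l0_sum P (index_enum 'I_d) (fun i => measurable_funB (m_ n i) (m i))).
rewrite le_eqVlt; apply/orP; left; apply/eqP; congr (l0 P _).
by apply/funext => w; rewrite /vint -sumrB.
Qed.

Lemma nearly_known_vint theta t : vector_bp theta -> t \in `[0, T] ->
  nearly_known P F t (vint theta t).
Proof.
move=> bt tT.
have kS i u : u \in `[0, T] -> known F u (fun w => S u w i 0).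
  by move=> uT; apply/(knownP filF) => // B mB; exact: S_adapted.
have mS i u : u \in `[0, T] -> measurable_fun setT (fun w => S u w i 0).
  by move=> uT; apply: (known_measurable filF uT); exact: kS.
have k i : nearly_known P F t (JS i (fun t w => theta t w 0 i) t).
  apply: (op_nearly_known T_ge0 filF (JSop i)) => // u uT; last exact: mS.
  by apply: known_nearly; exact: kS.
have m i : measurable_fun setT (JS i (fun t w => theta t w 0 i) t).
  exact: (op_measurable (JSop i)).
rewrite /vint; elim: (index_enum 'I_d) => [|i s ih].
  have -> : (fun w => \sum_(i <- [::]) JS i (fun t w => theta t w 0 i) t w) = fun=> 0.
    by apply/funext => w; rewrite big_nil.
  by apply: known_nearly; exact: measurable_cst.
have -> : (fun w => \sum_(j <- i :: s) JS j (fun t w => theta t w 0 j) t w) =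
   fun w => 1 * JS i (fun t w => theta t w 0 i) t w + \sum_(j <- s) JS j (fun t w => theta t w 0 j) t w.
  by apply/funext => w; rewrite big_cons mul1r.
by apply: (nearly_known_lin filF) => //; exact: measurable_sum.
Qed.

(* [J] integrates against [Y = theta . S]; testing with those bounded [K] that
   make [K theta] bounded avoids any limit of truncations. *)
Definition integrates theta (Y : R -> Omega -> R) J : Prop :=
  soi Y J /\ forall K, bp K -> vector_bp (scaled K theta) ->
    {ae P, forall w, J K T w = vint (scaled K theta) T w}.

(** Multiplying K by the indicator of ]0, t] turns T into t on both sides. *)
Lemma integrates_at theta Y J K t : integrates theta Y J -> bp K ->
  vector_bp (scaled K theta) -> t \in `[0, T] ->
  {ae P, forall w, J K t w = vint (scaled K theta) t w}.
Proof.
move=> [op h] bK bKt tT.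
have z0 := zero_in T_ge0; have FT := filtrationT filF z0.
move: (tT); rewrite in_itv/= => /andP[t0 tT'].
pose L u (w : Omega) : R := \1_(`]0, t]) u * K u w.
have bL : bp L.
  have -> : L = fun u w => \1_(`]0, t]) u * \1_setT w * K u w.
    by apply/funext => u; apply/funext => w; rewrite indicT/= mulr1.
  by apply: bpM => //; exact: bp_rectangle.
have E i : (fun u w => scaled L theta u w 0 i) = fun u w => \1_(`]0, t]) u * (scaled K theta u w 0 i).
  by apply/funext => u; apply/funext => w; rewrite /scaled !mxE /L mulrA.
have bLt : vector_bp (scaled L theta).
  move=> i; rewrite E.
  have -> : (fun u w => \1_(`]0, t]) u * scaled K theta u w 0 i) =
      fun u w => \1_(`]0, t]) u * \1_setT w * scaled K theta u w 0 i.
    by apply/funext => u; apply/funext => w; rewrite indicT/= mulr1.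
  by apply: bpM => //; exact: bp_rectangle.
have h1 := op_from0 T_ge0 filF op bK tT.
have h2 : {ae P, forall w, forall i, JS i (fun u w => scaled L theta u w 0 i) T w =
    JS i (fun u w => scaled K theta u w 0 i) t w}.
  by apply: ae_forall_ord => i; rewrite E; exact: (op_from0 T_ge0 filF (JSop i)).
apply: filterS3 h1 h2 (h L bL bLt) => w <- e ->.
by apply: eq_bigr => i _; exact: e.
Qed.

Lemma predictable_norm_le theta (c : R) : 0 <= c -> vector_predictable T F theta ->
  predictable T F (fun t w => (`|theta t w| <= c)%R%:R).
Proof.
move=> c0 pt.
have E : (fun t w => (`|theta t w| <= c)%R%:R : R) =
    fun t w => \prod_(i < d) (`|theta t w 0 i| <= c)%R%:R.
  apply/funext => t; apply/funext => w; rewrite rv_norm_le//.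
  case: forallP => [h|h]; first by rewrite big1// => i _; rewrite h.
  have [i hi] : exists i, ~~ (`|theta t w 0 i| <= c).
    by apply/existsP; rewrite -negb_forall; apply/negP => /forallP.
  by rewrite (bigD1 i)//= (negbTE hi) mul0r.
rewrite E; elim: (index_enum 'I_d) => [|i s ih].
  have -> : (fun t w => \prod_(i <- [::]) (`|theta t w 0 i| <= c)%R%:R : R) = fun _ _ => 1.
    by apply/funext => t; apply/funext => w; rewrite big_nil.
  exact: predictable_cst.
have -> : (fun t w => \prod_(j <- i :: s) (`|theta t w 0 j| <= c)%R%:R : R) =
    fun t w => (`|theta t w 0 i| <= c)%R%:R * \prod_(j <- s) (`|theta t w 0 j| <= c)%R%:R.
  by apply/funext => t; apply/funext => w; rewrite big_cons.
apply: predictableM => //; apply: predictable_ler; last exact: predictable_cst.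
by apply: predictable_norm; exact: pt.
Qed.

Definition below theta (n : nat) (t : R) (w : Omega) : R := (`|theta t w| <= n%:R)%R%:R.

Lemma below_bp theta n : vector_predictable T F theta -> bp (below theta n).
Proof. by move=> pt; apply: (@bp_bool _ _ _ _ _ (fun t w => `|theta t w| <= n%:R)); exact: predictable_norm_le. Qed.

Lemma truncationE theta n : truncation theta n = scaled (below theta n) theta.
Proof.
apply/funext => t; apply/funext => w; rewrite /truncation /scaled /below.
by case: ifP => _; rewrite ?scale1r ?scale0r.
Qed.

Lemma below_le1 theta n t w : `|below theta n t w| <= 1.
Proof. by rewrite /below; case: (`|theta t w| <= n%:R); rewrite ?normr1 ?normr0. Qed.

Lemma below_eventually theta t w : exists N, forall n, (N <= n)%N -> below theta n t w = 1.
Proof.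
exists (Num.truncn `|theta t w|).+1 => n Nn.
have /andP[_ h] := truncn_itv (normr_ge0 (theta t w)).
rewrite /below (_ : _ <= _ = true)//.
by apply: (le_trans (ltW h)); rewrite ler_nat.
Qed.

Lemma truncation_bp theta n : vector_predictable T F theta -> vector_bp (truncation theta n).
Proof.
move=> pt; rewrite truncationE => i.
have E : (fun t w => scaled (below theta n) theta t w 0 i) = fun t w => below theta n t w * theta t w 0 i.
  by apply/funext => t; apply/funext => w; rewrite /scaled mxE.
rewrite E; split; first by apply: predictableM; [exact: bp_pred (below_bp n pt)|exact: pt].
exists n%:R => t w _; rewrite normrM /below; case: (boolP (`|theta t w| <= n%:R)) => h; last first.
  by rewrite normr0 mul0r.
by rewrite normr1 mul1r; apply: le_trans h; exact: rv_norm_coord.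
Qed.

(** Emery convergence comes with operators for the differences Y_n - Y. Subtracting one of them from
    the operator of Y_n, a finite sum of component integrals, gives an operator for Y. By uniqueness
    the choice of n is immaterial, so large n identify its values. *)
Lemma vector_integral_integrates theta Y : vector_integral P T F S theta Y ->
  exists J, integrates theta Y J.
Proof.
move=> [pt [cY mY] Y0 [Y_ hY em]]; have TT := T_in T_ge0.
have Yv n : indistinguishable P T (Y_ n) (vint (truncation theta n)).
  have [W_ hW YW] := hY n.
  have : {ae P, forall w, forall i, forall t, t \in `[0, T] ->
      W_ i t w = JS i (fun t w => truncation theta n t w 0 i) t w}.
    apply: ae_forall_ord => i; have [bt [J' op' ->]] := hW i.
    apply: cadlag_indistinguishable => //; [exact: (op_cadlag op')|exact: (op_cadlag (JSop i))|].
    move=> t tT; apply: (op_unique T_ge0 filF op' (JSop i)) => //.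
    by move=> u _; apply/aeW.
  by apply: filterS => w h t tT; rewrite YW; apply: eq_bigr => i _; exact: h.
have soiY n Jn : soi (fun t w => Y_ n t w - Y t w) Jn ->
    soi Y (fun K t w => vint (scaled K (truncation theta n)) t w - Jn K t w).
  move=> opn; have ov := soi_vint (truncation_bp n pt).
  have := soi_sub (soi_indistinguishable ov _) opn.
  move=> /(_ (Y_ n)).
  have -> : (fun t w => Y_ n t w - (Y_ n t w - Y t w)) = Y.
    by apply/funext => t; apply/funext => w; ring.
  by apply; apply: filterS (Yv n) => w h t tT; rewrite h.
have p0 : predictable T F (fun _ _ => 0) by exact: predictable_cst.
have z1 : forall (t : R) (w : Omega), t \in `[0, T] -> `|0 : R| <= 1 by move=> *; rewrite normr0.
have [N0 hN0] := em 1 ltr01.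
(* The zero integrand is tested only to extract an operator for the difference. *)
have [W0 [_ [J0 op0 _]] _] := hN0 N0 (leqnn _) (fun _ _ => 0) p0 z1.
pose J K t w := vint (scaled K (truncation theta N0)) t w - J0 K t w.
have opJ : soi Y J by exact: soiY.
exists J; split=> // K bK bKt; have [pK [C hC]] := bK.
(* Emery convergence is quantified over |K| <= 1, hence the normalization; c >= 1 keeps the factor
   invertible. *)
pose c := Num.max C 1; have c0 : 0 < c by rewrite lt_max ltr01 orbT.
pose K' t w := c^-1 * K t w.
have bK' : bp K' by exact: bpZ.
have K'1 t w : t \in `[0, T] -> `|K' t w| <= 1.
  move=> tT; rewrite /K' normrM gtr0_norm ?invr_gt0// mulrC ler_pdivrMr// mul1r.
  by apply: (le_trans (hC t w tT)); rewrite le_max lexx.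
have bKt' : vector_bp (scaled K' theta).
  move=> i; have -> : (fun t w => scaled K' theta t w 0 i) = fun t w => c^-1 * scaled K theta t w 0 i.
    by apply/funext => t; apply/funext => w; rewrite /scaled !mxE mulrA.
  by apply: bpZ; exact: bKt.
have mJ L : bp L -> measurable_fun setT (J L T) by move=> bL; exact: (op_measurable opJ).
have mv eta : vector_bp eta -> measurable_fun setT (vint eta T) by move=> be; exact: vint_measurable.
have main : {ae P, forall w, J K' T w = vint (scaled K' theta) T w}.
  apply: l0_eq_ae; [exact: mJ|exact: mv|].
  apply/ler_addgt0Pr => e e0; rewrite add0r.
  pose e3 := Num.min (e / 3) 1.
  have e30 : 0 < e3 by rewrite lt_min ltr01 divr_gt0.
  have e3e : e3 <= e / 3 by rewrite ge_min lexx.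
  have [N1 hN1] := em e3 e30.
  have cv : vanishing (fun n => l0 P (fun w => vint (scaled K' (truncation theta n)) T w - vint (scaled K' theta) T w)).
    have hb i : exists D : R, forall t w, t \in `[0, T] -> `|scaled K' theta t w 0 i| <= D.
      by case: (bKt' i).
    have /choice [D hD] := hb.
    have E n i t w : scaled K' (truncation theta n) t w 0 i = below theta n t w * scaled K' theta t w 0 i.
      by rewrite truncationE /scaled !mxE; ring.
    apply: (@vint_dominated _ _ (\sum_i `|D i|)) => //.
    - move=> n i; apply: bp_pred; apply: scaled_bp => //; exact: truncation_bp.
    - by move=> i; apply: bp_pred; exact: bKt'.
    - move=> n i t w tT; rewrite E normrM.
      apply: (@le_trans _ _ `|D i|).
        apply: (@le_trans _ _ `|scaled K' theta t w 0 i|).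
          by rewrite ler_piMl// below_le1.
        by apply: le_trans (hD i t w tT) _; exact: ler_norm.
      rewrite (bigD1 i)//= lerDl; exact: sumr_ge0.
    - move=> i t w tT; have [M hM] := below_eventually theta t w.
      by apply: (@cvg_eventually _ _ _ M) => n Mn; rewrite E hM// mul1r.
  have [N2 hN2] := cv (e / 3) ltac:(rewrite divr_gt0//).
  pose n := maxn N1 N2.
  have [W [_ [Jn opn WE]] Wsmall] := hN1 n (leq_maxl _ _) K' (bp_pred bK') K'1.
  (* [J] was built at rank N0, but may be evaluated with the operators of rank n, at which the error
     is small. *)
  have uq := op_unique T_ge0 filF opJ (soiY n Jn opn) (fun t _ => aeW _ (fun w => erefl)) bK' TT.
  have mn : measurable_fun setT (Jn K' T) by exact: (op_measurable opn).
  have bn : vector_bp (scaled K' (truncation theta n)).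
    by apply: scaled_bp => //; exact: truncation_bp.
  have h1 : l0 P (Jn K' T) <= e3 + e3.
    apply: (le_trans (l0_le_probability P mn (ltW e30))); rewrite lerD2l.
    rewrite -lee_fin fineK ?fin_num_measure//; last first.
      rewrite -[X in measurable X]setTI; apply: measurable_fun_ltr => //.
      exact: measurableT_comp.
    apply: le_trans Wsmall; rewrite WE; apply: le_measure; rewrite ?inE.
    + rewrite -[X in measurable X]setTI; apply: measurable_fun_ltr => //.
      exact: measurableT_comp.
    + rewrite (_ : [set w | _] = \bigcup_k [set w | e3 < `|Jn K' (dyadic_enum T k) w|]).
        apply: bigcupT_measurable => k; rewrite -[X in measurable X]setTI.
        apply: measurable_fun_ltr => //; apply: measurableT_comp => //.
        by apply: (op_measurable opn) => //; exact: dyadic_enum_in.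
      apply/seteqP; split=> w /=; last first.
        by move=> [k _ hk]; exists (dyadic_enum T k) => //; exact: dyadic_enum_in.
      move=> [t tT ht]; apply: contrapT => nk; move: ht; rewrite ltNge => /negP; apply.
      apply: (cadlag_dyadic_bound T_ge0 (op_cadlag opn bK') _ tT) => m i i2.
      have [k hk] := dyadic_enumP T i2; rewrite leNgt; apply/negP => hlt; apply: nk.
      by exists k => //=; rewrite hk.
    + by move=> w /= hw; exists T.
  have h2 := hN2 n (leq_maxr _ _).
  have -> : l0 P (fun w => J K' T w - vint (scaled K' theta) T w) =
    l0 P (fun w => (vint (scaled K' (truncation theta n)) T w - vint (scaled K' theta) T w) - Jn K' T w).
    apply: l0_ae.
    - by apply: measurable_funB; [exact: mJ|exact: mv].
    - by apply: measurable_funB => //; apply: measurable_funB; exact: mv.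
    - by apply: filterS uq => w ->; ring.
  have := l0B P (measurable_funB (mv _ bn) (mv _ bKt')) mn.
  by move: h1 h2 e3e; rewrite /=; lra.
have e1 : {ae P, forall w, J K T w = c * J K' T w}.
  have := op_scale opJ c bK' TT.
  have -> // : (fun t w => c * K' t w) = K.
  by apply/funext => t; apply/funext => w; rewrite /K' mulrA mulfV ?mul1r// gt_eqF.
have e2 : {ae P, forall w, vint (scaled K theta) T w = c * vint (scaled K' theta) T w}.
  have b0 : vector_bp (fun _ _ => 0).
    move=> i; have -> : (fun (t : R) (w : Omega) => (0 : 'rV[R]_d) 0 i) = fun _ _ => 0.
      by apply/funext => t; apply/funext => w; rewrite mxE.
    exact: bp_cst.
  have l1 := vint_lin c bKt' b0 TT.
  have z : {ae P, forall w, vint (fun _ _ => 0) T w = 0}.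
    have : {ae P, forall w, forall i, JS i (fun _ _ => (0 : 'rV[R]_d) 0 i) T w = 0}.
      by apply: ae_forall_ord => i; apply: (op_eq0 (JSop i)) => // u w _; rewrite mxE.
    by apply: filterS => w h; rewrite /vint big1.
  apply: filterS2 l1 z => w e z0; rewrite z0 addr0 in e; rewrite -e; congr (vint _ T w).
  apply/funext => t; apply/funext => v; rewrite /scaled /K' addr0 scalerA mulrA.
  by rewrite mulfV ?mul1r// gt_eqF.
by apply: filterS3 e1 e2 main => w -> -> ->.
Qed.

Lemma integrates_below theta Y J n : vector_predictable T F theta -> integrates theta Y J ->
  forall K t, bp K -> t \in `[0, T] ->
  {ae P, forall w, J (fun t w => K t w * below theta n t w) t w =
    vint (scaled K (truncation theta n)) t w}.
Proof.
move=> pt h K t bK tT; have bb := below_bp n pt.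
have E : scaled (fun t w => K t w * below theta n t w) theta = scaled K (truncation theta n).
  by rewrite truncationE; apply/funext => u; apply/funext => w; rewrite /scaled scalerA.
rewrite -E; apply: (integrates_at h) => //; first exact: bpM.
by rewrite E; apply: scaled_bp => //; exact: truncation_bp.
Qed.

Lemma below_cvg theta K t w : K t w * below theta n t w @[n --> \oo] --> (K t w : R).
Proof.
have [M hM] := below_eventually theta t w.
by apply: (@cvg_eventually _ _ _ M) => n Mn; rewrite hM// mulr1.
Qed.

(** With K cut off where theta is large, the integral is a finite sum of component integrals, which
    are nearly known; dominated convergence removes the cut-off. *)
Lemma integrates_nearly_known theta Y J : vector_predictable T F theta -> integrates theta Y J ->
  forall K t, bp K -> t \in `[0, T] -> nearly_known P F t (J K t).
Proof.
move=> pt h K t bK tT; have [op _] := h; have [pK [C hC]] := bK.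
have bb n := below_bp n pt.
have bKb n : bp (fun t w => K t w * below theta n t w) by exact: bpM.
apply: (nearly_known_lim (f_ := fun n => J (fun t w => K t w * below theta n t w) t) filF tT).
- by move=> n; exact: (op_measurable op).
- exact: (op_measurable op).
- apply: (op_dominated op (C := C)) => //.
  + by move=> n; exact: bp_pred.
  + move=> n u w uT; rewrite normrM; apply: le_trans (hC u w uT).
    by rewrite ler_piMr// below_le1.
  + by move=> u w uT; exact: below_cvg.
- move=> n; apply: (nearly_known_ae filF _ _ tT) (nearly_known_vint (scaled_bp bK (truncation_bp n pt)) tT).
  + by apply: vint_measurable => //; apply: scaled_bp => //; exact: truncation_bp.
  + exact: (op_measurable op).
  + by apply: filterS (integrates_below n pt h bK tT) => w ->.
Qed.

End Integrators.
End VectorIntegral.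

(** * Localization, linearity and jumps of vector integrals *)

Section IntegratesTheory.
Context {disp : measure_display} {Omega : measurableType disp} {R : realType}.
Variables (P : probability Omega R) (T : R) (F : R -> set (set Omega)).
Hypothesis T_ge0 : 0 <= T.
Hypothesis filF : filtration T F.
Local Notation bp := (bounded_predictable T F).
Local Notation soi := (stochastic_integral_operator P T F).

Lemma op_dominated_mul X J (b_ : nat -> R -> Omega -> R) K : soi X J -> bp K ->
  (forall m, bp (b_ m)) -> (forall m t w, t \in `[0, T] -> `|b_ m t w| <= 1) ->
  (forall t w, t \in `[0, T] -> b_ m t w @[m --> \oo] --> (1 : R)) ->
  vanishing (fun m => l0 P (fun w => J (fun t w => K t w * b_ m t w) T w - J K T w)).
Proof.
move=> op bK bb b1 bcv; have [pK [C hC]] := bK.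
apply: (op_dominated op (C := C)) => //; last exact: T_in.
- by move=> m; apply: bp_pred; exact: bpM.
- move=> m t w tT; rewrite normrM; apply: le_trans (hC t w tT).
  by rewrite ler_piMr// b1.
- move=> t w tT; rewrite -[X in _ --> X]mulr1.
  by apply: cvgM; [exact: cvg_cst|exact: bcv].
Qed.

Lemma measurable_exceeds (W : R -> Omega -> R) (e : R) : cadlag T W ->
  (forall t, t \in `[0, T] -> measurable_fun setT (W t)) ->
  measurable [set w | exists2 t, (t \in `[0, T])%R & (e < `|W t w|)%R].
Proof.
move=> cW mW.
rewrite (_ : [set w | _] = \bigcup_k [set w | e < `|W (dyadic_enum T k) w|]).
  apply: bigcupT_measurable => k; rewrite -[X in measurable X]setTI.
  apply: measurable_fun_ltr => //; apply: measurableT_comp => //.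
  by apply: mW; exact: dyadic_enum_in.
apply/seteqP; split=> w /=; last first.
  by move=> [k _ hk]; exists (dyadic_enum T k) => //; exact: dyadic_enum_in.
move=> [t tT ht]; apply: contrapT => nk; move: ht; rewrite ltNge => /negP; apply.
apply: (cadlag_dyadic_bound T_ge0 cW _ tT) => m i i2.
have [k hk] := dyadic_enumP T i2; rewrite leNgt; apply/negP => hlt; apply: nk.
by exists k => //=; rewrite hk.
Qed.

Lemma exceeds_markov (W : R -> Omega -> R) (e : R) : cadlag T W ->
  (forall t, t \in `[0, T] -> measurable_fun setT (W t)) -> 0 < e ->
  (P [set w | exists2 t, (t \in `[0, T])%R & (e < `|W t w|)%R]
     <= (l0 P (running_sup T W) / Num.min e 1)%:E)%E.
Proof.
move=> cW mW e0; have mr := measurable_running_sup T_ge0 mW.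
have m0 : 0 < Num.min e 1 by rewrite lt_min e0 ltr01.
have m1 : Num.min e 1 <= 1 by rewrite ge_min lexx orbT.
apply: le_trans (l0_markov P mr m0 m1); apply: le_measure; rewrite ?inE.
- exact: measurable_exceeds.
- rewrite -[X in measurable X]setTI; apply: measurable_fun_ler => //.
  exact: measurableT_comp.
- move=> w [t tT et] /=; rewrite ger0_norm ?running_sup_ge0//.
  apply: le_trans (running_sup_ge T_ge0 w cW tT).
  by rewrite le_min !ge_min lexx (ltW et) orbT.
Qed.

Section Integrators.
Context {d : nat}.
Variables (S : R -> Omega -> 'cV[R]_d) (JS : 'I_d -> (R -> Omega -> R) -> R -> Omega -> R).
Hypothesis JSop : forall i, soi (fun t w => S t w i 0) (JS i).
Hypothesis S_adapted : forall i, adapted T F (fun t w => S t w i 0).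
Implicit Types theta eta : R -> Omega -> 'rV[R]_d.
Local Notation integrates := (integrates P T F JS).
Local Notation vector_bp := (vector_bp T F).

Lemma scaledM (b K : R -> Omega -> R) theta :
  scaled (fun t w => K t w * b t w) theta = scaled b (scaled K theta).
Proof. by apply/funext => t; apply/funext => w; rewrite /scaled scalerA mulrC. Qed.

Lemma scaled1 theta : scaled (fun _ _ => 1) theta = theta.
Proof. by apply/funext => t; apply/funext => w; rewrite /scaled scale1r. Qed.

Lemma vint_localized theta K (b_ : nat -> R -> Omega -> R) : vector_bp (scaled K theta) ->
  (forall m, bp (b_ m)) -> (forall m t w, t \in `[0, T] -> `|b_ m t w| <= 1) ->
  (forall t w, t \in `[0, T] -> b_ m t w @[m --> \oo] --> (1 : R)) ->
  vanishing (fun m => l0 P (fun w => vint JS (scaled (fun t w => K t w * b_ m t w) theta) T w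
    - vint JS (scaled K theta) T w)).
Proof.
move=> bKt bb b1 bcv.
have b0 : bp (fun _ _ => 1) by exact: bp_cst.
have := op_dominated_mul (soi_vint T_ge0 filF JSop bKt) b0 bb b1 bcv.
apply: vanishing_le => m; rewrite scaled1 le_eqVlt; apply/orP; left; apply/eqP.
congr (l0 P _); apply/funext => w; congr (vint _ _ _ _ - _).
rewrite scaledM; apply/funext => t; apply/funext => w'.
by rewrite /scaled mul1r.
Qed.

(** Both sides satisfy dominated convergence along bounded localizers tending to 1, so the relation
    need only be tested on localized integrands. *)
Lemma integrates_localized theta Y J (b_ : nat -> R -> Omega -> R) : soi Y J ->
  (forall m, bp (b_ m)) -> (forall m t w, t \in `[0, T] -> `|b_ m t w| <= 1) ->
  (forall t w, t \in `[0, T] -> b_ m t w @[m --> \oo] --> (1 : R)) ->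
  (forall m K, bp K -> vector_bp (scaled K theta) ->
    {ae P, forall w, J (fun t w => K t w * b_ m t w) T w =
      vint JS (scaled (fun t w => K t w * b_ m t w) theta) T w}) ->
  integrates theta Y J.
Proof.
move=> op bb b1 bcv h; split=> // K bK bKt; have TT := T_in T_ge0.
apply: ae_eq_vanishing (op_dominated_mul op bK bb b1 bcv) (vint_localized bKt bb b1 bcv) _.
- by move=> m; apply: (op_measurable op) => //; exact: bpM.
- exact: (op_measurable op).
- move=> m; apply: (vint_measurable JSop) => //; rewrite scaledM; exact: scaled_bp.
- exact: (vint_measurable JSop).
- by move=> m; exact: h.
Qed.

Lemma vector_predictable_lin (a : R) theta eta :
  vector_predictable T F theta -> vector_predictable T F eta ->
  vector_predictable T F (fun t w => a *: theta t w + eta t w).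
Proof.
move=> pt pe i.
have -> : (fun t w => (a *: theta t w + eta t w) 0 i) = fun t w => a * theta t w 0 i + eta t w 0 i.
  by apply/funext => t; apply/funext => w; rewrite !mxE.
by apply: predictableD => //; exact: predictableZ.
Qed.

Lemma below_cvg1 theta t w : below theta n t w @[n --> \oo] --> (1 : R).
Proof. by have [M hM] := below_eventually theta t w; exact: cvg_eventually hM. Qed.

(** K (a theta + eta) may be bounded by cancellation while K theta and K eta are not; hence the
    localization to the set where both strategies are bounded. *)
Lemma integrates_lin (a : R) theta eta Y Y' J J' :
  vector_predictable T F theta -> vector_predictable T F eta ->
  integrates theta Y J -> integrates eta Y' J' ->
  integrates (fun t w => a *: theta t w + eta t w) (fun t w => a * Y t w + Y' t w)
    (fun K t w => a * J K t w + J' K t w).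
Proof.
move=> pt pe [op h] [op' h']; have TT := T_in T_ge0.
apply: (@integrates_localized _ _ _ (fun m t w => below theta m t w * below eta m t w)).
- exact: soi_lin.
- by move=> m; apply: bpM; exact: below_bp.
- move=> m t w _; rewrite normrM -[1]mulr1.
  by apply: ler_pM => //; exact: below_le1.
- by move=> t w _; rewrite -[1]mulr1; apply: cvgM; exact: below_cvg1.
move=> m K bK _.
pose L t w := K t w * (below theta m t w * below eta m t w).
have bL : bp L by apply: bpM => //; apply: bpM; exact: below_bp.
have e1 : scaled L theta = scaled (fun t w => K t w * below eta m t w) (truncation theta m).
  rewrite truncationE; apply/funext => t; apply/funext => w; rewrite /scaled scalerA /L.
  by congr (_ *: _); ring.
have e2 : scaled L eta = scaled (fun t w => K t w * below theta m t w) (truncation eta m).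
  rewrite truncationE; apply/funext => t; apply/funext => w; rewrite /scaled scalerA /L.
  by congr (_ *: _); ring.
have b1 : vector_bp (scaled L theta).
  by rewrite e1; apply: scaled_bp; [apply: bpM => //; exact: below_bp|exact: truncation_bp].
have b2 : vector_bp (scaled L eta).
  by rewrite e2; apply: scaled_bp; [apply: bpM => //; exact: below_bp|exact: truncation_bp].
have l := vint_lin JSop a b1 b2 TT.
apply: filterS3 l (h L bL b1) (h' L bL b2) => w lw -> ->; rewrite -lw; congr (vint _ _ _ _).
by apply/funext => t; apply/funext => v; rewrite /scaled scalerDr !scalerA mulrC.
Qed.

(** The converse of [vector_integral_integrates]. Tested with K, the truncation error is up to sign
    the integral of K times the indicator of |theta| > n: small uniformly in K by [op_uniform], and
    uniformly in time by [op_running_sup]. *)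
Lemma integrates_vector_integral theta Y J : vector_predictable T F theta ->
  integrates theta Y J -> cadlag T Y ->
  (forall t, t \in `[0, T] -> measurable_fun setT (Y t)) -> (forall w, Y 0 w = 0) ->
  vector_integral P T F S theta Y.
Proof.
move=> pt ig cY mY Y0; have [op hJ] := ig; split=> //.
exists (fun n => vint JS (truncation theta n)).
  move=> n; exists (fun i => JS i (fun t w => truncation theta n t w 0 i)) => // i.
  by split; [exact: truncation_bp|exists (JS i)].
(* The factor [Num.min e 1] anticipates the division in [exceeds_markov]. *)
move=> e e0; pose k := e * Num.min e 1.
have m0 : 0 < Num.min e 1 by rewrite lt_min e0 ltr01.
have k0 : 0 < k by rewrite mulr_gt0.
pose e' := Num.min (k / 2) 1.
have e'0 : 0 < e' by rewrite lt_min ltr01 divr_gt0.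
have e'1 : e' <= 1 by rewrite ge_min lexx orbT.
have e'k : e' <= k / 2 by rewrite ge_min lexx.
have eta0 : 0 < e' * k / 4 by rewrite divr_gt0// mulr_gt0.
have bD n : bp (fun t w => 1 - below theta n t w).
  by apply: bpB; [exact: bp_cst|exact: below_bp].
have [N hN] := @op_uniform _ _ _ _ _ _ T_ge0 _ _ (fun n t w => 1 - below theta n t w) 1 op
  ltac:(by move=> n; exact: bp_pred)
  ltac:(by move=> n t w _; rewrite /below; case: (`|theta t w| <= n%:R); rewrite ?subrr ?subr0 ?normr0 ?normr1)
  ltac:(by move=> t w _; rewrite -(subrr (1 : R)); apply: cvgB; [exact: cvg_cst|exact: below_cvg1])
  _ eta0.
exists N => n Nn K pK K1.
have bK : bp K by split=> //; exists 1.
pose W K t w := vint JS (scaled K (truncation theta n)) t w - J K t w.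
have opW : soi (fun t w => vint JS (truncation theta n) t w - Y t w) W.
  by apply: soi_sub => //; apply: (soi_vint T_ge0 filF JSop); exact: truncation_bp.
exists (W K); first by split=> //; exists W.
pose H t w := K t w * (1 - below theta n t w).
have bH : bp H by exact: bpM.
have cW := op_cadlag opW bK; have mW := fun t => @op_measurable _ _ _ _ _ _ _ _ opW K t bK.
apply: le_trans (exceeds_markov cW mW e0) _; rewrite lee_fin ler_pdivrMr//.
have nk t : t \in `[0, T] -> nearly_known P F t (J H t).
  exact: (integrates_nearly_known T_ge0 filF JSop S_adapted pt ig bH).
have main := op_running_sup T_ge0 filF op nk bH e'0 e'1 (eta := e' * k / 4).
have WH : indistinguishable P T (W K) (fun t w => - J H t w).
  apply: cadlag_indistinguishable => //.
    have := cadlag_scale (fun _ => -1) (op_cadlag op bH).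
    by have -> // : (fun t w => -1 * J H t w) = fun t w => - J H t w;
      apply/funext => t; apply/funext => w; rewrite mulN1r.
  move=> t tT; have bb : bp (fun t w => K t w * below theta n t w).
    by apply: bpM => //; exact: below_bp.
  have h1 := integrates_below T_ge0 filF JSop n pt ig bK tT.
  have h2 := op_B op bK bb tT.
  have E : (fun t w => K t w - K t w * below theta n t w) = H.
    by apply/funext => u; apply/funext => w; rewrite /H mulrBr mulr1.
  by rewrite E in h2; apply: filterS2 h1 h2 => w e1 ->; rewrite /W e1 opprB.
have -> : l0 P (running_sup T (W K)) = l0 P (running_sup T (J H)).
  apply: l0_ae.
  - exact: measurable_running_sup.
  - by apply: measurable_running_sup => // t tT; exact: (op_measurable op).
  - by apply: filterS (running_sup_ae T_ge0 WH) => w ->; rewrite running_sup_N.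
apply: (@le_trans _ _ (e' + 2 * (e' * k / 4) / e')).
  apply: main => K' pK' K'1.
  have -> : (fun t w => K' t w * H t w) = fun t w => (K' t w * K t w) * (1 - below theta n t w).
    by apply/funext => t; apply/funext => w; rewrite /H mulrA.
  apply: hN => //; first exact: predictableM.
  by move=> t w tT; rewrite normrM -[1]mulr1 ler_pM ?K'1 ?K1.
have -> : 2 * (e' * k / 4) / e' = k / 2 by field; rewrite gt_eqF.
rewrite /k in e'k *; lra.
Qed.

Lemma cvg_sum0 (Fl : set_system R) (FF : Filter Fl) (I : Type) (s : seq I) (f : I -> R -> R) :
  (forall i, f i u @[u --> Fl] --> (0 : R)) -> \sum_(i <- s) f i u @[u --> Fl] --> (0 : R).
Proof.
move=> h; elim: s => [|i s ih].
  by under eq_fun do rewrite big_nil; exact: cvg_cst.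
under eq_fun do rewrite big_cons.
have c := cvgD (h i) ih; rewrite addr0 in c; exact: c.
Qed.

Lemma cvg_nearB (Fl : set_system R) (FF : Filter Fl) (f g h : R -> R) :
  f u @[u --> Fl] --> (0 : R) -> g u @[u --> Fl] --> (0 : R) ->
  (\forall u \near Fl, f u - g u = h u) -> h u @[u --> Fl] --> (0 : R).
Proof.
move=> cf cg e; have c := cvgB cf cg; rewrite subrr in c.
by apply: cvg_trans (c FF); exact: near_eq_cvg.
Qed.

(** For given (t, w) a truncation level above |theta_t(w)| leaves theta_t unchanged. At that level
    the truncated integral is both an integral against Y and a sum of component integrals, and its
    two jump formulas are compared. *)
Lemma integrates_jump theta Y J : vector_predictable T F theta ->
  integrates theta Y J -> cadlag T Y -> (forall i, cadlag T (fun t w => S t w i 0)) ->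
  {ae P, forall w, forall t, 0 < t <= T ->
    (Y t w - Y u w) - \sum_i theta t w 0 i * (S t w i 0 - S u w i 0) @[u --> t^'-] --> (0 : R)}.
Proof.
move=> pt ig cY cS; have [op _] := ig.
have nkJ K t : bp K -> t \in `[0, T] -> nearly_known P F t (J K t).
  by move=> bK tT; exact: (integrates_nearly_known T_ge0 filF JSop S_adapted pt ig bK).
have kS i t : t \in `[0, T] -> known F t (fun w => S t w i 0).
  by move=> tT; apply/(knownP filF) => // B mB; exact: S_adapted.
have nkS i K t : bp K -> t \in `[0, T] -> nearly_known P F t (JS i K t).
  move=> bK tT; apply: (op_nearly_known T_ge0 filF (JSop i)) => // u uT.
    by apply: known_nearly; exact: kS.
  exact: (known_measurable filF uT (kS i u uT)).
have h1 := ae_foralln (fun n => op_jump T_ge0 filF op cY nkJ (below_bp n pt)).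
have h2 := ae_foralln (fun n => ae_forall_ord (fun i =>
  op_jump T_ge0 filF (JSop i) (cS i) (nkS i) (truncation_bp n pt i))).
have h3 : {ae P, forall w, forall n t, t \in `[0, T] ->
    J (below theta n) t w = vint JS (truncation theta n) t w}.
  apply: ae_foralln => n; apply: cadlag_indistinguishable => //.
  - by apply: (op_cadlag op); exact: below_bp.
  - by apply: (vint_cadlag JSop); exact: truncation_bp.
  - move=> t tT; have b1 : bp (fun _ _ => 1) by exact: bp_cst.
    have := integrates_below T_ge0 filF JSop n pt ig b1 tT.
    rewrite scaled1; have -> // : (fun t w => 1 * below theta n t w) = below theta n.
    by apply/funext => u; apply/funext => w; rewrite mul1r.
apply: filterS3 h1 h2 h3 => w h1 h2 h3 t tT.
have [n /(_ n (leqnn n)) bn] := below_eventually theta t w.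
have c1 := h1 n t tT; rewrite bn in c1.
have FF : Filter (t^'-) by exact: _.
have c2 := cvg_sum0 FF (index_enum 'I_d) (fun i => h2 n i t tT).
have tr : truncation theta n t w = theta t w.
  by rewrite truncationE /scaled bn scale1r.
apply: (cvg_nearB FF c2 c1).
near=> u.
have u0 : 0 < u by near: u; apply: nbhs_left_gt; case/andP: (tT).
have ut : u < t by near: u; exact: nbhs_left_lt.
have tT' : t \in `[0, T] by case/andP: (tT) => t0 t1; rewrite in_itv/= ltW.
have uT' : u \in `[0, T].
  by rewrite in_itv/= (ltW u0) (le_trans (ltW ut))//; case/andP: (tT).
rewrite !h3// /vint tr !sumrB; ring.
Unshelve. all: by end_near.
Qed.

End Integrators.
End IntegratesTheory.

(** * A weak-type inequality for a quotient of martingales *)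

Section WeakType.
Context {disp : measure_display} {Omega : measurableType disp} {R : realType}.
Variables (P : probability Omega R) (T : R) (F : R -> set (set Omega)).
Hypothesis T_ge0 : 0 <= T.
Hypothesis filF : filtration T F.
Local Notation I f := (P.-integrable setT (EFin \o f)).
Local Notation E f := (\int[P]_w f w).

Definition bounded_known s (g : Omega -> R) : Prop :=
  known F s g /\ exists C : R, forall w, `|g w| <= C.

Lemma bounded_known_cst s (a : R) : bounded_known s (fun=> a).
Proof. by split; [exact: measurable_cst|exists `|a|]. Qed.

Lemma bounded_knownM s f g : bounded_known s f -> bounded_known s g ->
  bounded_known s (fun w => f w * g w).
Proof.
move=> [mf [C hC]] [mg [D hD]]; split; first exact: measurable_funM.
by exists (C * D) => w; rewrite normrM ler_pM.
Qed.

Lemma bounded_knownD s f g : bounded_known s f -> bounded_known s g ->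
  bounded_known s (fun w => f w + g w).
Proof.
move=> [mf [C hC]] [mg [D hD]]; split; first exact: measurable_funD.
by exists (C + D) => w; rewrite (le_trans (ler_normD _ _))// lerD.
Qed.

Lemma bounded_knownB s f g : bounded_known s f -> bounded_known s g ->
  bounded_known s (fun w => f w - g w).
Proof.
move=> [mf [C hC]] [mg [D hD]]; split; first exact: measurable_funB.
by exists (C + D) => w; rewrite (le_trans (ler_normB _ _))// lerD.
Qed.

Lemma bounded_known_sqr s f : bounded_known s f -> bounded_known s (fun w => f w ^+ 2).
Proof. by move=> bf; exact: (bounded_knownM bf bf). Qed.

Lemma bounded_known_measurable s g : s \in `[0, T] -> bounded_known s g -> measurable_fun setT g.
Proof. by move=> sT [kg _]; exact: (known_measurable filF sT). Qed.

Lemma integrable_bounded_known s g f : s \in `[0, T] -> bounded_known s g -> I f ->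
  I (fun w => g w * f w).
Proof.
move=> sT bg If; have mg := bounded_known_measurable sT bg; have [_ [C hC]] := bg.
have := @integrableMr _ _ _ P setT measurableT g (EFin \o f) mg _ If.
by apply; exists C; split; [exact: num_real|move=> M CM w _; apply: le_trans (hC w) (ltW CM)].
Qed.

Lemma known_comp s (f : R -> R) g : measurable_fun setT f -> known F s g ->
  known F s (fun w => f (g w)).
Proof. by rewrite /known => mf kg; exact: measurableT_comp. Qed.

Lemma known_bool s (b : Omega -> bool) : known F s (fun w => (b w)%:R : R) ->
  bounded_known s (fun w => (b w)%:R).
Proof.
by move=> kb; split=> //; exists 1 => w; case: (b w); rewrite ?normr1 ?normr0.
Qed.

Lemma known_ler s f g : known F s f -> known F s g ->
  bounded_known s (fun w => (f w <= g w)%R%:R).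
Proof.
move=> kf kg; apply: known_bool.
apply: (measurableT_comp measurable_natr_bool).
exact: (measurable_fun_ler kf kg).
Qed.

Lemma bounded_known_sub s t g : s \in `[0, T] -> t \in `[0, T] -> s <= t ->
  bounded_known s g -> bounded_known t g.
Proof. by move=> sT tT st [kg hC]; split=> //; exact: (known_sub filF sT tT st). Qed.

Variables (c : nat -> R).
Hypothesis c_in : forall i, c i \in `[0, T].
Hypothesis c_le : forall i j, (i <= j)%N -> c i <= c j.

(** The martingale property along the grid in tested form, which avoids conditional expectations. *)
Definition fair (X : nat -> Omega -> R) : Prop := forall i j g, (i <= j)%N ->
  bounded_known (c i) g -> E (fun w => g w * X j w) = E (fun w => g w * X i w).

Variables (N M : nat -> Omega -> R) (lam : R).
Hypothesis lam0 : 0 < lam.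
Hypothesis kN : forall i, known F (c i) (N i).
Hypothesis kM : forall i, known F (c i) (M i).
Hypothesis IN : forall i, I (N i).
Hypothesis IM : forall i, I (M i).
Hypothesis N_gt0 : forall i w, 0 < N i w.
Hypothesis M0 : forall w, M 0%N w = 0.
Hypothesis fairN : fair N.
Hypothesis fairM : fair M.

Definition ratio i w := M i w / N i w.
Definition small i w := `|ratio i w| <= lam.
Definition alive i w : R := (all (small^~ w) (iota 0 i.+1))%:R.
(** Killed rather than stopped: at the exit from [-lam, lam] the value becomes 0 instead of the
    overshoot. It is therefore bounded by lam, at the price of a martingale defect measured by
    [mass]. *)
Definition tamed i w := alive i w * ratio i w.
Definition dying i w := alive i w - alive i.+1 w.
(** Since |M| = |ratio| N, this is the N-weighted size of the ratio at the moment of exit, overshoot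
    included. *)
Definition mass i := E (fun w => dying i w * `|M i.+1 w|).
Local Notation bk i := (bounded_known (c i)).

Lemma bk_le i j g : (i <= j)%N -> bk i g -> bk j g.
Proof. by move=> ij; apply: bounded_known_sub => //; exact: c_le. Qed.

Lemma ratioM i w : ratio i w * N i w = M i w.
Proof. by rewrite /ratio divfK// gt_eqF. Qed.

Lemma aliveS i w : alive i.+1 w = alive i w * (small i.+1 w)%:R.
Proof. by rewrite /alive all_iotaS -mulnb natrM. Qed.

Lemma alive0 w : alive 0 w = 1.
Proof.
by rewrite /alive/= /small /ratio M0 mul0r normr0 (ltW lam0).
Qed.

Lemma ratio_known i : known F (c i) (ratio i).
Proof.
have kinv : known F (c i) (fun w => (N i w)^-1).
  apply: (@known_comp _ (fun x => x^-1)); [exact: measurable_inv|exact: kN].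
rewrite /known /ratio; apply: measurable_funM; [exact: kM|exact: kinv].
Qed.

Lemma small_known i : bk i (fun w => (small i w)%:R).
Proof.
apply: known_ler; last exact: measurable_cst.
apply: (@known_comp _ (fun x => `|x|)); [exact: normr_measurable|exact: ratio_known].
Qed.

Lemma alive_known i : bk i (alive i).
Proof.
elim: i => [|i ih].
  by rewrite (funext alive0 : alive 0 = fun=> 1); exact: bounded_known_cst.
rewrite (funext (aliveS i) : alive i.+1 = _); apply: bounded_knownM; last exact: small_known.
exact: bk_le ih.
Qed.

Lemma alive_01 i w : 0 <= alive i w <= 1.
Proof. by rewrite /alive; case: (all _ _); rewrite ?lexx ?ler01. Qed.

Lemma dying_01 i w : 0 <= dying i w <= 1.
Proof.
rewrite /dying aliveS; case/andP: (alive_01 i w) => h1 h2.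
by case: (small _ _); rewrite ?mulr1 ?mulr0 ?subrr ?subr0 ?lexx ?ler01// h1.
Qed.

Lemma dying_known i : bk i.+1 (dying i).
Proof. by apply: bounded_knownB; [apply: bk_le (alive_known i)|exact: alive_known]. Qed.

Lemma sum_dying m w : \sum_(i < m) dying i w = 1 - alive m w.
Proof.
elim: m => [|m ih]; first by rewrite big_ord0 alive0 subrr.
by rewrite big_ord_recr/= ih /dying; ring.
Qed.

Lemma tamed_le i w : `|tamed i w| <= lam.
Proof.
rewrite /tamed /alive; case: (boolP (all _ _)) => [/allP h|_].
  by rewrite mul1r; apply: h; rewrite mem_iota/= add0n.
by rewrite mul0r normr0 ltW.
Qed.

Lemma tamed_known i : bk i (tamed i).
Proof.
split; last by exists lam; exact: tamed_le.
apply: measurable_funM; first by case: (alive_known i).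
exact: ratio_known.
Qed.

Lemma tamedN i w : tamed i w * N i w = alive i w * M i w.
Proof. by rewrite /tamed -mulrA ratioM. Qed.

Lemma IbkN i j g : bk i g -> I (fun w => g w * N j w).
Proof. by move=> bg; exact: (integrable_bounded_known (c_in i)). Qed.

Lemma IbkM i j g : bk i g -> I (fun w => g w * M j w).
Proof. by move=> bg; exact: (integrable_bounded_known (c_in i)). Qed.

Lemma IabsM j : I (fun w => `|M j w|).
Proof. exact: integrable_norm. Qed.

Lemma IbkabsM i j g : bk i g -> I (fun w => g w * `|M j w|).
Proof. by move=> bg; apply: (integrable_bounded_known (c_in i)) => //; exact: IabsM. Qed.

(* [tamed] is a martingale under the weights [N] up to the jump at which
   [ratio] leaves [-lam, lam]. *)
Lemma tamed_drift i r (rho : R) : bk i r -> (forall w, `|r w| <= rho) ->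
  `|E (fun w => r w * (tamed i.+1 w - tamed i w) * N i.+1 w)| <= rho * mass i.
Proof.
move=> br hr; have bri : bk i.+1 r by exact: bk_le br.
have e1 : E (fun w => r w * tamed i w * N i.+1 w) = E (fun w => r w * alive i w * M i.+1 w).
  rewrite (fairN (leqnSn i) (bounded_knownM br (tamed_known i))).
  rewrite (fairM (leqnSn i) (bounded_knownM br (alive_known i))).
  by apply: eq_Rintegral => w _; rewrite -mulrA tamedN mulrA.
have e2 : E (fun w => r w * (tamed i.+1 w - tamed i w) * N i.+1 w) =
    - E (fun w => r w * dying i w * M i.+1 w).
  have -> : (fun w => r w * (tamed i.+1 w - tamed i w) * N i.+1 w) =
    fun w => r w * tamed i.+1 w * N i.+1 w - r w * tamed i w * N i.+1 w.
    by apply/funext => w; ring.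
  rewrite RintegralB//; last 2 first.
  - by apply: (IbkN (i := i.+1)); apply: bounded_knownM => //; exact: tamed_known.
  - by apply: (IbkN (i := i)); apply: bounded_knownM => //; exact: tamed_known.
  rewrite e1.
  have -> : E (fun w => r w * tamed i.+1 w * N i.+1 w) = E (fun w => r w * alive i.+1 w * M i.+1 w).
    by apply: eq_Rintegral => w _; rewrite -mulrA tamedN mulrA.
  rewrite -RintegralB//; last 2 first.
  - by apply: (IbkM (i := i.+1)); apply: bounded_knownM => //; exact: alive_known.
  - by apply: (IbkM (i := i)); apply: bounded_knownM => //; exact: alive_known.
  rewrite -mulN1r -RintegralZl//; last first.
    by apply: (IbkM (i := i.+1)); apply: bounded_knownM => //; exact: dying_known.
  by apply: eq_Rintegral => w _; rewrite /dying; ring.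
have Ird : I (fun w => r w * dying i w * M i.+1 w).
  by apply: (IbkM (i := i.+1)); apply: bounded_knownM => //; exact: dying_known.
rewrite e2 normrN; apply: (le_trans (le_normr_Rintegral measurableT Ird)).
have Id := IbkabsM i.+1 (dying_known i).
rewrite -RintegralZl//; apply: le_Rintegral => //.
- exact: integrable_norm.
- exact: integrable_funZ.
- move=> w _; rewrite !normrM (ger0_norm (andP (dying_01 i w)).1) -mulrA ler_wpM2r//.
  by rewrite mulr_ge0//; case/andP: (dying_01 i w).
Qed.

(** Submartingale property of |M|: the sign of M at the exit is known there, so |M| equals sign
    times M, and the fair M may be moved to the later time. *)
Lemma mass_le i m : (i < m)%N -> mass i <= E (fun w => dying i w * `|M m w|).
Proof.
move=> im; pose sg w : R := 2 * (0 <= M i.+1 w)%R%:R - 1.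
have bsg : bk i.+1 sg.
  apply: bounded_knownB; last exact: bounded_known_cst.
  apply: bounded_knownM; first exact: bounded_known_cst.
  by apply: known_ler => //; exact: measurable_cst.
have sgM w : `|M i.+1 w| = sg w * M i.+1 w.
  rewrite /sg; case: (boolP (0 <= M i.+1 w)) => h.
    by rewrite ger0_norm// (_ : true%:R = 1 :> R)//; ring.
  by rewrite ltr0_norm ?ltNge// (_ : false%:R = 0 :> R)//; ring.
have bds := bounded_knownM (dying_known i) bsg.
have -> : mass i = E (fun w => dying i w * sg w * M m w).
  rewrite (fairM im bds); apply: eq_Rintegral => w _; rewrite sgM; ring.
apply: le_Rintegral => //; [exact: IbkM bds|exact: IbkabsM (dying_known i)|].
move=> w _; rewrite -mulrA ler_wpM2l//; first by case/andP: (dying_01 i w).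
apply: le_trans (ler_norm _) _; rewrite normrM ler_piMl//.
rewrite /sg; case: (0 <= M i.+1 w).
  by rewrite (_ : 2 * true%:R - 1 = 1 :> R) ?normr1// (_ : true%:R = 1 :> R)//; ring.
by rewrite mulr0 sub0r normrN normr1.
Qed.

(** The exits at the various steps and survival up to m partition the space. *)
Lemma sum_mass m : \sum_(i < m) mass i + E (fun w => alive m w * `|M m w|) <= E (fun w => `|M m w|).
Proof.
have Ii (i : 'I_m) := IbkabsM m (dying_known i).
have [Is Es] := Rintegral_sum (index_enum 'I_m) Ii.
have Ia := IbkabsM m (alive_known m).
apply: (@le_trans _ _ (\sum_(i < m) E (fun w => dying i w * `|M m w|) + E (fun w => alive m w * `|M m w|))).
  by rewrite lerD2r; apply: ler_sum => i _; exact: mass_le.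
rewrite -Es -RintegralD// le_eqVlt; apply/orP; left; apply/eqP.
by apply: eq_Rintegral => w _; rewrite -mulr_suml sum_dying; ring.
Qed.

(** Doob's weak-type inequality for the ratio under the weights N: at the exit |M| exceeds lam N. *)
Lemma weak_maximal m : lam * E (fun w => (1 - alive m w) * N m w) <= E (fun w => `|M m w|).
Proof.
have Ii (i : 'I_m) := IbkN m (dying_known i).
have [Is Es] := Rintegral_sum (index_enum 'I_m) Ii.
have -> : E (fun w => (1 - alive m w) * N m w) = \sum_(i < m) E (fun w => dying i w * N m w).
  by rewrite -Es; apply: eq_Rintegral => w _; rewrite -mulr_suml sum_dying.
apply: (@le_trans _ _ (\sum_(i < m) mass i)); last first.
  apply: le_trans (sum_mass m); rewrite lerDl; apply: Rintegral_ge0 => w _.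
  by rewrite mulr_ge0//; case/andP: (alive_01 m w).
rewrite mulr_sumr; apply: ler_sum => i _.
rewrite (fairN (ltn_ord i) (dying_known i)).
have Id := IbkN i.+1 (dying_known i).
rewrite -RintegralZl//; apply: le_Rintegral => //.
- exact: integrable_funZ.
- exact: IbkabsM (dying_known i).
- move=> w _; rewrite mulrCA /dying aliveS; case: (boolP (small i.+1 w)) => h.
    by rewrite mulr1 subrr !mul0r.
  rewrite mulr0 subr0; apply: ler_wpM2l; first by case/andP: (alive_01 i w).
  rewrite -ratioM normrM (gtr0_norm (N_gt0 _ _)); apply: ler_wpM2r; first exact: ltW.
  by apply: ltW; rewrite ltNge.
Qed.

(** From (y' - y)^2 = y'^2 - y^2 - 2 y (y' - y): the last term would vanish for a martingale and
    here costs the drift with a factor |2 y| <= 2 lam. *)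
Lemma square_step i : E (fun w => (tamed i.+1 w - tamed i w) ^+ 2 * N i.+1 w) <=
  E (fun w => tamed i.+1 w ^+ 2 * N i.+1 w) - E (fun w => tamed i w ^+ 2 * N i w) + 2 * lam * mass i.
Proof.
have by1 := tamed_known i.+1; have by0 := tamed_known i.
have by01 : bk i.+1 (tamed i) by exact: bk_le by0.
have bdy := bounded_knownB by1 by01.
have d := @tamed_drift i (fun w => 2 * tamed i w) (2 * lam)
   (bounded_knownM (bounded_known_cst _ 2) by0)
   ltac:(by move=> w; rewrite normrM ger0_norm// ler_wpM2l// tamed_le).
have e0 : E (fun w => tamed i w ^+ 2 * N i w) = E (fun w => tamed i w ^+ 2 * N i.+1 w).
  by rewrite (fairN (leqnSn i) (bounded_knownM by0 by0)).
have I1 : I (fun w => tamed i.+1 w ^+ 2 * N i.+1 w) := IbkN _ (bounded_knownM by1 by1).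
have I0 : I (fun w => tamed i w ^+ 2 * N i.+1 w) := IbkN _ (bounded_knownM by0 by0).
have Id : I (fun w => 2 * tamed i w * (tamed i.+1 w - tamed i w) * N i.+1 w).
  by apply: (IbkN (i := i.+1)); apply: bounded_knownM => //; apply: bounded_knownM => //; exact: bounded_known_cst.
rewrite e0.
have -> : E (fun w => (tamed i.+1 w - tamed i w) ^+ 2 * N i.+1 w) =
   E (fun w => tamed i.+1 w ^+ 2 * N i.+1 w) - E (fun w => tamed i w ^+ 2 * N i.+1 w)
   - E (fun w => 2 * tamed i w * (tamed i.+1 w - tamed i w) * N i.+1 w).
  rewrite -RintegralB// -RintegralB//; last exact: integrable_funB.
  by apply: eq_Rintegral => w _; ring.
by rewrite lerD2l; apply: le_trans d; rewrite -normrN ler_norm.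
Qed.

(** The squares telescope. The last one, weighted by N, is at most lam |M| on survival, and together
    with 2 lam times the masses it fits into 2 lam E|M| by [sum_mass]. *)
Lemma sum_square m : \sum_(i < m) E (fun w => (tamed i.+1 w - tamed i w) ^+ 2 * N i.+1 w) <=
  2 * lam * E (fun w => `|M m w|).
Proof.
apply: (@le_trans _ _ (E (fun w => tamed m w ^+ 2 * N m w) + 2 * lam * \sum_(i < m) mass i)).
  elim: m => [|m ih].
    rewrite !big_ord0 mulr0 addr0; apply: Rintegral_ge0 => w _.
    by rewrite mulr_ge0 ?sqr_ge0// ltW.
  rewrite !big_ord_recr/= mulrDr; have := square_step m; lra.
have h := sum_mass m.
have h2 : E (fun w => tamed m w ^+ 2 * N m w) <= lam * E (fun w => alive m w * `|M m w|).
  rewrite -RintegralZl//; last exact: IbkabsM (alive_known m).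
  apply: le_Rintegral => //.
  - exact: IbkN (bounded_knownM (tamed_known m) (tamed_known m)).
  - by apply: integrable_funZ; exact: IbkabsM (alive_known m).
  - move=> w _; rewrite expr2 -mulrA tamedN; apply: le_trans (ler_norm _) _.
    rewrite normrM [X in _ * X]normrM (ger0_norm (andP (alive_01 m w)).1).
    apply: ler_wpM2r; last exact: tamed_le.
    by rewrite mulr_ge0//; case/andP: (alive_01 m w).
have a0 : 0 <= E (fun w => alive m w * `|M m w|).
  by apply: Rintegral_ge0 => w _; rewrite mulr_ge0//; case/andP: (alive_01 m w).
have l := ler_wpM2l (ltW lam0) h; have l0 := mulr_ge0 (ltW lam0) a0.
move: l; rewrite mulrDr; lra.
Qed.

Lemma weak_square m :
  E (fun w => (\sum_(i < m) (tamed i.+1 w - tamed i w) ^+ 2) * N m w) <=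
  2 * lam * E (fun w => `|M m w|).
Proof.
have bd i : bk i.+1 (fun w => (tamed i.+1 w - tamed i w) ^+ 2).
  have b : bk i.+1 (fun w => tamed i.+1 w - tamed i w).
    by apply: bounded_knownB; [exact: tamed_known|apply: bk_le (tamed_known i)].
  exact: bounded_known_sqr.
have [Is Es] := Rintegral_sum (index_enum 'I_m) (fun i : 'I_m => IbkN m (bd i)).
apply: le_trans (sum_square m); under eq_Rintegral do rewrite mulr_suml.
rewrite Es; apply: ler_sum => i _.
by rewrite (fairN (ltn_ord i) (bd i)).
Qed.

Definition clamp (x : R) : R := Num.max (- lam) (Num.min x lam).
(* Quadratic on [-lam, lam] and linear outside, so that the one large increment
   at the exit from [-lam, lam] costs only its first moment. *)
Definition huber (x : R) : R := clamp x ^+ 2 + 2 * lam * `|x - clamp x|.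

Lemma clamp_le x : `|clamp x| <= lam.
Proof.
rewrite /clamp ler_norml; apply/andP; split; first by rewrite le_max lexx.
by rewrite ge_max ge_min lexx orbT andbT; have := lam0; lra.
Qed.

(** Taylor's bound: the derivative of [huber] is 2 [clamp], which is 2-Lipschitz. *)
Lemma huber_step g x : huber (g + x) <= huber g + 2 * clamp g * x + x ^+ 2.
Proof.
rewrite /huber /clamp.
have [a1|a1] := leP (g + x) lam; have [a2|a2] := leP (- lam) (Num.min (g + x) lam);
have [b1|b1] := leP g lam; have [b2|b2] := leP (- lam) (Num.min g lam);
move: a2 b2; rewrite ?(min_l a1) ?(min_l b1) ?(min_r (ltW a1)) ?(min_r (ltW b1)) => a2 b2;
rewrite ?(max_r a2) ?(max_l (ltW a2)) ?(max_r b2) ?(max_l (ltW b2));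
rewrite ?subrr ?normr0 ?mulr0 ?addr0; try nra.
all: have l := lam0; rewrite ?(gtr0_norm (_ : 0 < _ - lam)) ?(ltr0_norm (_ : _ - - lam < 0)); try nra; try lra.
Qed.

Lemma huber_ge x : Num.min (x ^+ 2) (lam ^+ 2) <= huber x.
Proof.
have l := lam0; rewrite /huber /clamp.
have [a1|a1] := leP x lam; have [a2|a2] := leP (- lam) (Num.min x lam);
  move: a2; rewrite ?(min_l a1) ?(min_r (ltW a1)) => a2;
  rewrite ?(max_r a2) ?(max_l (ltW a2)).
- by rewrite ge_min subrr normr0 mulr0 addr0 lexx.
- by rewrite ge_min; apply/orP; right; rewrite sqrrN lerDl !mulr_ge0// ltW.
- by rewrite ge_min; apply/orP; right; rewrite lerDl !mulr_ge0// ltW.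
- by rewrite ge_min; apply/orP; right; rewrite sqrrN lerDl !mulr_ge0// ltW.
Qed.

Lemma measurable_clamp : measurable_fun setT clamp.
Proof.
by apply: measurable_maxr => //; apply: measurable_minr.
Qed.

Lemma measurable_huber : measurable_fun setT huber.
Proof.
apply: measurable_funD.
  by apply: measurable_funX; exact: measurable_clamp.
apply: measurable_funM => //; apply: measurableT_comp => //.
by apply: measurable_funB => //; exact: measurable_clamp.
Qed.

Lemma increment_known i : bk i.+1 (fun w => tamed i.+1 w - tamed i w).
Proof. by apply: bounded_knownB; [exact: tamed_known|apply: bk_le (tamed_known i)]. Qed.

Lemma sum_square_known k : bk k (fun w => \sum_(i < k) (tamed i.+1 w - tamed i w) ^+ 2).
Proof.
elim: k => [|k ih].
  by under eq_fun do rewrite big_ord0; exact: bounded_known_cst.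
under eq_fun do rewrite big_ord_recr/=; apply: bounded_knownD; first exact: bk_le ih.
by apply: bounded_known_sqr; exact: increment_known.
Qed.

Lemma transform_known (r : nat -> Omega -> R) k : (forall i, bk i (r i)) ->
  bk k (fun w => \sum_(i < k) r i w * (tamed i.+1 w - tamed i w)).
Proof.
move=> br; elim: k => [|k ih].
  by under eq_fun do rewrite big_ord0; exact: bounded_known_cst.
under eq_fun do rewrite big_ord_recr/=; apply: bounded_knownD; first exact: bk_le ih.
by apply: bounded_knownM; [exact: bk_le (br k)|exact: increment_known].
Qed.

Lemma huber_known i g : bk i g -> bk i (fun w => huber (g w)).
Proof.
move=> [kg [C hC]]; split; first exact: (known_comp measurable_huber).
exists (lam ^+ 2 + 2 * lam * (C + lam)) => w.
have l0 := ltW lam0; rewrite /huber ger0_norm ?addr_ge0 ?sqr_ge0 ?mulr_ge0//.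
apply: lerD.
  rewrite -real_normK ?num_real// ler_sqr ?nnegrE//; exact: clamp_le.
apply: ler_wpM2l; first by rewrite mulr_ge0.
by apply: (le_trans (ler_normB _ _)); rewrite lerD ?hC ?clamp_le.
Qed.

(** Weak-type inequality of Burkholder for transforms with coefficients in [-1, 1]. Expanding
    [huber] along the partial sums, the first-order terms are drifts with a factor at most 2 lam and
    the second-order terms are the squares; each group costs at most 2 lam E|M|. *)
Lemma weak_transform (r : nat -> Omega -> R) m : (forall i, bk i (r i)) ->
  (forall i w, `|r i w| <= 1) ->
  E (fun w => huber (\sum_(i < m) r i w * (tamed i.+1 w - tamed i w)) * N m w) <=
  4 * lam * E (fun w => `|M m w|).
Proof.
move=> br r1; pose G k w := \sum_(i < k) r i w * (tamed i.+1 w - tamed i w).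
have bdy := increment_known; have bG k : bk k (G k) by exact: transform_known.
have bc k : bk k (fun w => clamp (G k w)).
  split; last by exists lam => w; exact: clamp_le.
  by apply: (known_comp measurable_clamp); case: (bG k).
have bh k := huber_known (bG k).
have step k : E (fun w => huber (G k.+1 w) * N k.+1 w) <=
    E (fun w => huber (G k w) * N k w) + 2 * lam * mass k +
    E (fun w => (tamed k.+1 w - tamed k w) ^+ 2 * N k.+1 w).
  have b2 : bk k (fun w => 2 * clamp (G k w) * r k w).
    by apply: bounded_knownM => //; apply: bounded_knownM => //; exact: bounded_known_cst.
  have b3 w : `|2 * clamp (G k w) * r k w| <= 2 * lam.
    rewrite normrM -[leRHS]mulr1; apply: ler_pM; rewrite ?r1//.
    by rewrite normrM ger0_norm// ler_wpM2l// clamp_le.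
  have d := @tamed_drift k (fun w => 2 * clamp (G k w) * r k w) (2 * lam) b2 b3.
  have I1 := IbkN k.+1 (bh k); have I2 := IbkN k.+1 (bounded_knownM (bk_le (leqnSn k) b2) (bdy k)).
  have I3 := IbkN k.+1 (bounded_knownM (bdy k) (bdy k)).
  rewrite -(fairN (leqnSn k) (bh k)).
  apply: (@le_trans _ _ (E (fun w => huber (G k w) * N k.+1 w) +
     E (fun w => 2 * clamp (G k w) * r k w * (tamed k.+1 w - tamed k w) * N k.+1 w) +
     E (fun w => (tamed k.+1 w - tamed k w) * (tamed k.+1 w - tamed k w) * N k.+1 w))).
    rewrite -!RintegralD//; last exact: integrable_funD.
    apply: le_Rintegral => //; [exact: IbkN (bh k.+1)|by apply: integrable_funD => //; exact: integrable_funD|].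
    move=> w _; rewrite -!mulrDl ler_wpM2r//; first exact: ltW.
    rewrite /G big_ord_recr/= -/(G k w); apply: le_trans (huber_step _ _) _.
    rewrite -addrA -[leRHS]addrA lerD2l.
    have rr : r k w ^+ 2 <= 1.
      by rewrite -real_normK ?num_real// expr_le1.
    have q := sqr_ge0 (tamed k.+1 w - tamed k w).
    by rewrite exprMn; have := ler_wpM2r q rr; rewrite mul1r expr2 (expr2 (tamed k.+1 w - tamed k w)); nra.
  rewrite -!addrA lerD2l; apply: lerD; last by [].
  by apply: le_trans (ler_norm _) d.
have key : E (fun w => huber (G m w) * N m w) <= 2 * lam * \sum_(i < m) mass i +
    \sum_(i < m) E (fun w => (tamed i.+1 w - tamed i w) ^+ 2 * N i.+1 w).
  elim: m => [|k ih]; last by rewrite !big_ord_recr/= mulrDr; have := step k; lra.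
  rewrite !big_ord0 mulr0 addr0 le_eqVlt; apply/orP; left; apply/eqP.
  rewrite -[RHS](Rintegral_probability_cst P 0); apply: eq_Rintegral => w _.
  rewrite /G big_ord0 /huber /clamp (min_l (ltW lam0)) max_r ?oppr_le0 ?ltW//.
  by rewrite subrr normr0 expr0n/= mulr0 addr0 mul0r.
apply: (le_trans key); have := sum_square m; have h := sum_mass m.
have a0 : 0 <= E (fun w => alive m w * `|M m w|).
  by apply: Rintegral_ge0 => w _; rewrite mulr_ge0//; case/andP: (alive_01 m w).
have l := ler_wpM2l (ltW lam0) h; have l0 := mulr_ge0 (ltW lam0) a0.
move: l; rewrite mulrDr; lra.
Qed.

End WeakType.

(** * Martingales and stochastic sums on a grid *)

Section Martingales.
Context {disp : measure_display} {Omega : measurableType disp} {R : realType}.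
Variables (P : probability Omega R) (T : R) (F : R -> set (set Omega)).
Hypothesis T_ge0 : 0 <= T.
Hypothesis filF : filtration T F.
Local Notation I f := (P.-integrable setT (EFin \o f)).
Local Notation E f := (\int[P]_w f w).
Local Notation bp := (bounded_predictable T F).
Local Notation soi := (stochastic_integral_operator P T F).
Local Notation martingale := (martingale P T F).

Lemma integrable_ae_eq f g : I f -> measurable_fun setT g ->
  {ae P, forall w, f w = g w} -> I g.
Proof.
move=> /integrableP[mf If] mg fg; apply/integrableP; split; first exact/measurable_EFinP.
rewrite (ae_eq_integral (fun w => `|(f w)%:E|%E))//.
- by apply: measurableT_comp => //; exact/measurable_EFinP.
- exact: measurableT_comp.
- by apply: filterS fg => w /= -> _.
Qed.

Lemma Rintegral_dominated (g_ : nat -> Omega -> R) (g f : Omega -> R) (C : R) :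
  (forall n, measurable_fun setT (g_ n)) -> (forall n w, `|g_ n w| <= C) ->
  (forall w, g_ n w @[n --> \oo] --> g w) -> I f ->
  E (fun w => g_ n w * f w) @[n --> \oo] --> E (fun w => g w * f w).
Proof.
move=> mg_ gC cv If; have mf : measurable_fun setT f by apply/measurable_EFinP; exact: measurable_int If.
have m_ n : measurable_fun setT (EFin \o (fun w => g_ n w * f w)).
  by apply/measurable_EFinP; exact: measurable_funM.
have mg : measurable_fun setT g.
  by apply: (measurable_fun_cvg mg_) => w _; exact: cv.
have ml : measurable_fun setT (EFin \o (fun w => g w * f w)).
  by apply/measurable_EFinP; exact: measurable_funM.
have c0 : {ae P, forall w, setT w -> (EFin \o (fun w => g_ n w * f w)) w @[n --> \oo] --> (EFin \o (fun w => g w * f w)) w}.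
  apply/aeW => w _; apply: cvg_EFin; first by near=> n.
  by apply: cvgM; [exact: cv|exact: cvg_cst].
have Ib : P.-integrable setT (EFin \o (fun w => C * `|f w|)).
  by apply: integrable_funZ; exact: integrable_norm.
have bd : {ae P, forall w n, setT w -> (`|(g_ n w * f w)%R%:E| <= (C * `|f w|)%R%:E)%E}.
  by apply/aeW => w n _; rewrite /= lee_fin normrM ler_wpM2r.
have [Il _ h] := dominated_convergence measurableT m_ ml c0 Ib bd.
apply: fine_cvg; rewrite fineK//; exact: (integrable_fin_num measurableT Il).
Unshelve. all: by end_near.
Qed.

Lemma martingale_measurable X t : martingale X -> t \in `[0, T] -> measurable_fun setT (X t).
Proof. by move=> [_ /(_ t) h _] /h /Lfun1_integrable /measurable_int /measurable_EFinP. Qed.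

Lemma martingale_integrable X t : martingale X -> t \in `[0, T] -> I (X t).
Proof. by move=> [_ /(_ t) h _] /h /Lfun1_integrable. Qed.

Lemma martingale_known X t : martingale X -> t \in `[0, T] -> known F t (X t).
Proof. by move=> [h _ _] tT; apply/(knownP filF) => // B mB; exact: h. Qed.

Lemma Rintegral_indicM (A : set Omega) (f : Omega -> R) :
  E (fun w => \1_A w * f w) = fine (\int[P]_(w in A) (f w)%:E)%E.
Proof.
rewrite /Rintegral [in RHS]integral_mkcond; congr (fine _); apply: eq_integral => w _.
by rewrite patchE indicE; case: (_ \in _); rewrite ?mul1r ?mul0r.
Qed.

(** From events in F_s to bounded functions by a monotone class argument. *)
Lemma martingale_test X s t g : martingale X -> s \in `[0, T] -> t \in `[0, T] -> s <= t ->
  bounded_known F s g -> E (fun w => g w * X t w) = E (fun w => g w * X s w).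
Proof.
move=> mX sT tT st [kg [C hC]].
have It := martingale_integrable mX tT; have Is := martingale_integrable mX sT.
have mk (h : Omega -> R) : measurable_fun (setT : set (g_sigma_algebraType (F s))) h -> measurable_fun setT h.
  by move=> kh; apply: (known_measurable filF sT).
have Ib r (h : Omega -> R) : r \in `[0, T] -> I (X r) -> measurable_fun (setT : set (g_sigma_algebraType (F s))) h ->
    (exists C : R, forall w, `|h w| <= C) -> I (fun w => h w * X r w).
  by move=> rT Ir mh bh; exact: (integrable_bounded_known filF sT).
move: kg hC; apply: (@bounded_measurable_ind _ (g_sigma_algebraType (F s)) _
  (fun g => E (fun w => g w * X t w) = E (fun w => g w * X s w))).
- move=> A mA; have [_ _ hX] := mX.
  have FA : F s A.
    by have [hs _ _] := filF; rewrite -(sigma_algebra_id (hs s sT)).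
  by rewrite !Rintegral_indicM (hX s t).
- move=> a f h mf mh bf bh ef eh.
  have e r : r \in `[0, T] -> I (X r) -> E (fun w => (a * f w + h w) * X r w) =
      a * E (fun w => f w * X r w) + E (fun w => h w * X r w).
    move=> rT Ir; rewrite -RintegralZl ?Ib// -RintegralD ?Ib//; last first.
      by apply: integrable_funZ; exact: Ib.
    by apply: eq_Rintegral => w _; rewrite mulrDl mulrA.
  by rewrite !e// ef eh.
- move=> f_ f C' mf_ mf fC cv ef.
  have c1 := Rintegral_dominated (fun n => mk _ (mf_ n)) fC cv It.
  have c2 := Rintegral_dominated (fun n => mk _ (mf_ n)) fC cv Is.
  have e : (fun n => E (fun w => f_ n w * X t w)) = fun n => E (fun w => f_ n w * X s w).
    by apply/funext => n; exact: ef.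
  by rewrite e in c1; exact: (cvg_unique _ c1 c2).
Qed.

Lemma fair_of_martingale (c : nat -> R) X (X' : nat -> Omega -> R) : martingale X ->
  (forall i, c i \in `[0, T]) -> (forall i j, (i <= j)%N -> c i <= c j) ->
  (forall i, measurable_fun setT (X' i)) ->
  (forall i, {ae P, forall w, X' i w = X (c i) w}) -> fair P F c X'.
Proof.
move=> mX cT cle mX' e i j g ij bg.
have mg := bounded_known_measurable filF (cT i) bg.
have h k : E (fun w => g w * X' k w) = E (fun w => g w * X (c k) w).
  apply: ae_eq_Rintegral.
  - exact: measurable_funM.
  - by apply: measurable_funM => //; exact: martingale_measurable.
  - by apply: filterS (e k) => w ->.
by rewrite !h; apply: martingale_test => //; exact: cle.
Qed.

(** Presents a stochastic sum as an integral of some |K| <= 1, so that the tightness constant of X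
    applies to sums along every grid. *)
Lemma op_step_sum X J (c : nat -> R) (r : nat -> Omega -> R) m : soi X J ->
  (forall i, c i \in `[0, T]) -> (forall i j, (i <= j)%N -> c i <= c j) ->
  (forall i, known F (c i) (r i)) -> (forall i w, `|r i w| <= 1) ->
  exists K, [/\ predictable T F K, forall t w, t \in `[0, T] -> `|K t w| <= 1 &
    {ae P, forall w, J K T w = \sum_(i < m) r i w * (X (c i.+1) w - X (c i) w)}].
Proof.
move=> op cT cle kr r1; have TT := T_in T_ge0.
have c0 i : 0 <= c i by have := cT i; rewrite in_itv/= => /andP[].
have c1 i : c i <= T by have := cT i; rewrite in_itv/= => /andP[].
pose K_ (i : 'I_m) t w : R := \1_(`]c i, c i.+1]) t * r i w.
have bK i : bp (K_ i).
  split.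
    apply: (predictable_known_indic T_ge0 filF (c0 i) (cle _ _ (leqnSn i)) (c1 _) (kr i) (C := 1)).
    exact: r1.
  exists 1 => t w _; rewrite normrM -[1]mulr1; apply: ler_pM => //; exact: norm_indic_le1.
have [bS hS] := op_sum op (index_enum 'I_m) bK TT.
exists (fun t w => \sum_(i < m) K_ i t w); split.
- exact: bp_pred bS.
- move=> t w _; apply: le_trans (ler_norm_sum _ _ _) _.
  apply: le_trans (sum_indic_intervals m t (fun i => cle _ _ (leqnSn i))).
  apply: ler_sum => i _; rewrite normrM -[leRHS]mulr1; apply: ler_pM => //.
  by rewrite ger0_norm// indicE.
have h : {ae P, forall w, forall i, J (K_ i) T w = r i w * (X (c i.+1) w - X (c i) w)}.
  apply: ae_forall_ord => i.
  have b1 : bp (fun _ _ => 1) by exact: bp_cst.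
  have l := op_local_known T_ge0 filF op (c0 i) (cle _ _ (leqnSn i)) (c1 _) (kr i) (r1 i) b1.
  have E1 : (fun u w => \1_(`]c i, c i.+1]) u * r i w * 1) = K_ i.
    by apply/funext => u; apply/funext => w; rewrite mulr1.
  rewrite E1 in l.
  apply: filterS3 l (op_one T_ge0 filF op (cT i.+1)) (op_one T_ge0 filF op (cT i)) => w -> -> ->.
  by congr (_ * _); ring.
by apply: filterS2 hS h => w -> hw; apply: eq_bigr => i _; exact: hw.
Qed.

Lemma tight_real f : measurable_fun setT f -> forall e, 0 < e ->
  exists2 C : R, 0 < C & l0 P (fun w => C^-1 * f w) <= e.
Proof.
move=> mf e e0.
have := @vanishing_l0_ae _ _ _ P (fun n w => n.+1%:R^-1 * f w) (fun=> 0) _ _ _.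
case/(_ _ _ _ e e0).
- by move=> n; exact: measurable_funM.
- exact: measurable_cst.
- apply/aeW => w; rewrite -[X in _ --> X](mul0r (f w)).
  by apply: cvgM; [exact: cvg_harmonic|exact: cvg_cst].
move=> N /(_ N (leqnn N)) h; exists N.+1%:R => //.
by move: h; under eq_fun do rewrite subr0.
Qed.

(** The inequality 2 x u <= tau x^2 + u^2 / tau, summed. The weight balances the square sum of X,
    which is merely bounded, against that of U, which will be small. *)
Lemma weighted_sum_bound (U X k : nat -> R) (tau : R) m : 0 < tau ->
  (forall i, `|k i| <= 1) ->
  `|\sum_(i < m) k i * ((X i.+1 - X i) * (U i.+1 - U i))| <=
   (tau * \sum_(i < m) (X i.+1 - X i) ^+ 2 + tau^-1 * \sum_(i < m) (U i.+1 - U i) ^+ 2) / 2.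
Proof.
move=> t0 k1; rewrite !mulr_sumr -big_split/= mulr_suml.
apply: le_trans (ler_norm_sum _ _ _) _; apply: ler_sum => i _.
set x := X i.+1 - X i; set u := U i.+1 - U i.
apply: (@le_trans _ _ `|x * u|); first by rewrite normrM ler_piMl.
have h (a b : R) : a * b <= (tau * a ^+ 2 + tau^-1 * b ^+ 2) / 2.
  have e : (tau * a ^+ 2 + tau^-1 * b ^+ 2) / 2 - a * b = tau^-1 * (tau * a - b) ^+ 2 / 2.
    by field; rewrite gt_eqF.
  by rewrite -subr_ge0 e divr_ge0// mulr_ge0 ?invr_ge0 ?sqr_ge0// ltW.
rewrite ler_norml; apply/andP; split; last exact: h.
by have := h (- x) u; rewrite sqrrN mulNr; lra.
Qed.

(** Discrete form of [X] = X^2 - X_0^2 - 2 X_- . X; it bounds the square sum of X through an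
    integral against X. *)
Lemma sum_square_by_parts (X : nat -> R) m :
  \sum_(i < m) (X i.+1 - X i) ^+ 2 = X m ^+ 2 - X 0%N ^+ 2 - 2 * \sum_(i < m) X i * (X i.+1 - X i).
Proof.
elim: m => [|m ih]; first by rewrite !big_ord0; ring.
by rewrite !big_ord_recr/= ih; ring.
Qed.

Lemma product_increments (U X k : nat -> R) m :
  \sum_(i < m) k i * (U i.+1 * X i.+1 - U i * X i) =
  \sum_(i < m) k i * U i * (X i.+1 - X i) + \sum_(i < m) k i * X i * (U i.+1 - U i) +
  \sum_(i < m) k i * ((X i.+1 - X i) * (U i.+1 - U i)).
Proof.
by rewrite -!big_split/=; apply: eq_bigr => i _; ring.
Qed.

Lemma measurable_positive_part : measurable_fun setT (fun x : R => if 0 < x then x else 1).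
Proof.
apply: measurable_fun_ifT => //; exact: measurable_fun_ltr.
Qed.

End Martingales.

(** * Integrals of deflated martingales *)

Section DeflatedIntegrals.
Context {disp : measure_display} {Omega : measurableType disp} {R : realType}.
Variables (P : probability Omega R) (T : R) (F : R -> set (set Omega)).
Hypothesis T_ge0 : 0 <= T.
Hypothesis filF : filtration T F.
Local Notation I f := (P.-integrable setT (EFin \o f)).
Local Notation E f := (\int[P]_w f w).
Local Notation bp := (bounded_predictable T F).
Local Notation soi := (stochastic_integral_operator P T F).
Local Notation martingale := (martingale P T F).

Lemma knownM s (f g : Omega -> R) : known F s f -> known F s g -> known F s (fun w => f w * g w).
Proof. by rewrite /known => kf kg; exact: measurable_funM. Qed.

Lemma known_cst s (a : R) : known F s (fun=> a).
Proof. exact: measurable_cst. Qed.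

(** Frozen at T, so that every natural number is a legal index, as the weak-type inequalities
    require. *)
Definition grid (n i : nat) : R := dyadic T n (minn i (2 ^ n)).

Lemma grid_in n i : grid n i \in `[0, T].
Proof. by apply: dyadic_in => //; exact: geq_minr. Qed.

Lemma grid_le n i j : (i <= j)%N -> grid n i <= grid n j.
Proof.
move=> ij; apply: dyadic_le => //; rewrite leq_min geq_minr andbT.
by apply: leq_trans ij; exact: geq_minl.
Qed.

Lemma grid0 n : grid n 0 = 0.
Proof. by rewrite /grid min0n dyadic0. Qed.

Lemma gridT n : grid n (2 ^ n) = T.
Proof. by rewrite /grid minnn dyadicT. Qed.

Lemma grid_dyadic n i : (i <= 2 ^ n)%N -> grid n i = dyadic T n i.
Proof. by move=> i2; rewrite /grid (minn_idPl i2). Qed.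

Lemma sum_le8 (x1 x2 x3 x4 x5 x6 a : R) : x1 <= a -> x2 <= a -> x3 <= a -> x4 <= a -> x5 <= a ->
  x6 <= a -> x1 + 2 * a + x2 + x3 + x4 + x5 + x6 <= 8 * a.
Proof. lra. Qed.

(* On the event that nothing exceeds its level the integral of [k] is split
   by parts; every other event costs its probability. *)
Lemma ky_fan_split (s t Q x0 t2 h psi a e : R) : 0 <= Q -> 0 <= psi -> 0 <= e -> 0 <= a ->
  (Q < 1 -> `|x0| < 1 -> `|t2| < 1 -> `|h| < 1 -> psi * a < 1 -> `|s| <= `|t| + e) ->
  Num.min `|s| 1 <= Num.min `|t| 1 + e + Q + Num.min `|x0| 1 + Num.min `|t2| 1 +
    Num.min `|h| 1 + psi * a.
Proof.
move=> Q0 p0 e0 a0 H.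
have pa := mulr_ge0 p0 a0.
have m0 (x : R) : 0 <= Num.min `|x| 1 by rewrite le_min normr_ge0 ler01.
have s1 : Num.min `|s| 1 <= 1 by rewrite ge_min lexx orbT.
have mt := m0 t; have m2 := m0 t2; have mx := m0 x0; have mh := m0 h.
have big (x : R) : 1 <= `|x| -> 1 <= Num.min `|x| 1 by move=> hx; rewrite le_min hx lexx.
have lt1 (x : R) : `|x| < 1 \/ 1 <= Num.min `|x| 1.
  by case: (boolP (`|x| < 1)) => [|]; [left|rewrite -leNgt => /big; right].
case: (boolP (Q < 1)) => [q1|]; last by rewrite -leNgt => q1; lra.
case: (lt1 x0) => x1; last by lra.
case: (lt1 t2) => t1; last by lra.
case: (lt1 h) => h1; last by lra.
case: (boolP (psi * a < 1)) => [a1|]; last by rewrite -leNgt => a1; lra.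
have := H q1 x1 t1 h1 a1 => hs.
case: (lt1 t) => tt; last by lra.
have -> : Num.min `|t| 1 = `|t| by apply: min_l; exact: ltW.
have : Num.min `|s| 1 <= `|s| by rewrite ge_min lexx.
lra.
Qed.

Lemma sum_lt1 (x y z : R) : 0 <= x -> 0 <= y -> 0 <= z -> x + y + z < 1 ->
  [/\ x < 1, y < 1 & z < 1].
Proof. by move=> *; split; lra. Qed.

Lemma cancel_scale (x k u v : R) : x != 0 -> k * u * v = x^-1 * (k * (u / x^-1) * v).
Proof. by move=> x0; field. Qed.

Lemma parts_bound (rho C x y j : R) : 0 < rho -> x ^+ 2 <= rho ^+ 2 -> - j <= C ->
  x ^+ 2 - y ^+ 2 - 2 * (rho * j) <= rho ^+ 2 + 2 * rho * C.
Proof.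
move=> r0 hx hj; have := ler_wpM2l (ltW r0) hj; have := sqr_ge0 y.
by rewrite mulrN; lra.
Qed.

Lemma split_bound (a t r s u v : R) : `|r| <= a -> `|s| <= (u + v) / 2 -> u <= a -> v <= a ->
  `|t + r + s| <= `|t| + 2 * a.
Proof.
move=> hr hs hu hv; have := ler_normD (t + r) s; have := ler_normD t r; lra.
Qed.

Variables (X Z : R -> Omega -> R) (JX : (R -> Omega -> R) -> R -> Omega -> R).
Hypothesis opX : soi X JX.
Hypothesis kX : forall t, t \in `[0, T] -> known F t (X t).
Hypothesis mZX : martingale (fun t w => Z t w * X t w).
Hypothesis Z_gt0 : strictly_positive P T Z.
Hypothesis X_gt0 : strictly_positive P T X.

(** X - X_0 is the integral of 1, so tightness and the maximal inequality bound its whole path in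
    probability; C sits inside the integrand so that both apply directly. *)
Lemma op_tight_sup e : 0 < e -> exists2 C : R, 0 < C &
  l0 P (running_sup T (JX (fun _ _ => C^-1))) <= e.
Proof.
move=> e0; have TT := T_in T_ge0; pose e' := Num.min (e / 2) 1.
have e'0 : 0 < e' by rewrite lt_min ltr01 divr_gt0.
have e'1 : e' <= 1 by rewrite ge_min lexx orbT.
have e'k : e' <= e / 2 by rewrite ge_min lexx.
have eta0 : 0 < e' * e / 4 by rewrite divr_gt0// mulr_gt0.
have [C C0 hC] := op_tight T_ge0 opX eta0; exists C => //.
have bC : bp (fun _ _ => C^-1) by exact: bp_cst.
have nk t : t \in `[0, T] -> nearly_known P F t (JX (fun _ _ => C^-1) t).
  move=> tT; apply: (op_nearly_known T_ge0 filF opX) => //.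
  - by move=> u uT; apply: known_nearly; exact: kX.
  - by move=> u uT; apply: (known_measurable filF uT); exact: kX.
apply: le_trans (op_running_sup T_ge0 filF opX nk bC e'0 e'1 (eta := e' * e / 4) _) _.
  move=> K pK K1; have bK : bp K by split=> //; exists 1.
  have h := op_scale opX C^-1 bK TT.
  apply: le_trans (hC K pK K1); rewrite le_eqVlt; apply/orP; left; apply/eqP; apply: l0_ae.
  - by apply: (op_measurable opX) => //; exact: bpM.
  - by apply: measurable_funM => //; exact: (op_measurable opX).
  - apply: filterS h => w <-; congr (JX _ T w).
    by apply/funext => t; apply/funext => v; rewrite mulrC.
have -> : 2 * (e' * e / 4) / e' = e / 2 by field; rewrite gt_eqF.
lra.
Qed.

(** The central estimate. On a grid, with U = V / X, the sum of k dV splits into k U dX, small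
    because |U| <= lam, k X dU, small by [weak_transform], and k dX dU, small by the two square
    sums. All constants are fixed before V, K and the grid, from tightness involving X and Z_T X_T
    alone. *)
Lemma deflated_small e : 0 < e -> exists2 delta : R, 0 < delta &
  forall V J, soi V J -> martingale (fun t w => Z t w * V t w) ->
    {ae P, forall w, V 0 w = 0} -> E (fun w => `|Z T w * V T w|) <= delta ->
    forall K, predictable T F K -> (forall t w, t \in `[0, T] -> `|K t w| <= 1) ->
      l0 P (J K T) <= e.
Proof.
(* Nine shares of e: six expectations, the constant 2 a, and one share for replacing K by a step
   process. *)
move=> e_gt0; pose a : R := e / 9; have a0 : 0 < a by rewrite divr_gt0.
have TT := T_in T_ge0; have z0 := zero_in T_ge0.
have mN := martingale_measurable mZX TT.
have [C1 C10 hC1] := op_tight T_ge0 opX a0.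
have [C2 C20 hC2] := op_tight_sup a0.
have mX0 : measurable_fun setT (X 0) by apply: (known_measurable filF z0); exact: kX.
have [C3 C30 hC3] := tight_real P mX0 a0.
have mNi : measurable_fun setT (fun w => (Z T w * X T w)^-1).
  exact: (measurableT_comp (@measurable_inv R) mN).
have [C4 C40 hC4] := tight_real P mNi a0.
(* With |U| <= lam the sum of k U dX is lam times an integral against X with integrand in [-1, 1],
   which C1 makes small. *)
pose lam := C1^-1; have lam0 : 0 < lam by rewrite invr_gt0.
(* Bounds |X| along the grid when |X - X_0| <= C2 and |X_0| <= C3. *)
pose rho := C2 + C3; have rho0 : 0 < rho by rewrite addr_gt0.
(* Bounds the square sum of X, by [sum_square_by_parts] and |X| <= rho. *)
pose B := rho ^+ 2 + 2 * rho * C1.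
have B0 : 0 < B by rewrite addr_gt0 ?exprn_gt0// !mulr_gt0.
(* By [huber_ge] a value of [huber] below q forces the transform under a / rho; rho comes from
   normalizing X to [-1, 1]. *)
pose q := Num.min ((a / rho) ^+ 2) (lam ^+ 2).
have q0 : 0 < q by rewrite lt_min !exprn_gt0// divr_gt0.
pose tau := a / B; have tau0 : 0 < tau by rewrite divr_gt0.
(* The coefficients with which the maximal, the transform and the square inequality enter the bound
   for E[Psi N]. *)
pose D := lam^-1 + 4 * lam / q + 2 * lam / (a * tau).
have D0 : 0 < D.
  by rewrite /D !addr_gt0 ?divr_gt0 ?mulr_gt0 ?invr_gt0.
(* C4 bounds 1 / (Z_T X_T) up to small probability and so turns the N-weighted estimate into one
   under P. *)
exists (a / (D * C4)); first by rewrite divr_gt0// mulr_gt0.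
move=> V J op mZV V0 small_a K pK K1.
have bK : bp K by split=> //; exists 1.
have [n [k [sk k1 hk]]] := op_approx_contraction T_ge0 filF op pK K1 a0.
have bk : bp k by split; [exact: (dyadic_simple_predictable T_ge0 filF sk k1)|exists 1].
have mJ H : bp H -> measurable_fun setT (J H T) by move=> bH; exact: (op_measurable op).
pose c := grid n; pose m := (2 ^ n)%N.
have cT i : c i \in `[0, T] by exact: grid_in.
have cle i j : (i <= j)%N -> c i <= c j by exact: grid_le.
have cm : c m = T by exact: gridT.
(* Null sets are repaired so that N > 0, and below [M 0] = 0, hold everywhere, as the discrete
   inequalities assume; integrals do not notice. *)
pose pos (x : R) : R := if 0 < x then x else 1.
pose N i w := pos (Z (c i) w * X (c i) w).
pose M i w := if i == 0%N then 0 else Z (c i) w * V (c i) w.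
have kN i : known F (c i) (N i).
  by apply: (known_comp measurable_positive_part); exact: martingale_known mZX (cT i).
have kM i : known F (c i) (M i).
  rewrite /M; case: (i == 0%N); first exact: measurable_cst.
  exact: martingale_known mZV (cT i).
have N_gt0 i w : 0 < N i w by rewrite /N /pos; case: ifP.
have M0 w : M 0%N w = 0 by [].
have eN i : {ae P, forall w, N i w = Z (c i) w * X (c i) w}.
  by apply: filterS2 Z_gt0 X_gt0 => w hZ hX; rewrite /N /pos mulr_gt0 ?hZ ?hX.
have eM i : {ae P, forall w, M i w = Z (c i) w * V (c i) w}.
  rewrite /M; have [->|i0] := eqVneq i 0%N; last by apply/aeW.
  by rewrite /c grid0; apply: filterS V0 => w ->; rewrite mulr0.
have mN' i := known_measurable filF (cT i) (kN i).
have mM' i := known_measurable filF (cT i) (kM i).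
have IN i : I (N i).
  apply: (integrable_ae_eq (martingale_integrable mZX (cT i)) (mN' i)).
  by apply: filterS (eN i) => w ->.
have IM i : I (M i).
  apply: (integrable_ae_eq (martingale_integrable mZV (cT i)) (mM' i)).
  by apply: filterS (eM i) => w ->.
have fN := fair_of_martingale filF mZX cT cle mN' eN.
have fM := fair_of_martingale filF mZV cT cle mM' eM.
pose U := ratio N M; pose y := tamed N M lam; pose b := alive N M lam.
pose kk i w := if (i < m)%N then k (c i.+1) w else 0.
have kk_known i : known F (c i) (kk i).
  rewrite /kk; case: (ltnP i m) => im; last exact: measurable_cst.
  by have [_ /(_ i im) [h _]] := sk; rewrite /c !grid_dyadic// ltnW.
have kk1 i w : `|kk i w| <= 1.
  by rewrite /kk; case: ifP => _; rewrite ?k1// normr0.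
have bkk i : bounded_known F (c i) (kk i) by split=> //; exists 1.
have byk i : bounded_known F (c i) (y i).
  exact: (tamed_known filF cT cle lam0 kN kM M0).
pose r1 i w := kk i w * (y i w / lam).
have r1k i : known F (c i) (r1 i).
  by apply: knownM => //; apply: knownM; [case: (byk i)|exact: known_cst].
have r11 i w : `|r1 i w| <= 1.
  rewrite normrM -[1]mulr1; apply: ler_pM => //.
  rewrite normrM normfV (gtr0_norm lam0) ler_pdivrMr// mul1r.
  exact: tamed_le.
pose cx i w := clip (X (c i) w / rho).
have cxk i : known F (c i) (cx i).
  apply: (known_comp (@measurable_clip R)); apply: knownM; [exact: kX|exact: known_cst].
have cx1 i w : `|cx i w| <= 1 by exact: clip_le1.
have bcx i : bounded_known F (c i) (cx i) by split=> //; exists 1.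
pose r3 i w := kk i w * cx i w.
have b3 i : bounded_known F (c i) (r3 i) by exact: bounded_knownM.
have r31 i w : `|r3 i w| <= 1.
  by rewrite normrM -[1]mulr1; apply: ler_pM.
have [K1' [pK1 K11 hK1]] := op_step_sum T_ge0 filF m opX cT cle r1k r11.
have [K2' [pK2 K21 hK2]] := op_step_sum T_ge0 filF m opX cT cle cxk cx1.
have wm := weak_maximal filF cT cle lam0 kN kM IN IM N_gt0 M0 fN fM m.
have ws := weak_square filF cT cle lam0 kN kM IN IM N_gt0 M0 fN fM m.
have wt := weak_transform filF cT cle lam0 kN kM IN IM N_gt0 M0 fN fM m b3 r31.
pose alpha := E (fun w => `|M m w|).
have alphaE : alpha <= a / (D * C4).
  apply: le_trans small_a; rewrite le_eqVlt; apply/orP; left; apply/eqP.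
  apply: ae_eq_Rintegral.
  - exact: measurableT_comp.
  - by apply: measurableT_comp => //; exact: martingale_measurable mZV TT.
  - by apply: filterS (eM m) => w ->; rewrite cm.
pose G w := \sum_(i < m) r3 i w * (y i.+1 w - y i w).
pose Sq w := \sum_(i < m) (y i.+1 w - y i w) ^+ 2.
have bG : bounded_known F (c m) (fun w => huber lam (G w)).
  apply: (huber_known lam0).
  exact: (transform_known filF cT cle lam0 kN kM M0).
have bSq : bounded_known F (c m) Sq.
  exact: (sum_square_known filF cT cle lam0 kN kM M0).
have bb : bounded_known F (c m) (fun w => 1 - b m w).
  apply: bounded_knownB; first exact: bounded_known_cst.
  exact: (alive_known filF cT cle lam0 kN kM M0).
have If1 g : bounded_known F (c m) g -> I (fun w => g w * N m w).
  by move=> bg; apply: (integrable_bounded_known filF (cT m)).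
(* Each summand reaches 1 on one bad event: exit from [-lam, lam], large transform, large square
   sum. *)
pose Psi w := (1 - b m w) + huber lam (G w) / q + Sq w / (a * tau).
have Psi0 w : 0 <= Psi w.
  rewrite /Psi; apply: addr_ge0; first apply: addr_ge0.
  - by rewrite subr_ge0; case/andP: (alive_01 N M lam m w).
  - apply: divr_ge0; last exact: ltW.
    by rewrite /huber addr_ge0 ?sqr_ge0// !mulr_ge0// ltW.
  - by apply: divr_ge0; [apply: sumr_ge0 => i _; exact: sqr_ge0|rewrite ltW// mulr_gt0].
have bPsi : bounded_known F (c m) Psi.
  apply: bounded_knownD; last by apply: bounded_knownM => //; exact: bounded_known_cst.
  by apply: bounded_knownD => //; apply: bounded_knownM => //; exact: bounded_known_cst.
have EPsi : E (fun w => Psi w * N m w) <= alpha * D.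
  have -> : E (fun w => Psi w * N m w) = E (fun w => (1 - b m w) * N m w) +
     q^-1 * E (fun w => huber lam (G w) * N m w) + (a * tau)^-1 * E (fun w => Sq w * N m w).
    have J1 := If1 _ bb; have J2 := integrable_funZ q^-1 (If1 _ bG).
    have J3 := integrable_funZ (a * tau)^-1 (If1 _ bSq).
    rewrite -(RintegralZl _ measurableT (If1 _ bG)) -(RintegralZl _ measurableT (If1 _ bSq)).
    rewrite -(RintegralD measurableT J1 J2) -(RintegralD measurableT (integrable_funD J1 J2) J3).
    by apply: eq_Rintegral => w _; rewrite /Psi; ring.
  have w1 : E (fun w => (1 - b m w) * N m w) <= lam^-1 * alpha.
    by rewrite mulrC ler_pdivlMr// mulrC.
  have w2 : q^-1 * E (fun w => huber lam (G w) * N m w) <= q^-1 * (4 * lam * alpha).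
    by rewrite ler_wpM2l// invr_ge0 ltW.
  have w3 : (a * tau)^-1 * E (fun w => Sq w * N m w) <= (a * tau)^-1 * (2 * lam * alpha).
    by rewrite ler_wpM2l// invr_ge0 ltW// mulr_gt0.
  have -> : alpha * D = lam^-1 * alpha + q^-1 * (4 * lam * alpha) + (a * tau)^-1 * (2 * lam * alpha).
    by rewrite /D; ring.
  by rewrite !lerD.
have hJk := op_dyadic_simple T_ge0 filF op sk k1.
pose W := JX (fun _ _ => C2^-1).
have bC2 : bp (fun _ _ => C2^-1) by exact: bp_cst.
have hW : {ae P, forall w, forall i, W (c i) w = C2^-1 * (X (c i) w - X 0 w)}.
  apply: ae_foralln => i; have b1 : bp (fun _ _ => 1) by exact: bp_cst.
  have s := op_scale opX C2^-1 b1 (cT i).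
  apply: filterS2 s (op_one T_ge0 filF opX (cT i)) => w s1 <-; rewrite -s1 /W.
  by congr (JX _ _ w); apply/funext => u; apply/funext => v; rewrite mulr1.
have main : {ae P, forall w, Num.min `|J k T w| 1 <= Num.min `|C1^-1 * JX K1' T w| 1 + 2 * a +
    running_sup T W w + Num.min `|C3^-1 * X 0 w| 1 + Num.min `|C1^-1 * JX K2' T w| 1 +
    Num.min `|C4^-1 * (Z T w * X T w)^-1| 1 + Psi w * (C4 * N m w)}.
  have h1 := ae_and hJk hW; have h2 := ae_and hK1 hK2.
  have h3 := ae_and (ae_foralln eN) (ae_foralln eM).
  have h4 := ae_and Z_gt0 X_gt0.
  apply: filterS3 (ae_and h1 h2) h3 h4 => w [[eJ eW] [e1 e2]] [hN hM] [hZ hX].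
  apply: ky_fan_split.
  - exact: running_sup_ge0.
  - exact: Psi0.
  - by rewrite mulr_ge0// ltW.
  - by rewrite mulr_ge0// ltW.
  move=> Q1 x01 t21 h41 P1.
  (* Off the event of large 1 / (Z_T X_T) one has C4 N > 1, so the weighted smallness of [Psi]
     implies the plain one. *)
  have P1' : Psi w < 1.
    have NC : 1 < C4 * N m w.
      move: h41; rewrite hN cm -invfM normfV ger0_norm; last first.
        by rewrite mulr_ge0 ?ltW// mulr_gt0 ?hZ ?hX.
      by rewrite invf_lt1// mulr_gt0// mulr_gt0 ?hZ ?hX.
    apply: le_lt_trans P1; rewrite ler_peMr//; exact: ltW.
  have p1 : 0 <= 1 - b m w by rewrite subr_ge0; case/andP: (alive_01 N M lam m w).
  have p2 : 0 <= huber lam (G w) / q.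
    apply: divr_ge0; last exact: ltW.
    by rewrite /huber addr_ge0 ?sqr_ge0// !mulr_ge0// ltW.
  have p3 : 0 <= Sq w / (a * tau).
    by apply: divr_ge0; [apply: sumr_ge0 => i _; exact: sqr_ge0|rewrite ltW// mulr_gt0].
  have [q1 q2 q3] := sum_lt1 p1 p2 p3 P1'.
  have bm : all (small N M lam ^~ w) (iota 0 m.+1).
    apply: contraT => nb; have b0 : b m w = 0 by rewrite /b /alive (negbTE nb).
    by move: q1; rewrite b0 subr0 ltxx.
  have yU i : (i <= m)%N -> y i w = U i w.
    move=> im; rewrite /y /tamed /alive (_ : all _ _) ?mul1r//.
    apply/allP => j; rewrite mem_iota => /andP[_ ji]; apply: (allP bm).
    by rewrite mem_iota/= ltnS (leq_trans _ im)// -ltnS.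
  have yU1 (i : 'I_m) : y i.+1 w = U i.+1 w := yU _ (ltn_ord i).
  have yU0 (i : 'I_m) : y i w = U i w := yU _ (ltnW (ltn_ord i)).
  have hub : huber lam (G w) < q.
    by rewrite -[X in _ < X]mul1r -ltr_pdivrMr.
  have Gs : `|G w| <= a / rho.
    have hg := le_lt_trans (huber_ge lam0 (G w)) hub.
    rewrite leNgt; apply/negP => hG; move: hg; rewrite ltNge => /negP; apply.
    rewrite /q le_min !ge_min lexx orbT andbT; apply/orP; left.
    rewrite -[leRHS]real_normK ?num_real// ler_sqr ?nnegrE ?normr_ge0 ?divr_ge0 ?ltW//.
  have Sqs : Sq w <= a * tau.
    have at0 : 0 < a * tau by exact: mulr_gt0.
    by apply: ltW; rewrite -[X in _ < X]mul1r -ltr_pdivrMr.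
  have Xb i : `|X (c i) w| <= rho.
    have h := running_sup_lt1 T_ge0 (op_cadlag opX bC2) (cT i) Q1.
    have h' : `|W (c i) w| <= 1 by apply: le_trans h _; exact: ltW.
    move: h' x01; rewrite eW !normrM !normfV (gtr0_norm C20) (gtr0_norm C30).
    rewrite !ler_pdivrMl// ltr_pdivrMl// !mulr1 => u1 u2.
    have -> : X (c i) w = (X (c i) w - X 0 w) + X 0 w by ring.
    by apply: le_trans (ler_normD _ _) _; rewrite lerD// ltW.
  have cxE i : rho * cx i w = X (c i) w.
    rewrite /cx clip_id; first by rewrite mulrC divfK// gt_eqF.
    by rewrite normrM normfV (gtr0_norm rho0) ler_pdivrMr// mul1r.
  have VU i : V (c i) w = U i w * X (c i) w.
    rewrite /U /ratio hN hM; have z1 := hZ _ (cT i); have x1 := hX _ (cT i).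
    by field; rewrite !gt_eqF.
  have sJ : J k T w = \sum_(i < m) kk i w * (U i.+1 w * X (c i.+1) w - U i w * X (c i) w).
    rewrite eJ; apply: eq_bigr => i _; have i2 := ltn_ord i.
    by rewrite -!VU /kk i2 /c !grid_dyadic// ltnW.
  have S1 : \sum_(i < m) kk i w * U i w * (X (c i.+1) w - X (c i) w) = C1^-1 * JX K1' T w.
    rewrite e1 mulr_sumr; apply: eq_bigr => i _.
    by rewrite /r1 yU0; apply: cancel_scale; rewrite gt_eqF.
  have S2 : \sum_(i < m) kk i w * X (c i) w * (U i.+1 w - U i w) = rho * G w.
    rewrite mulr_sumr; apply: eq_bigr => i _; rewrite /r3 yU0 yU1 -cxE.
    by rewrite !mulrA [rho * _]mulrC.
  have S3 := weighted_sum_bound (fun i => U i w) (fun i => X (c i) w) m tau0 (fun i => kk1 i w).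
  have SU : \sum_(i < m) (U i.+1 w - U i w) ^+ 2 = Sq w.
    by apply: eq_bigr => i _; rewrite yU0 yU1.
  have SX : \sum_(i < m) (X (c i.+1) w - X (c i) w) ^+ 2 <= B.
    rewrite (sum_square_by_parts (fun i => X (c i) w)).
    have -> : \sum_(i < m) X (c i) w * (X (c i.+1) w - X (c i) w) = rho * JX K2' T w.
      by rewrite e2 mulr_sumr; apply: eq_bigr => i _; rewrite mulrA cxE.
    have x1 : X (c m) w ^+ 2 <= rho ^+ 2.
      by rewrite -[leLHS]real_normK ?num_real// ler_sqr ?nnegrE ?normr_ge0 ?Xb// ltW.
    have x3 : - JX K2' T w <= C1.
      move: t21; rewrite normrM normfV (gtr0_norm C10) ltr_pdivrMl// mulr1 => t2.
      by apply: ltW; apply: le_lt_trans t2; rewrite -normrN ler_norm.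
    exact: parts_bound.
  rewrite sJ (product_increments (fun i => U i w) (fun i => X (c i) w) (fun i => kk i w)) S1 S2.
  have n2 : `|rho * G w| <= a.
    by rewrite normrM (gtr0_norm rho0) mulrC -ler_pdivlMr.
  have n3 : tau * \sum_(i < m) (X (c i.+1) w - X (c i) w) ^+ 2 <= a.
    by apply: le_trans (ler_wpM2l (ltW tau0) SX) _; rewrite /tau divfK// gt_eqF.
  have n4 : tau^-1 * \sum_(i < m) (U i.+1 w - U i w) ^+ 2 <= a.
    by rewrite SU mulrC ler_pdivrMr.
  exact: split_bound n2 S3 n3 n4.
have Il (f : Omega -> R) : measurable_fun setT f -> I (fun w => Num.min `|f w| 1).
  exact: l0_integrable.
have mJ1 : measurable_fun setT (fun w => C1^-1 * JX K1' T w).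
  by apply: measurable_funM => //; apply: (op_measurable opX) => //; split=> //; exists 1.
have mJ2 : measurable_fun setT (fun w => C1^-1 * JX K2' T w).
  by apply: measurable_funM => //; apply: (op_measurable opX) => //; split=> //; exists 1.
have mX0' : measurable_fun setT (fun w => C3^-1 * X 0 w) by exact: measurable_funM.
have mNi' : measurable_fun setT (fun w => C4^-1 * (Z T w * X T w)^-1) by exact: measurable_funM.
have mrs : measurable_fun setT (running_sup T W).
  by apply: measurable_running_sup => // t tT; exact: (op_measurable opX).
have Irs : I (running_sup T W).
  apply: (@bounded_integrable _ _ _ _ _ 1) => // w.
  by rewrite ger0_norm ?running_sup_le1 ?running_sup_ge0.
have IPsi : I (fun w => Psi w * (C4 * N m w)).
  apply: (integrable_fun_eq (f := fun w => C4 * (Psi w * N m w))); first by move=> w; ring.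
  by apply: integrable_funZ; exact: If1.
have b1 := hC1 K1' pK1 K11; have b2 := hC1 K2' pK2 K21.
have ers : E (running_sup T W) <= a.
  apply: le_trans hC2; rewrite le_eqVlt; apply/orP; left; apply/eqP.
  apply: eq_Rintegral => w _.
  by rewrite ger0_norm ?running_sup_ge0// min_l// running_sup_le1.
have eps : E (fun w => Psi w * (C4 * N m w)) <= a.
  have -> : E (fun w => Psi w * (C4 * N m w)) = C4 * E (fun w => Psi w * N m w).
    by rewrite -RintegralZl ?If1//; apply: eq_Rintegral => w _; ring.
  apply: (@le_trans _ _ (C4 * (alpha * D))); first by rewrite ler_wpM2l// ltW.
  move: alphaE; rewrite ler_pdivlMr ?mulr_gt0// => h.
  by rewrite (_ : C4 * (alpha * D) = alpha * (D * C4))//; ring.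
have hk8 : l0 P (J k T) <= 8 * a.
  have I1 := Il _ mJ1; have I2 := integrable_funD I1 (integrable_cst P (2 * a)).
  have I3 := integrable_funD I2 Irs; have I4 := integrable_funD I3 (Il _ mX0').
  have I5 := integrable_funD I4 (Il _ mJ2); have I6 := integrable_funD I5 (Il _ mNi').
  have I7 := integrable_funD I6 IPsi.
  apply: le_trans (ae_le_Rintegral (Il _ (mJ k bk)) I7 main) _.
  rewrite (RintegralD measurableT I6 IPsi) (RintegralD measurableT I5 (Il _ mNi')).
  rewrite (RintegralD measurableT I4 (Il _ mJ2)) (RintegralD measurableT I3 (Il _ mX0')).
  rewrite (RintegralD measurableT I2 Irs) (RintegralD measurableT I1 (integrable_cst P (2 * a))).
  rewrite Rintegral_probability_cst.
  exact: sum_le8 b1 ers hC3 b2 hC4 eps.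
have -> : J K T = fun w => (J K T w - J k T w) + J k T w.
  by apply/funext => w; ring.
apply: le_trans (l0D P (measurable_funB (mJ K bK) (mJ k bk)) (mJ k bk)) _.
by apply: le_trans (lerD hk hk8) _; rewrite (_ : a + 8 * a = e)// /a; field.
Qed.

End DeflatedIntegrals.

(** * Completeness of the semimartingale topology *)

Section EmeryCompleteness.
Context {disp : measure_display} {Omega : measurableType disp} {R : realType}.
Variables (P : probability Omega R) (T : R) (F : R -> set (set Omega)).
Hypothesis T_ge0 : 0 <= T.
Hypothesis filF : filtration T F.
Local Notation bp := (bounded_predictable T F).
Local Notation soi := (stochastic_integral_operator P T F).
Local Notation meas W := (forall t, t \in `[0, T] -> measurable_fun setT (W t)).

Lemma real_cvg_ex (X : Type) (Fl : set_system X) (FF : ProperFilter Fl) (f : X -> R) :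
  (forall e, 0 < e -> exists x, \forall u \near Fl, `|x - f u| <= e) -> cvg (f u @[u --> Fl]).
Proof.
move=> h; apply: cauchy_cvg; apply: cauchy_exP => e e0.
have [x hx] := h (e / 2) ltac:(rewrite divr_gt0//).
exists x; rewrite /= /nbhs/=; apply: filterS hx => u hu; rewrite /ball/=.
by apply: le_lt_trans hu _; lra.
Qed.

Lemma cadlag_uniform_limit (V_ : nat -> R -> Omega -> R) (W : R -> Omega -> R) :
  (forall k, cadlag T (V_ k)) ->
  (forall w e, 0 < e -> exists k, forall t, t \in `[0, T] -> `|V_ k t w - W t w| <= e) ->
  cadlag T W.
Proof.
move=> cV hV w; split=> t tT.
- have [t0 t1] := andP tT.
  have tT' : t \in `[0, T] by rewrite in_itv/= t0 ltW.
  apply/cvgrPdist_le => e e0; have e3 : 0 < e / 3 by rewrite divr_gt0.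
  have [k hk] := hV w _ e3; have [/(_ t tT) /cvgrPdist_le /(_ _ e3) c _] := cV k w.
  near=> u.
  have uT : u \in `[0, T].
    rewrite in_itv/=; apply/andP; split.
      by apply: (le_trans t0); near: u; exact: nbhs_right_ge.
    by near: u; exact: nbhs_right_le.
  have b1 := hk t tT'; have b2 := hk u uT.
  have b3 : `|V_ k t w - V_ k u w| <= e / 3 by near: u; exact: c.
  rewrite (_ : W t w - W u w = - (V_ k t w - W t w) + (V_ k t w - V_ k u w) + (V_ k u w - W u w)); last by ring.
  apply: le_trans (ler_normD _ _) _.
  have := ler_normD (- (V_ k t w - W t w)) (V_ k t w - V_ k u w).
  rewrite normrN; lra.
- have [t0 t1] := andP tT; apply: real_cvg_ex => e e0.
  have e2 : 0 < e / 2 by rewrite divr_gt0.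
  have [k hk] := hV w _ e2; have [_ /(_ t tT) /cvg_ex [l /cvgrPdist_le /(_ _ e2) c]] := cV k w.
  exists l; near=> u.
  have u0 : 0 < u by near: u; exact: nbhs_left_gt.
  have ut : u < t by near: u; exact: nbhs_left_lt.
  have uT : u \in `[0, T] by rewrite in_itv/= ltW//= (le_trans (ltW ut)).
  have b2 := hk u uT.
  have b3 : `|l - V_ k u w| <= e / 2 by near: u; exact: c.
  rewrite (_ : l - W u w = (l - V_ k u w) + (V_ k u w - W u w)); last by ring.
  by apply: le_trans (ler_normD _ _) _; lra.
Unshelve. all: by end_near.
Qed.

(** Paths are replaced by 0 off E, because [cadlag] is required of every path and not just of almost
    every one. *)
Lemma uniform_limit (E : set Omega) (V_ : nat -> R -> Omega -> R) : measurable E ->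
  (forall k, cadlag T (V_ k)) -> (forall k, meas (V_ k)) ->
  (forall w e, E w -> 0 < e -> exists K, forall k l, (K <= k)%N -> (K <= l)%N ->
     forall t, t \in `[0, T] -> `|V_ k t w - V_ l t w| <= e) ->
  exists W, [/\ cadlag T W, meas W &
    forall w e, E w -> 0 < e -> exists K, forall k, (K <= k)%N ->
     forall t, t \in `[0, T] -> `|V_ k t w - W t w| <= e].
Proof.
move=> mE cV mV hV.
pose V' k t w : R := \1_E w * V_ k t w.
have V'E k t w : E w -> V' k t w = V_ k t w.
  by move=> Ew; rewrite /V' indicE mem_set// mul1r.
have V'n k t w : ~ E w -> V' k t w = 0.
  by move=> Ew; rewrite /V' indicE memNset// mul0r.
pose W t w := lim (V' k t w @[k --> \oo]).
have V'c w e : 0 < e -> exists K, forall k l, (K <= k)%N -> (K <= l)%N ->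
     forall t, t \in `[0, T] -> `|V' k t w - V' l t w| <= e.
  move=> e0; have [Ew|Ew] := pselect (E w).
    by have [K hK] := hV w e Ew e0; exists K => k l Kk Kl t tT; rewrite !V'E//; exact: hK.
  by exists 0%N => k l _ _ t tT; rewrite !V'n// subrr normr0 ltW.
have V'cvg t w : t \in `[0, T] -> V' k t w @[k --> \oo] --> W t w.
  move=> tT; apply: real_cvg_ex => e e0; have [K hK] := V'c w e e0.
  by exists (V' K t w); exists K => // l Kl; exact: hK.
have V'u w e : 0 < e -> exists K, forall k, (K <= k)%N ->
     forall t, t \in `[0, T] -> `|V' k t w - W t w| <= e.
  move=> e0; have [K hK] := V'c w e e0; exists K => k Kk t tT.
  have c : `|V' k t w - V' l t w| @[l --> \oo] --> `|V' k t w - W t w|.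
    by apply: cvg_norm; apply: cvgB; [exact: cvg_cst|exact: V'cvg].
  apply: (cvgr_to_le c).
  by exists K => // l Kl; exact: hK.
exists W; split.
- apply: (@cadlag_uniform_limit V') => [k|w e e0]; first by apply: (cadlag_scale (fun w => \1_E w)).
  by have [K hK] := V'u w e e0; exists K => t; exact: hK.
- move=> t tT; apply: (@measurable_fun_cvg _ _ _ _ (fun k => V' k t)) => [k|w _].
    by apply: measurable_funM; [exact: measurable_indic|exact: mV].
  exact: V'cvg.
- move=> w e Ew e0; have [K hK] := V'u w e e0; exists K => k Kk t tT.
  by rewrite -V'E//; exact: hK.
Qed.

(** A subsequence with summable running suprema converges uniformly in time off a null set; the
    Cauchy property then brings back the whole sequence. *)
Lemma ucp_complete (W_ : nat -> R -> Omega -> R) :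
  (forall n, cadlag T (W_ n)) -> (forall n, meas (W_ n)) ->
  (forall e, 0 < e -> exists N, forall n m, (N <= n)%N -> (N <= m)%N ->
    l0 P (running_sup T (fun t w => W_ n t w - W_ m t w)) <= e) ->
  exists W, [/\ cadlag T W, meas W &
    vanishing (fun n => l0 P (running_sup T (fun t w => W_ n t w - W t w)))].
Proof.
move=> cW mW hW.
have mrs (A B : R -> Omega -> R) : meas A -> meas B -> measurable_fun setT (running_sup T (fun t w => A t w - B t w)).
  by move=> mA mB; apply: measurable_running_sup => // t tT; apply: measurable_funB; [exact: mA|exact: mB].
have /choice [N hNk] : forall k, exists N, (k <= N)%N /\ forall n m, (N <= n)%N -> (N <= m)%N ->
    l0 P (running_sup T (fun t w => W_ n t w - W_ m t w)) <= (1 / 2) ^+ k.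
  move=> k; have [N hN] := hW ((1 / 2) ^+ k) ltac:(apply: exprn_gt0; lra).
  exists (maxn k N); rewrite leq_maxl; split=> // n m; rewrite !geq_max => /andP[_ ?] /andP[_ ?].
  exact: hN.
have hN k := (hNk k).2.
(* The maximum makes the ranks nondecreasing, so that both [s k] and [s k.+1] are beyond [N k]. *)
pose s k := (\max_(j < k.+1) N j)%N.
have sN k : (N k <= s k)%N by exact: (@leq_bigmax _ (fun j : 'I_k.+1 => N j) ord_max).
have sS k : (s k <= s k.+1)%N.
  by rewrite /s [X in (_ <= X)%N]big_ord_recr/=; exact: leq_maxl.
pose V_ k := W_ (s k).
pose f k := running_sup T (fun t w => V_ k.+1 t w - V_ k t w).
have mf k : measurable_fun setT (f k) := mrs _ _ (mW (s k.+1)) (mW (s k)).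
have f0 k w : 0 <= f k w by exact: running_sup_ge0.
have f1 k w : Num.min `|f k w| 1 = f k w.
  by rewrite ger0_norm// min_l// running_sup_le1.
have lf k : l0 P (f k) <= 1 * (1 / 2) ^+ k.
  by rewrite mul1r; apply: hN => //; apply: leq_trans (sN k) (sS k).
pose E := [set w | exists M : nat, forall n, \sum_(k < n) f k w <= M%:R].
have mE : measurable E.
  rewrite (_ : E = \bigcup_M \bigcap_n [set w | \sum_(k < n) f k w <= M%:R]).
    apply: bigcup_measurable => M _; apply: bigcapT_measurable => n.
    rewrite -[X in measurable X]setTI; apply: measurable_fun_ler => //.
    exact: measurable_sum.
  by apply/seteqP; split=> w /= [M]; [move=> h; exists M => // n _; exact: h|move=> _ h; exists M => n; exact: h].
have aeE : {ae P, forall w, E w}.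
  apply: filterS (l0_summable_ae mf lf) => w [M hM].
  exists (Num.truncn `|M|).+1 => n; apply: (@le_trans _ _ M).
    by apply: le_trans (hM n); rewrite le_eqVlt; apply/orP; left; apply/eqP; apply: eq_bigr => k _; rewrite f1.
  apply: le_trans (ler_norm _) _; have /andP[_ h] := truncn_itv (normr_ge0 M).
  exact: ltW.
have cau w e : E w -> 0 < e -> exists K, forall k l, (K <= k)%N -> (K <= l)%N ->
     forall t, t \in `[0, T] -> `|V_ k t w - V_ l t w| <= e.
  move=> [M hM] e0; pose S n := \sum_(k < n) f k w.
  have Snd : nondecreasing_seq S.
    apply/nondecreasing_seqP => n; rewrite /S big_ord_recr/= lerDl; exact: f0.
  have Scv : cvgn S by apply: nondecreasing_is_cvgn => //; exists M%:R => _ [n _ <-]; exact: hM.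
  (* With d <= 1/4 every single running supremum of the tail is below 1, hence untruncated. *)
  pose d := Num.min (e / 2) (1 / 4).
  have d0 : 0 < d by rewrite lt_min divr_gt0//=; lra.
  have [K _ hK] := (cvgrPdist_le _ _).1 Scv d d0.
  have dS k l : (K <= k)%N -> (K <= l)%N -> S l - S k <= d + d.
    move=> /hK h1 /hK h2; have := ler_norm (- (limn S - S l)); have := ler_norm (limn S - S k).
    by move: h1 h2; rewrite /= normrN; lra.
  have d4 : d <= 1 / 4 by rewrite ge_min lexx orbT.
  have de : d + d <= e.
    have : d <= e / 2 by rewrite ge_min lexx.
    lra.
  have fs k : (K <= k)%N -> f k w < 1.
    move=> Kk; have := dS k k.+1 Kk (leqW Kk).
    by rewrite /S big_ord_recr/=; lra.
  have step k n : (K <= k)%N -> forall t, t \in `[0, T] -> `|V_ (k + n)%N t w - V_ k t w| <= S (k + n)%N - S k.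
    move=> Kk t tT; elim: n => [|n ih]; first by rewrite addn0 !subrr normr0.
    have h := @running_sup_lt1 _ _ _ T T_ge0 _ w t (cadlagB (cW (s (k + n).+1)) (cW (s (k + n)%N))) tT
      (fs (k + n)%N (leq_trans Kk (leq_addr _ _))).
    have SS j : S j.+1 = S j + f j w by rewrite /S big_ord_recr.
    rewrite addnS SS.
    rewrite (_ : V_ (k + n).+1 t w - V_ k t w = (V_ (k + n).+1 t w - V_ (k + n)%N t w) + (V_ (k + n)%N t w - V_ k t w)); last by ring.
    apply: le_trans (ler_normD _ _) _; move: h ih; rewrite /f /V_; lra.
  exists K => k l Kk Kl t tT; wlog kl : k l Kk Kl / (k <= l)%N.
    by move=> wl; case: (leqP k l) => [|/ltnW] kl; [exact: wl|rewrite distrC; exact: wl].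
  rewrite distrC -(subnKC kl); apply: le_trans (step k (l - k)%N Kk t tT) _.
  by apply: le_trans (dS _ _ Kk _) de; rewrite subnKC.
have [W [cW' mW' uW]] := uniform_limit mE (fun k => cW (s k)) (fun k => mW (s k)) cau.
exists W; split=> //.
have vs : vanishing (fun k => l0 P (fun w => running_sup T (fun t w => V_ k t w - W t w) w - 0)).
  apply: (@vanishing_l0_ae _ _ _ P (fun k => running_sup T (fun t w => V_ k t w - W t w)) (fun=> 0)).
  - by move=> k; exact: (mrs _ _ (mW (s k)) mW').
  - exact: measurable_cst.
  apply: filterS aeE => w Ew; apply/cvgrPdist_le => e e0.
  have [K hK] := uW w e Ew e0; exists K => // k /= Kk.
  rewrite sub0r normrN ger0_norm ?running_sup_ge0//.
  by apply: (running_sup_le T_ge0) => t tT; rewrite ge_min hK.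
move=> e e0; have e2 : 0 < e / 2 by rewrite divr_gt0.
have [N0 hN0] := hW _ e2; have [N1 hN1] := vs _ e2.
exists N0 => n Nn; pose k := maxn N0 N1.
have ks : (N0 <= s k)%N.
  by apply: leq_trans (leq_maxl N0 N1) (leq_trans (hNk k).1 (sN k)).
apply: (@le_trans _ _ (l0 P (running_sup T (fun t w => W_ n t w - W_ (s k) t w)) +
    l0 P (running_sup T (fun t w => V_ k t w - W t w)))).
  apply: le_trans (l0D P (mrs _ _ (mW n) (mW (s k))) (mrs _ _ (mW (s k)) mW')).
  apply: l0_le_ae.
  - exact: (mrs _ _ (mW n) mW').
  - by apply: measurable_funD; [exact: (mrs _ _ (mW n) (mW (s k)))|exact: (mrs _ _ (mW (s k)) mW')].
  - apply/aeW => w; rewrite !ger0_norm ?addr_ge0 ?running_sup_ge0//.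
    have h := running_sup_D T (fun t w => W_ n t w - W_ (s k) t w) (fun t w => W_ (s k) t w - W t w) w.
    apply: le_trans h; rewrite le_eqVlt; apply/orP; left; apply/eqP.
    by congr (running_sup T _ w); apply/funext => t; apply/funext => v; rewrite /V_; ring.
have h1 := hN0 n (s k) Nn ks; have := hN1 k (leq_maxr _ _).
under eq_fun do rewrite subr0; move=> h2; lra.
Qed.

Section Limit.
Variables (Y_ : nat -> R -> Omega -> R) (J_ : nat -> (R -> Omega -> R) -> R -> Omega -> R).
Hypothesis op_ : forall n, soi (Y_ n) (J_ n).
Hypothesis nk_ : forall n K t, bp K -> t \in `[0, T] -> nearly_known P F t (J_ n K t).
Hypothesis cauchy_ : forall e, 0 < e -> exists N, forall n m, (N <= n)%N -> (N <= m)%N ->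
  forall K, predictable T F K -> (forall t w, t \in `[0, T] -> `|K t w| <= 1) ->
    l0 P (fun w => J_ n K T w - J_ m K T w) <= e.

Lemma bp_indicator_from0 t K : t \in `[0, T] -> bp K -> bp (fun u w => \1_(`]0, t]) u * K u w).
Proof.
rewrite in_itv/= => /andP[t0 tT] bK.
have := bpM (bp_rectangle T_ge0 (lexx 0) t0 tT (filtrationT filF (zero_in T_ge0))) bK.
have -> // : (fun u w => \1_(`]0, t]) u * \1_setT w * K u w) = fun u w => \1_(`]0, t]) u * K u w.
by apply/funext => u; apply/funext => w; rewrite indicT/= mulr1.
Qed.

(** Division by C and cutting at t reduce to integrands bounded by 1 and to the terminal time. *)
Lemma cauchy_bounded (C e : R) : 0 < C -> 0 < e -> exists N, forall n m, (N <= n)%N -> (N <= m)%N ->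
  forall K t, predictable T F K -> (forall t w, t \in `[0, T] -> `|K t w| <= C) -> t \in `[0, T] ->
    l0 P (fun w => J_ n K t w - J_ m K t w) <= e.
Proof.
move=> C0 e0; have TT := T_in T_ge0.
have M0 : 0 < Num.max 1 `|C| by rewrite lt_max ltr01.
have [N hN] := cauchy_ (divr_gt0 e0 M0); exists N => n m Nn Nm K t pK KC tT.
have bK : bp K by split=> //; exists C.
pose L u w := C^-1 * (\1_(`]0, t]) u * K u w).
have bI := bp_indicator_from0 tT bK.
have bL : bp L by exact: bpZ.
have L1 u w : u \in `[0, T] -> `|L u w| <= 1.
  move=> uT; rewrite /L normrM normfV (gtr0_norm C0) ler_pdivrMl// mulr1 normrM.
  rewrite -[leRHS]mul1r; apply: ler_pM; [by []|by []|exact: norm_indic_le1|exact: KC].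
have opd := soi_sub (op_ n) (op_ m).
have h1 := op_from0 T_ge0 filF opd bK tT.
have h2 := op_scale opd C bL TT.
have E : (fun u w => C * L u w) = fun u w => \1_(`]0, t]) u * K u w.
  by apply/funext => u; apply/funext => w; rewrite /L mulrA mulfV ?mul1r// gt_eqF.
rewrite E in h2.
have ml : measurable_fun setT (fun w => J_ n L T w - J_ m L T w).
  by apply: (op_measurable opd).
apply: (@le_trans _ _ (l0 P (fun w => C * (J_ n L T w - J_ m L T w)))).
  rewrite le_eqVlt; apply/orP; left; apply/eqP; apply: l0_ae.
  - exact: (op_measurable opd).
  - exact: measurable_funM.
  - by apply: filterS2 h1 h2 => w <- ->.
apply: le_trans (l0Z P C ml) _.
by rewrite mulrC -ler_pdivlMr//; apply: hN => //; exact: bp_pred.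
Qed.

Lemma emery_ucp K : bp K -> exists W, [/\ cadlag T W, meas W &
  vanishing (fun n => l0 P (running_sup T (fun t w => J_ n K t w - W t w)))].
Proof.
move=> bK; have [pK [C0 hC0]] := bK; pose C := Num.max C0 1.
have C_gt0 : 0 < C by rewrite lt_max ltr01 orbT.
have hC t w : t \in `[0, T] -> `|K t w| <= C.
  by move=> tT; apply: le_trans (hC0 t w tT) _; rewrite le_max lexx.
apply: ucp_complete => [n|n t tT|e e0]; [exact: (op_cadlag (op_ n))|exact: (op_measurable (op_ n))|].
pose e' := Num.min (e / 2) 1.
have e'0 : 0 < e' by rewrite lt_min ltr01 divr_gt0.
have e'1 : e' <= 1 by rewrite ge_min lexx orbT.
have e'k : e' <= e / 2 by rewrite ge_min lexx.
have eta0 : 0 < e' * e / 4 by rewrite divr_gt0// mulr_gt0.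
have [N hN] := cauchy_bounded C_gt0 eta0; exists N => n m Nn Nm.
have opd := soi_sub (op_ n) (op_ m).
have nk t : t \in `[0, T] -> nearly_known P F t (fun w => J_ n K t w - J_ m K t w).
  move=> tT; have mn k : measurable_fun setT (J_ k K t) by exact: (op_measurable (op_ k)).
  have := nearly_known_lin filF (-1) tT (mn m) (mn n) (nk_ m bK tT) (nk_ n bK tT).
  have -> // : (fun w => -1 * J_ m K t w + J_ n K t w) = fun w => J_ n K t w - J_ m K t w.
  by apply/funext => w; ring.
apply: le_trans (op_running_sup T_ge0 filF opd nk bK e'0 e'1 (eta := e' * e / 4) _) _.
  move=> K' pK' K'1; apply: hN => //.
  - exact: predictableM.
  - move=> t w tT; rewrite normrM -[leRHS]mul1r; apply: ler_pM; [by []|by []|exact: K'1|exact: hC].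
  - exact: T_in.
have -> : 2 * (e' * e / 4) / e' = e / 2 by field; rewrite gt_eqF.
lra.
Qed.

(** The limit operator is defined integrand by integrand. Linearity and the elementary clauses pass
    to the limit directly; dominated convergence does because the convergence is uniform over
    integrands with a common bound, which allows the two limits to be exchanged. *)
Lemma emery_complete : exists Y J, [/\ soi Y J, cadlag T Y /\ meas Y, forall w, Y 0 w = 0,
  forall e, 0 < e -> exists N, forall n, (N <= n)%N -> forall K, predictable T F K ->
    (forall t w, t \in `[0, T] -> `|K t w| <= 1) -> l0 P (fun w => J_ n K T w - J K T w) <= e &
  vanishing (fun n => l0 P (running_sup T (fun t w => J_ n (fun _ _ => 1) t w - Y t w)))].
Proof.
have TT := T_in T_ge0; have z0 := zero_in T_ge0.
have /choice [J hJ] : forall K, exists W, bp K -> [/\ cadlag T W, meas W &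
    vanishing (fun n => l0 P (running_sup T (fun t w => J_ n K t w - W t w)))].
  move=> K; have [bK|nK] := pselect (bp K); last by exists (fun _ _ => 0).
  by have [W hW] := emery_ucp bK; exists W.
have cJ K : bp K -> cadlag T (J K) by case/hJ.
have mJ K t : bp K -> t \in `[0, T] -> measurable_fun setT (J K t) by case/hJ => _ h _; exact: h.
have mJ_ n K t : bp K -> t \in `[0, T] -> measurable_fun setT (J_ n K t).
  by move=> bK tT; exact: (op_measurable (op_ n)).
have lim K t : bp K -> t \in `[0, T] -> vanishing (fun n => l0 P (fun w => J_ n K t w - J K t w)).
  move=> bK tT; have [cW mW v] := hJ K bK; apply: vanishing_le v => n.
  apply: (@l0_running_sup_ge _ _ _ P T T_ge0 (fun t w => J_ n K t w - J K t w)) => //.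
    by apply: cadlagB => //; exact: (op_cadlag (op_ n)).
  by move=> u uT; apply: measurable_funB; [exact: mJ_|exact: mJ].
have unif (C e : R) : 0 < C -> 0 < e -> exists N, forall n, (N <= n)%N ->
    forall K t, predictable T F K -> (forall t w, t \in `[0, T] -> `|K t w| <= C) ->
      t \in `[0, T] -> l0 P (fun w => J_ n K t w - J K t w) <= e.
  move=> C0 e0; have e2 : 0 < e / 2 by rewrite divr_gt0.
  have [N hN] := cauchy_bounded C0 e2; exists N => n Nn K t pK KC tT.
  have bK : bp K by split=> //; exists C.
  have [M hM] := lim K t bK tT _ e2; pose m := maxn N M.
  have -> : (fun w => J_ n K t w - J K t w) =
      fun w => (J_ n K t w - J_ m K t w) + (J_ m K t w - J K t w) by apply/funext => w; ring.
  have m1 := measurable_funB (mJ_ n K t bK tT) (mJ_ m K t bK tT).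
  have m2 := measurable_funB (mJ_ m K t bK tT) (mJ K t bK tT).
  apply: le_trans (l0D P m1 m2) _.
  have := hN n m Nn (leq_maxl _ _) K t pK KC tT; have := hM m (leq_maxr _ _); lra.
have b1 : bp (fun _ _ => 1) by exact: bp_cst.
(* The value at 0 vanishes only almost surely; subtracting it makes Y start at 0 everywhere. *)
pose Y t w := J (fun _ _ => 1) t w - J (fun _ _ => 1) 0 w.
have cY : cadlag T Y by apply: cadlagB; [exact: cJ|exact: (cadlag_cst T (J (fun _ _ => 1) 0))].
have mY : meas Y by move=> t tT; apply: measurable_funB; exact: mJ.
have lin a H K : bp H -> bp K -> indistinguishable P T (J (fun t w => a * H t w + K t w))
    (fun t w => a * J H t w + J K t w).
  move=> bH bK; have bHK : bp (fun t w => a * H t w + K t w) by apply: bpD => //; exact: bpZ.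
  apply: cadlag_indistinguishable => //; first exact: cJ.
    by apply: cadlagD; [exact: (cadlag_scale (fun=> a) (cJ _ bH))|exact: cJ].
  move=> t tT; have ma n := mJ_ n H t bH tT; have mb n := mJ_ n K t bK tT.
  have ma' := mJ H t bH tT; have mb' := mJ K t bK tT.
  have aJ_ n : measurable_fun setT (fun w => a * J_ n H t w) by exact: measurable_funM.
  have aJ : measurable_fun setT (fun w => a * J H t w) by exact: measurable_funM.
  apply: ae_eq_vanishing (lim _ t bHK tT) (vanishing_l0D aJ_ aJ mb mb'
    (vanishing_l0_scale a ma ma' (lim H t bH tT)) (lim K t bK tT)) _.
  - by move=> n; exact: mJ_.
  - exact: mJ.
  - by move=> n; exact: measurable_funD.
  - exact: measurable_funD.
  - by move=> n; exact: (op_lin (op_ n)).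
exists Y, J; split=> //.
- split=> //.
  + by move=> H bH; split; [exact: cJ|move=> t; exact: mJ].
  + move=> s t A s0 st tT FA.
    have bR := bp_rectangle T_ge0 s0 st tT FA.
    have tT' : t \in `[0, T] by rewrite in_itv/= (le_trans s0 st).
    have sT' : s \in `[0, T] by rewrite in_itv/= s0 (le_trans st).
    have mA : measurable A by exact: (filtration_measurable filF sT').
    have mI : measurable_fun setT (fun w => \1_A w : R) by exact: measurable_indic.
    apply: cadlag_indistinguishable => //; first exact: cJ.
      apply: (cadlag_scale (fun w => \1_A w)); apply: cadlagB; exact: cadlag_stop.
    move=> u uT; have u1 : Num.min t u \in `[0, T] by apply: min_in => //; exact: le_trans st.
    have u2 : Num.min s u \in `[0, T] by exact: min_in.
    have h : {ae P, forall w, J (fun u w => \1_(`]s, t]) u * \1_A w) u w =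
        \1_A w * (J (fun _ _ => 1) (Num.min t u) w - J (fun _ _ => 1) (Num.min s u) w)}.
      have ma v (vT : v \in `[0, T]) n := mJ_ n _ v b1 vT.
      have mb v (vT : v \in `[0, T]) := mJ _ v b1 vT.
      have md n := measurable_funB (ma _ u1 n) (ma _ u2 n).
      have md' := measurable_funB (mb _ u1) (mb _ u2).
      apply: ae_eq_vanishing (lim _ u bR uT) (vanishing_l0_contract mI (norm_indic_le1 R A) md md'
        (vanishing_l0B (ma _ u1) (mb _ u1) (ma _ u2) (mb _ u2) (lim _ _ b1 u1) (lim _ _ b1 u2))) _.
      * by move=> n; exact: mJ_.
      * exact: mJ.
      * by move=> n; exact: measurable_funM.
      * exact: measurable_funM.
      * move=> n; apply: filterS3 (op_rectangle (op_ n) s0 st tT FA uT)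
          (op_one T_ge0 filF (op_ n) u1) (op_one T_ge0 filF (op_ n) u2) => w e1 e2 e3.
        by rewrite /= e1 e2 e3; congr (_ * _); ring.
    by apply: filterS h => w ->; rewrite /Y; congr (_ * _); ring.
  + move=> A FA; have bR := bp_rectangle0 T_ge0 FA.
    apply: cadlag_indistinguishable => //; [exact: cJ|exact: (cadlag_cst T (fun=> 0))|].
    move=> u uT.
    apply: (ae_eq_vanishing (f_ := fun n => J_ n (fun u w => \1_(`[0, 0]) u * \1_A w) u)
      (g_ := fun _ _ => 0)) (lim _ u bR uT) _ _.
    * by move=> n; exact: mJ_.
    * exact: mJ.
    * by [].
    * by [].
    * by move=> e e0; exists 0%N => n _; under eq_fun do rewrite subrr; rewrite l0_cst0 ltW.
    * by move=> n; exact: (op_rectangle0 (op_ n)).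
  + move=> H_ H C pH_ pH hC cv t tT; have [bH_ bH] := bp_of_dominated pH_ pH hC cv.
    apply/cvg_in_probability_l0.
      by move=> n; exact: mJ.
      exact: mJ.
    move=> e e0; have e3 : 0 < e / 3 by rewrite divr_gt0.
    pose C' := Num.max C 1; have C'0 : 0 < C' by rewrite lt_max ltr01 orbT.
    have [N hN] := unif C' _ C'0 e3.
    have [M hM] := op_dominated (op_ N) pH_ pH hC cv tT e3.
    exists M => k Mk.
    have hC' n u w : u \in `[0, T] -> `|H_ n u w| <= C'.
      by move=> uT; apply: le_trans (hC n u w uT) _; rewrite le_max lexx.
    have hH' u w : u \in `[0, T] -> `|H u w| <= C'.
      by move=> uT; exact: (cvg_norm_bound (cv u w uT) (fun n => hC' n u w uT)).
    have x1 := hN N (leqnn N) (H_ k) t (pH_ k) (hC' k) tT.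
    have x2 := hN N (leqnn N) H t pH hH' tT.
    have x3 := hM k Mk.
    have -> : (fun w => J (H_ k) t w - J H t w) = fun w =>
      (J_ N (H_ k) t w - J_ N H t w) - (J_ N (H_ k) t w - J (H_ k) t w) + (J_ N H t w - J H t w).
      by apply/funext => w; ring.
    have a1 := measurable_funB (mJ_ N _ t (bH_ k) tT) (mJ_ N _ t bH tT).
    have a2 := measurable_funB (mJ_ N _ t (bH_ k) tT) (mJ _ t (bH_ k) tT).
    have a3 := measurable_funB (mJ_ N _ t bH tT) (mJ _ t bH tT).
    apply: le_trans (l0D P (measurable_funB a1 a2) a3) _.
    have := l0B P a1 a2; move: x1 x2 x3; rewrite /=; lra.
- by move=> w; rewrite /Y subrr.
- move=> e e0; have [N hN] := unif 1 e ltr01 e0.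
  by exists N => n Nn K pK K1; exact: (hN n Nn K T).
- have [_ _ v] := hJ _ b1.
  have Jz : {ae P, forall w, J (fun _ _ => 1) 0 w = 0}.
    apply: (ae_eq_vanishing (f_ := fun n => J_ n (fun _ _ => 1) 0) (g_ := fun _ _ => 0)) (lim _ 0 b1 z0) _ _.
    * by move=> k; exact: mJ_.
    * exact: mJ.
    * by [].
    * by [].
    * by move=> e e0; exists 0%N => k _; under eq_fun do rewrite subrr; rewrite l0_cst0 ltW.
    * by move=> k; exact: (op_at0 T_ge0 filF (op_ k)).
  apply: vanishing_le v => n; rewrite le_eqVlt; apply/orP; left; apply/eqP; apply: l0_ae.
  + by apply: measurable_running_sup => // t tT; apply: measurable_funB; [exact: mJ_|exact: mY].
  + by apply: measurable_running_sup => // t tT; apply: measurable_funB; [exact: mJ_|exact: mJ].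
  + by apply: (running_sup_ae T_ge0); apply: filterS Jz => w z t tT; rewrite /Y z subr0.
Qed.

End Limit.

End EmeryCompleteness.

(** * Closedness of the space of vector integrals *)

Section RandomSubsequences.
Context {disp : measure_display} {Omega : measurableType disp} {R : realType}.
Variables (T : R) (F : R -> set (set Omega)).

(** Predictability through level sets, since [predictable] speaks of real-valued processes. *)
Definition random_index (mu : R -> Omega -> nat) : Prop :=
  forall k, predictable T F (fun t w => (mu t w == k)%:R).

Lemma predictable_select (g : nat -> R -> Omega -> R) mu : random_index mu ->
  (forall k, predictable T F (g k)) -> predictable T F (fun t w => g (mu t w) t w).
Proof.
move=> rmu pg.
apply: (@predictable_lim _ _ _ _ _ (fun n t w => \sum_(k < n) (mu t w == k)%:R * g k t w)).
  by move=> n; apply: predictable_sum => k; exact: predictableM.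
move=> t w _; apply: (@cvg_eventually _ _ _ (mu t w).+1) => n mun.
rewrite (bigD1 (Ordinal mun))//= eqxx mul1r big1 ?addr0// => k nk.
rewrite (_ : (mu t w == k) = false) ?mul0r//; apply/negbTE; apply: contra nk => /eqP mk.
by apply/eqP/val_inj.
Qed.

Lemma random_index_comp (mu : nat -> R -> Omega -> nat) nu : random_index nu ->
  (forall j, random_index (mu j)) -> random_index (fun t w => mu (nu t w) t w).
Proof.
move=> rnu rmu k.
exact: (@predictable_select (fun j t w => (mu j t w == k)%:R) nu rnu (fun j => rmu j k)).
Qed.

Lemma random_index_cst n : random_index (fun _ _ => n).
Proof. by move=> k; exact: predictable_cst. Qed.

Lemma limsup_recurrent (u : nat -> R) : (forall n, `|u n| <= 1) ->
  forall n e, 0 < e -> exists m, (n <= m)%N && (`|u m - limn_sup u| <= e).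
Proof.
move=> u1 n e e0.
have ub : has_ubound (range u).
  by exists 1 => _ [k _ <-]; apply: le_trans (u1 k); exact: ler_norm.
have lb : has_lbound (range u).
  by exists (-1) => _ [k _ <-]; have := u1 k; rewrite ler_norml => /andP[].
have c : sups u @ \oo --> limn_sup u.
  have c := cvg_sups_inf ub lb.
  by rewrite /limn_sup (cvg_lim _ c).
have e2 : 0 < e / 2 by rewrite divr_gt0.
have [N _ hN] := (cvgrPdist_le _ _).1 c _ e2.
pose k := maxn n N; have hk : `|limn_sup u - sups u k| <= e / 2 by apply: hN; exact: leq_maxr.
have hs : has_sup (sdrop u k).
  split; first by exists (u k); exists k => /=.
  by case: ub => M hM; exists M => _ [j _ <-]; apply: hM; exists j.
have [x [m /= km <-] hm] := sup_adherent e2 hs.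
have um : u m <= sups u k by apply: ub_le_sup; [case: hs|exists m].
exists m; rewrite (leq_trans (leq_maxl n N) km)/=.
have -> : u m - limn_sup u = - (sups u k - u m) - (limn_sup u - sups u k) by ring.
apply: le_trans (ler_normB _ _) _; rewrite normrN ger0_norm ?subr_ge0//.
have hm' : sups u k - e / 2 < u m := hm.
lra.
Qed.

Lemma predictable_all (b : nat -> R -> Omega -> bool) (s : seq nat) :
  (forall k, predictable T F (fun t w => (b k t w)%:R)) ->
  predictable T F (fun t w => (all (fun k => b k t w) s)%:R).
Proof.
move=> pb; elim: s => [|k s ih] /=; first exact: predictable_cst.
exact: predictableI.
Qed.

(** A predictable Bolzano-Weierstrass theorem: the n-th index is the first m >= n at which the
    sequence is within 1/(n+1) of its upper limit, and the upper limit is predictable. The indices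
    tend to infinity but need not increase. *)
Lemma random_subsequence1 (x : nat -> R -> Omega -> R) :
  (forall n, predictable T F (x n)) -> (forall n t w, `|x n t w| <= 1) ->
  exists mu : nat -> R -> Omega -> nat, [/\ forall n, random_index (mu n),
    forall n t w, (n <= mu n t w)%N & forall t w, cvg (x (mu n t w) t w @[n --> \oo])].
Proof.
move=> px x1.
pose l t w := limn_sup (fun n => x n t w).
have pl : predictable T F l.
  apply/predictableP; apply: (@measurable_fun_limn_sup _ (predictableType T F) R (timeline T) (fun n z => x n z.1 z.2)).
  - move=> z _; exists 1 => _ [k _ <-]; apply: le_trans (x1 k z.1 z.2); exact: ler_norm.
  - by move=> z _; exists (-1) => _ [k _ <-]; have := x1 k z.1 z.2; rewrite ler_norml => /andP[].
  - by move=> n; apply/predictableP; exact: px.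
pose close n m t w := (n <= m)%N && (`|x m t w - l t w| <= n.+1%:R^-1).
have ex n t w : exists m, close n m t w.
  by apply: (limsup_recurrent (fun n => x1 n t w)); rewrite invr_gt0.
pose mu n t w := ex_minn (ex n t w).
have muP n t w : close n (mu n t w) t w by rewrite /mu; case: ex_minnP.
exists mu; split.
- move=> n k.
  have pc m : predictable T F (fun t w => (close n m t w)%:R).
    rewrite /close; case: (n <= m)%N => /=; last exact: predictable_cst.
    apply: predictable_ler; last exact: predictable_cst.
    by apply: predictable_norm; exact: predictableB.
  have -> : (fun t w => (mu n t w == k)%:R : R) =
      fun t w => (close n k t w && all (fun j => ~~ close n j t w) (iota 0 k))%:R.
    apply/funext => t; apply/funext => w; congr (_%:R); congr nat_of_bool.
    apply/idP/idP => [/eqP <-|/andP[ck /allP hk]].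
      rewrite muP/=; apply/allP => j; rewrite mem_iota/= add0n => jm.
      by move: jm; rewrite /mu; case: ex_minnP => m _ hm; apply: contraL => /hm; rewrite -leqNgt.
    rewrite /mu; case: ex_minnP => m cm hm; rewrite eqn_leq hm//= leqNgt; apply/negP => mk.
    by move: (hk m); rewrite mem_iota/= add0n mk cm => /(_ isT).
  by apply: predictableI => //; apply: predictable_all => j; apply: predictableC.
- by move=> n t w; case/andP: (muP n t w).
- move=> t w; apply/cvg_ex; exists (l t w); apply/cvgrPdist_le => e e0.
  have [N _ hN] := (cvgrPdist_le _ _).1 (@cvg_harmonic R) e e0.
  exists N => // n Nn; have := hN n Nn; rewrite /= sub0r normrN ger0_norm => [|//] hn.
  by case/andP: (muP n t w) => _ h; rewrite distrC; apply: le_trans h hn.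
Qed.

Lemma cvg_subindex (u : nat -> R) (nu : nat -> nat) (l : R) : (forall n, (n <= nu n)%N) ->
  u n @[n --> \oo] --> l -> u (nu n) @[n --> \oo] --> l.
Proof.
move=> h c; apply/cvgrPdist_le => e e0; have [N _ hN] := (cvgrPdist_le _ _).1 c e e0.
by exists N => // n Nn; apply: hN; exact: leq_trans (h n).
Qed.

(** One sequence after the other: a further selection keeps the limits already obtained. *)
Lemma random_subsequence (x : nat -> nat -> R -> Omega -> R) m :
  (forall j n, predictable T F (x j n)) -> (forall j n t w, `|x j n t w| <= 1) ->
  exists mu : nat -> R -> Omega -> nat, [/\ forall n, random_index (mu n),
    forall n t w, (n <= mu n t w)%N &
    forall j t w, (j < m)%N -> cvg (x j (mu n t w) t w @[n --> \oo])].
Proof.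
move=> px x1; elim: m => [|m [mu [rmu gmu cmu]]].
  by exists (fun n _ _ => n); split=> // n; exact: random_index_cst.
have [nu [rnu gnu cnu]] := @random_subsequence1 (fun n t w => x m (mu n t w) t w)
  (fun n => predictable_select (rmu n) (px m)) (fun n t w => x1 m (mu n t w) t w).
exists (fun n t w => mu (nu n t w) t w); split.
- by move=> n; exact: random_index_comp.
- by move=> n t w; apply: leq_trans (gmu _ _ _).
- move=> j t w; rewrite ltnS leq_eqVlt => /orP[/eqP ->|jm]; first exact: cnu.
  have /cvg_ex [l hl] := cmu j t w jm; apply/cvg_ex; exists l.
  exact: (@cvg_subindex (fun n => x j (mu n t w) t w) (fun n => nu n t w)).
Qed.

End RandomSubsequences.

(** * Existence of a limit integrand *)

Section LimitIntegrands.
Context {disp : measure_display} {Omega : measurableType disp} {R : realType}.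
Variables (P : probability Omega R) (T : R) (F : R -> set (set Omega)).
Hypothesis T_ge0 : 0 <= T.
Hypothesis filF : filtration T F.
Context {d : nat}.
Variables (S : R -> Omega -> 'cV[R]_d) (JS : 'I_d -> (R -> Omega -> R) -> R -> Omega -> R).
Local Notation bp := (bounded_predictable T F).
Local Notation soi := (stochastic_integral_operator P T F).
Local Notation vector_bp := (vector_bp T F).
Local Notation predictable := (predictable T F).
Local Notation vector_predictable := (vector_predictable T F).
Local Notation random_index := (random_index T F).
Hypothesis JSop : forall i, soi (fun t w => S t w i 0) (JS i).
Variables (Y : R -> Omega -> R) (J : (R -> Omega -> R) -> R -> Omega -> R).
Hypothesis opJ : soi Y J.
Variable V : R -> Omega -> R.
Hypothesis cV : cadlag T V.
Hypothesis cS : forall i, cadlag T (fun t w => S t w i 0).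
Implicit Types y z : nat -> R -> Omega -> 'rV[R]_d.

Definition select y (mu : R -> Omega -> nat) : R -> Omega -> 'rV[R]_d :=
  fun t w => y (mu t w) t w.

(* The integrals of every random selection from the tail of [y] are close to
   those of [Y]; unlike convergence of the integrals of [y n], this passes to
   random subsequences. *)
Definition approximates y : Prop := forall e, 0 < e -> exists n0,
  forall mu K, random_index mu -> (forall t w, (n0 <= mu t w)%N) ->
  predictable K -> (forall t w, t \in `[0, T] -> `|K t w| <= 1) ->
  vector_bp (scaled K (select y mu)) ->
  l0 P (fun w => vint JS (scaled K (select y mu)) T w - J K T w) <= e.

Definition dot (x : 'rV[R]_d) t w : R := \sum_i x 0 i * S t w i 0.

(** The self-financing relation on left limits, y_t S_{t-} = V_{t-}, asymptotically in n. The
    integrand is frozen at t, so that selecting an index at each (t, w) does not disturb the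
    relation. *)
Definition tracks y : Prop := {ae P, forall w, forall e, 0 < e -> exists n0,
  forall n t, (n0 <= n)%N -> 0 < t <= T ->
    \forall u \near t^'-, `|dot (y n t w) u w - V u w| <= e}.

Lemma vector_predictable_select y mu : random_index mu ->
  (forall n, vector_predictable (y n)) -> vector_predictable (select y mu).
Proof.
by move=> rmu py i; exact: (@predictable_select _ _ _ _ _ (fun n t w => y n t w 0 i) mu rmu (fun n => py n i)).
Qed.

Lemma approximates_select y (mu : nat -> R -> Omega -> nat) : (forall n, random_index (mu n)) ->
  (forall n t w, (n <= mu n t w)%N) -> approximates y -> approximates (fun n => select y (mu n)).
Proof.
move=> rmu gmu hy e e0; have [n0 h0] := hy e e0; exists n0 => nu K rnu gnu pK K1 bK.
apply: (h0 (fun t w => mu (nu t w) t w)) => //; first exact: random_index_comp.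
by move=> t w; apply: leq_trans (gmu _ _ _).
Qed.

Lemma tracks_select y (mu : nat -> R -> Omega -> nat) :
  (forall n t w, (n <= mu n t w)%N) -> tracks y -> tracks (fun n => select y (mu n)).
Proof.
move=> gmu; apply: filterS => w h e e0; have [n0 hn] := h e e0; exists n0 => n t nn tT.
by apply: hn => //; exact: leq_trans (gmu n t w).
Qed.

(** A selection is cut along the events mu = n0 + j, on each of which it coincides with a single
    theta n. The errors 2^-(n0 + j) are summable, and this yields uniformity over all selections. *)
Lemma approximates_initial theta (Y_ : nat -> R -> Omega -> R) J_ :
  (forall n, vector_predictable (theta n)) ->
  (forall n, integrates P T F JS (theta n) (Y_ n) (J_ n)) ->
  (forall n K, predictable K -> (forall t w, t \in `[0, T] -> `|K t w| <= 1) ->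
    l0 P (fun w => J_ n K T w - J K T w) <= (1 / 2) ^+ n) ->
  approximates theta.
Proof.
move=> pt ig sm e e0; have TT := T_in T_ge0.
have [n0 _ hn0] : \forall n \near \oo, (2 * (1 / 2) ^+ n : R) <= e / 2.
  have c : (2 * (1 / 2) ^+ n : R) @[n --> \oo] --> (2 * 0 : R).
    by apply: cvgM; [exact: cvg_cst|apply: cvg_expr; rewrite ger0_norm; lra].
  have [N _ hN] := (cvgrPdist_le _ _).1 c _ (divr_gt0 e0 (ltr0n R 2)).
  exists N => // n Nn; have := hN n Nn; rewrite mulr0 sub0r normrN; apply: le_trans; exact: ler_norm.
have {}hn0 := hn0 n0 (leqnn _).
exists n0 => mu K rmu gmu pK K1 bKz; set z := select theta mu.
have bK : bp K by split=> //; exists 1.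
pose ind j t w : R := (mu t w == (n0 + j)%N)%:R.
have pind j : predictable (ind j) by exact: rmu.
have bind j : bp (ind j) by exact: bp_bool.
(* The indicator of mu < n0 + m: finitely many pieces are estimated by the geometric series before m
   tends to infinity. *)
pose b m t w := \sum_(j < m) ind j t w.
have b01 m t w : b m t w = (mu t w < n0 + m)%N%:R.
  rewrite /b; elim: m => [|m ih]; first by rewrite big_ord0 addn0 ltnNge gmu.
  rewrite big_ord_recr/= ih /ind addnS ltnS.
  by case: (ltngtP (mu t w) (n0 + m)%N) => _; rewrite ?addr0 ?add0r.
have b1 m t w : `|b m t w| <= 1 by rewrite b01; case: (_ < _)%N; rewrite ?normr0 ?normr1.
have pb m : predictable (b m) by exact: predictable_sum.
have bb m : bp (b m) by split=> //; exists 1.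
have bcv t w : b m t w @[m --> \oo] --> (1 : R).
  apply: (@cvg_eventually _ _ _ (mu t w).+1) => m mum.
  by rewrite b01 (leq_trans mum)// leq_addl.
have opz := soi_vint T_ge0 filF JSop bKz.
have opK := soi_assoc T_ge0 filF opJ bK.
have v1 := vint_localized T_ge0 filF JSop bKz bb (fun m t w _ => b1 m t w) (fun t w _ => bcv t w).
have v2 := op_dominated_mul T_ge0 opJ bK bb (fun m t w _ => b1 m t w) (fun t w _ => bcv t w).
have mv m : measurable_fun setT (vint JS (scaled (fun t w => K t w * b m t w) z) T).
  by apply: (vint_measurable JSop) => //; rewrite scaledM; exact: scaled_bp.
have mv' : measurable_fun setT (vint JS (scaled K z) T) by exact: (vint_measurable JSop).
have mJ L : bp L -> measurable_fun setT (J L T) by move=> bL; exact: (op_measurable opJ).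
have mJm m : measurable_fun setT (J (fun t w => K t w * b m t w) T) by apply: mJ; exact: bpM.
pose L j t w := K t w * ind j t w.
have bL j : bp (L j) by exact: bpM.
have L1 j t w : t \in `[0, T] -> `|L j t w| <= 1.
  move=> tT; rewrite /L normrM -[leRHS]mul1r; apply: ler_pM => //; first exact: K1.
  by rewrite /ind; case: (_ == _); rewrite ?normr0 ?normr1.
have mid m : l0 P (fun w => vint JS (scaled (fun t w => K t w * b m t w) z) T w
    - J (fun t w => K t w * b m t w) T w) <= e / 2.
  have mJ_ j : measurable_fun setT (J_ (n0 + j)%N (L j) T).
    by apply: (op_measurable (ig _).1).
  have md (j : 'I_m) := measurable_funB (mJ_ j) (mJ _ (bL j)).
  have eL j : scaled (L j) (theta (n0 + j)%N) = scaled (L j) z.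
    apply/funext => t; apply/funext => w; rewrite /scaled /L /ind /z /select.
    by case: eqP => [->//|_]; rewrite mulr0 !scale0r.
  have bLz j : vector_bp (scaled (L j) z) by rewrite /L scaledM; exact: scaled_bp.
  have s1 := (op_sum opz (index_enum 'I_m) (fun j => bind j) TT).2.
  have s2 := (op_sum opK (index_enum 'I_m) (fun j => bind j) TT).2.
  have h : {ae P, forall w, forall j : 'I_m, J_ (n0 + j)%N (L j) T w = vint JS (scaled (L j) z) T w}.
    by apply: ae_forall_ord => j; rewrite -eL; apply: (ig _).2 => //; rewrite eL.
  have ae : {ae P, forall w, vint JS (scaled (fun t w => K t w * b m t w) z) T w
      - J (fun t w => K t w * b m t w) T w = \sum_(j < m) (J_ (n0 + j)%N (L j) T w - J (L j) T w)}.
    apply: filterS3 s1 s2 h => w e1 e2 e3.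
    have -> : vint JS (scaled (fun t w => K t w * b m t w) z) T w = \sum_(j < m) J_ (n0 + j)%N (L j) T w.
      rewrite scaledM e1; apply: eq_bigr => j _; rewrite e3 /L scaledM//.
    have -> : J (fun t w => K t w * b m t w) T w = \sum_(j < m) J (L j) T w.
      have -> : (fun t w => K t w * b m t w) = fun t w => b m t w * K t w.
        by apply/funext => t; apply/funext => v; rewrite mulrC.
      rewrite e2; apply: eq_bigr => j _; congr (J _ T w).
      by apply/funext => t; apply/funext => v; rewrite /L mulrC.
    by rewrite sumrB.
  have mS : measurable_fun setT (fun w => \sum_(j < m) (J_ (n0 + j)%N (L j) T w - J (L j) T w)).
    by apply: measurable_sum => j; exact: md.
  rewrite (l0_ae (measurable_funB (mv m) (mJm m)) mS ae).
  apply: le_trans (l0_sum P (index_enum 'I_m) md) _; apply: le_trans hn0.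
  apply: (@le_trans _ _ (\sum_(j < m) (1 / 2) ^+ (n0 + j) : R)).
    by apply: ler_sum => j _; apply: sm; [exact: bp_pred|exact: L1].
  have : (\sum_(j < m) (1 / 2) ^+ (n0 + j) : R) = 2 * (1 / 2) ^+ n0 * (1 - (1 / 2) ^+ m).
    clear md s1 s2 h ae mS; elim: m => [|m ih]; first by rewrite big_ord0 expr0 subrr mulr0.
    by rewrite big_ord_recr/= ih exprD exprS; field.
  move=> ->; rewrite -[leRHS]mulr1; have h2 : 0 <= 1 / 2 :> R by lra.
  apply: ler_wpM2l; first by rewrite mulr_ge0// exprn_ge0.
  by rewrite gerBl exprn_ge0.
apply/ler_addgt0Pr => eps eps0.
have e4 : 0 < eps / 2 by rewrite divr_gt0.
have [N1 h1] := v1 _ e4; have [N2 h2] := v2 _ e4; pose m := maxn N1 N2.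
have {}h1 := h1 m (leq_maxl _ _); have {}h2 := h2 m (leq_maxr _ _); have h3 := mid m.
set A := vint JS (scaled (fun t w => K t w * b m t w) z) T in h1 h3.
set B := J (fun t w => K t w * b m t w) T in h2 h3.
have -> : (fun w => vint JS (scaled K z) T w - J K T w) =
    fun w => (A w - B w) - (A w - vint JS (scaled K z) T w) + (B w - J K T w).
  by apply/funext => w; ring.
have m1 := measurable_funB (mv m) (mJm m); have m2 := measurable_funB (mv m) mv'.
have m3 := measurable_funB (mJm m) (mJ K bK).
apply: le_trans (l0D P (measurable_funB m1 m2) m3) _.
have := l0B P m1 m2; rewrite -/A -/B; lra.
Qed.

Definition vsum (x : 'rV[R]_d) : R := \sum_i `|x 0 i|.
(** Together with [shrink x *: x] it compactifies the space. The l1 norm places the image on the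
    surface where the sum of all |p_i| plus p0 equals 1 ([shrink_vsum]), a relation that passes to
    limits. *)
Definition shrink (x : 'rV[R]_d) : R := (1 + vsum x)^-1.

Lemma vsum_ge0 x : 0 <= vsum x.
Proof. by apply: sumr_ge0 => i _. Qed.

Lemma shrink_gt0 x : 0 < shrink x.
Proof. by rewrite invr_gt0 ltr_wpDr// vsum_ge0. Qed.

Lemma shrink_le1 x : `|shrink x| <= 1.
Proof.
rewrite gtr0_norm ?shrink_gt0// invf_le1; first by rewrite lerDl vsum_ge0.
by rewrite ltr_wpDr// vsum_ge0.
Qed.

Lemma shrinkV x : (shrink x)^-1 = 1 + vsum x.
Proof. by rewrite invrK. Qed.

Lemma shrink_vsum x : \sum_i `|shrink x * x 0 i| = 1 - shrink x.
Proof.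
under eq_bigr do rewrite normrM (gtr0_norm (shrink_gt0 x)).
rewrite -mulr_sumr -/(vsum x) /shrink; field.
by rewrite gt_eqF// ltr_wpDr// vsum_ge0.
Qed.

Lemma shrink_coord_le1 x i : `|shrink x * x 0 i| <= 1.
Proof.
have : `|shrink x * x 0 i| <= \sum_i `|shrink x * x 0 i|.
  by rewrite (bigD1 i)//= lerDl sumr_ge0.
by move=> h; apply: le_trans h _; rewrite shrink_vsum gerBl ltW// shrink_gt0.
Qed.

Lemma predictable_shrink (theta : R -> Omega -> 'rV[R]_d) : vector_predictable theta ->
  predictable (fun t w => shrink (theta t w)).
Proof.
move=> pt; apply: predictable_inv; apply: predictableD; first exact: predictable_cst.
by apply: predictable_sum => i; apply: predictable_norm; exact: pt.
Qed.

(* Compactified limits of a sequence of integrands: [p / p0] is a finite limit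
   where [p0] is not 0, and [p] a direction of divergence where it is. *)
Definition directions z (p : R -> Omega -> 'rV[R]_d) (p0 : R -> Omega -> R) : Prop :=
  (forall i t w, shrink (z n t w) * z n t w 0 i @[n --> \oo] --> p t w 0 i) /\
  (forall t w, shrink (z n t w) @[n --> \oo] --> p0 t w).

Lemma normalize y : (forall n, vector_predictable (y n)) -> approximates y -> tracks y ->
  exists z p p0, [/\ forall n, vector_predictable (z n), approximates z, tracks z,
    forall n t w, exists m, z n t w = y m t w & directions z p p0].
Proof.
move=> py ay ty.
(* The d coordinates and, at j = d, the factor [shrink] itself: d + 1 bounded sequences sharing one
   random subsequence. *)
pose x j n t w : R := if insub j is Some i then shrink (y n t w) * y n t w 0 (i : 'I_d) else shrink (y n t w).
have px j n : predictable (x j n).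
  rewrite /x; case: insub => [i|]; last exact: predictable_shrink.
  by apply: predictableM; [exact: predictable_shrink|exact: py].
have x1 j n t w : `|x j n t w| <= 1.
  by rewrite /x; case: insub => [i|]; [exact: shrink_coord_le1|exact: shrink_le1].
have [mu [rmu gmu cmu]] := random_subsequence d.+1 px x1.
pose z n := select y (mu n).
exists z, (fun t w => \row_i lim (shrink (z n t w) * z n t w 0 i @[n --> \oo])),
  (fun t w => lim (shrink (z n t w) @[n --> \oo])); split.
- by move=> n; exact: vector_predictable_select.
- exact: approximates_select.
- exact: tracks_select.
- by move=> n t w; exists (mu n t w).
- split=> [i t w|t w].
    have := cmu i t w (ltnW (ltn_ord i : (i < d)%N)); rewrite mxE /x.
    by rewrite (insubT (fun j => (j < d)%N) (ltn_ord i)) (_ : Sub _ _ = i)//; exact: val_inj.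
  by have := cmu d t w (ltnSn d); rewrite /x insubF// ltnn.
Qed.

Section Directions.
Variables (z : nat -> R -> Omega -> 'rV[R]_d) (p : R -> Omega -> 'rV[R]_d) (p0 : R -> Omega -> R).
Hypothesis pz : forall n, vector_predictable (z n).
Hypothesis az : approximates z.
Hypothesis tz : tracks z.
Hypothesis dz : directions z p p0.

Lemma directions_predictable i : predictable (fun t w => p t w 0 i).
Proof.
have [h _] := dz.
apply: (@predictable_lim _ _ _ _ _ (fun n t w => shrink (z n t w) * z n t w 0 i)) => [n|t w _].
  by apply: predictableM; [exact: predictable_shrink|exact: pz].
exact: h.
Qed.

Lemma directions0_predictable : predictable p0.
Proof.
have [_ h] := dz.
apply: (@predictable_lim _ _ _ _ _ (fun n t w => shrink (z n t w))) => [n|t w _].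
  exact: predictable_shrink.
exact: h.
Qed.

Lemma directions_le1 i t w : `|p t w 0 i| <= 1.
Proof.
by have [h _] := dz; apply: (cvg_norm_bound (h i t w)) => n; exact: shrink_coord_le1.
Qed.

Lemma directions0_le1 t w : `|p0 t w| <= 1.
Proof. by have [_ h] := dz; apply: (cvg_norm_bound (h t w)) => n; exact: shrink_le1. Qed.

Lemma directions0_ge0 t w : 0 <= p0 t w.
Proof.
have [_ h] := dz; apply: (cvgr_to_ge (h t w)); near=> n; exact: ltW (shrink_gt0 _).
Unshelve. all: by end_near.
Qed.

Lemma directions_bp : vector_bp p.
Proof.
move=> i; split; first exact: directions_predictable.
by exists 1 => t w _; exact: directions_le1.
Qed.

(** The limit of [shrink_vsum]; it shows that p is nonzero wherever p0 = 0, which provides the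
    pivot. *)
Lemma directions_sum t w : \sum_i `|p t w 0 i| = 1 - p0 t w.
Proof.
have [h h0] := dz.
have c1 : (1 - shrink (z n t w)) @[n --> \oo] --> 1 - p0 t w.
  by apply: cvgB; [exact: cvg_cst|exact: h0].
have c2 : \sum_i (`|shrink (z n t w) * z n t w 0 i| - `|p t w 0 i|) @[n --> \oo] --> (0 : R).
  elim: (index_enum _) => [|i s ih].
    by under eq_fun do rewrite big_nil; exact: cvg_cst.
  under eq_fun do rewrite big_cons.
  have ci : `|shrink (z n t w) * z n t w 0 i| - `|p t w 0 i| @[n --> \oo] --> (0 : R).
    rewrite -(subrr `|p t w 0 i|); apply: cvgB; last exact: cvg_cst.
    by apply: cvg_norm; exact: h.
  by have c := cvgD ci ih; rewrite addr0 in c; exact: c.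
have c3 : (1 - shrink (z n t w)) @[n --> \oo] --> \sum_i `|p t w 0 i|.
  rewrite -[X in _ --> X]add0r.
  have -> : (fun n => 1 - shrink (z n t w)) = fun n =>
      \sum_i (`|shrink (z n t w) * z n t w 0 i| - `|p t w 0 i|) + \sum_i `|p t w 0 i|.
    by apply/funext => n; rewrite sumrB shrink_vsum; ring.
  by apply: cvgD; [exact: c2|exact: cvg_cst].
exact: (cvg_unique _ c3 c1).
Qed.

Lemma directions_unbounded t w (C : R) : (forall n, vsum (z n t w) <= C) -> p0 t w != 0.
Proof.
move=> hC; have [_ h] := dz; have C0 : 0 <= C := le_trans (vsum_ge0 _) (hC 0%N).
rewrite gt_eqF//; apply: (@lt_le_trans _ _ (1 + C)^-1); first by rewrite invr_gt0 ltr_wpDr.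
apply: (cvgr_to_ge (h t w)); near=> n.
by rewrite lef_pV2 ?posrE ?ltr_wpDr ?vsum_ge0// lerD2l.
Unshelve. all: by end_near.
Qed.

Lemma directions_bounded t w : p0 t w != 0 -> exists C, forall n, vsum (z n t w) <= C.
Proof.
move=> hp; have [_ h] := dz.
have c : (1 + vsum (z n t w)) @[n --> \oo] --> (p0 t w)^-1.
  by under eq_fun do rewrite -shrinkV; apply: cvgV => //; exact: h.
have [M [_ hM]] := cvg_seq_bounded (cvgP _ c).
exists (M + 1) => n; have := hM (M + 1) ltac:(rewrite ltrDl//) n I.
rewrite /= ger0_norm ?addr_ge0 ?vsum_ge0// => hn; apply: le_trans hn; rewrite lerDr.
exact: ler01.
Qed.

(** Multiplying z . S, which approximates Y, by K and [shrink] makes both integrands bounded, so the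
    limit can be taken: p . S = p0 . Y. Where p0 = 0 this says that p is a null strategy. *)
Lemma directions_relation K : bp K ->
  {ae P, forall w, vint JS (scaled K p) T w = J (fun t w => K t w * p0 t w) T w}.
Proof.
have TT := T_in T_ge0; have [h h0] := dz.
have bp0 : bp p0 by split; [exact: directions0_predictable|exists 1 => t w _; exact: directions0_le1].
have mv L : bp L -> measurable_fun setT (vint JS (scaled L p) T).
  by move=> bL; apply: (vint_measurable JSop) => //; apply: scaled_bp => //; exact: directions_bp.
have mJ L : bp L -> measurable_fun setT (J L T) by move=> bL; exact: (op_measurable opJ).
have unit L : predictable L -> (forall t w, t \in `[0, T] -> `|L t w| <= 1) ->
    {ae P, forall w, vint JS (scaled L p) T w = J (fun t w => L t w * p0 t w) T w}.
  move=> pL L1; have bL : bp L by split=> //; exists 1.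
  have bLp := bpM bL bp0.
  apply: l0_eq_ae; [exact: mv|exact: mJ|].
  apply/ler_addgt0Pr => e e0; rewrite add0r; have e3 : 0 < e / 3 by rewrite divr_gt0.
  have [n0 hn0] := az e3.
  pose q n : R -> Omega -> 'rV[R]_d := scaled (fun t w => shrink (z n t w)) (z n).
  have qE n i t w : scaled L (q n) t w 0 i = L t w * (shrink (z n t w) * z n t w 0 i).
    by rewrite /scaled !mxE.
  have q1 n i t w : t \in `[0, T] -> `|scaled L (q n) t w 0 i| <= 1.
    move=> tT; rewrite qE normrM -[leRHS]mul1r.
    by apply: ler_pM => //; [exact: L1|exact: shrink_coord_le1].
  have pq n i : predictable (fun t w => scaled L (q n) t w 0 i).
    have -> : (fun t w => scaled L (q n) t w 0 i) = fun t w => L t w * (shrink (z n t w) * z n t w 0 i).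
      by apply/funext => t; apply/funext => w; exact: qE.
    apply: predictableM => //; apply: predictableM; [exact: predictable_shrink|exact: pz].
  have bq n : vector_bp (scaled L (q n)) by move=> i; split=> //; exists 1 => t w; exact: q1.
  have bLr n : bp (fun t w => L t w * shrink (z n t w)).
    apply: bpM => //; split; first exact: predictable_shrink.
    by exists 1 => t w _; exact: shrink_le1.
  have v1 : vanishing (fun n => l0 P (fun w => vint JS (scaled L (q n)) T w - vint JS (scaled L p) T w)).
    apply: (vint_dominated JSop (C := 1)) => //.
    - move=> i; apply: bp_pred; apply: scaled_bp => //; exact: directions_bp.
    - move=> i t w tT; under eq_fun do rewrite qE.
      by rewrite /scaled mxE; apply: cvgM; [exact: cvg_cst|exact: h].
  have v2 : vanishing (fun n => l0 P (fun w => J (fun t w => L t w * shrink (z n t w)) T w -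
      J (fun t w => L t w * p0 t w) T w)).
    apply: (op_dominated opJ (C := 1)) => //.
    - by move=> n; exact: bp_pred.
    - exact: bp_pred.
    - move=> n t w tT; rewrite normrM -[leRHS]mul1r.
      by apply: ler_pM => //; [exact: L1|exact: shrink_le1].
    - by move=> t w _; apply: cvgM; [exact: cvg_cst|exact: h0].
  have [N1 h1] := v1 _ e3; have [N2 h2] := v2 _ e3.
  pose n := maxn n0 (maxn N1 N2).
  have n0n : (n0 <= n)%N by exact: leq_maxl.
  have {}h1 := h1 n (leq_trans (leq_maxl _ _) (leq_maxr _ _)).
  have {}h2 := h2 n (leq_trans (leq_maxr _ _) (leq_maxr _ _)).
  have E : scaled (fun t w => L t w * shrink (z n t w)) (select z (fun _ _ => n)) = scaled L (q n).
    by apply/funext => t; apply/funext => w; rewrite /scaled /q /scaled scalerA.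
  have h3 := hn0 (fun _ _ => n) (fun t w => L t w * shrink (z n t w)) (random_index_cst n)
    (fun _ _ => n0n) (bp_pred (bLr n)).
  rewrite E in h3.
  have {}h3 := h3 ltac:(by move=> t w tT; rewrite normrM -[leRHS]mul1r; apply: ler_pM => //; [exact: L1|exact: shrink_le1]) (bq n).
  set A := vint JS (scaled L (q n)) T in h1 h3.
  set B := J (fun t w => L t w * shrink (z n t w)) T in h2 h3.
  have -> : (fun w => vint JS (scaled L p) T w - J (fun t w => L t w * p0 t w) T w) =
      fun w => (A w - B w) - (A w - vint JS (scaled L p) T w) + (B w - J (fun t w => L t w * p0 t w) T w).
    by apply/funext => w; ring.
  have mA : measurable_fun setT A by exact: (vint_measurable JSop).
  have mB : measurable_fun setT B by exact: mJ.
  have m1 := measurable_funB mA mB; have m2 := measurable_funB mA (mv L bL).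
  have m3 := measurable_funB mB (mJ _ bLp).
  apply: le_trans (l0D P (measurable_funB m1 m2) m3) _.
  have := l0B P m1 m2; lra.
move=> bK; have [pK [C hC]] := bK; pose c := Num.max C 1.
have c0 : 0 < c by rewrite lt_max ltr01 orbT.
pose L t w := c^-1 * K t w.
have bL : bp L by exact: bpZ.
have L1 t w : t \in `[0, T] -> `|L t w| <= 1.
  move=> tT; rewrite /L normrM normfV (gtr0_norm c0) ler_pdivrMl// mulr1.
  by apply: le_trans (hC t w tT) _; rewrite le_max lexx.
have cL t w : c * L t w = K t w by rewrite /L mulrA mulfV ?mul1r// gt_eqF.
have s1 := op_scale (soi_vint T_ge0 filF JSop directions_bp) c bL TT.
have s2 := op_scale opJ c (bpM bL bp0) TT.
have E1 : (fun t w => c * L t w) = K by apply/funext => t; apply/funext => w; exact: cL.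
have E2 : (fun t w => c * (L t w * p0 t w)) = fun t w => K t w * p0 t w.
  by apply/funext => t; apply/funext => w; rewrite mulrA cL.
rewrite E1 in s1; rewrite E2 in s2.
by apply: filterS3 s1 s2 (unit L (bp_pred bL) L1) => w -> -> ->.
Qed.

Lemma dot_near_bounded w t : 0 < t <= T -> exists2 M : R, 0 < M &
  \forall u \near t^'-, (forall i, `|S u w i 0| <= M) /\ `|V u w| <= M.
Proof.
move=> tT; have bnd (W : R -> Omega -> R) : cadlag T W -> exists2 M : R, 0 < M & \forall u \near t^'-, `|W u w| <= M.
  move=> cW; have [_ /(_ t tT) /cvg_ex [l cl]] := cW w.
  exists (`|l| + 1); first by rewrite ltr_wpDl.
  by apply: (cvgr_norm_le _ cl); rewrite ltrDl.
have [MV MV0 hV] := bnd V cV.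
have [MS MS0 hS] : exists2 M : R, 0 < M & \forall u \near t^'-, forall i : 'I_d, i \in index_enum 'I_d -> `|S u w i 0| <= M.
  elim: (index_enum 'I_d) => [|i s [M M0 ih]]; first by exists 1 => //; near=> u.
  have [Mi Mi0 hi] := bnd _ (cS i).
  exists (Num.max Mi M); first by rewrite lt_max Mi0.
  near=> u => j; rewrite inE => /orP[/eqP ->|js].
    by rewrite le_max; apply/orP; left; near: u; exact: hi.
  by rewrite le_max; apply/orP; right; move: j js; near: u; exact: ih.
exists (Num.max MS MV); first by rewrite lt_max MS0.
near=> u; split.
- move=> i; rewrite le_max; apply/orP; left.
  have h : forall i : 'I_d, i \in index_enum 'I_d -> `|S u w i 0| <= MS by near: u; exact: hS.
  by apply: h; exact: mem_index_enum.
- by rewrite le_max; apply/orP; right; near: u; exact: hV.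
Unshelve. all: by end_near.
Qed.

(** The counterpart of [directions_relation] on left limits, p S_{t-} = p0 V_{t-}. *)
Lemma directions_track : {ae P, forall w, forall t, 0 < t <= T -> forall e, 0 < e ->
  \forall u \near t^'-, `|dot (p t w) u w - p0 t w * V u w| <= e}.
Proof.
have [h h0] := dz; apply: filterS tz => w tw t tT e e0.
have [M M0 hM] := dot_near_bounded w tT.
have e4 : 0 < e / 4 by rewrite divr_gt0.
have [n0 hn0] := tw _ e4.
(* The d coordinate errors and the error in p0, each multiplied by at most M, add up to e / 4. *)
pose del := e / 4 / (M * d.+1%:R); have del0 : 0 < del by rewrite !divr_gt0// mulr_gt0.
have [N1 hN1] : exists N, forall n, (N <= n)%N -> forall i, i \in index_enum 'I_d ->
    `|p t w 0 i - shrink (z n t w) * z n t w 0 i| <= del.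
  elim: (index_enum 'I_d) => [|i s [N ih]]; first by exists 0%N.
  have [Ni _ hi] := (cvgrPdist_le _ _).1 (h i t w) _ del0.
  exists (maxn Ni N) => n; rewrite geq_max => /andP[Nin Nn] j.
  by rewrite inE => /orP[/eqP ->|js]; [exact: hi|exact: ih].
have [N2 _ hN2] := (cvgrPdist_le _ _).1 (h0 t w) _ del0.
pose n := maxn n0 (maxn N1 N2).
have n0n : (n0 <= n)%N by exact: leq_maxl.
have a1 i := hN1 n (leq_trans (leq_maxl _ _) (leq_maxr _ _)) i (mem_index_enum i).
have a2 := hN2 n (leq_trans (leq_maxr _ _) (leq_maxr _ _)).
have a3 := hn0 n t n0n tT.
near=> u.
have [b1 b2] : (forall i, `|S u w i 0| <= M) /\ `|V u w| <= M by near: u; exact: hM.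
have b3 : `|dot (z n t w) u w - V u w| <= e / 4 by near: u; exact: a3.
pose r := shrink (z n t w).
have -> : dot (p t w) u w - p0 t w * V u w =
   \sum_i (p t w 0 i - r * z n t w 0 i) * S u w i 0 + r * (dot (z n t w) u w - V u w)
     - (p0 t w - r) * V u w.
  rewrite /dot mulrBr mulr_sumr.
  under [X in _ = X + _ - _]eq_bigr do rewrite mulrBl.
  rewrite sumrB; under [X in _ = _ + (X - _) - _]eq_bigr do rewrite mulrA.
  ring.
have dM : del * M * d.+1%:R = e / 4.
  by rewrite /del; field; rewrite gt_eqF//=; apply/eqP; lra.
have c1 : `|\sum_i (p t w 0 i - r * z n t w 0 i) * S u w i 0| <= del * M * d%:R.
  apply: le_trans (ler_norm_sum _ _ _) _.
  rewrite -[X in _ <= _ * X%:R](card_ord d) mulr_natr -sumr_const.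
  by apply: ler_sum => i _; rewrite normrM ler_pM ?a1 ?b1.
have c2 : `|r * (dot (z n t w) u w - V u w)| <= e / 4.
  rewrite normrM -[leRHS]mul1r; apply: ler_pM => //; exact: shrink_le1.
have c3 : `|(p0 t w - r) * V u w| <= del * M.
  by rewrite normrM; apply: ler_pM => //; exact: a2.
have dM0 : 0 <= del * M by rewrite mulr_ge0// ltW.
have d1 : (d.+1%:R : R) = d%:R + 1 by rewrite -natr1.
rewrite d1 mulrDr mulr1 in dM.
apply: le_trans (ler_normB _ _) _.
have := ler_normD (\sum_i (p t w 0 i - r * z n t w 0 i) * S u w i 0) (r * (dot (z n t w) u w - V u w)).
have dd : 0 <= del * M * d%:R by rewrite mulr_ge0.
lra.
Unshelve. all: by end_near.
Qed.

Definition eliminated (c : nat -> R -> Omega -> R) n : R -> Omega -> 'rV[R]_d :=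
  fun t w => (- c n t w) *: p t w + z n t w.

Variable c : nat -> R -> Omega -> R.
Hypothesis pc : forall n, predictable (c n).
Hypothesis cp0 : forall n t w, c n t w * p0 t w = 0.

Lemma eliminated_predictable n : vector_predictable (eliminated c n).
Proof.
move=> i; have -> : (fun t w => eliminated c n t w 0 i) =
    fun t w => z n t w 0 i - c n t w * p t w 0 i.
  by apply/funext => t; apply/funext => w; rewrite !mxE; ring.
apply: predictableB; first exact: pz.
by apply: predictableM => //; exact: directions_predictable.
Qed.

(** From c p0 = 0 follows (c p) . S = (c p0) . Y = 0, so subtracting c p changes no integral. As c
    may be unbounded, this is carried out where z and c are at most m. *)
Lemma eliminated_approximates : approximates (eliminated c).
Proof.
move=> e e0; have [n0 hn0] := az e0; have TT := T_in T_ge0.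
exists n0 => mu K rmu gmu pK K1 bKz'.
have bK : bp K by split=> //; exists 1.
pose cm t w := c (mu t w) t w.
have pcm : predictable cm by exact: predictable_select.
have pzm := vector_predictable_select rmu pz.
pose b m t w := below (select z mu) m t w * (`|cm t w| <= m%:R)%R%:R.
have bcm m : bp (fun t w => (`|cm t w| <= m%:R)%R%:R).
  apply: (@bp_bool _ _ _ _ _ (fun t w => `|cm t w| <= m%:R)).
  by apply: predictable_ler; [exact: predictable_norm|exact: predictable_cst].
have bb m : bp (b m) by apply: bpM => //; exact: below_bp.
have b1 m t w : `|b m t w| <= 1.
  rewrite normrM -[leRHS]mul1r; apply: ler_pM => //; first exact: below_le1.
  by case: (`|cm t w| <= m%:R); rewrite ?normr0 ?normr1.
have bcv t w : b m t w @[m --> \oo] --> (1 : R).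
  rewrite -[X in _ --> X]mulr1; apply: cvgM; first exact: below_cvg1.
  apply: (@cvg_eventually _ _ _ (Num.truncn `|cm t w|).+1) => m mm.
  have /andP[_ h] := truncn_itv (normr_ge0 (cm t w)).
  by rewrite (_ : _ <= _ = true)//; apply: (le_trans (ltW h)); rewrite ler_nat.
have v1 := vint_localized T_ge0 filF JSop bKz' bb (fun m t w _ => b1 m t w) (fun t w _ => bcv t w).
have v2 := op_dominated_mul T_ge0 opJ bK bb (fun m t w _ => b1 m t w) (fun t w _ => bcv t w).
set z' := select (eliminated c) mu in bKz' v1 *.
have mv m : measurable_fun setT (vint JS (scaled (fun t w => K t w * b m t w) z') T).
  by apply: (vint_measurable JSop) => //; rewrite scaledM; exact: scaled_bp.
have mv' : measurable_fun setT (vint JS (scaled K z') T) by exact: (vint_measurable JSop).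
have mJ L : bp L -> measurable_fun setT (J L T) by move=> bL; exact: (op_measurable opJ).
have mJm m : measurable_fun setT (J (fun t w => K t w * b m t w) T) by apply: mJ; exact: bpM.
have mid m : l0 P (fun w => vint JS (scaled (fun t w => K t w * b m t w) z') T w
    - J (fun t w => K t w * b m t w) T w) <= e.
  pose L t w := K t w * b m t w.
  have bL : bp L by exact: bpM.
  have L1 t w : t \in `[0, T] -> `|L t w| <= 1.
    by move=> tT; rewrite normrM -[leRHS]mul1r; apply: ler_pM => //; exact: K1.
  have bLz : vector_bp (scaled L (select z mu)).
    have -> : scaled L (select z mu) = scaled (fun t w => K t w * (`|cm t w| <= m%:R)%R%:R) (truncation (select z mu) m).
      rewrite truncationE; apply/funext => t; apply/funext => w; rewrite /scaled scalerA /L /b.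
      by congr (_ *: _); ring.
    by apply: scaled_bp; [exact: bpM|exact: truncation_bp].
  pose Lc t w := - (L t w * cm t w).
  have bLc : bp Lc.
    split; first by apply: predictableN; apply: predictableM => //; exact: bp_pred.
    exists m%:R => t w tT; rewrite /Lc normrN /L /b !mulrA -mulrA normrM -[leRHS]mul1r.
    apply: ler_pM => //.
      rewrite normrM -[leRHS]mul1r; apply: ler_pM => //; [exact: K1|exact: below_le1].
    by rewrite normrM; case: (boolP (`|cm t w| <= m%:R)) => hc; rewrite ?normr1 ?mul1r// normr0 mul0r.
  have E : scaled L z' = fun t w => 1 *: scaled Lc p t w + scaled L (select z mu) t w.
    apply/funext => t; apply/funext => w.
    rewrite /scaled scale1r /z' /select /eliminated scalerDr scalerA; congr (_ *: _ + _).
    by rewrite /Lc /cm; ring.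
  have l := vint_lin JSop 1 (scaled_bp bLc directions_bp) bLz TT.
  have r := directions_relation bLc.
  have E0 : (fun t w => Lc t w * p0 t w) = fun _ _ => 0.
    by apply/funext => t; apply/funext => w; rewrite /Lc mulNr -mulrA cp0 mulr0 oppr0.
  rewrite E0 in r.
  have j0 : {ae P, forall w, J (fun _ _ => 0) T w = 0} by apply: (op_eq0 opJ).
  have ae : {ae P, forall w, vint JS (scaled L z') T w - J L T w =
      vint JS (scaled L (select z mu)) T w - J L T w}.
    by rewrite E; apply: filterS3 l r j0 => w -> -> ->; ring.
  have mz : measurable_fun setT (vint JS (scaled L (select z mu)) T) by exact: (vint_measurable JSop).
  rewrite (l0_ae (measurable_funB (mv m) (mJm m)) (measurable_funB mz (mJm m)) ae).
  by apply: hn0 => //; exact: bp_pred.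
apply/ler_addgt0Pr => eps eps0.
have e4 : 0 < eps / 2 by rewrite divr_gt0.
have [N1 h1] := v1 _ e4; have [N2 h2] := v2 _ e4; pose m := maxn N1 N2.
have {}h1 := h1 m (leq_maxl _ _); have {}h2 := h2 m (leq_maxr _ _); have h3 := mid m.
set A := vint JS (scaled (fun t w => K t w * b m t w) z') T in h1 h3.
set B := J (fun t w => K t w * b m t w) T in h2 h3.
have -> : (fun w => vint JS (scaled K z') T w - J K T w) =
    fun w => (A w - B w) - (A w - vint JS (scaled K z') T w) + (B w - J K T w).
  by apply/funext => w; ring.
have m1 := measurable_funB (mv m) (mJm m); have m2 := measurable_funB (mv m) mv'.
have m3 := measurable_funB (mJm m) (mJ K bK).
apply: le_trans (l0D P (measurable_funB m1 m2) m3) _.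
have := l0B P m1 m2; rewrite -/A -/B; lra.
Qed.

(** Where c is nonzero, p0 = 0 and hence p S_{t-} = 0; elsewhere z is unchanged. *)
Lemma eliminated_tracks : tracks (eliminated c).
Proof.
apply: filterS2 tz directions_track => w tw dw e e0.
have e2 : 0 < e / 2 by rewrite divr_gt0.
have [n0 hn0] := tw _ e2; exists n0 => n t nn tT.
have dE u : dot (eliminated c n t w) u w = dot (z n t w) u w - c n t w * dot (p t w) u w.
  rewrite /dot mulr_sumr -sumrB; apply: eq_bigr => i _; rewrite !mxE; ring.
have [c0|c0] := eqVneq (c n t w) 0.
  near=> u; rewrite dE c0 mul0r subr0.
  by apply: (@le_trans _ _ (e / 2)); [near: u; exact: hn0|lra].
have z0 : p0 t w = 0 by have := cp0 n t w => /eqP; rewrite mulf_eq0 (negbTE c0) => /eqP.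
have del0 : 0 < e / 2 / `|c n t w| by rewrite divr_gt0// normr_gt0.
have hd := dw t tT _ del0.
near=> u; rewrite dE.
have a1 : `|dot (z n t w) u w - V u w| <= e / 2 by near: u; exact: hn0.
have a2 : `|dot (p t w) u w - p0 t w * V u w| <= e / 2 / `|c n t w| by near: u; exact: hd.
rewrite z0 mul0r subr0 in a2.
have a3 : `|c n t w * dot (p t w) u w| <= e / 2.
  by rewrite normrM mulrC -ler_pdivlMr// normr_gt0.
rewrite (_ : _ - _ - _ = (dot (z n t w) u w - V u w) - c n t w * dot (p t w) u w); last by ring.
by apply: le_trans (ler_normB _ _) _; lra.
Unshelve. all: by end_near.
Qed.

End Directions.

(* The invariant of the elimination: at each [(t, w)] a round that does not reach
   a bounded sequence makes one more coordinate vanish, so finitely many rounds suffice. *)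
Definition settled k y : Prop := forall t w, (exists C, forall n, vsum (y n t w) <= C) \/
  exists A : {set 'I_d}, (k <= #|A|)%N /\ forall j, j \in A -> forall n, y n t w 0 j = 0.

Lemma settled_normalized k y z : settled k y ->
  (forall n t w, exists m, z n t w = y m t w) -> settled k z.
Proof.
move=> sy zy t w; have [[C hC]|[A [kA hA]]] := sy t w; [left; exists C|right; exists A; split=> // j jA];
  by move=> n; have [m ->] := zy n t w => //; exact: hA.
Qed.

Definition first_nonzero (p : R -> Omega -> 'rV[R]_d) (i : 'I_d) t w : bool :=
  (p t w 0 i != 0) && all (fun j => if insub j is Some j' then p t w 0 (j' : 'I_d) == 0 else true) (iota 0 i).

(** As in Gaussian elimination, the multiple of p that clears the first coordinate in which p is
    nonzero; it is 0 where p0 is not. The sum has at most one nonzero term and makes predictability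
    evident. *)
Definition pivot z p (p0 : R -> Omega -> R) n t w : R :=
  \sum_i (p0 t w == 0)%:R * (first_nonzero p i t w)%:R * (z n t w 0 i / p t w 0 i).

Lemma first_nonzero_exists (p : R -> Omega -> 'rV[R]_d) t w : (exists i, p t w 0 i != 0) -> exists i, first_nonzero p i t w.
Proof.
move=> [i0 hi0].
pose b k := if insub k is Some k' then p t w 0 (k' : 'I_d) != 0 else false.
have bi0 : b i0 by rewrite /b valK.
have [m bm hm] := ex_minnP (ex_intro b _ bi0).
move: bm; rewrite /b; case: insubP => // i md im pi.
exists i; rewrite /first_nonzero pi/=; apply/allP => j; rewrite mem_iota/= add0n => ji.
case: insubP => // j' _ jj; apply: contraT => pj.
have : b j by rewrite /b -jj valK.
by move=> /hm; rewrite -im leqNgt ji.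
Qed.

Lemma first_nonzero_unique p t w i j : first_nonzero p i t w -> first_nonzero p j t w -> i = j.
Proof.
have h i' j' : first_nonzero p i' t w -> first_nonzero p j' t w -> ~~ (i' < j')%N.
  move=> /andP[pi _] /andP[_ /allP hj]; apply/negP => ij.
  by have := hj (val i'); rewrite mem_iota/= add0n ij valK => /(_ isT); rewrite (negbTE pi).
move=> hi hj; apply/val_inj/eqP; rewrite eqn_leq; apply/andP; split; rewrite leqNgt; exact: h.
Qed.

Lemma pivotE z p p0 n t w i : p0 t w = 0 -> first_nonzero p i t w ->
  pivot z p p0 n t w = z n t w 0 i / p t w 0 i.
Proof.
move=> z0 fi; rewrite /pivot (bigD1 i)//= fi z0 eqxx !mul1r big1 ?addr0// => j ji.
case: (boolP (first_nonzero p j t w)) => fj; last by rewrite mulr0 mul0r.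
by rewrite (first_nonzero_unique fj fi) eqxx in ji.
Qed.

Lemma pivot_predictable z (p : R -> Omega -> 'rV[R]_d) p0 n : (forall i, predictable (fun t w => z n t w 0 i)) ->
  (forall i, predictable (fun t w => p t w 0 i)) -> predictable p0 -> predictable (pivot z p p0 n).
Proof.
move=> pz pp pp0; apply: predictable_sum => i.
apply: predictableM; last by apply: predictableM => //; exact: predictable_inv.
apply: predictableM; first exact: predictable_eqr.
apply: predictableI; first by apply: predictableC; exact: predictable_eqr.
apply: (@predictable_all _ _ _ _ _ (fun j t w => if insub j is Some j' then p t w 0 (j' : 'I_d) == 0 else true)).
by move=> j; case: insub => [j'|]; [exact: predictable_eqr|exact: predictable_cst].
Qed.

(** Where p0 is nonzero the sequence is bounded and left alone. Where p0 = 0, p is nonzero and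
    inherits the zero coordinates of z, so the pivot coordinate is new and the old zeros survive the
    subtraction. *)
Lemma eliminate_round k y : (forall n, vector_predictable (y n)) -> approximates y -> tracks y ->
  settled k y -> exists y', [/\ forall n, vector_predictable (y' n), approximates y', tracks y' &
    settled k.+1 y'].
Proof.
move=> py ay ty sy; have [z [p [p0 [pz az tz zy dz]]]] := normalize py ay ty.
have sz := settled_normalized sy zy.
have pp i := directions_predictable pz dz i; have pp0 := directions0_predictable pz dz.
pose c := pivot z p p0.
have pc n : predictable (c n) by exact: pivot_predictable (fun i => pz n i) pp pp0.
have cp0 n t w : c n t w * p0 t w = 0.
  rewrite /c /pivot mulr_suml big1// => i _.
  by case: eqP => [->|_]; rewrite ?mulr0// !mul0r.
exists (eliminated z p c); split.
- by move=> n; exact: (eliminated_predictable pz dz pc).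
- exact: (eliminated_approximates pz az dz pc cp0).
- exact: (eliminated_tracks tz dz cp0).
move=> t w; have [z0|nz0] := eqVneq (p0 t w) 0; last first.
  left; have [C hC] := directions_bounded dz nz0; exists C => n.
  have cn : c n t w = 0 by have := cp0 n t w => /eqP; rewrite mulf_eq0 (negbTE nz0) orbF => /eqP.
  by rewrite /eliminated cn oppr0 scale0r add0r.
right; have [[C hC]|[A [kA hA]]] := sz t w.
  by have := directions_unbounded dz hC; rewrite z0 eqxx.
have [i fi] : exists i, first_nonzero p i t w.
  apply: first_nonzero_exists; apply: contrapT => hn.
  have := directions_sum dz t w; rewrite z0 subr0 big1 => [/eqP|i _]; first by rewrite eq_sym oner_eq0.
  by apply/eqP; rewrite normr_eq0; apply/negP => /negP h; apply: hn; exists i.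
have pi : p t w 0 i != 0 by case/andP: fi.
have pA j : j \in A -> p t w 0 j = 0.
  move=> jA; have [h _] := dz; have c0 := h j t w.
  have E : (fun n => shrink (z n t w) * z n t w 0 j) = fun=> 0.
    by apply/funext => n; rewrite hA// mulr0.
  rewrite E in c0; have c1 : (0 : R) @[n --> \oo] --> (0 : R) by exact: cvg_cst.
  exact: (cvg_unique _ c0 c1).
exists (i |: A); split.
  by rewrite cardsU1 (_ : i \notin A)//; apply: contra pi => /pA ->.
move=> j; rewrite in_setU1 => /orP[/eqP ->|jA] n; rewrite !mxE.
  by rewrite /c (pivotE z n z0 fi); field.
by rewrite hA// pA// mulr0 add0r.
Qed.

Lemma settled_all y : (forall n, vector_predictable (y n)) -> approximates y -> tracks y ->
  forall k, exists y', [/\ forall n, vector_predictable (y' n), approximates y', tracks y' &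
    settled k y'].
Proof.
move=> py ay ty; elim=> [|k [y' [py' ay' ty' sy']]]; last exact: eliminate_round sy'.
by exists y; split=> // t w; right; exists finset.set0; split=> // j; rewrite inE.
Qed.

(** After d + 1 rounds the vanishing coordinates would outnumber all coordinates, so the sequence is
    bounded at every (t, w). Hence p0 is nonzero and p / p0 is the limit integrand. *)
Lemma limit_integrand y : (forall n, vector_predictable (y n)) -> approximates y -> tracks y ->
  exists theta, [/\ vector_predictable theta, integrates P T F JS theta Y J &
    {ae P, forall w, forall t, 0 < t <= T -> forall e, 0 < e ->
      \forall u \near t^'-, `|dot (theta t w) u w - V u w| <= e}].
Proof.
move=> py ay ty; have [y' [py' ay' ty' sy']] := settled_all py ay ty d.+1.
have [z [p [p0 [pz az tz zy dz]]]] := normalize py' ay' ty'.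
have pp i := directions_predictable pz dz i; have pp0 := directions0_predictable pz dz.
have nz t w : p0 t w != 0.
  have [[C hC]|[A [kA _]]] := settled_normalized sy' zy t w; first exact: (directions_unbounded dz hC).
  by have := leq_trans kA (max_card _); rewrite card_ord ltnn.
have p0_gt0 t w : 0 < p0 t w by rewrite lt_neqAle eq_sym nz (directions0_ge0 dz).
pose theta : R -> Omega -> 'rV[R]_d := fun t w => (p0 t w)^-1 *: p t w.
exists theta; split.
- move=> i; have -> : (fun t w => theta t w 0 i) = fun t w => (p0 t w)^-1 * p t w 0 i.
    by apply/funext => t; apply/funext => w; rewrite mxE.
  by apply: predictableM => //; exact: predictable_inv.
(* Localization to p0 >= 1/(m+1), where K / p0 is bounded and can be inserted into
   [directions_relation]. *)
- pose b m t w : R := (m.+1%:R^-1 <= p0 t w)%R%:R.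
  have bb m : bp (b m).
    by apply: (@bp_bool _ _ _ _ _ (fun t w => m.+1%:R^-1 <= p0 t w)); apply: predictable_ler => //; exact: predictable_cst.
  apply: (integrates_localized T_ge0 filF JSop (b_ := b) opJ bb).
  + by move=> m t w _; rewrite /b; case: (m.+1%:R^-1 <= p0 t w); rewrite ?normr0 ?normr1.
  + move=> t w _; apply: (@cvg_eventually _ _ _ (Num.truncn (p0 t w)^-1).+1) => m mm.
    have pi0 : 0 <= (p0 t w)^-1 by rewrite invr_ge0 ltW.
    have /andP[_ h] := truncn_itv pi0.
    rewrite /b (_ : _ <= _ = true)// invf_ple ?posrE//.
    by apply: (le_trans (ltW h)); rewrite ler_nat; exact: leq_trans mm (leqnSn m).
  + move=> m K bK _; pose L t w := K t w * b m t w / p0 t w.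
    have bL : bp L.
      have -> : L = fun t w => K t w * (b m t w / p0 t w).
        by apply/funext => t; apply/funext => w; rewrite mulrA.
      apply: bpM => //; split.
        by apply: predictableM; [exact: bp_pred|exact: predictable_inv].
      exists m.+1%:R => t w _; rewrite /b; case: (boolP (m.+1%:R^-1 <= p0 t w)) => h; last by rewrite mul0r normr0.
      rewrite mul1r gtr0_norm; last by rewrite invr_gt0.
      by rewrite invf_ple ?posrE.
    have r := directions_relation pz az dz bL.
    have E1 : (fun t w => L t w * p0 t w) = fun t w => K t w * b m t w.
      by apply/funext => t; apply/funext => w; rewrite /L divfK.
    have E2 : scaled L p = scaled (fun t w => K t w * b m t w) theta.
      by apply/funext => t; apply/funext => w; rewrite /scaled /theta scalerA.
    by rewrite E1 E2 in r; apply: filterS r => w ->.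
- apply: filterS (directions_track tz dz) => w h t tT e e0.
  have hd := h t tT (e * p0 t w) (mulr_gt0 e0 (p0_gt0 t w)).
  apply: filterS hd => u hu.
  have -> : dot (theta t w) u w - V u w = (dot (p t w) u w - p0 t w * V u w) / p0 t w.
    rewrite mulrBl [p0 t w * _]mulrC mulfK//; congr (_ - _).
    by rewrite /dot mulr_suml; apply: eq_bigr => i _; rewrite mxE; ring.
  by rewrite normrM normfV (gtr0_norm (p0_gt0 t w)) ler_pdivrMr.
Qed.

End LimitIntegrands.

(** * Stopping times *)

Section StoppingTimes.
Context {disp : measure_display} {Omega : measurableType disp} {R : realType}.
Variables (P : probability Omega R) (T : R) (F : R -> set (set Omega)).
Hypothesis T_ge0 : 0 <= T.
Hypothesis filF : filtration T F.
Local Notation meas W := (forall t, t \in `[0, T] -> measurable_fun setT (W t)).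

(** The graph map w -> (sigma w, w) is measurable as soon as it is so on rectangles. G is a
    parameter: F_t for a constant time, all events for a stopping time. *)
Lemma predictable_sets_preimage (G : set (set Omega)) (sigma : Omega -> R) : sigma_algebra setT G ->
  (forall w, sigma w \in `[0, T]) ->
  (forall B, predictable_rectangles T F B -> G [set w | B (sigma w, w)]) ->
  forall B, predictable_sets T F B -> G [set w | B (sigma w, w)].
Proof.
move=> [G0 GC GU] sT hG; rewrite /predictable_sets.
suff : <<s `[0, T] `*` setT, predictable_rectangles T F >> `<=`
    [set B : set (R * Omega) | G [set w | B (sigma w, w)]] by [].
apply: smallest_sub => //; split=> /=.
- by rewrite (_ : [set w | _] = set0).
- move=> A GA; rewrite (_ : [set w | _] = setT `\` [set w | A (sigma w, w)]); first exact: GC.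
  by apply/seteqP; split=> w /= [h1 h2]; split=> //; split=> //; exact: sT.
- move=> A GA; rewrite (_ : [set w | _] = \bigcup_k [set w | A k (sigma w, w)]); first exact: GU.
  by apply/seteqP; split=> w /= [k _ h]; exists k.
Qed.

Lemma predictable_preimage (G : set (set Omega)) (sigma : Omega -> R) H : sigma_algebra setT G ->
  (forall w, sigma w \in `[0, T]) ->
  (forall B, predictable_rectangles T F B -> G [set w | B (sigma w, w)]) ->
  predictable T F H -> forall B, measurable B -> G [set w | B (H (sigma w) w)].
Proof.
move=> sG sT hG pH B mB; have := predictable_sets_preimage sG sT hG (pH B mB).
rewrite (_ : [set w | _] = [set w | B (H (sigma w) w)])//.
apply/seteqP; split=> w /= => [[]//|h]; split=> //; split=> //=; exact: sT.
Qed.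

Lemma predictable_known H t : predictable T F H -> t \in `[0, T] -> known F t (H t).
Proof.
move=> pH tT; have [hs hle _] := filF; apply/(knownP filF) => // B mB.
have sG := hs t tT; have [G0 GC GU] := sG.
apply: (predictable_preimage (sigma := fun=> t) sG _ _ pH) => // {B mB} B [[A FA <-]|[s [r [A [s0 sr rT FA ->]]]]].
- have [t0|t0] := eqVneq t 0.
    rewrite (_ : [set w | _] = A) ?t0//.
    by apply/seteqP; split=> w /=; [case|move=> Aw; split=> //=; rewrite in_itv/= lexx].
  rewrite (_ : [set w | _] = set0)//; apply/seteqP; split=> w //= [].
  by rewrite /= in_itv/= -eq_le eq_sym (negbTE t0).
- case: (boolP (t \in `]s, r])) => tr; last first.
    by rewrite (_ : [set w | _] = set0)//; apply/seteqP; split=> w //= [] /=; rewrite (negbTE tr).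
  rewrite (_ : [set w | _] = A); last by apply/seteqP; split=> w /=; [case|].
  move: (tr); rewrite in_itv/= => /andP[st _].
  apply: (hle s t) => //; last exact: ltW.
  by rewrite in_itv/= s0 (le_trans sr).
Qed.

Lemma stopping_time_measurable sigma : stopping_time T F sigma -> measurable_fun setT sigma.
Proof.
move=> [sT hs]; have [_ _ hm] := filF.
apply: (measurability _ (RGenOInfty.measurableE R)) => //.
move=> _ [_ [a ->] <-]; rewrite setTI.
have [a0|a0] := ltP a 0.
  rewrite (_ : _ @^-1` _ = setT)//; apply/seteqP; split=> w //= _.
  by have := sT w; rewrite !in_itv/= andbT => /andP[s0 _]; exact: lt_le_trans s0.
have [aT|aT] := leP a T; last first.
  rewrite (_ : _ @^-1` _ = set0)//; apply/seteqP; split=> w //=.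
  by have := sT w; rewrite !in_itv/= andbT => /andP[_ s1]; rewrite ltNge (le_trans s1 (ltW aT)).
have aT' : a \in `[0, T] by rewrite in_itv/= a0.
rewrite (_ : _ @^-1` _ = ~` [set w | sigma w <= a]).
  by apply: measurableC; apply: (hm a aT'); exact: hs.
by apply/seteqP; split=> w /=; rewrite in_itv/= andbT ltNge => /negP.
Qed.

Lemma predictable_at_stopping H sigma : predictable T F H -> stopping_time T F sigma ->
  measurable_fun setT (fun w => H (sigma w) w).
Proof.
move=> pH st; have ms := stopping_time_measurable st; have [sT _] := st; have [_ _ hm] := filF.
move=> _ B mB; rewrite setTI.
apply: (predictable_preimage (G := measurable) _ sT _ pH mB); first exact: sigma_algebra_measurable.
have mI (D : set R) : measurable D -> measurable [set w | D (sigma w)].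
  by move=> mD; have := ms measurableT D mD; rewrite setTI.
move=> {B mB} B [[A FA <-]|[s [r [A [s0 sr rT FA ->]]]]].
- rewrite (_ : [set w | _] = [set w | `[0, 0]%classic (sigma w)] `&` A).
    by apply: measurableI; [exact: mI|apply: (hm 0 (zero_in T_ge0))].
  by apply/seteqP; split=> w.
- rewrite (_ : [set w | _] = [set w | `]s, r]%classic (sigma w)] `&` A).
    apply: measurableI; first exact: mI.
    by apply: (hm s) => //; rewrite in_itv/= s0 (le_trans sr).
  by apply/seteqP; split=> w.
Qed.

Lemma stopping_time_cst t : t \in `[0, T] -> stopping_time T F (fun=> t).
Proof.
move=> tT; split=> // s sT; have [hs _ _] := filF; have [G0 GC _] := hs s sT.
have [ts|st] := leP t s; first by rewrite (_ : [set w | _] = setT); [exact: (filtrationT filF sT)|apply/seteqP; split].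
by rewrite (_ : [set w | _] = set0)//; apply/seteqP; split.
Qed.

Lemma dyadic_ceil n t : 0 < t <= T -> exists2 i, (i < 2 ^ n)%N & dyadic T n i < t <= dyadic T n i.+1.
Proof.
move=> /andP[t0 tT].
have ex : exists i, t <= dyadic T n i by exists (2 ^ n)%N; rewrite dyadicT.
have [m tm hm] := ex_minnP ex.
case: m tm hm => [|m] tm hm; first by move: tm; rewrite dyadic0 leNgt t0.
exists m.
  by have := hm (2 ^ n)%N; rewrite dyadicT => /(_ tT).
by rewrite tm andbT ltNge; apply/negP => /hm; rewrite ltnn.
Qed.

Lemma sum_indic_dyadic n t (f : nat -> R) i : (i < 2 ^ n)%N -> dyadic T n i < t <= dyadic T n i.+1 ->
  \sum_(j < 2 ^ n) \1_(`]dyadic T n j, dyadic T n j.+1]) t * f j = f i.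
Proof.
move=> i2 ti; rewrite (bigD1 (Ordinal i2))//= indicE mem_setE in_itv/= ti mul1r big1 ?addr0// => j ji.
rewrite indicE mem_setE in_itv/=; case: (boolP (_ < t <= _)) => [/andP[h1 h2]|]; last by rewrite mul0r.
case/andP: ti => h3 h4; exfalso; move: ji; rewrite -val_eqE/= => /eqP; apply.
apply/eqP; rewrite eqn_leq; apply/andP; split; rewrite leqNgt; apply/negP => ij.
  by have := lt_le_trans h1 h4; rewrite ltNge dyadic_le.
by have := lt_le_trans h3 h2; rewrite ltNge dyadic_le.
Qed.

(** Rounding sigma up to the grid gives finite combinations of measurable variables, and right
    continuity removes the rounding. The time 0 lies in no cell and is treated separately. *)
Lemma cadlag_at_random (W : R -> Omega -> R) sigma : cadlag T W -> meas W ->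
  measurable_fun setT sigma -> (forall w, sigma w \in `[0, T]) ->
  measurable_fun setT (fun w => W (sigma w) w).
Proof.
move=> cW mW ms sT.
pose f n w := \1_(`[0, 0]) (sigma w) * W 0 w +
  \sum_(i < 2 ^ n) \1_(`]dyadic T n i, dyadic T n i.+1]) (sigma w) * W (dyadic T n i.+1) w.
have mind (D : set R) : measurable D -> measurable_fun setT (fun w => \1_D (sigma w) : R).
  by move=> mD; apply: (measurableT_comp _ ms); exact: measurable_indic.
have mf n : measurable_fun setT (f n).
  apply: measurable_funD.
    by apply: measurable_funM; [exact: mind|apply: mW; exact: zero_in].
  apply: measurable_sum => i; apply: measurable_funM; first exact: mind.
  by apply: mW; apply: dyadic_in.
apply: (measurable_fun_cvg mf) => w _.
have := sT w; rewrite in_itv/= => /andP[s0 s1].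
move: s0; rewrite le_eqVlt => /orP[/eqP s0|s0].
  apply: (@cvg_eventually _ _ _ 0%N) => n _; rewrite /f -s0 indicE mem_setE in_itv/= lexx mul1r big1 ?addr0// => i _.
  by rewrite indicE mem_setE in_itv/= ltNge dyadic_ge0// mul0r.
have fE n : exists2 r, (sigma w <= r <= T) && (r - sigma w <= T / 2 ^+ n) & f n w = W r w.
  have [i i2 hi] := dyadic_ceil n (introT andP (conj s0 s1)).
  exists (dyadic T n i.+1).
    have := dyadic_step T n i; have := dyadic_leT T_ge0 i2; case/andP: hi => h1 h2 h3 h4.
    by apply/andP; split; [apply/andP; split|]; lra.
  rewrite /f (sum_indic_dyadic (fun j => W (dyadic T n j.+1) w) i2 hi).
  by rewrite indicE mem_setE in_itv/= (leNgt (sigma w)) s0 andbF mul0r add0r.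
move: s1; rewrite le_eqVlt => /orP[/eqP sT'|s1].
  apply: (@cvg_eventually _ _ _ 0%N) => n _; have [r /andP[/andP[h1 h2] _] ->] := fE n.
  by congr (W _ w); apply/le_anti; rewrite h1 {1}sT' h2.
have [c _] := cW w; have {}c := c (sigma w) ltac:(by rewrite (ltW s0) s1).
apply/cvgrPdist_le => e e0; have := (cvgrPdist_le _ _).1 c e e0.
rewrite near_withinE => -[/= del del0 hdel].
have [N hN] := dyadic_mesh T_ge0 del0.
exists N => // n Nn /=; have [r /andP[/andP[h1 h2] h3] ->] := fE n.
move: h1; rewrite le_eqVlt => /orP[/eqP <-|h1]; first by rewrite subrr normr0 ltW.
apply: hdel => //=; rewrite distrC ger0_norm ?subr_ge0 ?(ltW h1)//.
exact: le_lt_trans h3 (hN n Nn).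
Qed.

(** The distribution function of g takes the values 0 and 1 only, so g equals the infimum of its
    almost sure upper bounds. *)
Lemma trivial_constant (g : Omega -> R) : trivial_at0 P F -> known F 0 g ->
  exists c, {ae P, forall w, g w = c}.
Proof.
move=> tr kg; have z0 := zero_in T_ge0.
have mle (x : R) : measurable [set w | g w <= x].
  by apply: (filtration_measurable filF z0); exact: (known_le_set filF x z0 kg).
have zo x : {ae P, forall w, g w <= x} \/ {ae P, forall w, x < g w}.
  have [h|h] := tr _ (known_le_set filF x z0 kg).
    right; exists [set w | g w <= x]; split=> // w /= /negP; by rewrite -leNgt.
  left; exists (~` [set w | g w <= x]); split=> //; first exact: measurableC.
  by rewrite probability_setC// h subee.
have no_ae0 : ~ {ae P, forall w, False}.
  move=> [B [mB PB hB]]; have BT : B = setT by apply/seteqP; split=> w // _; apply: hB.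
  by move: PB; rewrite BT probability_setT => /eqP; rewrite onee_eq0.
pose A := [set x | {ae P, forall w, g w <= x}].
have A0 : A !=set0.
  apply: contrapT => h; apply: (no_ae0).
  have : {ae P, forall w, forall n : nat, n%:R < g w}.
    apply: ae_foralln => n; have [hn|//] := zo n%:R.
    by exfalso; apply: h; exists n%:R.
  apply: filterS => w /(_ (Num.truncn `|g w|).+1); apply/negP; rewrite -leNgt.
  apply: le_trans (ler_norm _) _; have /andP[_ hn] := truncn_itv (normr_ge0 (g w)).
  exact: ltW.
have Alb : has_lbound A.
  apply: contrapT => h; apply: (no_ae0).
  have : {ae P, forall w, forall n : nat, g w <= - n%:R}.
    apply: ae_foralln => n; have [//|hn] := zo (- n%:R).
    exfalso; apply: h; exists (- n%:R) => x Ax; rewrite leNgt; apply/negP => xn; apply: (no_ae0).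
    by apply: filterS2 hn Ax => w h1 h2; have := lt_le_trans h1 h2; rewrite ltNge (ltW xn).
  apply: filterS => w /(_ (Num.truncn `|g w|).+1); apply/negP; rewrite -ltNge.
  have /andP[_ hn] := truncn_itv (normr_ge0 (g w)).
  by have := ler_norm (- g w); rewrite normrN; lra.
exists (inf A).
have h1 : {ae P, forall w, forall n : nat, g w <= inf A + n.+1%:R^-1}.
  apply: ae_foralln => n; have [//|hn] := zo (inf A + n.+1%:R^-1).
  have [x Ax xn] := inf_adherent (ltac:(by rewrite invr_gt0) : 0 < n.+1%:R^-1 :> R) (conj A0 Alb).
  by apply: filterS Ax => w hw; apply: le_trans hw (ltW xn).
have h2 : {ae P, forall w, forall n : nat, inf A - n.+1%:R^-1 < g w}.
  apply: ae_foralln => n; have [hn|//] := zo (inf A - n.+1%:R^-1).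
  exfalso; have h := ge_inf Alb hn; have i0 : 0 < n.+1%:R^-1 :> R by rewrite invr_gt0.
  by move: h; rewrite lerDl oppr_ge0 leNgt i0.
apply: filterS2 h1 h2 => w h1 h2.
have c : (inf A + n.+1%:R^-1) @[n --> \oo] --> inf A + 0.
  by apply: cvgD; [exact: cvg_cst|exact: cvg_harmonic].
have c' : (inf A - n.+1%:R^-1) @[n --> \oo] --> inf A - 0.
  by apply: cvgB; [exact: cvg_cst|exact: cvg_harmonic].
apply/le_anti/andP; split.
  by rewrite -[leRHS]addr0; apply: (cvgr_to_ge c); near=> n; exact: h1.
by rewrite -[leLHS]subr0; apply: (cvgr_to_le c'); near=> n; exact: ltW.
Unshelve. all: by end_near.
Qed.

End StoppingTimes.

(** * Square-integrable random variables *)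

Section SquareIntegrable.
Context {disp : measure_display} {Omega : measurableType disp} {R : realType}.
Variable P : probability Omega R.
Local Notation I f := (P.-integrable setT (EFin \o f)).
Local Notation E f := (\int[P]_w f w).

Definition square_integrable (f : Omega -> R) : Prop :=
  measurable_fun setT f /\ I (fun w => f w ^+ 2).

Lemma le_integrable_fun (f g : Omega -> R) : measurable_fun setT f ->
  (forall w, `|f w| <= g w) -> I g -> I f.
Proof.
move=> mf fg; apply: le_integrable => //; first exact/measurable_EFinP.
by move=> w _ /=; rewrite lee_fin; apply: le_trans (fg w) (ler_norm _).
Qed.

Lemma sqr_lin_le (a x y : R) : (a * x + y) ^+ 2 <= 2 * a ^+ 2 * x ^+ 2 + 2 * y ^+ 2.
Proof. by have := sqr_ge0 (a * x - y); rewrite !expr2; lra. Qed.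

Lemma square_integrable_lin (a : R) f g : square_integrable f -> square_integrable g ->
  square_integrable (fun w => a * f w + g w).
Proof.
move=> [mf If] [mg Ig]; have m : measurable_fun setT (fun w => a * f w + g w).
  by apply: measurable_funD => //; exact: measurable_funM.
split=> //; apply: (@le_integrable_fun _ (fun w => 2 * a ^+ 2 * f w ^+ 2 + 2 * g w ^+ 2)).
- exact: measurable_funX.
- by move=> w; rewrite ger0_norm ?sqr_ge0//; exact: sqr_lin_le.
- by apply: integrable_funD; exact: integrable_funZ.
Qed.

Lemma square_integrableB f g : square_integrable f -> square_integrable g ->
  square_integrable (fun w => f w - g w).
Proof.
move=> sf sg; have := square_integrable_lin (-1) sg sf.
by have -> // : (fun w => -1 * g w + f w) = fun w => f w - g w; apply/funext => w; ring.
Qed.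

Lemma square_integrable_ae f g : square_integrable f -> measurable_fun setT g ->
  {ae P, forall w, f w = g w} -> square_integrable g.
Proof.
move=> [mf If] mg fg; split=> //; apply: (integrable_ae_eq If); first exact: measurable_funX.
by apply: filterS fg => w ->.
Qed.

Lemma square_mean_ge0 f : 0 <= E (fun w => f w ^+ 2).
Proof. by apply: Rintegral_ge0 => w _; exact: sqr_ge0. Qed.

Lemma parallelogram f g h : square_integrable f -> square_integrable g -> square_integrable h ->
  E (fun w => (f w - g w) ^+ 2) = 2 * E (fun w => (f w - h w) ^+ 2) + 2 * E (fun w => (g w - h w) ^+ 2)
    - 4 * E (fun w => (2^-1 * f w + 2^-1 * g w - h w) ^+ 2).
Proof.
move=> sf sg sh.
have [_ I1] := square_integrableB sf sh; have [_ I2] := square_integrableB sg sh.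
have sg2 := square_integrable_lin (2^-1) sg (square_integrable_lin 0 sg sg).
have [_ I3] : square_integrable (fun w => 2^-1 * f w + 2^-1 * g w - h w).
  apply: square_integrableB => //; apply: square_integrable_lin => //.
  have := square_integrable_lin (- (1 / 2)) sg sg.
  by have -> // : (fun w => - (1 / 2) * g w + g w) = fun w => 2^-1 * g w; apply/funext => w; field.
rewrite -!RintegralZl// -RintegralD//; [|exact: integrable_funZ|exact: integrable_funZ].
rewrite -RintegralB//; [|by apply: integrable_funD; exact: integrable_funZ|exact: integrable_funZ].
by apply: eq_Rintegral => w _; field.
Qed.

(** Integrates (x + y)^2 <= (1 + k) x^2 + (1 + 1/k) y^2, a triangle inequality without square
    roots. *)
Lemma square_mean_perturb (k : R) f g h : 0 < k -> square_integrable f -> square_integrable g ->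
  square_integrable h ->
  E (fun w => (f w - h w) ^+ 2) <= (1 + k) * E (fun w => (g w - h w) ^+ 2) +
    (1 + k^-1) * E (fun w => (f w - g w) ^+ 2).
Proof.
move=> k0 sf sg sh.
have [_ I1] := square_integrableB sf sh; have [_ I2] := square_integrableB sg sh.
have [_ I3] := square_integrableB sf sg.
rewrite -!RintegralZl// -RintegralD//; [|exact: integrable_funZ|exact: integrable_funZ].
apply: le_Rintegral => //; first by apply: integrable_funD; exact: integrable_funZ.
move=> w _; set x := g w - h w; set y := f w - g w.
have -> : f w - h w = x + y by rewrite /x /y; ring.
have e : (1 + k) * x ^+ 2 + (1 + k^-1) * y ^+ 2 - (x + y) ^+ 2 = k^-1 * (k * x - y) ^+ 2.
  by field; rewrite gt_eqF.
by rewrite -subr_ge0 e mulr_ge0 ?sqr_ge0// invr_ge0 ltW.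
Qed.

(** Weighted form of Cauchy-Schwarz: |Z f| <= tau Z^2 / 2 + f^2 / (2 tau). The added 1 in C keeps
    tau = e / C meaningful when Z = 0. *)
Lemma product_mean_bound (Z : Omega -> R) (e : R) : square_integrable Z -> 0 < e ->
  exists2 delta, 0 < delta & forall f, square_integrable f -> E (fun w => f w ^+ 2) <= delta ->
    E (fun w => `|Z w * f w|) <= e.
Proof.
move=> [mZ IZ] e0; pose C := E (fun w => Z w ^+ 2) + 1.
have C0 : 0 < C by rewrite ltr_wpDl// square_mean_ge0.
pose tau := e / C; have tau0 : 0 < tau by rewrite divr_gt0.
exists (tau * e); first exact: mulr_gt0.
move=> {}f [mf If] hf.
have le w : `|Z w * f w| <= tau / 2 * Z w ^+ 2 + tau^-1 / 2 * f w ^+ 2.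
  have h (a b : R) : a * b <= tau / 2 * a ^+ 2 + tau^-1 / 2 * b ^+ 2.
    have q : tau / 2 * a ^+ 2 + tau^-1 / 2 * b ^+ 2 - a * b = tau^-1 * (tau * a - b) ^+ 2 / 2.
      by field; rewrite gt_eqF.
    by rewrite -subr_ge0 q divr_ge0// mulr_ge0 ?invr_ge0 ?sqr_ge0// ltW.
  rewrite ler_norml; apply/andP; split; last exact: h.
  by have := h (- Z w) (f w); rewrite sqrrN mulNr; lra.
have I1 := integrable_funZ (tau / 2) IZ; have I2 := integrable_funZ (tau^-1 / 2) If.
have Iz : I (fun w => `|Z w * f w|).
  apply: (@le_integrable_fun _ (fun w => tau / 2 * Z w ^+ 2 + tau^-1 / 2 * f w ^+ 2)).
  - by apply: measurableT_comp => //; exact: measurable_funM.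
  - by move=> w; rewrite normr_id.
  - exact: integrable_funD.
apply: le_trans (le_Rintegral measurableT Iz (integrable_funD I1 I2) (fun w _ => le w)) _.
rewrite (RintegralD measurableT I1 I2) !RintegralZl//.
have h1 : tau / 2 * E (fun w => Z w ^+ 2) <= e / 2.
  apply: (@le_trans _ _ (tau / 2 * C)).
    by rewrite ler_wpM2l ?lerDl// divr_ge0// ltW.
  by rewrite /tau le_eqVlt; apply/orP; left; apply/eqP; field; rewrite gt_eqF.
have h2 : tau^-1 / 2 * E (fun w => f w ^+ 2) <= e / 2.
  apply: (@le_trans _ _ (tau^-1 / 2 * (tau * e))).
    by rewrite ler_wpM2l// divr_ge0// invr_ge0 ltW.
  by rewrite le_eqVlt; apply/orP; left; apply/eqP; field; rewrite gt_eqF.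
lra.
Qed.

(** Fatou's lemma for real-valued integrals; the integrability it delivers is what later places the
    limiting terminal value in L^2. *)
Lemma fatou_bound (g_ : nat -> Omega -> R) (g : Omega -> R) (c : R) :
  (forall n, I (g_ n)) -> (forall n w, 0 <= g_ n w) -> (forall n, E (g_ n) <= c) ->
  measurable_fun setT g -> {ae P, forall w, g_ n w @[n --> \oo] --> g w} ->
  I g /\ E g <= c.
Proof.
move=> Ig g0 gc mg cv.
have mg_ n : measurable_fun setT (EFin \o g_ n) by exact: measurable_int (Ig n).
have ge0 : {ae P, forall w, 0 <= g w}.
  by apply: filterS cv => w h; apply: (cvgr_to_ge h); near=> n; exact: g0.
have fat := fatou P measurableT mg_ (fun n x _ => (ltac:(by rewrite /= lee_fin) : (0 <= (EFin \o g_ n) x)%E)).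
have rhs : (limn_einf (fun n => \int[P]_x (EFin \o g_ n) x) <= c%:E)%E.
  rewrite limn_einf_lim; apply: lime_le; first exact: is_cvg_einfs.
  near=> n; apply: (@le_trans _ _ (\int[P]_x (EFin \o g_ n) x)%E).
    by apply: ereal_inf_lbound; exists n => /=.
  have fin := integrable_fin_num measurableT (Ig n).
  by rewrite -(fineK fin) lee_fin; exact: gc.
have mabs : measurable_fun setT (fun w => (`|g w|)%R%:E).
  by apply/measurable_EFinP; exact: measurableT_comp.
have lhs : (\int[P]_x (`|g x|)%R%:E = \int[P]_x limn_einf ((fun n => EFin \o g_ n) ^~ x))%E.
  apply: ae_eq_integral => //.
    under eq_fun do rewrite limn_einf_lim.
    apply: (emeasurable_fun_cvg (fun n w => einfs (fun k => (EFin \o g_ k) w) n)) => [n|w _].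
      exact: measurable_fun_einfs.
    exact: is_cvg_einfs.
  apply: filterS2 cv ge0 => w h g0' _.
  have c1 : (EFin \o (fun n => g_ n w)) @ \oo --> (g w)%:E by apply: cvg_EFin => //; near=> n.
  have [e1 e2] := cvg_limn_einf_sup c1.
  by rewrite /= ger0_norm//; rewrite -e1.
have bnd : (\int[P]_x (`|g x|)%R%:E <= c%:E)%E by rewrite lhs; apply: le_trans fat rhs.
have Igi : I g.
  apply/integrableP; split; first exact/measurable_EFinP.
  by apply: le_lt_trans bnd _; rewrite ltry.
split=> //.
have : (\int[P]_x (g x)%:E <= c%:E)%E.
  apply: le_trans bnd; apply: le_integral => //; first exact: integrable_norm.
  by move=> w _ /=; rewrite lee_fin ler_norm.
by rewrite -(fineK (integrable_fin_num measurableT Igi)) lee_fin.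
Unshelve. all: by end_near.
Qed.

Lemma Lfun2_square_integrable f : f \in Lfun P 2%:E <-> square_integrable f.
Proof.
split=> [lf|[mf If]].
  split; last exact: Lfun2_integrable_sqr.
  by move: lf; rewrite inE => /andP[/[!inE]].
rewrite inE; apply/andP; split; rewrite inE/=; first by [].
rewrite /finite_norm unlock /Lnorm poweR_lty//.
have /integrableP[_] := If; apply: le_lt_trans; apply: ge0_le_integral => //.
- by move=> w _; exact: poweR_ge0.
- by apply/measurable_EFinP; apply: (@measurableT_comp _ _ _ _ _ _ (fun x : R => x `^ 2)); [exact: measurable_powR|exact: measurableT_comp].
- by apply: measurableT_comp => //; apply/measurable_EFinP; exact: measurable_funX.
- by move=> w _ /=; rewrite lee_fin normrX powR_mulrn.
Qed.

Lemma Lnorm2 f : square_integrable f -> 'N[P]_(2%:E)[EFin \o f]%E = (Num.sqrt (E (fun w => f w ^+ 2)))%:E.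
Proof.
move=> [mf If]; rewrite unlock /Lnorm.
have -> : (\int[P]_x `|(EFin \o f) x| `^ 2 = (E (fun w => f w ^+ 2))%:E)%E.
  rewrite /Rintegral fineK; last exact: (integrable_fin_num measurableT If).
  by apply: eq_integral => w _ /=; rewrite powR_mulrn// real_normK ?num_real.
by rewrite poweR_EFin powR12_sqrt// square_mean_ge0.
Qed.

Lemma cvg_in_L2_vanishing (f_ : nat -> Omega -> R) f : (forall n, square_integrable (f_ n)) ->
  square_integrable f ->
  cvg_in_L2 P f_ f <-> vanishing (fun n => E (fun w => (f_ n w - f w) ^+ 2)).
Proof.
move=> sf_ sf.
have N2 n := Lnorm2 (square_integrableB (sf_ n) sf).
split=> [[_ _ c]|v].
- move=> e e0; have se0 : 0 < Num.sqrt e by rewrite sqrtr_gt0.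
  have EN : (fun n => 'N[P]_(2%:E)[EFin \o (fun w => (f_ n w - f w)%R)]%E) =
      fun n => (Num.sqrt (E (fun w => (f_ n w - f w) ^+ 2)))%:E by apply/funext => n; exact: N2.
  rewrite EN in c.
  have /fine_cvgP[_ /cvgrPdist_le /(_ _ se0) [N _ hN]] := c.
  exists N => n Nn; have := hN n Nn; rewrite /= sub0r normrN ger0_norm ?sqrtr_ge0//.
  by rewrite ler_sqrt// ltW.
- split; [by move=> n; exact/Lfun2_square_integrable|exact/Lfun2_square_integrable|].
  have EN : (fun n => 'N[P]_(2%:E)[EFin \o (fun w => (f_ n w - f w)%R)]%E) =
      fun n => (Num.sqrt (E (fun w => (f_ n w - f w) ^+ 2)))%:E by apply/funext => n; exact: N2.
  rewrite EN; apply: cvg_EFin; first by near=> n.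
  apply/cvgrPdist_le => e e0; have [N hN] := v (e ^+ 2) (exprn_gt0 2 e0).
  exists N => // n Nn; rewrite /= sub0r normrN ger0_norm ?sqrtr_ge0//.
  by rewrite -(ger0_norm (ltW e0)) -sqrtr_sqr ler_sqrt ?sqr_ge0//; exact: hN.
Unshelve. all: by end_near.
Qed.

Lemma expectation_square f : square_integrable f ->
  ('E_P[fun w => (f w ^+ 2)%R])%E = (E (fun w => f w ^+ 2))%:E.
Proof.
move=> [mf If]; rewrite unlock /Rintegral fineK//; exact: (integrable_fin_num measurableT If).
Qed.

End SquareIntegrable.

(** * Strategies and their limits *)

Section Strategies.
Context {disp : measure_display} {Omega : measurableType disp} {R : realType}.
Variables (P : probability Omega R) (T : R) (F : R -> set (set Omega)).
Hypothesis T_ge0 : 0 <= T.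
Hypothesis filF : filtration T F.
Context {d : nat}.
Variables (S : R -> Omega -> 'cV[R]_d) (JS : 'I_d -> (R -> Omega -> R) -> R -> Omega -> R).
Local Notation I f := (P.-integrable setT (EFin \o f)).
Local Notation E f := (\int[P]_w f w).
Local Notation bp := (bounded_predictable T F).
Local Notation soi := (stochastic_integral_operator P T F).
Local Notation meas W := (forall t, t \in `[0, T] -> measurable_fun setT (W t)).
Local Notation integrates := (integrates P T F JS).
Local Notation self_financing := (self_financing P T F S).
Local Notation tame := (tame P T F S).
Local Notation stopping_time := (stopping_time T F).
Hypothesis JSop : forall i, soi (fun t w => S t w i 0) (JS i).
Hypothesis S_adapted : forall i, adapted T F (fun t w => S t w i 0).
Hypothesis cS : forall i, cadlag T (fun t w => S t w i 0).
Implicit Types theta eta : R -> Omega -> 'rV[R]_d.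

Lemma soi_shift X Y J : soi Y J -> indistinguishable P T X (fun t w => X 0 w + Y t w) -> soi X J.
Proof.
move=> [h1 h2 h3 h4 h5] XY; split=> // s t A s0 st tT FA.
apply: filterS2 (h3 s t A s0 st tT FA) XY => w e x u uT; rewrite e//.
have u1 : Num.min t u \in `[0, T] by apply: min_in => //; exact: le_trans st.
have u2 : Num.min s u \in `[0, T] by exact: min_in.
by rewrite (x _ u1) (x _ u2); congr (_ * _); ring.
Qed.

Lemma valueE theta t w : value theta S t w = \sum_i theta t w 0 i * S t w i 0.
Proof. by rewrite /value mxE. Qed.

Lemma value_lin (a : R) theta eta t w :
  value (fun t w => a *: theta t w + eta t w) S t w = a * value theta S t w + value eta S t w.
Proof.
rewrite !valueE mulr_sumr -big_split/=; apply: eq_bigr => i _; rewrite !mxE; ring.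
Qed.

Lemma S_known i t : t \in `[0, T] -> known F t (fun w => S t w i 0).
Proof. by move=> tT; apply/(knownP filF) => // B mB; exact: S_adapted. Qed.

Lemma value_known theta t : vector_predictable T F theta -> t \in `[0, T] ->
  known F t (value theta S t).
Proof.
move=> pt tT.
rewrite (_ : value theta S t = fun w => \sum_i theta t w 0 i * S t w i 0); last first.
  by apply/funext => w; exact: valueE.
have k i : known F t (fun w => theta t w 0 i * S t w i 0).
  by apply: knownM; [exact: (predictable_known filF (pt i) tT)|exact: S_known].
by apply: measurable_sum => i; exact: k.
Qed.

Lemma value_at_stopping theta sigma : vector_predictable T F theta -> stopping_time sigma ->
  measurable_fun setT (fun w => value theta S (sigma w) w).
Proof.
move=> pt st; under eq_fun do rewrite valueE; apply: measurable_sum => i.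
apply: measurable_funM; first exact: (predictable_at_stopping T_ge0 filF (pt i) st).
have [sT _] := st; apply: (cadlag_at_random T_ge0 (cS i)) => //.
- by move=> t tT; apply: (known_measurable filF tT); exact: S_known.
- exact: (stopping_time_measurable filF st).
Qed.

Definition financed theta Y J : Prop := [/\ vector_predictable T F theta, integrates theta Y J,
  cadlag T Y /\ meas Y, forall w, Y 0 w = 0 &
  indistinguishable P T (value theta S) (fun t w => value theta S 0 w + Y t w)].

(** The bridge in both directions between vector integrals and operators; later arguments work with
    Y and [J] alone. *)
Lemma self_financing_financed theta : self_financing theta <-> exists Y J, financed theta Y J.
Proof.
split=> [[Y vY vi]|[Y [J [pt ig [cY mY] Y0 vi]]]].
  have [pt cm Y0 _] := vY; have [J ig] := vector_integral_integrates T_ge0 filF JSop vY.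
  by exists Y, J.
by exists Y => //; exact: (integrates_vector_integral T_ge0 filF JSop S_adapted pt ig).
Qed.

Lemma financed_lin (a : R) theta eta Y Y' J J' : financed theta Y J -> financed eta Y' J' ->
  financed (fun t w => a *: theta t w + eta t w) (fun t w => a * Y t w + Y' t w)
    (fun K t w => a * J K t w + J' K t w).
Proof.
move=> [pt ig [cY mY] Y0 vi] [pe ig' [cY' mY'] Y0' vi']; split.
- exact: vector_predictable_lin.
- exact: (integrates_lin T_ge0 filF JSop).
- split; first by apply: cadlagD => //; exact: (cadlag_scale (fun=> a)).
  by move=> t tT; apply: measurable_funD; [apply: measurable_funM => //; exact: mY|exact: mY'].
- by move=> w; rewrite Y0 Y0' mulr0 addr0.
- by apply: filterS2 vi vi' => w e e' t tT; rewrite !value_lin e// e'//; ring.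
Qed.

Lemma financed_soi theta Y J : financed theta Y J -> soi (value theta S) J.
Proof. by move=> [_ [op _] _ _ vi]; exact: soi_shift op vi. Qed.

Lemma tame_financed theta : tame theta -> exists Y J, financed theta Y J.
Proof. by move=> [sf _]; exact/self_financing_financed. Qed.

Lemma tame_square theta : tame theta <-> self_financing theta /\
  exists C, forall sigma, stopping_time sigma ->
    square_integrable P (fun w => value theta S (sigma w) w) /\
    E (fun w => value theta S (sigma w) w ^+ 2) <= C.
Proof.
split=> [[sf fin]|[sf [C hC]]].
  split=> //; have [Y [J [pt _ _ _ _]]] := (self_financing_financed theta).1 sf.
  set s := ereal_sup _ in fin.
  have ub sigma : stopping_time sigma -> ('E_P[fun w => (value theta S (sigma w) w ^+ 2)%R] <= s)%E.
    by move=> st; apply: ereal_sup_ubound; exists sigma.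
  have s0 : (0 <= s)%E.
    apply: le_trans (ub _ (stopping_time_cst filF (T_in T_ge0))).
    by rewrite unlock; apply: integral_ge0 => w _; rewrite lee_fin sqr_ge0.
  have sfin : s \is a fin_num by rewrite ge0_fin_numE.
  exists (fine s) => sigma st; have mv := value_at_stopping pt st; have := ub sigma st.
  rewrite unlock => h.
  have Iv : I (fun w => value theta S (sigma w) w ^+ 2).
    apply/integrableP; split; first by apply/measurable_EFinP; exact: measurable_funX.
    under eq_integral do rewrite /= ger0_norm ?sqr_ge0//.
    exact: le_lt_trans h fin.
  split; first by split.
  by rewrite -lee_fin (fineK sfin) /Rintegral fineK//; exact: (integrable_fin_num measurableT Iv).
split=> //; apply: (@le_lt_trans _ _ C%:E); last by rewrite ltry.
apply: ge_ereal_sup => _ [sigma /= st <-]; have [sq hE] := hC sigma st.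
by rewrite expectation_square// lee_fin.
Qed.

Lemma tame_lin (a : R) theta eta : tame theta -> tame eta ->
  tame (fun t w => a *: theta t w + eta t w).
Proof.
move=> /tame_square [/self_financing_financed [Y [J fY]] [C hC]].
move=> /tame_square [/self_financing_financed [Y' [J' fY']] [C' hC']].
apply/tame_square; split.
  by apply/self_financing_financed; do 2 eexists; exact: (financed_lin a fY fY').
exists (2 * a ^+ 2 * C + 2 * C') => sigma st.
have [s1 e1] := hC sigma st; have [s2 e2] := hC' sigma st.
have s3 := square_integrable_lin a s1 s2.
have E1 : (fun w => value (fun t w => a *: theta t w + eta t w) S (sigma w) w) =
    fun w => a * value theta S (sigma w) w + value eta S (sigma w) w.
  by apply/funext => w; exact: value_lin.
rewrite E1; split=> //.
have [_ I1] := s1; have [_ I2] := s2; have [_ I3] := s3.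
have J1 := integrable_funZ (2 * a ^+ 2) I1; have J2 := integrable_funZ 2 I2.
under eq_Rintegral do rewrite value_lin.
apply: le_trans (le_Rintegral measurableT I3 (integrable_funD J1 J2) (fun w _ => sqr_lin_le _ _ _)) _.
rewrite (RintegralD measurableT J1 J2) !RintegralZl//.
by apply: lerD; rewrite ler_wpM2l// mulr_ge0// sqr_ge0.
Qed.

Lemma tame_square_integrable theta t : tame theta -> t \in `[0, T] ->
  square_integrable P (value theta S t).
Proof.
move=> /tame_square [_ [C hC]] tT.
by have [] := hC _ (stopping_time_cst filF tT).
Qed.

(* Integrals over ]0, t] do not see the integrand at time 0, so it is free to carry
   the prescribed initial value. *)
Definition grafted theta eta : R -> Omega -> 'rV[R]_d :=
  fun t w => if t == 0 then eta 0 w else theta t w.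

Lemma grafted_predictable theta eta : vector_predictable T F theta -> vector_predictable T F eta ->
  vector_predictable T F (grafted theta eta).
Proof.
move=> pt pe i; have z0 := zero_in T_ge0.
have p0 : predictable T F (fun t w => (t == 0)%:R : R).
  apply: (@predictable_ext _ _ _ _ _ (fun t w => \1_(`[0, 0]) t * \1_setT w)).
    move=> t w _; rewrite indicT/= mulr1 indicE mem_setE in_itv/= -eq_le.
    by rewrite eq_sym.
  by apply: (predictable_rectangle0 T_ge0); exact: (filtrationT filF z0).
apply: (@predictable_ext _ _ _ _ _ (fun t w => if t == 0 then eta t w 0 i else theta t w 0 i)).
  by move=> t w _; rewrite /grafted; case: eqP => [->|].
exact: (@predictable_if _ _ _ _ _ (fun t w => t == 0) _ _ p0 (pe i) (pt i)).
Qed.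

Lemma grafted_integrates theta eta Y J : integrates theta Y J -> integrates (grafted theta eta) Y J.
Proof.
move=> [op h]; split=> // K bK bKg; have TT := T_in T_ge0.
pose K' t (w : Omega) := \1_(`]0, T]) t * K t w.
have bK' : bp K' by exact: (bp_indicator_from0 T_ge0 filF TT bK).
have E1 : scaled K' theta = scaled K' (grafted theta eta).
  apply/funext => t; apply/funext => w; rewrite /scaled /K' /grafted.
  by case: eqP => [->|//]; rewrite indicE mem_setE in_itv/= ltxx !mul0r !scale0r.
have E2 i : (fun t w => scaled K' (grafted theta eta) t w 0 i) =
    fun t w => \1_(`]0, T]) t * (scaled K (grafted theta eta) t w 0 i).
  by apply/funext => t; apply/funext => w; rewrite /scaled !mxE /K' mulrA.
have b' : vector_bp T F (scaled K' theta).
  by rewrite E1 => i; rewrite E2; exact: (bp_indicator_from0 T_ge0 filF TT (bKg i)).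
have i1 := op_indep_at0 T_ge0 filF op bK.
have i2 : {ae P, forall w, forall i, JS i (fun t w => scaled K' theta t w 0 i) T w =
    JS i (fun t w => scaled K (grafted theta eta) t w 0 i) T w}.
  by apply: ae_forall_ord => i; rewrite E1 E2; exact: (op_indep_at0 T_ge0 filF (JSop i) (bKg i)).
apply: filterS3 i1 i2 (h K' bK' b') => w <- e ->.
by apply: eq_bigr => i _; exact: e.
Qed.

End Strategies.

(** * Limits of tame strategies in L^2 *)

Section Limits.
Context {disp : measure_display} {Omega : measurableType disp} {R : realType}.
Variables (P : probability Omega R) (T : R) (F : R -> set (set Omega)).
Hypothesis T_ge0 : 0 <= T.
Hypothesis filF : filtration T F.
Context {d : nat}.
Variables (S : R -> Omega -> 'cV[R]_d) (JS : 'I_d -> (R -> Omega -> R) -> R -> Omega -> R).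
Local Notation I f := (P.-integrable setT (EFin \o f)).
Local Notation E f := (\int[P]_w f w).
Local Notation bp := (bounded_predictable T F).
Local Notation soi := (stochastic_integral_operator P T F).
Local Notation meas W := (forall t, t \in `[0, T] -> measurable_fun setT (W t)).
Local Notation integrates := (integrates P T F JS).
Local Notation financed := (financed P T F S JS).
Local Notation tame_from := (tame_from P T F S).
Local Notation admissible_from := (admissible_from P T F S).
Hypothesis JSop : forall i, soi (fun t w => S t w i 0) (JS i).
Hypothesis S_adapted : forall i, adapted T F (fun t w => S t w i 0).
Hypothesis cS : forall i, cadlag T (fun t w => S t w i 0).
Implicit Types theta eta : R -> Omega -> 'rV[R]_d.

Lemma value_dot theta t w : value theta S t w = dot S (theta t w) t w.
Proof. exact: valueE. Qed.

Lemma dotB (x : 'rV[R]_d) t u w :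
  dot S x t w - dot S x u w = \sum_i x 0 i * (S t w i 0 - S u w i 0).
Proof. by rewrite -sumrB; apply: eq_bigr => i _; rewrite mulrBr. Qed.

Lemma near_left_in t : 0 < t <= T -> \forall u \near t^'-, u \in `[0, T].
Proof.
move=> /andP[t0 tT]; near=> u.
have u0 : 0 < u by near: u; exact: nbhs_left_gt.
have ut : u < t by near: u; exact: nbhs_left_lt.
by rewrite in_itv/= (ltW u0) (le_trans (ltW ut)).
Unshelve. all: by end_near.
Qed.

Lemma financed_jump theta Y J : financed theta Y J ->
  {ae P, forall w, forall t, 0 < t <= T ->
    (Y t w - Y u w) - (dot S (theta t w) t w - dot S (theta t w) u w) @[u --> t^'-] --> (0 : R)}.
Proof.
move=> [pt ig [cY _] _ _].
apply: filterS (integrates_jump T_ge0 filF JSop S_adapted pt ig cY cS) => w h t tT.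
by under eq_fun do rewrite dotB; exact: h.
Qed.

(** At t the value is y_t S_t = v + Y_n(t); subtracting the jump relation for Y_n leaves left
    limits, and uniform convergence replaces Y_n by Y. *)
Lemma financed_tracks (v : R) (y : nat -> R -> Omega -> 'rV[R]_d) Y_ J_ Y :
  (forall n, financed (y n) (Y_ n) (J_ n)) -> (forall n, initial_value P S (y n) v) ->
  cadlag T Y ->
  {ae P, forall w, running_sup T (fun t w => Y_ n t w - Y t w) w @[n --> \oo] --> (0 : R)} ->
  tracks P T S (fun t w => v + Y t w) y.
Proof.
move=> fy iv cY h1.
have h2 := ae_foralln (fun n => financed_jump (fy n)).
have h3 : {ae P, forall w, forall n t, t \in `[0, T] -> dot S (y n t w) t w = v + Y_ n t w}.
  apply: ae_foralln => n; have [_ _ _ _ vi] := fy n.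
  by apply: filterS2 vi (iv n) => w e1 e2 t tT; rewrite -value_dot e1// e2.
apply: filterS3 h1 h2 h3 => w h1 h2 h3 e e0; have e2 : 0 < e / 2 by lra.
have d0 : 0 < Num.min (e / 2) (1 / 2) by rewrite lt_min e2/=; lra.
have [N _ hN] := (cvgrPdist_le _ _).1 h1 _ d0.
exists N => n t Nn tT; have := hN n Nn.
rewrite /= sub0r normrN (ger0_norm (running_sup_ge0 _ _ _)) le_min => /andP[r1 r2].
have c := (cvgrPdist_le _ _).1 (h2 n t tT) _ e2.
apply: filterS2 (near_left_in tT) (c _) => u uT; rewrite sub0r normrN.
have [_ _ [cYn _] _ _] := fy n.
have lt1 : running_sup T (fun t w => Y_ n t w - Y t w) w < 1 by lra.
have b := running_sup_lt1 T_ge0 (cadlagB cYn cY) uT lt1.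
have tT' : t \in `[0, T] by case/andP: (tT) => t0 t1; rewrite in_itv/= ltW.
rewrite (h3 n t tT'); move: (dot S (y n t w) u w) b => x b c'.
have -> : x - (v + Y u w) = (Y_ n u w - Y u w) + (Y_ n t w - Y_ n u w - (v + Y_ n t w - x)) by ring.
by apply: le_trans (ler_normD _ _) _; lra.
Qed.

(** The way back from [financed_tracks]: left limits plus the jump relation give theta_t S_t = v +
    Y_t for t > 0. At t = 0 there is no left limit, and the graft supplies the value v. *)
Lemma financed_grafted (v : R) theta eta Y J :
  vector_predictable T F theta -> vector_predictable T F eta -> integrates theta Y J ->
  cadlag T Y -> meas Y -> (forall w, Y 0 w = 0) -> initial_value P S eta v ->
  {ae P, forall w, forall t, 0 < t <= T -> forall e, 0 < e ->
    \forall u \near t^'-, `|dot S (theta t w) u w - (v + Y u w)| <= e} ->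
  financed (grafted theta eta) Y J /\ initial_value P S (grafted theta eta) v.
Proof.
move=> pt pe ig cY mY Y0 iv near0.
have iv' : initial_value P S (grafted theta eta) v.
  by apply: filterS iv => w; rewrite /value /grafted eqxx.
split=> //; split => //; first exact: grafted_predictable.
  exact: (grafted_integrates T_ge0 filF JSop).
have jump := integrates_jump T_ge0 filF JSop S_adapted pt ig cY cS.
apply: filterS3 near0 jump iv' => w h1 h2 e0 t tT.
have [->|t0] := eqVneq t 0; first by rewrite Y0 addr0.
have tT' : 0 < t <= T by move: tT; rewrite in_itv/= lt0r t0.
rewrite e0 value_dot /grafted (negbTE t0).
apply/eqP; rewrite -subr_eq0 -normr_le0; apply/ler_addgt0Pl => e e_gt0; rewrite addr0.
have e2 : 0 < e / 2 by lra.
have c := (cvgrPdist_le _ _).1 (h2 t tT') _ e2.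
have [u [/= a b]] := @filter_ex _ _ (at_left_proper_filter t) _ (filterI (h1 t tT' _ e2) (c _)).
move: b; rewrite sub0r normrN -dotB => b.
have -> : dot S (theta t w) t w - (v + Y t w) = (dot S (theta t w) u w - (v + Y u w)) -
  (Y t w - Y u w - (dot S (theta t w) t w - dot S (theta t w) u w)) by ring.
by apply: le_trans (ler_normB _ _) _; lra.
Qed.

Lemma financed_op_one theta Y J : financed theta Y J ->
  indistinguishable P T (J (fun _ _ => 1)) Y.
Proof.
move=> [_ [op _] [cY _] Y0 _].
apply: cadlag_indistinguishable => //; first by apply: (op_cadlag op); exact: bp_cst.
by move=> t tT; apply: filterS (op_one T_ge0 filF op tT) => w ->; rewrite Y0 subr0.
Qed.

Lemma cvg_value_at_stopping (v : R) theta y Y_ J_ Y J sigma :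
  financed theta Y J -> initial_value P S theta v ->
  (forall n, financed (y n) (Y_ n) (J_ n)) -> (forall n, initial_value P S (y n) v) ->
  {ae P, forall w, running_sup T (fun t w => Y_ n t w - Y t w) w @[n --> \oo] --> (0 : R)} ->
  (forall w, sigma w \in `[0, T]) ->
  {ae P, forall w, value (y n) S (sigma w) w @[n --> \oo] --> value theta S (sigma w) w}.
Proof.
move=> ft it fy iv h1 sT; have [_ _ [cY _] _ vi] := ft.
have h2 : {ae P, forall w, forall n t, t \in `[0, T] -> value (y n) S t w = v + Y_ n t w}.
  apply: ae_foralln => n; have [_ _ _ _ vi'] := fy n.
  by apply: filterS2 vi' (iv n) => w e1 e2 t tT; rewrite e1// e2.
have h3 : {ae P, forall w, forall t, t \in `[0, T] -> value theta S t w = v + Y t w}.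
  by apply: filterS2 vi it => w e1 e2 t tT; rewrite e1// e2.
apply: filterS3 h1 h2 h3 => w h1 h2 h3; apply/cvgrPdist_le => e e0.
have d0 : 0 < Num.min e (1 / 2) by rewrite lt_min e0/=; lra.
have [N _ hN] := (cvgrPdist_le _ _).1 h1 _ d0.
exists N => // n Nn; have := hN n Nn.
rewrite /= sub0r normrN (ger0_norm (running_sup_ge0 _ _ _)) le_min => /andP[r1 r2].
have [_ _ [cYn _] _ _] := fy n.
have lt1 : running_sup T (fun t w => Y_ n t w - Y t w) w < 1 by lra.
have b := running_sup_lt1 T_ge0 (cadlagB cYn cY) (sT w) lt1.
by rewrite h2// h3// distrC opprD addrACA subrr add0r; exact: le_trans r1.
Qed.

Variable Z : R -> Omega -> R.
Hypothesis dZ : deflator P T F S Z.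
Hypothesis Z_gt0 : strictly_positive P T Z.

(** The difference of two tame strategies from v is tame from 0, so Z times its value is a
    martingale. As Z_T is in L^2, a small L^2 distance at T gives the first-moment bound that
    [deflated_small] needs, with the value of [phi] as X. *)
Lemma deflated_stable (e : R) : 0 < e -> exists2 delta, 0 < delta &
  forall (v : R) theta eta Y Y' J J', tame_from v theta -> tame_from v eta ->
    financed theta Y J -> financed eta Y' J' ->
    E (fun w => (value theta S T w - value eta S T w) ^+ 2) <= delta ->
    forall K, predictable T F K -> (forall t w, t \in `[0, T] -> `|K t w| <= 1) ->
    l0 P (fun w => J K T w - J' K T w) <= e.
Proof.
move=> e0; have [/Lfun2_square_integrable Z2 mZ [phi [sfphi phi0 mphi]]] := dZ.
have [Yp [Jp fphi]] := (self_financing_financed T_ge0 filF JSop S_adapted phi).1 sfphi.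
have kphi t : t \in `[0, T] -> known F t (value phi S t).
  by move=> tT; apply: (value_known filF S_adapted) => //; case: fphi.
have [d1 d10 h] := deflated_small T_ge0 filF (financed_soi fphi) kphi mphi Z_gt0 phi0 e0.
have [d2 d20 h2] := product_mean_bound Z2 d10.
exists d2 => // v theta eta Y Y' J J' [tt it] [te ie] ft fe hd K pK K1.
pose D t w := (-1) *: eta t w + theta t w.
have tD : tame P T F S D by exact: (tame_lin T_ge0 filF JSop S_adapted cS).
have DE t w : value D S t w = value theta S t w - value eta S t w.
  by rewrite value_lin mulN1r addrC.
have iD : {ae P, forall w, value D S 0 w = 0}.
  by apply: filterS2 it ie => w a b; rewrite DE a b subrr.
have fD := financed_lin T_ge0 filF JSop (-1) fe ft.
have TT := T_in T_ge0.
have sD := tame_square_integrable T_ge0 filF JSop S_adapted cS tD TT.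
have s : E (fun w => value D S T w ^+ 2) <= d2 by under eq_Rintegral do rewrite DE.
have := h _ _ (financed_soi fD) (mZ D (conj tD iD)) iD (h2 _ sD s) K pK K1.
by congr (l0 P _ <= _); apply/funext => w; rewrite mulN1r addrC.
Qed.

Lemma cauchy_limit (v : R) (eta : nat -> R -> Omega -> 'rV[R]_d) :
  (forall n, tame_from v (eta n)) ->
  (forall e, 0 < e -> exists N, forall n m, (N <= n)%N -> (N <= m)%N ->
    E (fun w => (value (eta n) S T w - value (eta m) S T w) ^+ 2) <= e) ->
  exists2 theta, admissible_from v theta &
    vanishing (fun n => E (fun w => (value (eta n) S T w - value theta S T w) ^+ 2)).
Proof.
move=> te ce; have TT := T_in T_ge0.
have /choice [Y_ /choice [J_ fe]] : forall n, exists Y J, financed (eta n) Y J.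
  by move=> n; apply: (tame_financed T_ge0 filF JSop S_adapted); case: (te n).
have op_ n : soi (Y_ n) (J_ n) by have [_ []] := fe n.
have nk_ n K t : bp K -> t \in `[0, T] -> nearly_known P F t (J_ n K t).
  move=> bK tT; have [pt ig _ _ _] := fe n.
  exact: (integrates_nearly_known T_ge0 filF JSop S_adapted pt ig bK).
have cauchy_ e : 0 < e -> exists N, forall n m, (N <= n)%N -> (N <= m)%N ->
    forall K, predictable T F K -> (forall t w, t \in `[0, T] -> `|K t w| <= 1) ->
    l0 P (fun w => J_ n K T w - J_ m K T w) <= e.
  move=> e0; have [delta delta0 h] := deflated_stable e0.
  have [N hN] := ce _ delta0; exists N => n m Nn Nm.
  exact: (h v _ _ _ _ _ _ (te n) (te m) (fe n) (fe m) (hN n m Nn Nm)).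
have [Y [J [opJ [cY mY] Y0 unif ucp]]] := emery_complete T_ge0 filF op_ nk_ cauchy_.
have mY_ n : meas (Y_ n) by have [_ _ [_ mYn] _ _] := fe n.
have cY_ n : cadlag T (Y_ n) by have [_ _ [cYn _] _ _] := fe n.
pose W n := running_sup T (fun t w => Y_ n t w - Y t w).
have mW n : measurable_fun setT (W n).
  by apply: (measurable_running_sup T_ge0) => t tT; apply: measurable_funB; [exact: mY_|exact: mY].
have ucpW : vanishing (fun n => l0 P (W n)).
  move=> e e0; have [N hN] := ucp e e0; exists N => n Nn; apply: le_trans (hN n Nn).
  rewrite (@l0_ae _ _ _ _ (W n) (running_sup T (fun t w => J_ n (fun _ _ => 1) t w - Y t w)))//.
    apply: (measurable_running_sup T_ge0) => t tT; apply: measurable_funB; last exact: mY.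
    by apply: (op_measurable (op_ n)) => //; exact: bp_cst.
  apply: (running_sup_ae T_ge0); apply: filterS (financed_op_one (fe n)) => w h t tT.
  by rewrite h.
(* Two extractions: r gives errors 2^-k uniformly over integrands, as [approximates_initial]
   demands, and s then gives almost sure uniform convergence in time. *)
have /choice [r hr] : forall k, exists n, (k <= n)%N /\ (forall K, predictable T F K ->
    (forall t w, t \in `[0, T] -> `|K t w| <= 1) ->
    l0 P (fun w => J_ n K T w - J K T w) <= (1 / 2) ^+ k).
  move=> k; have [N hN] := unif ((1 / 2) ^+ k) ltac:(apply: exprn_gt0; lra).
  by exists (maxn N k); rewrite leq_maxr; split=> //; apply: hN; exact: leq_maxl.
have [s [sk hs]] := ae_fast_subsequence (fun k => mW (r k)) (fun e e0 =>
  let: ex_intro N hN := ucpW e e0 in ex_intro _ N (fun k Nk => hN (r k) (leq_trans Nk (hr k).1))).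
pose q k := r (s k).
have qk k : (k <= q k)%N by apply: leq_trans (sk k) _; case: (hr (s k)).
have cW : {ae P, forall w, W (q k) w @[k --> \oo] --> (0 : R)}.
  apply: filterS hs => w; apply: cvg_trans; apply: near_eq_cvg; near=> k.
  by rewrite ger0_norm ?running_sup_ge0// min_l// running_sup_le1.
have fq k := fe (q k); have iq k : initial_value P S (eta (q k)) v by case: (te (q k)).
have pq k : vector_predictable T F (eta (q k)) by have [] := fq k.
have igq k : integrates (eta (q k)) (Y_ (q k)) (J_ (q k)) by have [] := fq k.
have ap : approximates P T F JS J (fun k => eta (q k)).
  apply: (approximates_initial T_ge0 filF JSop opJ pq igq) => k K pK K1.
  apply: le_trans ((hr (s k)).2 K pK K1) _.
  by apply: ler_wiXn2l; rewrite ?sk//; lra.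
have tr := financed_tracks fq iq cY cW.
have cV : cadlag T (fun t w => v + Y t w).
  by apply: cadlagD => //; exact: (cadlag_cst _ (fun=> v)).
have [theta0 [p0 ig0 near0]] := limit_integrand T_ge0 filF JSop opJ cV cS pq ap tr.
have [ft it] := financed_grafted p0 (pq 0%N) ig0 cY mY Y0 (iq 0%N) near0.
set theta := grafted theta0 (eta (q 0%N)) in ft it.
have pt : vector_predictable T F theta by case: ft.
have cv sigma (sT : forall w, sigma w \in `[0, T]) := cvg_value_at_stopping ft it fq iq cW sT.
have sq n : square_integrable P (value (eta n) S T).
  by apply: (tame_square_integrable T_ge0 filF JSop S_adapted cS) => //; case: (te n).
have mt : measurable_fun setT (value theta S T).
  by apply: (known_measurable filF TT); exact: (value_known filF S_adapted).
(* Fatou's lemma along the almost surely convergent subsequence, with n fixed, carries the Cauchy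
   bound over to the limit. *)
have lim e : 0 < e -> exists N, forall n, (N <= n)%N ->
    I (fun w => (value (eta n) S T w - value theta S T w) ^+ 2) /\
    E (fun w => (value (eta n) S T w - value theta S T w) ^+ 2) <= e.
  move=> e0; have [N hN] := ce e e0; exists N => n Nn.
  pose g k w := (value (eta n) S T w - value (eta (q (k + N)%N)) S T w) ^+ 2.
  apply: (@fatou_bound _ _ _ P g).
  - by move=> k; case: (square_integrableB (sq n) (sq (q (k + N)%N))).
  - by move=> k w; exact: sqr_ge0.
  - by move=> k; apply: hN => //; apply: leq_trans (qk _); exact: leq_addl.
  - apply: measurable_funX; apply: measurable_funB => //; by case: (sq n).
  - apply: filterS (cv (fun=> T) (fun=> TT)) => w c.
    have c' : value (eta (q (k + N)%N)) S T w @[k --> \oo] --> value theta S T w.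
      by move: c; rewrite -(cvg_shiftn N).
    have c2 : value (eta n) S T w - value (eta (q (k + N)%N)) S T w @[k --> \oo] -->
      value (eta n) S T w - value theta S T w by apply: cvgB => //; exact: cvg_cst.
    by rewrite /g expr2; under eq_fun do rewrite expr2; exact: cvgM.
have st : square_integrable P (value theta S T).
  have [N hN] := lim 1 ltr01; have [IN _] := hN N (leqnn N).
  have sB : square_integrable P (fun w => value (eta N) S T w - value theta S T w).
    by split=> //; apply: measurable_funB => //; case: (sq N).
  apply: (square_integrable_ae (square_integrableB (sq N) sB)) => //.
  by apply: aeW => w; rewrite subKr.
have van : vanishing (fun n => E (fun w => (value (eta n) S T w - value theta S T w) ^+ 2)).
  by move=> e e0; have [N hN] := lim e e0; exists N => n Nn; case: (hN n Nn).
exists theta => //; split=> //; split.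
  by apply/(self_financing_financed T_ge0 filF JSop S_adapted); exists Y, J.
exists (fun k => eta (q k)); split.
- by move=> k; case: (te (q k)).
- move=> sigma sst; have [sT _] := sst.
  have m1 k : measurable_fun setT (fun w => value (eta (q k)) S (sigma w) w).
    exact: (value_at_stopping T_ge0 filF S_adapted cS).
  have m2 : measurable_fun setT (fun w => value theta S (sigma w) w).
    exact: (value_at_stopping T_ge0 filF S_adapted cS).
  apply/(cvg_in_probability_l0 (f_ := fun k w => value (eta (q k)) S (sigma w) w) P m1 m2).
  by apply: vanishing_l0_ae => //; exact: cv.
- apply/cvg_in_L2_vanishing => // e e0; have [N hN] := van e e0; exists N => k Nk.
  by apply: hN; exact: leq_trans (qk k).
Unshelve. all: by end_near.
Qed.

End Limits.

(** * Optimization *)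

Section Optimization.
Context {disp : measure_display} {Omega : measurableType disp} {R : realType}.
Variables (P : probability Omega R) (T : R) (F : R -> set (set Omega)).
Hypothesis T_ge0 : 0 <= T.
Hypothesis filF : filtration T F.
Hypothesis F0_trivial : trivial_at0 P F.
Context {d : nat}.
Variables (S : R -> Omega -> 'cV[R]_d) (JS : 'I_d -> (R -> Omega -> R) -> R -> Omega -> R).
Local Notation E f := (\int[P]_w f w).
Local Notation bp := (bounded_predictable T F).
Local Notation soi := (stochastic_integral_operator P T F).
Local Notation financed := (financed P T F S JS).
Local Notation tame_from := (tame_from P T F S).
Local Notation admissible_from := (admissible_from P T F S).
Hypothesis JSop : forall i, soi (fun t w => S t w i 0) (JS i).
Hypothesis S_adapted : forall i, adapted T F (fun t w => S t w i 0).
Hypothesis cS : forall i, cadlag T (fun t w => S t w i 0).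
Implicit Types theta eta : R -> Omega -> 'rV[R]_d.

Lemma square_mean_continuous (f_ : nat -> Omega -> R) (f h : Omega -> R) :
  (forall n, square_integrable P (f_ n)) -> square_integrable P f -> square_integrable P h ->
  vanishing (fun n => E (fun w => (f_ n w - f w) ^+ 2)) ->
  forall e, 0 < e -> exists N, forall n, (N <= n)%N ->
    `|E (fun w => (f_ n w - h w) ^+ 2) - E (fun w => (f w - h w) ^+ 2)| <= e.
Proof.
move=> sf_ sf sh vf e e0; set x := E (fun w => (f w - h w) ^+ 2).
have x0 : 0 <= x by exact: (square_mean_ge0 P (fun w => f w - h w)).
(* With k = e / (c + e) <= 1, k times either second moment is a small fraction of e; the remaining
   term of [square_mean_perturb] is made small through n. *)
pose c : R := 8 * (x + e + 1); have c0 : 0 < c by rewrite /c; lra.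
pose k := e / (c + e); have ce0 : 0 < c + e by lra.
have k0 : 0 < k by rewrite divr_gt0.
have kc : k * (c + e) = e by rewrite /k divfK// gt_eqF.
have k'0 : 0 < 1 + k^-1 by rewrite addr_gt0// invr_gt0.
have [N hN] := vf (e / 4 / (1 + k^-1)) ltac:(by rewrite !divr_gt0//; lra).
exists N => n Nn; have := hN n Nn; rewrite ler_pdivlMr// => b.
set y := E (fun w => (f_ n w - h w) ^+ 2).
have y0 : 0 <= y by exact: (square_mean_ge0 P (fun w => f_ n w - h w)).
have h1 := square_mean_perturb k0 (sf_ n) sf sh.
have h2 := square_mean_perturb k0 sf (sf_ n) sh.
have sym : E (fun w => (f w - f_ n w) ^+ 2) = E (fun w => (f_ n w - f w) ^+ 2).
  by apply: eq_Rintegral => w _; rewrite -sqrrN opprB.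
rewrite sym in h2; rewrite -/x -/y in h1 h2.
move: (E (fun w => (f_ n w - f w) ^+ 2)) b h1 h2 => z b h1 h2.
move: (k^-1) k'0 b h1 h2 => k' k'0 b h1 h2.
have k1 : k <= 1 by rewrite /k ler_pdivrMr//; lra.
rewrite ler_norml; clearbody x y k; rewrite /c in kc; apply/andP; split; nra.
Qed.

(** The approximating tame strategies need not start at v. Triviality of F_0 makes their initial
    values constants c n, which tend to v; adding a n times one fixed y k with c k nonzero corrects
    them, and a n tends to 0. *)
Lemma admissible_approximation (v : R) theta : admissible_from v theta ->
  [/\ vector_predictable T F theta, square_integrable P (value theta S T) &
  exists eta : nat -> R -> Omega -> 'rV[R]_d, [/\ forall n, tame_from v (eta n),
    vanishing (fun n => E (fun w => (value (eta n) S T w - value theta S T w) ^+ 2)) &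
    forall t, t \in `[0, T] ->
      vanishing (fun n => l0 P (fun w => value (eta n) S t w - value theta S t w))]].
Proof.
move=> [[sf [y [ty cp cl]]] iv]; have TT := T_in T_ge0; have z0 := zero_in T_ge0.
have [Y [J [pt _ _ _ _]]] := (self_financing_financed T_ge0 filF JSop S_adapted theta).1 sf.
have py n : vector_predictable T F (y n).
  by have [Yn [Jn []]] := tame_financed T_ge0 filF JSop S_adapted (ty n).
have sy n : square_integrable P (value (y n) S T).
  exact: (tame_square_integrable T_ge0 filF JSop S_adapted cS).
have st : square_integrable P (value theta S T) by apply/Lfun2_square_integrable; case: cl.
have kv eta t : vector_predictable T F eta -> t \in `[0, T] -> measurable_fun setT (value eta S t).
  by move=> pe tT; apply: (known_measurable filF tT); exact: (value_known filF S_adapted).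
have cpt t : t \in `[0, T] -> vanishing (fun n => l0 P (fun w => value (y n) S t w - value theta S t w)).
  move=> tT.
  apply/(cvg_in_probability_l0 (f_ := fun n => value (y n) S t) P (fun n => kv _ _ (py n) tT) (kv _ _ pt tT)).
  exact: (cp (fun=> t) (stopping_time_cst filF tT)).
have cl2 := (cvg_in_L2_vanishing sy st).1 cl.
have /choice [c hc] : forall n, exists c : R, {ae P, forall w, value (y n) S 0 w = c}.
  move=> n; apply: (trivial_constant T_ge0 filF F0_trivial).
  exact: (value_known filF S_adapted).
have cv : c n @[n --> \oo] --> v.
  apply/cvgrPdist_le => e e0.
  have [N hN] := cpt 0 z0 (Num.min e (1 / 2)) ltac:(by rewrite lt_min e0/=; lra).
  exists N => // n /hN; rewrite (@l0_ae _ _ _ _ _ (fun=> c n - v)); last 3 first.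
  - by apply: measurable_funB; exact: kv.
  - exact: measurable_cst.
  - by apply: filterS2 (hc n) iv => w -> ->.
  rewrite /l0 Rintegral_probability_cst le_min => /andP[]; rewrite distrC /=.
  case: (leP `|v - c n| 1) => //; lra.
have [k hk] : exists k, forall n, (v - c n) / c k * c k + c n = v.
  have [[k ck]|h] := pselect (exists k, c k != 0).
    by exists k => n; rewrite divfK// subrK.
  have c0 n : c n = 0 by apply/eqP; apply: contrapT => /negP ?; apply: h; exists n.
  have v0 : v = 0.
    by apply: (cvg_unique _ cv) => //; rewrite (_ : c = fun=> 0); [exact: cvg_cst|exact/funext].
  by exists 0%N => n; rewrite !c0 v0; ring.
pose a n := (v - c n) / c k.
have a0 : a n @[n --> \oo] --> (0 : R).
  have -> : (0 : R) = (v - v) / c k by rewrite subrr mul0r.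
  by apply: cvgM; [apply: cvgB => //; exact: cvg_cst|exact: cvg_cst].
split=> //; exists (fun n t w => a n *: y k t w + y n t w); split.
- move=> n; split; first exact: (tame_lin T_ge0 filF JSop S_adapted cS).
  by apply: filterS2 (hc k) (hc n) => w e1 e2; rewrite (value_lin S (a n)) e1 e2; exact: hk.
- have [_ I1] := sy k.
  pose u n := 2 * (a n * a n) * E (fun w => value (y k) S T w ^+ 2) +
    2 * E (fun w => (value (y n) S T w - value theta S T w) ^+ 2).
  have van : vanishing u.
    apply: vanishingD; last by apply: vanishingZ.
    apply/cvg0_vanishing => [n|].
      apply: mulr_ge0; last exact: (square_mean_ge0 P (value (y k) S T)).
      by rewrite mulr_ge0// -expr2 sqr_ge0.
    have -> : (0 : R) = 2 * (0 * 0) * E (fun w => value (y k) S T w ^+ 2) by ring.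
    by apply: cvgM; [apply: cvgM; [exact: cvg_cst|exact: cvgM]|exact: cvg_cst].
  apply: vanishing_le van => n.
  have sB := square_integrableB (sy n) st; have [_ I2] := sB.
  have J1 := integrable_funZ (2 * a n ^+ 2) I1; have J2 := integrable_funZ 2 I2.
  have [_ I3] := square_integrable_lin (a n) (sy k) sB.
  rewrite /u -expr2 -!RintegralZl// -(RintegralD measurableT J1 J2).
  under eq_Rintegral do rewrite value_lin -addrA.
  by apply: (le_Rintegral measurableT I3 (integrable_funD J1 J2)) => w _; exact: sqr_lin_le.
- move=> t tT; have m1 := kv _ _ (py k) tT; have m0 := kv _ _ pt tT.
  have m2 n := kv _ _ (py n) tT.
  have van : vanishing (fun n => l0 P (fun w => a n * value (y k) S t w - 0)).
    apply: vanishing_l0_ae => // [n|]; first by apply: measurable_funM.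
    apply: aeW => w; have -> : (0 : R) = 0 * value (y k) S t w by rewrite mul0r.
    by apply: cvgM => //; exact: cvg_cst.
  apply: vanishing_le (vanishingD van (cpt t tT)) => n.
  under [X in l0 P X <= _]eq_fun do rewrite value_lin -addrA.
  under [X in _ <= l0 P X + _]eq_fun do rewrite subr0.
  by apply: l0D; [exact: measurable_funM|exact: measurable_funB].
Qed.

Variable Z : R -> Omega -> R.
Hypothesis dZ : deflator P T F S Z.
Hypothesis Z_gt0 : strictly_positive P T Z.
Variables (H : Omega -> R) (v : R).
Hypothesis sH : square_integrable P H.
Hypothesis nonempty : exists theta, admissible_from v theta.

Definition risk theta : R := E (fun w => (value theta S T w - H w) ^+ 2).

(** Taken over tame strategies, since linear combinations and [deflated_stable] are available for
    them; by [admissible_risk] admissible strategies do not fall below it. *)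
Definition least_risk : R := inf [set risk theta | theta in [set theta | tame_from v theta]].

Lemma has_least_risk : has_inf [set risk theta | theta in [set theta | tame_from v theta]].
Proof.
split; last by exists 0 => _ [theta _ <-]; exact: (square_mean_ge0 P (fun w => value theta S T w - H w)).
have [theta adm] := nonempty.
have [_ _ [eta [te _ _]]] := admissible_approximation adm.
by exists (risk (eta 0%N)), (eta 0%N); [exact: te|].
Qed.

Lemma tame_from_square_integrable theta : tame_from v theta -> square_integrable P (value theta S T).
Proof.
by move=> [tt _]; apply: (tame_square_integrable T_ge0 filF JSop S_adapted cS) => //; exact: T_in.
Qed.

Lemma least_risk_le theta : tame_from v theta -> least_risk <= risk theta.
Proof. by move=> tt; apply: ge_inf; [case: has_least_risk|exists theta]. Qed.

(** The midpoint is again tame from v, so its risk in the parallelogram identity is at least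
    [least_risk]. *)
Lemma near_minimizers theta eta : tame_from v theta -> tame_from v eta ->
  E (fun w => (value theta S T w - value eta S T w) ^+ 2) <=
    2 * (risk theta - least_risk) + 2 * (risk eta - least_risk).
Proof.
move=> tt te; have s1 := tame_from_square_integrable tt; have s2 := tame_from_square_integrable te.
rewrite (parallelogram s1 s2 sH).
(* The midpoint, written as half the difference plus [eta] to fit the shape of [tame_lin]. *)
pose mid t w := 2^-1 *: ((-1) *: eta t w + theta t w) + eta t w.
have ltame := tame_lin T_ge0 filF JSop S_adapted cS.
have mE t w : value mid S t w = 2^-1 * value theta S t w + 2^-1 * value eta S t w.
  by rewrite (value_lin S 2^-1 (fun t w => (-1) *: eta t w + theta t w)) value_lin; field.
have tm : tame_from v mid.
  have [[t1 i1] [t2 i2]] := (tt, te); split; first by apply: (ltame) => //; exact: ltame.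
  by apply: filterS2 i1 i2 => w e1 e2; rewrite mE e1 e2; field.
have := least_risk_le tm; rewrite /risk; under eq_Rintegral do rewrite mE.
move: (Rintegral _ _ _) (Rintegral _ _ _) (Rintegral _ _ _) => x y z; lra.
Qed.

Lemma admissible_risk theta : admissible_from v theta -> least_risk <= risk theta.
Proof.
move=> adm; have [_ st [eta [te van _]]] := admissible_approximation adm.
apply/ler_addgt0Pr => e e0.
have [N hN] := square_mean_continuous (fun n => tame_from_square_integrable (te n)) st sH van e0.
have := hN N (leqnn N); have := least_risk_le (te N); rewrite /risk ler_norml.
move: (Rintegral _ _ _) (Rintegral _ _ _) => x y; lra.
Qed.

Lemma least_risk_attained : exists2 theta, admissible_from v theta & risk theta <= least_risk.
Proof.
have /choice [eta he] : forall n, exists eta, tame_from v eta /\ risk eta <= least_risk + n.+1%:R^-1.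
  move=> n; have n0 : 0 < n.+1%:R^-1 :> R by rewrite invr_gt0.
  have [_ [theta tt <-] h] := inf_adherent n0 has_least_risk.
  by exists theta; split=> //; exact: ltW.
have te n : tame_from v (eta n) by case: (he n).
have re e : 0 < e -> exists N, forall n, (N <= n)%N -> risk (eta n) <= least_risk + e.
  move=> e0; have [N _ hN] := (cvgrPdist_le _ _).1 (@cvg_harmonic R) _ e0.
  exists N => n Nn; apply: le_trans (he n).2 _; rewrite lerD2l.
  by have := hN n Nn; rewrite /= sub0r normrN; apply: le_trans; exact: ler_norm.
have ce e : 0 < e -> exists N, forall n m, (N <= n)%N -> (N <= m)%N ->
    E (fun w => (value (eta n) S T w - value (eta m) S T w) ^+ 2) <= e.
  move=> e0; have [N hN] := re (e / 4) ltac:(lra); exists N => n m Nn Nm.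
  have := near_minimizers (te n) (te m); have := hN n Nn; have := hN m Nm; lra.
have [theta adm van] := cauchy_limit T_ge0 filF JSop S_adapted cS dZ Z_gt0 te ce.
exists theta => //; have [_ st _] := admissible_approximation adm.
apply/ler_addgt0Pr => e e0.
have [N hN] := square_mean_continuous (fun n => tame_from_square_integrable (te n)) st sH van
  (ltac:(lra) : 0 < e / 2).
have [M hM] := re (e / 2) ltac:(lra).
have := hN _ (leq_maxl N M); have := hM _ (leq_maxr N M); rewrite /risk ler_norml.
move: (Rintegral _ _ _) (Rintegral _ _ _) => x y; lra.
Qed.

(** A value process is cadlag only up to a null set. Equality at each fixed time is therefore passed
    on to the gains Y, whose paths are cadlag, and indistinguishability is concluded for these. *)
Lemma least_risk_unique theta eta : admissible_from v theta -> admissible_from v eta ->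
  risk theta <= least_risk -> risk eta <= least_risk ->
  indistinguishable P T (value theta S) (value eta S).
Proof.
move=> adt ade rt re; have TT := T_in T_ge0.
have [pt st [x [tx vx lx]]] := admissible_approximation adt.
have [pe se [y [ty vy ly]]] := admissible_approximation ade.
have kv (z : R -> Omega -> 'rV[R]_d) t : vector_predictable T F z -> t \in `[0, T] ->
    measurable_fun setT (value z S t).
  by move=> pz tT; apply: (known_measurable filF tT); exact: (value_known filF S_adapted).
have sf_financed z : self_financing P T F S z -> exists Y J, financed z Y J.
  by move/(self_financing_financed T_ge0 filF JSop S_adapted).
have gap e : 0 < e -> exists N, forall n, (N <= n)%N ->
    E (fun w => (value (x n) S T w - value (y n) S T w) ^+ 2) <= e.
  move=> e0; have e4 : 0 < e / 4 by lra.
  have [N hN] := square_mean_continuous (fun n => tame_from_square_integrable (tx n)) st sH vx e4.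
  have [M hM] := square_mean_continuous (fun n => tame_from_square_integrable (ty n)) se sH vy e4.
  exists (maxn N M) => n; rewrite geq_max => /andP[Nn Mn].
  apply: le_trans (near_minimizers (tx n) (ty n)) _.
  have := hN n Nn; have := hM n Mn; move: rt re; rewrite /risk !ler_norml.
  move: (Rintegral _ _ _) (Rintegral _ _ _) (Rintegral _ _ _) (Rintegral _ _ _) => ? ? ? ?; lra.
have close t e : t \in `[0, T] -> 0 < e -> exists N, forall n, (N <= n)%N ->
    l0 P (fun w => value (x n) S t w - value (y n) S t w) <= e.
  move=> tT e0; move: (tT); rewrite in_itv/= => /andP[t0 tT'].
  have [delta delta0 h] := deflated_stable T_ge0 filF JSop S_adapted cS dZ Z_gt0 e0.
  have [N hN] := gap _ delta0; exists N => n Nn.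
  have [Y [J fY]] := sf_financed _ (tx n).1.1.
  have [Y' [J' fY']] := sf_financed _ (ty n).1.1.
  (* Its integral up to T is the value at t minus v, so the estimate for integrals becomes one for
     values at t. *)
  pose K u (w : Omega) := \1_(`]0, t]) u * \1_[set: Omega] w : R.
  have F0T : F 0 setT by exact: (filtrationT filF (zero_in T_ge0)).
  have pK : predictable T F K by exact: predictable_rectangle.
  have K1 u w : u \in `[0, T] -> `|K u w| <= 1.
    by move=> _; rewrite /K !indicE; case: (_ \in _); case: (_ \in _); rewrite ?mulr1 ?mulr0 ?normr0 ?normr1.
  have := h v _ _ _ _ _ _ (tx n) (ty n) fY fY' (hN n Nn) K pK K1.
  have JK z Y1 J1 : tame_from v z -> financed z Y1 J1 -> {ae P, forall w, J1 K T w = value z S t w - v}.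
    move=> [_ iz] fz; have [_ _ h3 _ _] := financed_soi fz.
    apply: filterS2 (h3 0 t setT (lexx 0) t0 tT' F0T) iz => w e1 e2.
    by rewrite /K e1// indicT mul1r (min_l tT') (min_l (T_ge0)) e2.
  have bK : bp K by split=> //; exists 1.
  have mJ z Y1 J1 : financed z Y1 J1 -> measurable_fun setT (J1 K T).
    by move=> fz; apply: (op_measurable (financed_soi fz)).
  have pz z : tame_from v z -> vector_predictable T F z.
    by move=> [[sf _] _]; have [? [? []]] := sf_financed _ sf.
  rewrite (@l0_ae _ _ _ _ _ (fun w => value (x n) S t w - value (y n) S t w))//.
  - by apply: measurable_funB; [exact: mJ fY|exact: mJ fY'].
  - by apply: measurable_funB; apply: kv => //; exact: pz.
  - apply: filterS2 (JK _ _ _ (tx n) fY) (JK _ _ _ (ty n) fY') => w -> ->.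
    ring.
have eqt t : t \in `[0, T] -> {ae P, forall w, value theta S t w = value eta S t w}.
  move=> tT; have m1 := kv _ _ pt tT; have m2 := kv _ _ pe tT.
  have pz z : tame_from v z -> vector_predictable T F z.
    by move=> [[sf _] _]; have [? [? []]] := sf_financed _ sf.
  have : {ae P, forall w, value theta S t w - value eta S t w = 0}.
    apply: l0_eq0; first exact: measurable_funB.
    apply/ler_addgt0Pr => e e0; rewrite add0r; have e3 : 0 < e / 3 by lra.
    have [N1 h1] := lx t tT _ e3; have [N2 h2] := ly t tT _ e3; have [N3 h3] := close t _ tT e3.
    pose n := maxn N1 (maxn N2 N3).
    have b1 := h1 n (leq_maxl _ _).
    have b2 := h2 n (leq_trans (leq_maxl _ _) (leq_maxr _ _)).
    have b3 := h3 n (leq_trans (leq_maxr _ _) (leq_maxr _ _)).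
    have mx := kv _ _ (pz _ (tx n)) tT; have my := kv _ _ (pz _ (ty n)) tT.
    have E1 : (fun w => value theta S t w - value eta S t w) = fun w =>
       ((value (x n) S t w - value (y n) S t w) + (value (y n) S t w - value eta S t w)) -
       (value (x n) S t w - value theta S t w) by apply/funext => w; ring.
    have mA := measurable_funB mx my; have mB := measurable_funB my m2.
    have mC := measurable_funB mx m1.
    rewrite E1; apply: (@le_trans _ _ (e / 3 + e / 3 + e / 3)); last by lra.
    apply: le_trans (l0B P (measurable_funD mA mB) mC) _; apply: lerD b1.
    by apply: le_trans (l0D P mA mB) _; exact: lerD.
  by apply: filterS => w /eqP; rewrite subr_eq0 => /eqP.
have [[sft _] it] := adt; have [[sfe _] ie] := ade.
have [Y [J [_ _ [cY _] _ vi]]] := sf_financed _ sft.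
have [Y' [J' [_ _ [cY' _] _ vi']]] := sf_financed _ sfe.
have YY : indistinguishable P T Y Y'.
  apply: cadlag_indistinguishable => // t tT.
  apply: filterS3 (ae_and vi vi') (eqt t tT) (ae_and it ie) => w [e1 e2] e3 [e4 e5].
  by move: e3; rewrite e1// e2// e4 e5 => /addrI.
apply: filterS3 YY (ae_and vi vi') (ae_and it ie) => w e3 [e1 e2] [e4 e5] t tT.
by rewrite e1// e2// e4 e5 e3.
Qed.

Lemma hedging_error_risk theta : admissible_from v theta -> hedging_error P T S H theta = (risk theta)%:E.
Proof.
move=> adm; have [_ st _] := admissible_approximation adm.
by rewrite /hedging_error (expectation_square (square_integrableB st sH)).
Qed.

Lemma hedging_optimizerP theta :
  hedging_optimizer P T F S H v theta <-> admissible_from v theta /\ risk theta <= least_risk.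
Proof.
split=> [[adm opt]|[adm rt]]; split=> //.
  have [eta ade re] := least_risk_attained.
  by have := opt eta ade; rewrite !hedging_error_risk// lee_fin => /le_trans; exact.
by move=> eta ade; rewrite !hedging_error_risk// lee_fin; exact: le_trans (admissible_risk ade).
Qed.

End Optimization.

(** The bounded integrals of the truncations inside a vector integral carry operators for the
    components of S; truncation level 0 suffices to extract them. *)
Lemma self_financing_operators {disp : measure_display} {Omega : measurableType disp} {R : realType}
    (P : probability Omega R) (T : R) (F : R -> set (set Omega)) (d : nat)
    (S : R -> Omega -> 'cV[R]_d) theta : self_financing P T F S theta ->
  exists JS, forall i, stochastic_integral_operator P T F (fun t w => S t w i 0) (JS i).
Proof.
move=> [Y [_ _ _ [Y_ bY _]] _]; have [W_ hW _] := bY 0%N.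
have hJ i : exists J, stochastic_integral_operator P T F (fun t w => S t w i 0) J.
  by have [_ [J op _]] := hW i; exists J.
by have [JS hJS] := choice hJ; exists JS.
Qed.

Theorem theorem3p1 (R : realType) (disp : measure_display)
    (Omega : measurableType disp) (P : probability Omega R)
    (T : R) (T_ge0 : 0 <= T)
    (F : R -> set (set Omega)) (F_filtration : filtration T F)
    (F0_trivial : trivial_at0 P F)
    (d : nat) (d_ge2 : (2 <= d)%N)
    (S : R -> Omega -> 'cV[R]_d) (S_semimart : vector_semimartingale P T F S)
    (H : Omega -> R) (H_L2 : H \in Lfun P 2%:E) (v : R)
    (Z_ex : exists2 Z : R -> Omega -> R,
        deflator P T F S Z & strictly_positive P T Z)
    (nonempty : exists theta : R -> Omega -> 'rV[R]_d,
        admissible_from P T F S v theta) :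
  (exists theta : R -> Omega -> 'rV[R]_d,
      hedging_optimizer P T F S H v theta) /\
  (forall theta eta : R -> Omega -> 'rV[R]_d,
      hedging_optimizer P T F S H v theta ->
      hedging_optimizer P T F S H v eta ->
      indistinguishable P T (value theta S) (value eta S)).
Proof.
have [Z dZ Z_gt0] := Z_ex; have sH := (Lfun2_square_integrable P H).1 H_L2.
have S_adapted i : adapted T F (fun t w => S t w i 0) by case: (S_semimart i).
have cS i : cadlag T (fun t w => S t w i 0) by case: (S_semimart i).
have [JS JSop] : exists JS, forall i,
    stochastic_integral_operator P T F (fun t w => S t w i 0) (JS i).
  by have [theta [[sf _] _]] := nonempty; exact: self_financing_operators sf.
have optP theta := hedging_optimizerP T_ge0 F_filtration F0_trivial JSop S_adapted cS
  dZ Z_gt0 sH nonempty theta.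
split.
  have [theta adm rt] := least_risk_attained T_ge0 F_filtration F0_trivial JSop S_adapted cS
    dZ Z_gt0 sH nonempty.
  by exists theta; apply/optP.
move=> theta eta /optP[adt rt] /optP[ade re].
exact: (least_risk_unique T_ge0 F_filtration F0_trivial JSop S_adapted cS dZ Z_gt0 sH nonempty adt ade rt re).
Qed.
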